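(* Let $n\ge1$, let $\rho\in\mathbb{N}$ with $1\le\rho<\infty$, and let $\lambda\in\{1,-1\}$. Consider the Cauchy problem $$i\partial_tu+\Delta u+\mu(x)u=\lambda u^\rho,\quad x\in\Omega,\ t\in\mathbb{R},\qquad u(x,0)=u_0(x),\quad x\in\Omega.$$ (1) (Periodic case, $\Omega=\mathbb{T}^n$.) Let $u_0\in\mathcal{I}_{per}$ and $\mu\in\mathcal{I}_{per}$. There is $T>0$ such that the Cauchy problem has a unique mild solution $u\in L^\infty((-T,T);\mathcal{I}_{per})$ satisfying $$\sup_{t\in(-T,T)}\|u(\cdot,t)\|_{\mathcal{I}_{per}}\le2\|u_0\|_{\mathcal{I}_{per}}.$$ Moreover, the data-solution map $u_0\mapsto u$ is locally Lipschitz continuous from $\mathcal{I}_{per}$ to $L^\infty((-T,T);\mathcal{I}_{per})$. (2) (Nonperiodic case, $\Omega=\mathbb{R}^n$.) Let $u_0\in\mathcal{I}$ and $\mu\in\mathcal{I}$. There is $T>0$ such that the Cauchy problem has a unique mild solution $u\in L^\infty((-T,T);\mathcal{I})$ satisfying $$\sup_{t\in(-T,T)}\|u(\cdot,t)\|_{\mathcal{I}}\le2\|u_0\|_{\mathcal{I}}.$$ Moreover, the data-solution map $u_0\mapsto u$ is locally Lipschitz continuous from $\mathcal{I}$ to $L^\infty((-T,T);\mathcal{I})$.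
   Context: Nonperiodic case. $\mathcal{M}(\mathbb{R}^n)$ is the space of complex (finite) Radon measures on $\mathbb{R}^n$ with total variation norm $\|\nu\|_{\mathcal{M}}=|\nu|(\mathbb{R}^n)$, viewed as a subspace of $\mathcal{S}'(\mathbb{R}^n)$. The Fourier transform is normalized by $\widehat f(\xi)=\int e^{-2\pi i\xi\cdot x}f(x)\,dx$ and extended to $\mathcal{S}'$. $\mathcal{I}=\{f\in\mathcal{S}'(\mathbb{R}^n):\widehat f\in\mathcal{M}(\mathbb{R}^n)\}$ with norm $\|f\|_{\mathcal{I}}=\|\widehat f\|_{\mathcal{M}}$ (a Banach space contained in the bounded continuous functions). A mild solution is a function $u\in L^\infty((-T,T);\mathcal{I})$ with $u(t)=S(t)u_0+B(u)(t)+L_\mu(u)(t)$, where, in Fourier variables, $$\widehat{S(t)u_0}=e^{-4\pi^2i|\xi|^2t}\,\widehat{u_0},\qquad\widehat{L_\mu(u)}(\cdot,t)=i\int_0^te^{-4\pi^2i|\xi|^2(t-s)}(\widehat\mu*\widehat u)(\cdot,s)\,ds,$$ $$\widehat{B(u)}(\cdot,t)=-i\lambda\int_0^te^{-4\pi^2i|\xi|^2(t-s)}(\underbrace{\widehat u*\cdots*\widehat u}_{\rho\text{ times}})(\cdot,s)\,ds,$$ and $*$ is convolution of measures. Periodic case. $\mathbb{T}^n=\mathbb{R}^n/\mathbb{Z}^n$, $\mathcal{D}'(\mathbb{T}^n)$ is the space of periodic distributions (period $1$ in each variable), and $\widehat f(m)=\langle f,e^{-2\pi ix\cdot m}\rangle$,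 $m\in\mathbb{Z}^n$, are the Fourier coefficients. $\mathcal{I}_{per}=\{f\in\mathcal{D}'(\mathbb{T}^n):\widehat f\in\ell^1(\mathbb{Z}^n)\}$ with norm $\|f\|_{\mathcal{I}_{per}}=\|\widehat f\|_{\ell^1(\mathbb{Z}^n)}$. A mild solution is a function $u\in L^\infty((-T,T);\mathcal{I}_{per})$ with $u(t)=S_{per}(t)u_0+B_{per}(u)(t)+L_{\mu,per}(u)(t)$, where $$\widehat{S_{per}(t)u_0}(m)=e^{-4\pi^2i|m|^2t}\,\widehat{u_0}(m),\qquad\widehat{L_{\mu,per}(u)}(m,t)=i\int_0^te^{-4\pi^2i|m|^2(t-s)}(\widehat\mu*\widehat u)(m,s)\,ds,$$ $$\widehat{B_{per}(u)}(m,t)=-i\lambda\int_0^te^{-4\pi^2i|m|^2(t-s)}(\underbrace{\widehat u*\cdots*\widehat u}_{\rho\text{ times}})(m,s)\,ds,$$ and $*$ is the discrete convolution $(\widehat f*\widehat g)(m)=\sum_{\xi\in\mathbb{Z}^n}\widehat f(m-\xi)\widehat g(\xi)$. ''Locally Lipschitz continuous'' means: each initial datum has a neighbourhood on which a common $T$ can be used and on which the data-solution map is Lipschitz. *)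

(* Defs.v *)
From HB Require Import structures.
From mathcomp Require Import all_boot all_order all_algebra.
From mathcomp Require Import all_classical all_reals all_analysis.
From mathcomp Require Import measurable_realfun ess_sup_inf complex.

Set Implicit Arguments.
Unset Strict Implicit.
Unset Printing Implicit Defensive.

Import Order.TTheory GRing.Theory Num.Theory.
Import numFieldNormedType.Exports.

Local Open Scope classical_set_scope.
Local Open Scope ring_scope.
Local Open Scope complex_scope.

(* The sigma-algebra put on R^n is the one generated by the coordinates, as the
   library does for tuples. Lemma measurable_rV_open below shows that it is the
   Borel sigma-algebra. *)
Definition rV_display : measure_display. Proof. exact. Qed.

Section measurable_rV.
Context (R : realType) (n : nat).

Let coor (i : 'I_n) (x : 'rV[R]_n) : R := x 0 i.

Let rV_set0 : g_sigma_preimage coor set0.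
Proof. exact: sigma_algebra0. Qed.

Let rV_setC A : g_sigma_preimage coor A -> g_sigma_preimage coor (~` A).
Proof. exact: sigma_algebraC. Qed.

Let rV_bigcup (F : (set _)^nat) : (forall i, g_sigma_preimage coor (F i)) ->
  g_sigma_preimage coor (\bigcup_i (F i)).
Proof. exact: sigma_algebra_bigcup. Qed.

HB.instance Definition _ := @isMeasurable.Build rV_display 'rV[R]_n
  (g_sigma_preimage coor) rV_set0 rV_setC rV_bigcup.

End measurable_rV.

Section measurable_rV_theory.
Context (R : realType) (n : nat).

Lemma measurable_coor (i : 'I_n) :
  measurable_fun [set: 'rV[R]_n] (fun x => x 0 i).
Proof.
move=> _ Y mY; rewrite setTI; apply: sub_sigma_algebra => /=.
rewrite -bigcup_seq/=; exists i => /=; first by rewrite mem_index_enum.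
by exists Y => //; rewrite setTI.
Qed.

Lemma measurable_rVP d (T : measurableType d) (f : T -> 'rV[R]_n) :
  (forall i, measurable_fun [set: T] (fun t => f t 0 i)) ->
  measurable_fun [set: T] f.
Proof.
move=> mf; apply: (@measurability _ _ _ _ _ _ (\big[setU/set0]_(i < n)
  preimage_set_system setT (fun x : 'rV[R]_n => x 0 i) measurable)) => //.
move=> A [B + <-]; rewrite -bigcup_seq => -[i _ [C mC <-]].
by rewrite setTI; have := mf i measurableT _ mC; rewrite !setTI.
Qed.

Lemma measurable_rV_open :
  (@measurable _ 'rV[R]_n) = <<s [set U : set 'rV[R]_n | open U] >>.
Proof.
apply/seteqP; split.
  apply: smallest_sub; first exact: smallest_sigma_algebra.
  move=> B; rewrite -bigcup_seq => -[i _ [C mC <-]].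
  pose T := g_sigma_algebraType [set U : set 'rV[R]_n | open U].
  suff mi : measurable_fun [set: T] (fun x : T => (x : 'rV[R]_n) 0 i) by exact: mi.
  apply: (measurability _ (RGenOInfty.measurableE R)).
  move=> _ [_ [r ->] <-]; rewrite setTI; apply: sub_sigma_algebra => /=.
  by apply: open_comp => [x _|]; [exact: coord_continuous|rewrite set_itvE; exact: open_gt].
apply: smallest_sub; first exact: sigma_algebra_measurable.
move=> U /= oU.
pose q (z : 'rV[rat]_n) : 'rV[R]_n := map_mx ratr z.
pose V (p : 'rV[rat]_n * nat) : set 'rV[R]_n := ball (q p.1) p.2.+1%:R^-1.
have -> : U = \bigcup_(p in [set p | V p `<=` U]) V p.
  apply/seteqP; split=> [x Ux|x [p pU /pU//]].
  have /nbhs_ballP[e /= e0 xeU] : nbhs x U by exact: open_nbhs_nbhs.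
  have [k ke] : exists k, k.+1%:R^-1 < e / 2.
    have e20 : 0 < e / 2 by rewrite divr_gt0.
    by have [k _ /(_ k (leqnn _))] := near_infty_natSinv_lt (PosNum e20); exists k.
  have /choice[z xz] : forall i, exists z : rat, `|x 0 i - ratr z| < k.+1%:R^-1.
    move=> i; have /rat_in_itvoo[z] : x 0 i - k.+1%:R^-1 < x 0 i + k.+1%:R^-1.
      by rewrite ltrBlDr -addrA ltrDl addr_gt0 ?invr_gt0 ?ltr0n.
    by rewrite in_itv/= => /andP[? ?]; exists z; rewrite ltr_distlC; apply/andP; split.
  have zx : ball (q (\row_i z i)) k.+1%:R^-1 x.
    split; first by rewrite invr_gt0 ltr0n.
    by move=> a b; rewrite !mxE ord1 /ball/= distrC.
  exists (\row_i z i, k) => //=.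
  move=> y zy; apply: xeU; apply: (@le_ball _ _ _ (k.+1%:R^-1 + k.+1%:R^-1)).
    by rewrite (splitr e) lerD// ltW.
  by apply: (ball_triangle _ zy); exact: ball_sym.
rewrite bigcup_mkcond.
apply: countable_bigcupT_measurable => [|p]; first exact: countableP.
case: ifP => // _.
rewrite (_ : V p = \bigcap_(i in [set: 'I_n])
    ((fun x : 'rV[R]_n => x 0 i) @^-1` ball (q p.1 0 i) p.2.+1%:R^-1)).
  apply: fin_bigcap_measurable => // i _; rewrite -[X in measurable X]setTI.
  by apply: measurable_coor => //; rewrite ball_itv; exact: measurable_itv.
apply/seteqP; split=> [x [_ xp] i _|x xp]; first exact: xp.
by split=> [|a b]; [rewrite invr_gt0 ltr0n|rewrite ord1; exact: xp].
Qed.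

Lemma measurable_rVD :
  measurable_fun [set: 'rV[R]_n * 'rV[R]_n] (fun z => z.1 + z.2).
Proof.
apply: measurable_rVP => i.
rewrite (_ : (fun _ => _) = (fun z : 'rV[R]_n * 'rV[R]_n => z.1 0 i + z.2 0 i)); last first.
  by apply/funext => z; rewrite mxE.
by apply: measurable_funD;
  apply: (measurableT_comp (measurable_coor i)).
Qed.

End measurable_rV_theory.

Section rV_cons.
Context (R : realType) (n : nat).

Definition rV_cons (z : R * 'rV[R]_n) : 'rV[R]_n.+1 := row_mx z.1%:M z.2.

Lemma measurable_rV_cons : measurable_fun [set: R * 'rV[R]_n] rV_cons.
Proof.
apply: measurable_rVP => i; case: (unliftP ord0 i) => [j|] ->.
  rewrite (_ : (fun _ => _) = (fun z : R * 'rV[R]_n => z.2 0 j)); last first.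
    apply/funext => z; rewrite /rV_cons.
    have -> : lift ord0 j = rshift 1 (j : 'I_n) :> 'I_n.+1 by apply: val_inj.
    exact: (row_mxEr z.1%:M z.2).
  exact: (measurableT_comp (measurable_coor j)).
rewrite (_ : (fun _ => _) = (fun z : R * 'rV[R]_n => z.1)); first exact: measurable_fst.
apply/funext => z; rewrite /rV_cons.
rewrite (_ : @ord0 n = lshift n (0 : 'I_1)); last exact: val_inj.
by rewrite [LHS](row_mxEl z.1%:M z.2) mxE eqxx mulr1n.
Qed.

Definition rV_uncons (x : 'rV[R]_n.+1) : R * 'rV[R]_n :=
  (x 0 ord0, \row_j x 0 (lift ord0 j)).

Lemma measurable_rV_uncons : measurable_fun setT rV_uncons.
Proof.
apply/measurable_fun_pairP; split; first exact: (measurable_coor ord0).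
apply: measurable_rVP => i.
rewrite (_ : (fun _ => _) = (fun x : 'rV[R]_n.+1 => x 0 (lift ord0 i))).
  exact: measurable_coor.
by apply/funext => x; rewrite mxE.
Qed.

Lemma rV_consK : cancel rV_cons rV_uncons.
Proof.
move=> [x y]; congr pair => /=.
  rewrite /rV_cons (_ : @ord0 n = lshift n (0 : 'I_1)); last exact: val_inj.
  by rewrite [LHS](row_mxEl x%:M y) mxE eqxx mulr1n.
apply/rowP => j; rewrite mxE /rV_cons.
have -> : lift ord0 j = rshift 1 (j : 'I_n) :> 'I_n.+1 by apply: val_inj.
exact: (row_mxEr x%:M y).
Qed.

End rV_cons.


(* Lebesgue measure on R^n, as an iterated product of Lebesgue measure on R. *)
Section lebesgue_measure_rV.
Local Open Scope ereal_scope.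
Context (R : realType).

Section step.
Context (n : nat) (mu : {sigma_finite_measure set 'rV[R]_n -> \bar R}).

Definition lebesgue_rV_step : set 'rV[R]_n.+1 -> \bar R :=
  pushforward (@lebesgue_measure R \x mu) (@rV_cons R n).

Let step0 : lebesgue_rV_step set0 = 0.
Proof. by rewrite /lebesgue_rV_step /pushforward preimage_set0 measure0. Qed.

Let step_ge0 A : 0 <= lebesgue_rV_step A.
Proof. by rewrite /lebesgue_rV_step /pushforward; exact: measure_ge0. Qed.

Let measurable_preim A : measurable A -> measurable (@rV_cons R n @^-1` A).
Proof. by rewrite -[X in _ -> measurable X]setTI; exact: measurable_rV_cons. Qed.

Let step_sigma_additive : semi_sigma_additive lebesgue_rV_step.
Proof.
move=> F mF tF mUF; rewrite /lebesgue_rV_step /pushforward preimage_bigcup.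
apply: measure_semi_sigma_additive.
- by move=> k; exact: measurable_preim.
- apply/trivIsetP => /= i j _ _ ij; rewrite -preimage_setI.
  by move/trivIsetP : tF => /(_ _ _ _ _ ij) ->//; rewrite preimage_set0.
- by rewrite -preimage_bigcup; exact: measurable_preim.
Qed.

HB.instance Definition _ := isMeasure.Build _ _ _ lebesgue_rV_step
  step0 step_ge0 step_sigma_additive.

Let step_sigma_finite : sigma_finite setT lebesgue_rV_step.
Proof.
have /sigma_finiteP[F [TF ndF Foo]] := sigma_finiteT (@lebesgue_measure R).
have /sigma_finiteP[G [TG ndG Goo]] := sigma_finiteT mu.
exists (fun k => @rV_uncons R n @^-1` (F k `*` G k)).
  rewrite -preimage_bigcup -(preimage_setT (@rV_uncons R n)); congr (_ @^-1` _).
  apply/seteqP; split=> // -[x y] _.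
  have [i _ Fi] : (\bigcup_i F i) x by rewrite -TF.
  have [j _ Gj] : (\bigcup_i G i) y by rewrite -TG.
  exists (maxn i j) => //; split.
    by move: Fi; apply/subsetPset/ndF/leq_maxl.
  by move: Gj; apply/subsetPset/ndG/leq_maxr.
move=> k; have [mF Fk] := Foo k; have [mG Gk] := Goo k; split.
  rewrite -[X in measurable X]setTI.
  by apply: measurable_rV_uncons => //; exact: measurableX.
rewrite /lebesgue_rV_step /pushforward -comp_preimage.
rewrite (_ : _ \o _ = id); last by apply/funext => z; exact: rV_consK.
by rewrite preimage_id product_measure1E// lte_mul_pinfty// ge0_fin_numE.
Qed.

HB.instance Definition _ := Measure_isSigmaFinite.Build _ _ _ lebesgue_rV_step
  step_sigma_finite.

End step.

Fixpoint lebesgue_measure_rV n : {sigma_finite_measure set 'rV[R]_n -> \bar R} :=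
  if n is n'.+1 then lebesgue_rV_step (lebesgue_measure_rV n')
  else \d_(0%R : 'rV[R]_0).

End lebesgue_measure_rV.

Section choose_elt.
Context (T : Type).

(* Some element of P, or x0 if P is empty. *)
Definition choose_elt (x0 : T) (P : set T) : T :=
  if pselect (exists x, P x) is left exP then projT1 (cid exP) else x0.

End choose_elt.

Section complex_functions.
Context (R : realType).

Definition modulus (z : R[i]) : R := Normc.normc z.

Definition expi (theta : R) : R[i] := cos theta +i* sin theta.

Definition cintegral d (T : measurableType d) (mu : {measure set T -> \bar R})
    (D : set T) (f : T -> R[i]) : R[i] :=
  (\int[mu]_(x in D) complex.Re (f x)) +i* (\int[mu]_(x in D) complex.Im (f x)).

(* The oriented integral from 0 to t, also for t < 0. *)
Definition time_integral (t : R) (f : R -> R[i]) : R[i] :=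
  if 0 <= t then cintegral (@lebesgue_measure R) `[0, t] f
  else - cintegral (@lebesgue_measure R) `[t, 0] f.

End complex_functions.

Section test_functions.
Context (R : realType) (n : nat).
Implicit Types (f : 'rV[R]_n -> R) (phi : 'rV[R]_n -> R[i]).

Definition dot (x y : 'rV[R]_n) : R := \sum_i x 0 i * y 0 i.

Definition partial (i : 'I_n) f : 'rV[R]_n -> R := 'D_(delta_mx 0 i) f.

Definition partials (s : seq 'I_n) f := foldr partial f s.

Definition smooth f := forall s x, differentiable (partials s f) x.

Definition csmooth phi :=
  smooth (@complex.Re R \o phi) /\ smooth (@complex.Im R \o phi).

Definition cpartials (s : seq 'I_n) phi (x : 'rV[R]_n) : R[i] :=
  partials s (@complex.Re R \o phi) x +i* partials s (@complex.Im R \o phi) x.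

(* The norm on R^n here is the max norm. With w = k these seminorms generate the
   topology of the Schwartz space, with w = 0 that of C^oo(T^n). *)
Definition seminorm (w k : nat) phi : \bar R :=
  ereal_sup [set ((1 + `|p.2|) ^+ w * modulus (cpartials p.1 phi p.2))%:E |
             p in [set p : seq 'I_n * 'rV[R]_n | (size p.1 <= k)%N]].

Definition schwartz : set ('rV[R]_n -> R[i]) :=
  [set phi | csmooth phi /\ forall k, (seminorm k k phi < +oo)%E].

Definition periodic_smooth : set ('rV[R]_n -> R[i]) :=
  [set phi | csmooth phi /\ forall i x, phi (x + delta_mx 0 i) = phi x].

End test_functions.

(* Distributions are encoded as functionals on all functions R^n -> C which
   vanish off the space of test functions, so that two distributions agree on
   test functions iff they are equal, and sums are pointwise. *)
Section distributions.
Context (R : realType) (n : nat).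

Definition distr := ('rV[R]_n -> R[i]) -> R[i].

HB.instance Definition _ := GRing.Zmodule.on distr.

Definition continuous_dual (test : set ('rV[R]_n -> R[i]))
    (p : nat -> ('rV[R]_n -> R[i]) -> \bar R) : set distr :=
  [set T | [/\ forall (a : R[i]) phi psi, test phi -> test psi ->
                 T (fun x => a * phi x + psi x) = a * T phi + T psi,
               exists k (c : R), forall phi, test phi ->
                 ((modulus (T phi))%:E <= c%:E * p k phi)%E &
               forall phi, ~ test phi -> T phi = 0]].

Definition tempered : set distr :=
  continuous_dual (@schwartz R n) (fun k => seminorm k k).

Definition periodic_distribution : set distr :=
  continuous_dual (@periodic_smooth R n) (seminorm 0).

End distributions.

Section periodic.
Context (R : realType) (n : nat).
Implicit Types (f : distr R n) (a b : 'rV[int]_n -> R[i]).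

Definition intv (m : 'rV[int]_n) : 'rV[R]_n := map_mx intr m.

Definition fcoef f (m : 'rV[int]_n) : R[i] :=
  f (fun x => expi (- (2 * pi * dot x (intv m)))).

Definition norm_l1 a : \bar R := \esum_(m in [set: 'rV[int]_n]) (modulus (a m))%:E.

Definition norm_Iper f : \bar R := norm_l1 (fcoef f).

Definition Iper : set (distr R n) :=
  [set f | periodic_distribution f /\ (norm_Iper f < +oo)%E].

(* Sum of an absolutely convergent family. *)
Definition rsum (g : 'rV[int]_n -> R) : R :=
  fine (\esum_(m in [set: 'rV[int]_n]) (g^\+ m)%:E) -
  fine (\esum_(m in [set: 'rV[int]_n]) (g^\- m)%:E).

Definition csum a : R[i] :=
  rsum (@complex.Re R \o a) +i* rsum (@complex.Im R \o a).

Definition conv_seq a b (m : 'rV[int]_n) : R[i] :=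
  csum (fun xi => a (m - xi) * b xi).

Definition conv_seq_pow (rho : nat) a : 'rV[int]_n -> R[i] :=
  iter rho.-1 (conv_seq a) a.

(* The element of Iper with Fourier coefficients a, for a in l^1. *)
Definition of_fcoef a : distr R n :=
  choose_elt 0 [set f | Iper f /\ fcoef f = a].

Definition phase_per (t : R) (m : 'rV[int]_n) : R[i] :=
  expi (- (4 * pi ^+ 2 * dot (intv m) (intv m) * t)).

Definition S_per (t : R) (u0 : distr R n) : distr R n :=
  of_fcoef (fun m => phase_per t m * fcoef u0 m).

Definition L_per (mu : distr R n) (u : R -> distr R n) (t : R) :
    distr R n :=
  of_fcoef (fun m => 'i * time_integral t (fun s =>
    phase_per (t - s) m * conv_seq (fcoef mu) (fcoef (u s)) m)).

Definition B_per (rho : nat) (lam : R) (u : R -> distr R n) (t : R) :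
    distr R n :=
  of_fcoef (fun m => - 'i * lam%:C * time_integral t (fun s =>
    phase_per (t - s) m * conv_seq_pow rho (fcoef (u s)) m)).

End periodic.

Section real_charges.
Context (R : realType) (n : nat).
Local Notation V := 'rV[R]_n.
Implicit Types nu eta : {charge set V -> \bar R}.

Definition jordanp nu : {finite_measure set V -> \bar R} :=
  jordan_pos (projT2 (cid (projT2 (cid (Hahn_decomposition nu))))).

Definition jordann nu : {finite_measure set V -> \bar R} :=
  jordan_neg (projT2 (cid (projT2 (cid (Hahn_decomposition nu))))).

Definition integral_charge nu (D : set V) (f : V -> R) : R :=
  \int[jordanp nu]_(x in D) f x - \int[jordann nu]_(x in D) f x.

Section conv_measure.
Local Open Scope ereal_scope.
Variables p q : {finite_measure set V -> \bar R}.

Definition conv_measure : set V -> \bar R :=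
  pushforward (p \x q) (fun z : V * V => (z.1 + z.2)%R).

Let preim_add A : measurable A -> measurable ((fun z : V * V => (z.1 + z.2)%R) @^-1` A).
Proof. by rewrite -[X in _ -> measurable X]setTI; exact: measurable_rVD. Qed.

Let conv_measure0 : conv_measure set0 = 0.
Proof. by rewrite /conv_measure /pushforward preimage_set0 measure0. Qed.

Let conv_measure_ge0 A : 0 <= conv_measure A.
Proof. by rewrite /conv_measure /pushforward; exact: measure_ge0. Qed.

Let conv_measure_sigma_additive : semi_sigma_additive conv_measure.
Proof.
move=> F mF tF mUF; rewrite /conv_measure /pushforward preimage_bigcup.
apply: measure_semi_sigma_additive.
- by move=> k; exact: preim_add.
- apply/trivIsetP => /= i j _ _ ij; rewrite -preimage_setI.
  by move/trivIsetP : tF => /(_ _ _ _ _ ij) ->//; rewrite preimage_set0.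
- by rewrite -preimage_bigcup; exact: preim_add.
Qed.

HB.instance Definition _ := isMeasure.Build _ _ _ conv_measure
  conv_measure0 conv_measure_ge0 conv_measure_sigma_additive.

Let conv_measure_finite : fin_num_fun conv_measure.
Proof.
move=> A mA; rewrite ge0_fin_numE; last exact: conv_measure_ge0.
pose m : {measure set (V * V)%type -> \bar R} := p \x q.
apply: (@le_lt_trans _ _ (m (setT `*` setT))).
  rewrite (_ : conv_measure A = m ((fun z : V * V => (z.1 + z.2)%R) @^-1` A))//.
  by rewrite setXTT le_measure ?inE//; exact: preim_add.
rewrite /m/= product_measure1E// lte_mul_pinfty// ?fin_num_measure//.
by rewrite -ge0_fin_numE// fin_num_measure.
Qed.

HB.instance Definition _ := @Measure_isFinite.Build _ _ _ conv_measure
  conv_measure_finite.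

End conv_measure.

Definition conv_charge nu eta : {charge set V -> \bar R} :=
  cadd (cadd (conv_measure (jordanp nu) (jordanp eta))
             (conv_measure (jordann nu) (jordann eta)))
       (copp (cadd (conv_measure (jordanp nu) (jordann eta))
                   (conv_measure (jordann nu) (jordanp eta)))).

End real_charges.

(* Complex measures, as pairs (real part, imaginary part) of finite signed
   Borel measures; on R^n these are automatically Radon. *)
Record cmeasure (R : realType) (n : nat) := CMeasure {
  cmRe : {charge set 'rV[R]_n -> \bar R} ;
  cmIm : {charge set 'rV[R]_n -> \bar R} }.

Section complex_measures.
Context (R : realType) (n : nat).
Local Notation V := 'rV[R]_n.
Implicit Types nu eta : cmeasure R n.

Definition cmval nu (A : set V) : R[i] :=
  fine (cmRe nu A) +i* fine (cmIm nu A).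

Definition cmzero : cmeasure R n :=
  CMeasure (czero : {charge set V -> \bar R}) (czero : {charge set V -> \bar R}).

Definition total_variation nu : \bar R :=
  ereal_sup [set (\sum_(0 <= i <oo) (modulus (cmval nu (F i)))%:E)%E |
    F in [set F : (set V)^nat | [/\ forall i, measurable (F i),
      trivIset setT F & \bigcup_i F i = setT]]].

Definition cmintegral nu (D : set V) (f : V -> R[i]) : R[i] :=
  (integral_charge (cmRe nu) D (@complex.Re R \o f) -
   integral_charge (cmIm nu) D (@complex.Im R \o f)) +i*
  (integral_charge (cmRe nu) D (@complex.Im R \o f) +
   integral_charge (cmIm nu) D (@complex.Re R \o f)).

Definition cmconv nu eta : cmeasure R n :=
  CMeasure
    (cadd (conv_charge (cmRe nu) (cmRe eta))
          (copp (conv_charge (cmIm nu) (cmIm eta))))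
    (cadd (conv_charge (cmRe nu) (cmIm eta))
          (conv_charge (cmIm nu) (cmRe eta))).

Definition cmconv_pow (rho : nat) nu : cmeasure R n := iter rho.-1 (cmconv nu) nu.

End complex_measures.

Section nonperiodic.
Context (R : realType) (n : nat).
Local Notation V := 'rV[R]_n.
Implicit Types (f : distr R n) (nu : cmeasure R n).

Definition fourier (phi : V -> R[i]) (xi : V) : R[i] :=
  cintegral (lebesgue_measure_rV R n) setT
    (fun x => expi (- (2 * pi * dot xi x)) * phi x).

(* The Fourier transform of f, <f^, phi> = <f, phi^>, is the measure nu. *)
Definition is_hat f nu := forall phi, schwartz phi ->
  f (fourier phi) = cmintegral nu setT phi.

Definition I_space : set (distr R n) :=
  [set f | tempered f /\ exists nu, is_hat f nu].

Definition hat f : cmeasure R n := choose_elt (cmzero R n) (is_hat f).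

Definition norm_I f : \bar R := total_variation (hat f).

(* The element of I whose Fourier transform is the measure A |-> m A; measures
   are compared on Borel sets. *)
Definition of_hat (m : set V -> R[i]) : distr R n :=
  choose_elt 0 [set f | I_space f /\ forall A, measurable A -> cmval (hat f) A = m A].

Definition phase (t : R) (xi : V) : R[i] :=
  expi (- (4 * pi ^+ 2 * dot xi xi * t)).

Definition S_free (t : R) (u0 : distr R n) : distr R n :=
  of_hat (fun A => cmintegral (hat u0) A (phase t)).

(* The time integral of a measure-valued function is taken setwise. *)
Definition L_free (mu : distr R n) (u : R -> distr R n) (t : R) :
    distr R n :=
  of_hat (fun A => 'i * time_integral t (fun s =>
    cmintegral (cmconv (hat mu) (hat (u s))) A (phase (t - s)))).

Definition B_free (rho : nat) (lam : R) (u : R -> distr R n) (t : R) :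
    distr R n :=
  of_hat (fun A => - 'i * lam%:C * time_integral t (fun s =>
    cmintegral (cmconv_pow rho (hat (u s))) A (phase (t - s)))).

End nonperiodic.

(* Here X is one of the two spaces of distributions and N is its norm. *)
Section mild_solutions.
Context (R : realType) (n : nat).
Variables (X : set (distr R n)) (N : distr R n -> \bar R).
Implicit Types (u v w : R -> distr R n) (T : R).

Definition simple_function T u :=
  [/\ finite_set (u @` `]-T, T[),
      forall t, t \in `]-T, T[ -> X (u t) &
      forall f, measurable (`]-T, T[ `&` u @^-1` [set f])].

Definition strongly_measurable T u :=
  exists w : nat -> R -> distr R n,
    (forall k, simple_function T (w k)) /\
    {ae @lebesgue_measure R, forall t, t \in `]-T, T[ ->
      (fun k => N (w k t - u t)) @ \oo --> 0%E}.

Definition Linfty_norm T u : \bar R :=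
  ess_sup (mrestr (@lebesgue_measure R) (measurable_itv `]-T, T[)) (N \o u).

Definition Linfty T u :=
  [/\ forall t, t \in `]-T, T[ -> X (u t), strongly_measurable T u &
      (Linfty_norm T u < +oo)%E].

Definition sup_norm T u : \bar R := ereal_sup [set N (u t) | t in `]-T, T[].

Variables (S : R -> distr R n -> distr R n)
  (B L : (R -> distr R n) -> R -> distr R n).

Definition mild_solution T (u0 : distr R n) u :=
  Linfty T u /\
  forall t, t \in `]-T, T[ -> u t = S t u0 + B u t + L u t.

Definition bounded_solution T (u0 : distr R n) u :=
  mild_solution T u0 u /\ (sup_norm T u <= 2%:E * N u0)%E.

Definition unique_bounded_solution T (u0 : distr R n) :=
  exists u, bounded_solution T u0 u /\
    forall v, bounded_solution T u0 v -> forall t, t \in `]-T, T[ -> v t = u t.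

(* On the ball of X of radius r around u0 the data-solution map is defined with
   values in functions on (-T, T), and is Lipschitz. *)
Definition data_solution_map_lipschitz_near T (u0 : distr R n) :=
  exists r K : R, [/\ 0 < r,
    forall v0 : distr R n, X v0 -> (N (v0 - u0)%R < r%:E)%E -> unique_bounded_solution T v0 &
    forall (v0 w0 : distr R n) v w, X v0 -> X w0 ->
      (N (v0 - u0)%R < r%:E)%E -> (N (w0 - u0)%R < r%:E)%E ->
      bounded_solution T v0 v -> bounded_solution T w0 w ->
      (Linfty_norm T (fun t => v t - w t)%R <= K%:E * N (v0 - w0)%R)%E].

End mild_solutions.

(* Main.v *)
From HB Require Import structures.
Require Import Defs.
From mathcomp Require Import all_boot all_order all_algebra.
From mathcomp Require Import all_classical all_reals all_analysis.
From mathcomp Require Import measurable_realfun ess_sup_inf complex ring lra.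

(** In Fourier variables the flow acts by multiplication with numbers of modulus one and
    the powers of u become convolution powers, so that the equation lives in a normed
    algebra (l^1 of the lattice, or the complex measures with the total variation norm)
    on which S(t) is a strongly continuous family of contractions. The nonlinearities
    v |-> v^rho and v |-> mu^ * v are Lipschitz on balls; hence, on a short time interval
    depending only on the size of the datum and of mu, the right-hand side of the mild
    equation is a contraction with constant 1/2 of the ball of radius 2 |u0|. Its fixed
    point is the solution, and iterating the contraction estimate for two mild solutions
    gives uniqueness and the Lipschitz constant 2 for the dependence on the datum
    ([mild_solution_exists], [mild_solution_lipschitz]).

    Both cases are instances of one theorem, [local_wellposedness]. An element of the
    space is described by a family of complex numbers: its Fourier coefficients, or the
    values of its Fourier transform on Borel sets. In both cases the norm is the supremum
    of finite sums of moduli, over lists of distinct lattice points or over lists of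
    disjoint Borel sets, and time integrals are taken entry by entry. This is the
    structure [flow_algebra], and all estimates reduce to: a finite sum of moduli of
    integrals is at most the integral of the sum of moduli. The limit of the Picard
    iterates is built entry by entry ([carrier_geometric_limit]). Its strong measurability
    follows from the continuity of the iterates in time ([duhamel_continuous]), which
    rests on compactness of a time segment and strong continuity of the flow.

    In the periodic case what remains is that each summable family of coefficients comes
    from a periodic distribution. Tested against phi, it is the sum over m of the m-th
    coefficient times the mean of phi e^(2 pi i m.x), for a mean on the torus for which the
    characters are orthonormal; an ultrafilter limit of averages over finite grids is such
    a mean ([torus_mean_character], [of_coefficients_Iper]).

    In the nonperiodic case the algebra is [free_algebra]. A complex measure is a
    combination of four positive ones; a family indexed by Borel sets is a measure as
    soon as it is finitely additive and continuous along increasing unions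
    ([cmeasure_exists]), and by dominated convergence both properties pass to time
    integrals ([is_cmv_int]). By Fubini a convolution is an integral of translates, which
    yields its bilinearity and its bound ([cmval_conv], [cmconv_le]). To pass between
    distributions and measures one needs that each measure is the Fourier transform of a
    tempered distribution and that a measure is determined by its integrals of Schwartz
    functions. The first is the inversion formula ([fourier_inversion]), obtained for the
    real integrals of f(x) cos (2 pi xi.x + theta), whose phases make them stable under
    derivatives, by inserting a Gaussian. For the second, products of logistic functions
    with Gaussians are Schwartz functions that converge boundedly to indicators of
    orthants, and these form a pi-system generating the Borel sets
    ([schwartz_determined]). *)

Import Order.TTheory GRing.Theory Num.Theory.
Import numFieldNormedType.Exports.

Set Implicit Arguments.
Unset Strict Implicit.
Unset Printing Implicit Defensive.

Local Open Scope classical_set_scope.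
Local Open Scope ring_scope.
Local Open Scope complex_scope.

(** * Integrals of complex-valued functions *)

Section modulus_theory.
Context (R : realType).
Implicit Types z w : R[i].

Lemma modulus_ge0 z : 0 <= modulus z.
Proof. by case: z => a b; exact: sqrtr_ge0. Qed.

Lemma modulus0 : modulus (0 : R[i]) = 0.
Proof. exact: Normc.normc0. Qed.

Lemma modulusD z w : modulus (z + w) <= modulus z + modulus w.
Proof. exact: le_normcD. Qed.

Lemma modulusN z : modulus (- z) = modulus z.
Proof. exact: normcN. Qed.

Lemma modulusB z w : modulus (z - w) <= modulus z + modulus w.
Proof. by rewrite -(modulusN w) modulusD. Qed.

Lemma modulusBC z w : modulus (z - w) = modulus (w - z).
Proof. by rewrite -modulusN opprB. Qed.

Lemma modulusM z w : modulus (z * w) = modulus z * modulus w.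
Proof. exact: Normc.normcM. Qed.

Lemma modulus_eq0 z : modulus z = 0 -> z = 0.
Proof. exact: Normc.eq0_normc. Qed.

Lemma modulus_real (x : R) : modulus x%:C = `|x|.
Proof. by rewrite /modulus /= expr0n addr0 sqrtr_sqr. Qed.

Lemma modulus_i : modulus ('i : R[i]) = 1.
Proof. by rewrite /modulus /= expr0n expr1n add0r sqrtr1. Qed.

Lemma modulus1 : modulus (1 : R[i]) = 1.
Proof. exact: Normc.normc1. Qed.

Lemma normr_Re_le z : `|complex.Re z| <= modulus z.
Proof.
case: z => a b; rewrite /modulus /= -sqrtr_sqr ler_wsqrtr// lerDl sqr_ge0//.
Qed.

Lemma normr_Im_le z : `|complex.Im z| <= modulus z.
Proof.
case: z => a b; rewrite /modulus /= -sqrtr_sqr ler_wsqrtr// lerDr sqr_ge0//.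
Qed.

Lemma modulus_le_ReIm z : modulus z <= `|complex.Re z| + `|complex.Im z|.
Proof.
case: z => a b; rewrite /modulus /=.
rewrite -[leRHS]ger0_norm ?addr_ge0// -sqrtr_sqr ler_wsqrtr//.
by rewrite sqrrD !real_normK ?num_real// -addrA lerD2l lerDr mulrn_wge0// mulr_ge0.
Qed.

Lemma modulus_sum (I : Type) (s : seq I) (F : I -> R[i]) :
  modulus (\sum_(i <- s) F i) <= \sum_(i <- s) modulus (F i).
Proof.
elim/big_ind2 : _ => [|x a y b xa yb|//]; first by rewrite modulus0.
by rewrite (le_trans (modulusD _ _))// lerD.
Qed.

Lemma modulus_expi (t : R) : modulus (expi t) = 1.
Proof. by rewrite /modulus /expi /= cos2Dsin2 sqrtr1. Qed.

(** Bounds for sums of moduli of integrals are reduced by such rotations to bounds for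
    real integrals. *)
Lemma modulus_rotate z : exists2 w : R[i], modulus w = 1 & w * z = (modulus z)%:C.
Proof.
have [->|z0] := eqVneq z 0.
  by exists 1; rewrite ?mulr0 ?modulus0 ?modulus1.
exists ((modulus z)%:C / z).
  rewrite modulusM [modulus z^-1]Normc.normcV modulus_real ger0_norm ?modulus_ge0// mulfV//.
  by apply: contra_neq z0; exact: modulus_eq0.
by rewrite -mulrA mulVf// mulr1.
Qed.

Lemma ReD z w : complex.Re (z + w) = complex.Re z + complex.Re w.
Proof. by case: z w => [? ?] [? ?]. Qed.

Lemma ImD z w : complex.Im (z + w) = complex.Im z + complex.Im w.
Proof. by case: z w => [? ?] [? ?]. Qed.

Lemma ReN z : complex.Re (- z) = - complex.Re z. Proof. by case: z. Qed.

Lemma ImN z : complex.Im (- z) = - complex.Im z. Proof. by case: z. Qed.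

Lemma ReM z w : complex.Re (z * w) =
  complex.Re z * complex.Re w - complex.Im z * complex.Im w.
Proof. by case: z w => [? ?] [? ?]. Qed.

Lemma ImM z w : complex.Im (z * w) =
  complex.Re z * complex.Im w + complex.Im z * complex.Re w.
Proof. by case: z w => [? ?] [? ?]. Qed.

Lemma complex_eqP z w : complex.Re z = complex.Re w ->
  complex.Im z = complex.Im w -> z = w.
Proof. by case: z w => [? ?] [? ?] /= -> ->. Qed.

Lemma Re_sum (I : Type) (s : seq I) (F : I -> R[i]) :
  complex.Re (\sum_(i <- s) F i) = \sum_(i <- s) complex.Re (F i).
Proof. by elim/big_rec2 : _ => // i y x _ <-; rewrite ReD. Qed.

Lemma Im_sum (I : Type) (s : seq I) (F : I -> R[i]) :
  complex.Im (\sum_(i <- s) F i) = \sum_(i <- s) complex.Im (F i).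
Proof. by elim/big_rec2 : _ => // i y x _ <-; rewrite ImD. Qed.

End modulus_theory.

Section null_sets.
Context d (T : measurableType d) (R : realType) (mu : {measure set T -> \bar R}).
Local Open Scope ereal_scope.
Import HBNNSimple.

(** The integral is a supremum over simple functions, so that removing a null set
    is harmless even for a function which is not measurable. *)
Lemma integral_setD_null (D N : set T) (f : T -> \bar R) :
  measurable N -> mu N = 0 ->
  \int[mu]_(x in D) f x = \int[mu]_(x in D `\` N) f x.
Proof.
move=> mN N0.
have key (g h : T -> \bar R) : (forall x, 0 <= g x) -> (forall x, 0 <= h x) ->
    (forall x, ~ N x -> g x <= h x) -> \int[mu]_x g x <= \int[mu]_x h x.
  move=> g0 h0 gh; rewrite !ge0_integralTE//.
  apply: ub_ereal_sup => _ [s sg <-].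
  pose s' := proj_nnsfun s (measurableC mN).
  have -> : sintegral mu s = sintegral mu s'.
    rewrite -!integralT_nnsfun; apply: ge0_ae_eq_integral => //.
    - exact/measurable_EFinP.
    - exact/measurable_EFinP.
    - by move=> x _; rewrite lee_fin.
    - by move=> x _; rewrite lee_fin.
    - exists N; split=> // x /= h1; apply: contrapT => Nx; apply: h1 => _.
      by rewrite /s' /= mindicE mem_set// mulr1.
  apply: ereal_sup_ubound; exists s' => // x; rewrite /s' /= mindicE.
  have [xN|xN] := boolP (x \in ~` N).
    by rewrite mulr1 (le_trans (sg x))// gh//; exact: set_mem.
  by rewrite mulr0 h0.
rewrite integral_mkcond [RHS]integral_mkcond integralE [RHS]integralE.
congr (_ - _); apply/eqP; rewrite eq_le; apply/andP; split; apply: key => // x.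
- by move=> Nx; rewrite !funeposE !patchE in_setD (memNset Nx) andbT.
- by move=> Nx; rewrite !funeposE !patchE in_setD (memNset Nx) andbT.
- by move=> Nx; rewrite !funenegE !patchE in_setD (memNset Nx) andbT.
- by move=> Nx; rewrite !funenegE !patchE in_setD (memNset Nx) andbT.
Qed.

End null_sets.

Section complex_integral.
Context d (T : measurableType d) (R : realType) (mu : {measure set T -> \bar R}).
Implicit Types (D : set T) (f g : T -> R[i]).

Definition cmeasurable D f :=
  measurable_fun D (fun x => complex.Re (f x)) /\ measurable_fun D (fun x => complex.Im (f x)).

Definition cintegrable D f :=
  mu.-integrable D (EFin \o (fun x => complex.Re (f x))) /\
  mu.-integrable D (EFin \o (fun x => complex.Im (f x))).

Lemma cmeasurable_cst D z : cmeasurable D (fun=> z).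
Proof. by split; exact: measurable_cst. Qed.

Lemma cmeasurable_real D (f : T -> R) : measurable_fun D f ->
  cmeasurable D (fun x => (f x)%:C).
Proof. by move=> mf; split => //; exact: measurable_cst. Qed.

Lemma cmeasurableD D f g : cmeasurable D f -> cmeasurable D g ->
  cmeasurable D (fun x => f x + g x).
Proof.
move=> [f1 f2] [g1 g2]; split.
  by under eq_fun do rewrite ReD; exact: measurable_funD.
by under eq_fun do rewrite ImD; exact: measurable_funD.
Qed.

Lemma cmeasurableN D f : cmeasurable D f -> cmeasurable D (fun x => - f x).
Proof.
move=> [f1 f2]; split.
  by under eq_fun do rewrite ReN; exact: measurableT_comp.
by under eq_fun do rewrite ImN; exact: measurableT_comp.
Qed.

Lemma cmeasurableM D f g : cmeasurable D f -> cmeasurable D g ->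
  cmeasurable D (fun x => f x * g x).
Proof.
move=> [f1 f2] [g1 g2]; split.
  by under eq_fun do rewrite ReM; apply: measurable_funB; exact: measurable_funM.
by under eq_fun do rewrite ImM; apply: measurable_funD; exact: measurable_funM.
Qed.

Lemma measurable_modulus D f : cmeasurable D f ->
  measurable_fun D (fun x => modulus (f x)).
Proof.
move=> [f1 f2].
rewrite (_ : (fun x => _) = (@Num.sqrt R) \o (fun x =>
  (complex.Re (f x)) ^+ 2 + (complex.Im (f x)) ^+ 2)); last first.
  by apply/funext => x /=; case: (f x).
apply: measurableT_comp => //; first exact: continuous_measurable_fun (@sqrt_continuous R).
by apply: measurable_funD; exact: measurable_funX.
Qed.

Lemma sub_cmeasurable D E f : measurable E -> D `<=` E -> cmeasurable E f ->
  cmeasurable D f.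
Proof. by move=> mE DE [f1 f2]; split; exact: measurable_funS f1 || exact: measurable_funS f2. Qed.

Lemma cintegrable_le D f (g : T -> R) : measurable D -> cmeasurable D f ->
  mu.-integrable D (EFin \o g) -> (forall x, D x -> modulus (f x) <= g x) ->
  cintegrable D f.
Proof.
move=> mD [f1 f2] ig fg; split; apply: le_integrable ig => //.
- exact/measurable_EFinP.
- move=> x Dx /=; rewrite lee_fin (le_trans (normr_Re_le _))// (le_trans (fg _ Dx))//.
  exact: ler_norm.
- exact/measurable_EFinP.
- move=> x Dx /=; rewrite lee_fin (le_trans (normr_Im_le _))// (le_trans (fg _ Dx))//.
  exact: ler_norm.
Qed.

Lemma cintegrable_bounded D f C : measurable D -> (mu D < +oo)%E -> cmeasurable D f ->
  (forall x, D x -> modulus (f x) <= C) -> cintegrable D f.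
Proof.
move=> mD Doo mf fC; apply: (@cintegrable_le _ _ (fun=> C)) => //.
apply: measurable_bounded_integrable => //.
exists `|C|; split; first exact: num_real.
by move=> M CM x _; rewrite (le_trans _ (ltW CM)).
Qed.

Lemma integrable_modulus D f : measurable D -> cintegrable D f ->
  mu.-integrable D (EFin \o (fun x => modulus (f x))).
Proof.
move=> mD [f1 f2].
have mf : cmeasurable D f.
  by split; apply/measurable_EFinP; [exact: measurable_int f1|exact: measurable_int f2].
have := integrableD mD (integrable_abse f1) (integrable_abse f2).
apply: le_integrable => //; first by apply/measurable_EFinP; exact: measurable_modulus.
move=> x Dx /=; rewrite lee_fin (ger0_norm (modulus_ge0 _)) ger0_norm ?addr_ge0//.
exact: modulus_le_ReIm.
Qed.

Lemma cintegrable_measurable D f : cintegrable D f -> cmeasurable D f.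
Proof.
move=> [f1 f2].
by split; apply/measurable_EFinP; [exact: measurable_int f1|exact: measurable_int f2].
Qed.

Lemma cintegrableD D f g : measurable D -> cintegrable D f -> cintegrable D g ->
  cintegrable D (fun x => f x + g x).
Proof.
move=> mD [f1 f2] [g1 g2]; split.
  have := integrableD mD f1 g1; apply: eq_integrable => // x _ /=.
  by rewrite -EFinD ReD.
have := integrableD mD f2 g2; apply: eq_integrable => // x _ /=.
by rewrite -EFinD ImD.
Qed.

Lemma cintegrableZ D f z : measurable D -> cintegrable D f ->
  cintegrable D (fun x => z * f x).
Proof.
move=> mD fi; apply: (@cintegrable_le _ _ (fun x => modulus z * modulus (f x))) => //.
- by apply: cmeasurableM; [exact: cmeasurable_cst|exact: cintegrable_measurable].
- have := integrableZl mD (modulus z) (integrable_modulus mD fi).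
  by apply: eq_integrable.
- by move=> x _; rewrite modulusM.
Qed.

Lemma cintegrableN D f : measurable D -> cintegrable D f ->
  cintegrable D (fun x => - f x).
Proof.
move=> mD fi; have := cintegrableZ (-1) mD fi.
by under eq_fun do rewrite mulN1r.
Qed.

Lemma cintegrableB D f g : measurable D -> cintegrable D f -> cintegrable D g ->
  cintegrable D (fun x => f x - g x).
Proof. by move=> mD fi gi; apply: cintegrableD => //; exact: cintegrableN. Qed.

Lemma eq_cintegral D f g : (forall x, D x -> f x = g x) ->
  cintegral mu D f = cintegral mu D g.
Proof.
move=> fg; rewrite /cintegral; congr (_ +i* _); apply: eq_Rintegral => x /set_mem Dx;
  by rewrite fg.
Qed.

Lemma cintegralD D f g : measurable D -> cintegrable D f -> cintegrable D g ->
  cintegral mu D (fun x => f x + g x) = cintegral mu D f + cintegral mu D g.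
Proof.
move=> mD [f1 f2] [g1 g2]; rewrite /cintegral.
apply: complex_eqP; rewrite ?ReD ?ImD /= -RintegralD//.
  by apply: eq_Rintegral => x _; rewrite ReD.
by apply: eq_Rintegral => x _; rewrite ImD.
Qed.

Lemma cintegralZ D f z : measurable D -> cintegrable D f ->
  cintegral mu D (fun x => z * f x) = z * cintegral mu D f.
Proof.
move=> mD [f1 f2]; rewrite /cintegral.
have rZ (r : R) (h : T -> R) : mu.-integrable D (EFin \o h) ->
    mu.-integrable D (EFin \o (fun x => r * h x)).
  by move=> hi; have := integrableZl mD r hi; exact: eq_integrable.
apply: complex_eqP; rewrite ?ReM ?ImM /= -!RintegralZl//.
  by rewrite -RintegralB//; [apply: eq_Rintegral => x _; rewrite ReM|exact: rZ..].
by rewrite -RintegralD//; [apply: eq_Rintegral => x _; rewrite ImM|exact: rZ..].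
Qed.

Lemma cintegralN D f : measurable D -> cintegrable D f ->
  cintegral mu D (fun x => - f x) = - cintegral mu D f.
Proof.
move=> mD fi; rewrite -mulN1r -cintegralZ//.
by apply: eq_cintegral => x _; rewrite mulN1r.
Qed.

Lemma cintegralB D f g : measurable D -> cintegrable D f -> cintegrable D g ->
  cintegral mu D (fun x => f x - g x) = cintegral mu D f - cintegral mu D g.
Proof.
by move=> mD fi gi; rewrite cintegralD ?cintegralN//; exact: cintegrableN.
Qed.

Lemma cintegral_sum (I : Type) (s : seq I) D (F : I -> T -> R[i]) : measurable D ->
  (forall i, cintegrable D (F i)) -> cintegrable D (fun x => \sum_(i <- s) F i x) /\
  cintegral mu D (fun x => \sum_(i <- s) F i x) = \sum_(i <- s) cintegral mu D (F i).
Proof.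
move=> mD Fi; elim: s => [|i s [IH1 IH2]].
  split.
    under eq_fun do rewrite big_nil.
    by split; apply: eq_integrable (integrable0 mu D).
  rewrite big_nil /cintegral.
  by apply: complex_eqP => /=; rewrite /Rintegral integral0_eq// => x _; rewrite big_nil.
split; first by under eq_fun do rewrite big_cons; exact: cintegrableD.
rewrite big_cons -IH2 -cintegralD//.
by apply: eq_cintegral => x _; rewrite big_cons.
Qed.

(** Multiplying each integral by a unimodular number makes it real; after that only
    the integral of a sum of real functions has to be estimated. *)
Lemma sum_modulus_cintegral (I : Type) (s : seq I) D (F : I -> T -> R[i]) (g : T -> R) :
  measurable D -> (forall i, cintegrable D (F i)) -> mu.-integrable D (EFin \o g) ->
  (forall x, D x -> \sum_(i <- s) modulus (F i x) <= g x) ->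
  \sum_(i <- s) modulus (cintegral mu D (F i)) <= \int[mu]_(x in D) g x.
Proof.
move=> mD Fi gi Fg.
have /choice[w Hw] : forall i, exists w : R[i],
    modulus w = 1 /\ w * cintegral mu D (F i) = (modulus (cintegral mu D (F i)))%:C.
  by move=> i; have [w w1 w2] := modulus_rotate (cintegral mu D (F i)); exists w.
have wFi i : cintegrable D (fun x => w i * F i x) by exact: cintegrableZ.
have [ci cE] := cintegral_sum s mD wFi.
have -> : \sum_(i <- s) modulus (cintegral mu D (F i)) =
    complex.Re (cintegral mu D (fun x => \sum_(i <- s) w i * F i x)).
  rewrite cE Re_sum; apply: eq_bigr => i _.
  by rewrite cintegralZ// (Hw i).2.
rewrite /cintegral /=; apply: le_Rintegral => //; first exact: ci.1.
move=> x Dx; rewrite Re_sum; apply: le_trans (Fg _ Dx).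
apply: ler_sum => i _; apply: le_trans (ler_norm _) _.
by rewrite (le_trans (normr_Re_le _))// modulusM (Hw i).1 mul1r.
Qed.

Lemma modulus_cintegral D f (g : T -> R) : measurable D -> cintegrable D f ->
  mu.-integrable D (EFin \o g) -> (forall x, D x -> modulus (f x) <= g x) ->
  modulus (cintegral mu D f) <= \int[mu]_(x in D) g x.
Proof.
move=> mD fi gi fg.
have := @sum_modulus_cintegral _ [:: tt] D (fun=> f) g mD (fun=> fi) gi.
by rewrite big_seq1; apply => x Dx; rewrite big_seq1 fg.
Qed.

End complex_integral.

Lemma cmeasurable_comp d d' (T : measurableType d) (T' : measurableType d')
    (R : realType) (h : T' -> T) (D : set T') (f : T -> R[i]) :
  measurable_fun D h -> cmeasurable setT f -> cmeasurable D (fun x => f (h x)).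
Proof.
by move=> mh [f1 f2]; split; [exact: measurableT_comp f1 _|exact: measurableT_comp f2 _].
Qed.

(** * Integrals in time of functions measurable off a null set *)

Section time_integrals.
Context (R : realType).
Local Notation leb := (@lebesgue_measure R).
Local Notation TR := (measurableTypeR R).
Implicit Types (t s C : R) (f g : R -> R[i]).

Definition time_segment t : set TR :=
  if 0 <= t then `[0, t]%classic else `[t, 0]%classic.

(** The exceptional set is a measurable null set, as Lebesgue measure on Borel sets is
    not complete. *)
Definition ae_cmeasurable (D : set TR) f := exists N : set TR,
  [/\ measurable N, leb N = 0%E & @cmeasurable _ TR R (D `\` N) f].

Lemma measurable_time_segment t : measurable (time_segment t).
Proof. by rewrite /time_segment; case: ifP => _; exact: measurable_itv. Qed.

Lemma lebesgue_time_segment t : leb (time_segment t) = `|t|%:E.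
Proof.
rewrite /time_segment; case: ifPn => t0; rewrite lebesgue_measure_itv/= lte_fin.
  by rewrite ger0_norm//; move: t0; rewrite le_eqVlt => /orP[/eqP <-|->];
    rewrite ?ltxx ?normr0// sube0.
move: t0; rewrite -ltNge => t0; rewrite t0 ltr0_norm// -EFinB sub0r//.
Qed.

Lemma time_integralE t f : time_integral t f =
  (if 0 <= t then 1 else -1) * cintegral leb (time_segment t) f.
Proof. by rewrite /time_integral /time_segment; case: ifP; rewrite ?mul1r ?mulN1r. Qed.

Lemma time_sign t : modulus (if 0 <= t then 1 else -1 : R[i]) = 1.
Proof. by case: ifP; rewrite ?modulusN modulus1. Qed.

Lemma cintegral_setD_null (D N : set TR) f : measurable N -> leb N = 0%E ->
  cintegral leb D f = cintegral leb (D `\` N) f.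
Proof.
by move=> mN N0; rewrite /cintegral /Rintegral -!(integral_setD_null D _ mN N0).
Qed.

Lemma eq_time_integral t f g : (forall s, time_segment t s -> f s = g s) ->
  time_integral t f = time_integral t g.
Proof. by move=> fg; rewrite !time_integralE; congr (_ * _); exact: eq_cintegral. Qed.

Lemma ae_cmeasurable_common (D : set TR) (F : nat -> R -> R[i]) : measurable D ->
  (forall k, ae_cmeasurable D (F k)) ->
  exists N : set TR, [/\ measurable N, leb N = 0%E & forall k, @cmeasurable _ TR R (D `\` N) (F k)].
Proof.
move=> mD /choice[N NP]; exists (\bigcup_k N k); split.
- by apply: bigcup_measurable => k _; case: (NP k).
- apply/negligibleP; first by apply: bigcup_measurable => k _; case: (NP k).
  apply: negligible_bigcup => k; case: (NP k) => mN N0 _.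
  by exists (N k); split.
- move=> k; case: (NP k) => mN N0 mF.
  apply: sub_cmeasurable mF; first exact: measurableD.
  by apply: setDS; exact: bigcup_sup.
Qed.

Lemma ae_cmeasurableB (D : set TR) f g : measurable D ->
  ae_cmeasurable D f -> ae_cmeasurable D g -> ae_cmeasurable D (fun s => f s - g s).
Proof.
move=> mD mf mg.
have [N [mN N0 mF]] := @ae_cmeasurable_common D (fun k => if k is 0%N then f else g)
  mD ltac:(by case).
exists N; split => //; apply: cmeasurableD; first exact: (mF 0%N).
by apply: cmeasurableN; exact: (mF 1%N).
Qed.

(** Almost everywhere limits of measurable functions: the exceptional null set is why
    measurability off a null set, and not Borel measurability, is what the
    coordinates of a strongly measurable function satisfy. *)
Lemma ae_cmeasurable_lim (D : set TR) (F : nat -> R -> R[i]) f : measurable D ->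
  (forall k, ae_cmeasurable D (F k)) ->
  {ae leb, forall s, D s -> modulus (F k s - f s) @[k --> \oo] --> (0:R)} ->
  ae_cmeasurable D f.
Proof.
move=> mD /ae_cmeasurable_common -/(_ mD)[N [mN N0 mF]] [M [mM M0 MP]].
have cv s : (D `\` (N `|` M)) s -> modulus (F k s - f s) @[k --> \oo] --> (0:R).
  move=> [Ds NMs]; apply: contrapT => h; apply: NMs; right; apply: MP => /= hs.
  by apply: h; exact: hs.
have mNM : measurable (N `|` M) by exact: measurableU.
exists (N `|` M); split => //.
  by apply: (null_set_setU (mu := leb)).
have mF' k : cmeasurable (D `\` (N `|` M)) (F k).
  apply: sub_cmeasurable (mF k); first exact: measurableD.
  by apply: setDS => x; left.
have sq (h : R[i] -> R) : (forall z w, h (z - w) = h z - h w) ->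
    (forall z, `|h z| <= modulus z) -> forall s, (D `\` (N `|` M)) s ->
    h (F k s) @[k --> \oo] --> h (f s).
  move=> hB hle s /cv c0; apply/cvgrPdist_le => e e0.
  move/cvgrPdist_le : c0 => /(_ _ e0); apply: filterS => k.
  rewrite sub0r normrN ger0_norm ?modulus_ge0// => le_e.
  by rewrite distrC -hB (le_trans (hle _)).
split.
- apply: (@measurable_fun_cvg _ _ _ _ (fun k s => complex.Re (F k s))).
    by move=> k; exact: (mF' k).1.
  by apply: sq; [move=> z w; rewrite ReD ReN|exact: normr_Re_le].
- apply: (@measurable_fun_cvg _ _ _ _ (fun k s => complex.Im (F k s))).
    by move=> k; exact: (mF' k).2.
  by apply: sq; [move=> z w; rewrite ImD ImN|exact: normr_Im_le].
Qed.

Let segD t (N : set TR) : measurable N -> leb N = 0%E ->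
  [/\ measurable (time_segment t `\` N), (leb (time_segment t `\` N) <= `|t|%:E)%E &
      (leb (time_segment t `\` N) < +oo)%E].
Proof.
move=> mN N0; have mD : measurable (time_segment t `\` N).
  by apply: measurableD => //; exact: measurable_time_segment.
have le_t : (leb (time_segment t `\` N) <= `|t|%:E)%E.
  rewrite -lebesgue_time_segment le_measure// ?inE//; first exact: measurable_time_segment.
split => //; exact: le_lt_trans le_t (ltry _).
Qed.

Lemma time_integralB t f g C :
  ae_cmeasurable (time_segment t) f -> ae_cmeasurable (time_segment t) g ->
  (forall s, time_segment t s -> modulus (f s) <= C) ->
  (forall s, time_segment t s -> modulus (g s) <= C) ->
  time_integral t (fun s => f s - g s) = time_integral t f - time_integral t g.
Proof.
move=> mf mg fC gC.
have [N [mN N0 mF]] := @ae_cmeasurable_common _ (fun k => if k is 0%N then f else g)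
  (measurable_time_segment t) ltac:(by case).
have [mD _ Doo] := segD t mN N0.
rewrite !time_integralE -mulrBr; congr (_ * _).
rewrite !(cintegral_setD_null (time_segment t) _ mN N0) cintegralB//.
  by apply: (cintegrable_bounded (C := C) mD Doo (mF 0%N)) => s [ts _]; exact: fC.
by apply: (cintegrable_bounded (C := C) mD Doo (mF 1%N)) => s [ts _]; exact: gC.
Qed.

(** Only countably many functions have a common exceptional null set, hence the
    restriction to families indexed by natural numbers; a finite sum over any index
    type is of this form. *)
Lemma sum_cintegral_ae_nat (D : set TR) (m : R) n (F : nat -> R -> R[i]) C :
  measurable D -> (leb D <= m%:E)%E -> 0 <= C ->
  (forall k, ae_cmeasurable D (F k)) ->
  (forall k, exists C', forall s, D s -> modulus (F k s) <= C') ->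
  (forall s, D s -> \sum_(0 <= k < n) modulus (F k s) <= C) ->
  \sum_(0 <= k < n) modulus (cintegral leb D (F k)) <= m * C.
Proof.
move=> mD Dm C0 mF bF FC.
have [N [mN N0 mF']] := ae_cmeasurable_common mD mF.
have mDN : measurable (D `\` N) by exact: measurableD.
have DNm : (leb (D `\` N) <= m%:E)%E.
  by apply: le_trans Dm; rewrite le_measure// ?inE//; exact: subDsetl.
have DNoo : (leb (D `\` N) < +oo)%E by exact: le_lt_trans DNm (ltry _).
under eq_bigr do rewrite (cintegral_setD_null _ _ mN N0).
have iF k : cintegrable leb (D `\` N) (F k).
  have [C' FC'] := bF k.
  by apply: (cintegrable_bounded (C := C') mDN DNoo (mF' k)) => s [ts _]; exact: FC'.
have iC : leb.-integrable (D `\` N) (EFin \o (fun=> C)).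
  apply: measurable_bounded_integrable => //; exists `|C|; split; first exact: num_real.
  by move=> M CM x _; rewrite (le_trans _ (ltW CM)).
apply: (le_trans (@sum_modulus_cintegral _ _ _ _ _ _ _ _ _ mDN iF iC _)).
  by move=> s [/FC].
rewrite Rintegral_cst// mulrC ler_wpM2r// -lee_fin fineK//.
by rewrite ge0_fin_numE.
Qed.

Lemma sum_cintegral_ae (I : Type) (l : seq I) (D : set TR) (m : R) (F : I -> R -> R[i]) C :
  measurable D -> (leb D <= m%:E)%E -> 0 <= C ->
  (forall i, ae_cmeasurable D (F i)) ->
  (forall i, exists C', forall s, D s -> modulus (F i s) <= C') ->
  (forall s, D s -> \sum_(i <- l) modulus (F i s) <= C) ->
  \sum_(i <- l) modulus (cintegral leb D (F i)) <= m * C.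
Proof.
case: l => [|i0 l] mD Dm C0 mF bF FC.
  rewrite big_nil mulr_ge0// -lee_fin; apply: le_trans Dm; exact: measure_ge0.
rewrite (big_nth i0); apply: sum_cintegral_ae_nat => // s /FC.
by rewrite (big_nth i0).
Qed.

Lemma time_segment0 t : time_segment t 0.
Proof.
rewrite /time_segment; case: ifPn => t0; rewrite /= in_itv/= lexx ?t0//.
by rewrite andbT ltW// ltNge.
Qed.

Lemma sum_modulus_time_integral (I : Type) (l : seq I) t (F : I -> R -> R[i]) C :
  (forall i, ae_cmeasurable (time_segment t) (F i)) ->
  (forall i, exists C', forall s, time_segment t s -> modulus (F i s) <= C') ->
  (forall s, time_segment t s -> \sum_(i <- l) modulus (F i s) <= C) ->
  \sum_(i <- l) modulus (time_integral t (F i)) <= `|t| * C.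
Proof.
move=> mF bF FC; under eq_bigr do rewrite time_integralE modulusM time_sign mul1r.
apply: sum_cintegral_ae => //; first exact: measurable_time_segment.
  by rewrite -lebesgue_time_segment.
apply: le_trans (FC 0 (time_segment0 t)).
by rewrite sumr_ge0// => i _; exact: modulus_ge0.
Qed.

(** When t and t0 have the same sign, the increment is an integral over the part of
    the longer segment outside the shorter one, of length |t - t0|; when the signs
    differ, |t| + |t0| = |t - t0| and the two integrals are estimated separately. *)
Lemma sum_time_integral_increment (I : Type) (l : seq I) t t0 (F : I -> R -> R[i]) C :
  (forall t' i, t' = t \/ t' = t0 -> ae_cmeasurable (time_segment t') (F i)) ->
  (forall i, exists C', forall t' s, t' = t \/ t' = t0 -> time_segment t' s -> modulus (F i s) <= C') ->
  (forall t' s, t' = t \/ t' = t0 -> time_segment t' s -> \sum_(i <- l) modulus (F i s) <= C) ->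
  \sum_(i <- l) modulus (time_integral t (F i) - time_integral t0 (F i)) <= `|t - t0| * C.
Proof.
wlog tt0 : t t0 / `|t0| <= `|t| => [wl|] mF bF FC.
  have [/wl|/ltW /wl] := leP `|t0| `|t|; first exact.
  rewrite distrC; under [X in _ -> X <= _]eq_bigr do rewrite modulusBC.
  apply.
  - by move=> t' i tt; apply: mF; case: tt => ->; [right|left].
  - by move=> i; have [C' h] := bF i; exists C' => t' s tt; apply: h; case: tt => ->; [right|left].
  - by move=> t' s tt; apply: FC; case: tt => ->; [right|left].
have C0 : 0 <= C.
  apply: le_trans (FC t 0 (or_introl erefl) (time_segment0 t)).
  by rewrite sumr_ge0// => i _; exact: modulus_ge0.
have bnd t' : t' = t \/ t' = t0 -> \sum_(i <- l) modulus (time_integral t' (F i)) <= `|t'| * C.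
  move=> tt; apply: sum_modulus_time_integral.
  - by move=> i; exact: mF.
  - by move=> i; have [C' h] := bF i; exists C' => s; exact: h.
  - by move=> s; exact: FC.
have [same|opp] := eqVneq (0 <= t) (0 <= t0); last first.
  apply: (@le_trans _ _ (`|t| * C + `|t0| * C)).
    apply: le_trans (lerD (bnd t (or_introl erefl)) (bnd t0 (or_intror erefl))).
    by rewrite -big_split/=; apply: ler_sum => i _; exact: modulusB.
  rewrite -mulrDl ler_wpM2r//; move: opp.
  have [h|h] := leP 0 t; have [h0|h0] := leP 0 t0 => // _.
    rewrite (ger0_norm h) (ltr0_norm h0) ger0_norm// subr_ge0; lra.
  rewrite (ltr0_norm h) (ger0_norm h0) ltr0_norm; lra.
have sub : time_segment t0 `<=` time_segment t.
  move: tt0; rewrite /time_segment -same; case: ifPn => [h|]; last rewrite -ltNge => h.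
    have h0 : 0 <= t0 by rewrite -same.
    rewrite (ger0_norm h) (ger0_norm h0) => tt0 s; rewrite /= !in_itv/= => /andP[? ?].
    by apply/andP; split; lra.
  have h0 : t0 < 0 by rewrite ltNge -same -ltNge.
  rewrite (ltr0_norm h) (ltr0_norm h0) => tt0 s; rewrite /= !in_itv/= => /andP[? ?].
  by apply/andP; split; lra.
pose D := time_segment t `\` time_segment t0.
have mt t' : measurable (time_segment t') by exact: measurable_time_segment.
have mD : measurable D by exact: measurableD.
have DE : leb D = `|t - t0|%:E.
  rewrite measureD//; last by rewrite [ltLHS]lebesgue_time_segment ltry.
  rewrite setIidr// [X in (X - _)%E]lebesgue_time_segment [X in (_ - X)%E]lebesgue_time_segment.
  rewrite -EFinB; congr EFin; move: tt0 same; have [h|h] := leP 0 t.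
    move=> + /esym h0; rewrite (ger0_norm h) (ger0_norm h0) => ?.
    by rewrite ger0_norm// subr_ge0.
  move=> + /esym/negbT; rewrite -ltNge => + h0; rewrite (ltr0_norm h) (ltr0_norm h0) => ?.
  by rewrite ler0_norm ?subr_le0; lra.
have E i : time_integral t (F i) - time_integral t0 (F i) =
    (if 0 <= t then 1 else -1) * cintegral leb D (F i).
  rewrite !time_integralE -same -mulrBr; congr (_ * _).
  have [N [mN N0 mFi]] := mF t i (or_introl erefl); have [C' FC'] := bF i.
  have mtN t' : measurable (time_segment t' `\` N) by exact: measurableD.
  have mDN : measurable (D `\` N) by exact: measurableD.
  have UE : time_segment t `\` N = (time_segment t0 `\` N) `|` (D `\` N).
    rewrite -setDUl; congr (_ `\` _).
    by rewrite /D setDUK.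
  have disj : [disjoint time_segment t0 `\` N & D `\` N].
    apply/disj_set2P/seteqP; split => // s [[h _] [[_ h'] _]]; exact: h'.
  have iF : cintegrable leb (time_segment t `\` N) (F i).
    have [_ _ oo] := segD t mN N0.
    by apply: (cintegrable_bounded (C := C') (mtN t) oo mFi) => s [ts _];
      exact: (FC' t s (or_introl erefl) ts).
  rewrite (cintegral_setD_null (time_segment t) _ mN N0).
  rewrite (cintegral_setD_null (time_segment t0) _ mN N0).
  rewrite (cintegral_setD_null D _ mN N0) UE /cintegral.
  rewrite UE in iF; rewrite !Rintegral_setU//; [|exact: iF.2|exact: iF.1].
  apply: complex_eqP; rewrite ?ReD ?ImD ?ReN ?ImN /=.
    by rewrite addrAC subrr add0r.
  by rewrite addrAC subrr add0r.
under eq_bigr do rewrite E modulusM time_sign mul1r.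
apply: sum_cintegral_ae => //.
- by rewrite DE.
- move=> i; have [N [mN N0 mFi]] := mF t i (or_introl erefl).
  exists N; split => //; apply: sub_cmeasurable mFi; first exact: measurableD.
  by apply: setSD; exact: subDsetl.
- by move=> i; have [C' h] := bF i; exists C' => s [ts _]; exact: (h t s (or_introl erefl) ts).
- by move=> s [ts _]; exact: (FC t s (or_introl erefl) ts).
Qed.

(** Dominated convergence, for complex functions that are measurable only off a null
    set and on the oriented segment from 0 to t. *)
Lemma time_integral_cvg t (F : nat -> R -> R[i]) f C :
  (forall k, ae_cmeasurable (time_segment t) (F k)) ->
  (forall k s, time_segment t s -> modulus (F k s) <= C) ->
  (forall s, time_segment t s -> modulus (F k s - f s) @[k --> \oo] --> (0:R)) ->
  modulus (time_integral t (F k) - time_integral t f) @[k --> \oo] --> (0:R).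
Proof.
move=> mF FC cvF.
have mf : ae_cmeasurable (time_segment t) f.
  apply: (@ae_cmeasurable_lim _ F) => //; first exact: measurable_time_segment.
  by apply/aeW => s; exact: cvF.
have fC s : time_segment t s -> modulus (f s) <= C.
  move=> ts; apply/ler_addgt0Pr => e e0.
  have /cvgrPdist_le/(_ _ e0)[k _ /(_ _ (leqnn _))] := cvF _ ts.
  rewrite sub0r normrN ger0_norm ?modulus_ge0// => le_e.
  rewrite (_ : f s = F k s - (F k s - f s)); last by rewrite opprB addrC subrK.
  by rewrite (le_trans (modulusB _ _))// lerD// FC.
have [N [mN N0 mF']] := @ae_cmeasurable_common _ (fun k => if k is k'.+1 then F k' else f)
  (measurable_time_segment t) ltac:(by case).
have [mD Dt Doo] := segD t mN N0.
pose h k s : R := modulus (F k s - f s).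
have mh k : measurable_fun (time_segment t `\` N) (h k).
  apply: measurable_modulus; apply: cmeasurableD; first exact: (mF' k.+1).
  by apply: cmeasurableN; exact: (mF' 0%N).
have C2 k s : time_segment t s -> h k s <= C + C.
  by move=> ts; rewrite (le_trans (modulusB _ _))// lerD ?FC ?fC.
have iC : leb.-integrable (time_segment t `\` N) (EFin \o (fun=> C + C)).
  apply: measurable_bounded_integrable => //; exists `|C + C|; split; first exact: num_real.
  by move=> M CM x _; rewrite (le_trans _ (ltW CM)).
have [_ _ cv] := @dominated_convergence _ _ _ leb _ mD (fun k => EFin \o h k) (cst 0%E)
  (EFin \o (fun=> C + C)) (fun k => (measurable_EFinP _ _).2 (mh k)) (measurable_cst _)
  ltac:(by apply/aeW => s [ts _] /=; apply: cvg_EFin; [exact: nearW|exact: cvF])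
  iC
  ltac:(apply/aeW => s k [ts _] /=; rewrite lee_fin ger0_norm ?modulus_ge0//; exact: C2).
rewrite integral0 in cv.
have ih k : leb.-integrable (time_segment t `\` N) (EFin \o h k).
  apply: le_integrable iC => //; first exact/measurable_EFinP.
  move=> s [ts _] /=; rewrite lee_fin ger0_norm ?modulus_ge0// (le_trans (C2 k s ts))//.
  exact: ler_norm.
apply: (@squeeze_cvgr _ _ _ _ (fun=> 0) (fun k => fine (\int[leb]_(x in time_segment t `\` N) (h k x)%:E))).
- apply: nearW => k; rewrite modulus_ge0/= !time_integralE -mulrBr modulusM time_sign mul1r.
  rewrite !(cintegral_setD_null (time_segment t) _ mN N0).
  have i1 : cintegrable leb (time_segment t `\` N) (F k).
    by apply: (cintegrable_bounded mD Doo (mF' k.+1)) => s [/FC].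
  have i2 : cintegrable leb (time_segment t `\` N) f.
    by apply: (cintegrable_bounded (C := C) mD Doo (mF' 0%N)) => s [ts _]; exact: fC.
  rewrite -cintegralB//; apply: modulus_cintegral => //; exact: cintegrableB.
- exact: cvg_cst.
- by apply: fine_cvg; exact: cv.
Qed.

End time_integrals.

(** * Normed algebras of coefficient families with a flow *)

Section variation.
Context (R : realType) (I : Type) (Pi : set (seq I)).
Implicit Types (a b : I -> R[i]) (C : R).

Definition var_le a C := forall l, Pi l -> \sum_(i <- l) modulus (a i) <= C.

Lemma var_leW a C C' : C <= C' -> var_le a C -> var_le a C'.
Proof. by move=> CC' aC l /aC /le_trans; exact. Qed.

Lemma var_leD a b A B : var_le a A -> var_le b B -> var_le (a \+ b) (A + B).
Proof.
move=> aA bB l Pl; apply: le_trans (lerD (aA _ Pl) (bB _ Pl)).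
by rewrite -big_split/=; apply: ler_sum => i _; exact: modulusD.
Qed.

Lemma var_leZ z a A : var_le a A -> var_le (fun i => z * a i) (modulus z * A).
Proof.
move=> aA l Pl; under eq_bigr do rewrite modulusM.
by rewrite -mulr_sumr ler_wpM2l ?modulus_ge0// aA.
Qed.

Lemma var_leN a A : var_le a A -> var_le (fun i => - a i) A.
Proof. by move=> aA l /aA; under [X in _ -> X <= _]eq_bigr do rewrite modulusN. Qed.

Lemma var_leB a b A B : var_le a A -> var_le b B -> var_le (a \- b) (A + B).
Proof. by move=> aA bB; apply: var_leD => //; exact: var_leN. Qed.

Lemma var_leBC a b A : var_le (a \- b) A -> var_le (b \- a) A.
Proof. by move=> aA l /aA; under [X in _ -> X <= _]eq_bigr do rewrite /= modulusBC. Qed.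

Lemma var_le_trans b a c A B : var_le (a \- b) A -> var_le (b \- c) B ->
  var_le (a \- c) (A + B).
Proof.
move=> aA bB; rewrite (_ : _ \- c = (a \- b) \+ (b \- c)); first exact: var_leD.
by apply/funext => i /=; rewrite addrA subrK.
Qed.

Lemma var_le0 : var_le (fun=> 0) 0.
Proof. by move=> l _; rewrite big1// => i _; rewrite modulus0. Qed.

End variation.

(** Both settings are instances of one structure: families of complex numbers indexed
    by I (Fourier coefficients indexed by lattice points, or values of a measure
    indexed by Borel sets), whose norm is the least bound of the finite sums of
    moduli over the lists in [tests] (lists of distinct points, or of disjoint
    sets). Time integrals are taken index by index, as in the definition of a mild
    solution. *)
Record flow_algebra (R : realType) (I : Type) := FlowAlgebra {
  tests : set (seq I) ;
  carrier : set (I -> R[i]) ;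
  mulc : (I -> R[i]) -> (I -> R[i]) -> (I -> R[i]) ;
  flow : R -> (I -> R[i]) -> (I -> R[i]) ;
  tests_nil : tests [::] ;
  tests1 : forall i, tests [:: i] ;
  carrier0 : carrier (fun=> 0) ;
  carrierD : forall a b, carrier a -> carrier b -> carrier (a \+ b) ;
  carrierZ : forall z a, carrier a -> carrier (fun i => z * a i) ;
  carrier_fin : forall a, carrier a -> exists C, var_le tests a C ;
  carrier_lim : forall (u : nat -> I -> R[i]) a, (forall k, carrier (u k)) ->
    (forall e : R, 0 < e -> exists k, var_le tests (u k \- a) e) -> carrier a ;
  carrier_int : forall t (g : R -> I -> R[i]) C,
    (forall s, time_segment t s -> carrier (g s)) ->
    (forall s, time_segment t s -> var_le tests (g s) C) ->
    (forall i, ae_cmeasurable (time_segment t) (fun s => g s i)) ->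
    carrier (fun i => time_integral t (fun s => g s i)) ;
  carrierM : forall a b, carrier a -> carrier b -> carrier (mulc a b) ;
  mulcBl : forall a b c, carrier a -> carrier b -> carrier c ->
    mulc (a \- b) c = mulc a c \- mulc b c ;
  mulcBr : forall a b c, carrier a -> carrier b -> carrier c ->
    mulc a (b \- c) = mulc a b \- mulc a c ;
  mulc_le : forall a b A B, carrier a -> carrier b -> var_le tests a A ->
    var_le tests b B -> var_le tests (mulc a b) (A * B) ;
  carrier_flow : forall t a, carrier a -> carrier (flow t a) ;
  flowB : forall t a b, carrier a -> carrier b -> flow t (a \- b) = flow t a \- flow t b ;
  flow_le : forall t a C, carrier a -> var_le tests a C -> var_le tests (flow t a) C ;
  flow_cont : forall a t (e : R), carrier a -> 0 < e ->
    \forall s \near t, var_le tests (flow s a \- flow t a) e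
}.

Section nonlinearity.
Context (R : realType) (I : Type) (A : flow_algebra R I).
Local Notation K := (@carrier R I A).
Local Notation "a <=v C" := (var_le (tests A) a C) (at level 70).
Implicit Types (a b : I -> R[i]).

Lemma carrierN a : K a -> K (fun i => - a i).
Proof.
move=> /(carrierZ (-1)); rewrite (_ : (fun i => _ * _) = (fun i => - a i))//.
by apply/funext => i; rewrite mulN1r.
Qed.

Lemma carrierB a b : K a -> K b -> K (a \- b).
Proof. by move=> Ka Kb; apply: carrierD => //; exact: carrierN. Qed.

Lemma var_le_ge0 a C : a <=v C -> 0 <= C.
Proof. by move=> /(_ _ (tests_nil A)); rewrite big_nil. Qed.

Lemma var_le_coord a C i : a <=v C -> modulus (a i) <= C.
Proof. by move=> /(_ _ (tests1 A i)); rewrite big_seq1. Qed.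

(** An equality of families may be proved up to an error of arbitrarily small norm,
    because singletons are tests. *)
Lemma var_le_eq a b : (forall e, 0 < e -> (a \- b) <=v e) -> a = b.
Proof.
move=> ab; apply/funext => i; apply/subr0_eq/modulus_eq0/eqP.
rewrite eq_le modulus_ge0 andbT; apply/ler_addgt0Pr => e e0; rewrite add0r.
exact: (var_le_coord i (ab _ e0)).
Qed.

Lemma var_le_near_trans a b c (e : R) : (a \- b) <=v (e / 2) -> (b \- c) <=v (e / 2) ->
  (a \- c) <=v e.
Proof. by move=> ab bc; rewrite (splitr e); exact: var_le_trans ab bc. Qed.

(** The local Lipschitz property shared by the two nonlinear terms. The bound on
    F a is the one against a itself, because the ball in which the solution lives
    has radius proportional to the size of the datum. *)
Definition lipschitz_upto (F : (I -> R[i]) -> I -> R[i]) (r L : R) :=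
  [/\ 0 <= L,
      forall a, K a -> K (F a),
      forall a al, K a -> a <=v al -> al <= r -> F a <=v (L * al) &
      forall a b d, K a -> K b -> a <=v r -> b <=v r -> (a \- b) <=v d ->
        (F a \- F b) <=v (L * d)].

Definition powc (rho : nat) a := iter rho.-1 (mulc A a) a.

Lemma iter_mulc_le k a al : K a -> a <=v al ->
  K (iter k (mulc A a) a) /\ iter k (mulc A a) a <=v (al ^+ k.+1).
Proof.
move=> Ka aal; elim: k => [|k [IH1 IH2]]; first by rewrite expr1.
split; first exact: carrierM.
by rewrite exprS; exact: mulc_le.
Qed.

(** The constant is that of the derivative of the power of order k + 1 on the ball of
    radius al: a^(k+2) - b^(k+2) = (a - b) a^(k+1) + b (a^(k+1) - b^(k+1)). *)
Lemma iter_mulc_lip k a b al d : K a -> K b -> a <=v al -> b <=v al -> (a \- b) <=v d ->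
  (iter k (mulc A a) a \- iter k (mulc A b) b) <=v (k.+1%:R * al ^+ k * d).
Proof.
move=> Ka Kb aal bal abd; elim: k => [|k IH].
  by rewrite expr0 !mul1r.
have [Kak ak] := iter_mulc_le k Ka aal; have [Kbk bk] := iter_mulc_le k Kb bal.
set x := iter k (mulc A a) a in IH Kak ak *; set y := iter k (mulc A b) b in IH Kbk bk *.
rewrite !iterS -/x -/y (_ : _ \- _ = mulc A (a \- b) x \+ mulc A b (x \- y)); last first.
  rewrite mulcBl// mulcBr//; apply/funext => i /=.
  by rewrite addrA subrK.
have := var_leD (mulc_le (carrierB Ka Kb) Kak abd ak)
  (mulc_le Kb (carrierB Kak Kbk) bal IH).
apply: var_leW; rewrite -[k.+2]addn1 natrD exprS.
by rewrite le_eqVlt; apply/orP; left; apply/eqP; ring.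
Qed.

Lemma powc_lipschitz rho r : (1 <= rho)%N -> 0 <= r ->
  lipschitz_upto (powc rho) r (rho%:R * r ^+ rho.-1).
Proof.
case: rho => // k _ r0; split.
- by rewrite mulr_ge0// exprn_ge0.
- move=> a Ka; have [C aC] := carrier_fin Ka; exact: (iter_mulc_le k Ka aC).1.
- move=> a al Ka aal alr; have [_] := iter_mulc_le k Ka aal.
  have al0 := var_le_ge0 aal; apply: var_leW; rewrite exprSr ler_wpM2r//.
  rewrite (@le_trans _ _ (r ^+ k))//; first by rewrite lerXn2r// nnegrE.
  by rewrite ler_peMl ?exprn_ge0// ler1n.
- by move=> a b d Ka Kb ar br abd; exact: iter_mulc_lip.
Qed.

Lemma mulc_lipschitz m M r : K m -> m <=v M -> lipschitz_upto (mulc A m) r M.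
Proof.
move=> Km mM; split.
- exact: var_le_ge0 mM.
- by move=> a Ka; exact: carrierM.
- by move=> a al Ka aal _; exact: mulc_le.
- move=> a b d Ka Kb _ _ abd; rewrite -mulcBr//.
  by apply: mulc_le => //; exact: carrierB.
Qed.

End nonlinearity.

(** * Simple functions of time *)

Section simple_maps.
Context (R : realType).
Local Notation leb := (@lebesgue_measure R).
Local Notation TR := (measurableTypeR R).
Implicit Types (T : R).

(** Values in an arbitrary type, with measurable fibres: it serves both for functions
    into distributions and for their coordinates. *)
Definition simple_map (Y : Type) T (w : R -> Y) := finite_set (w @` `]-T, T[) /\
  forall y, measurable ((`]-T, T[%classic : set TR) `&` w @^-1` [set y]).

Lemma simple_map_comp (Y Z : Type) T (w : R -> Y) (u : Y -> Z) :
  simple_map T w -> simple_map T (fun t => u (w t)).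
Proof.
move=> [fw mw]; split.
  by rewrite (_ : _ @` _ = u @` (w @` `]-T, T[)); [exact: finite_image|rewrite image_comp].
move=> z; rewrite (_ : _ `&` _ = \bigcup_(y in (w @` `]-T, T[) `&` u @^-1` [set z])
    ((`]-T, T[%classic : set TR) `&` w @^-1` [set y])); last first.
  apply/seteqP; split=> [t [Dt /= uz]|t [y [_ /= uy]] [Dt /= wy]].
    by exists (w t) => //; split => //; exists t.
  by split => //=; rewrite wy.
apply: fin_bigcup_measurable; last by move=> y _; exact: mw.
exact: finite_setIl.
Qed.

(** Inserting a simple function into a function of two variables only needs
    measurability in time for each fixed value. *)
Lemma simple_map_measurable (Y : Type) T (w : R -> Y) (G : Y -> R -> R) :
  simple_map T w ->
  (forall y, (w @` `]-T, T[) y -> @measurable_fun _ _ TR R `]-T, T[ (G y)) ->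
  @measurable_fun _ _ TR R `]-T, T[ (fun s => G (w s) s).
Proof.
move=> [fw mw] mG _ B mB.
rewrite (_ : _ `&` _ = \bigcup_(y in w @` `]-T, T[)
    (((`]-T, T[%classic : set TR) `&` w @^-1` [set y]) `&`
     ((`]-T, T[%classic : set TR) `&` (G y) @^-1` B))); last first.
  apply/seteqP; split=> [t [Dt /= Bt]|t [y _] [[Dt /= <-]] [_ Bt]//].
  by exists (w t) => //; exists t.
apply: fin_bigcup_measurable => // y wy; apply: measurableI; first exact: mw.
by apply: mG => //; exact: measurable_itv.
Qed.

Lemma simple_map_cmeasurable (Y : Type) T (w : R -> Y) (G : Y -> R -> R[i]) :
  simple_map T w ->
  (forall y, (w @` `]-T, T[) y -> @cmeasurable _ TR R `]-T, T[ (G y)) ->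
  @cmeasurable _ TR R `]-T, T[ (fun s => G (w s) s).
Proof.
move=> sw mG; split.
  by apply: (simple_map_measurable (G := fun y s => complex.Re (G y s)) sw) => y /mG[].
by apply: (simple_map_measurable (G := fun y s => complex.Im (G y s)) sw) => y /mG[].
Qed.

(** Sampling at the midpoints of a subdivision of the interval: composing it with a
    continuous function yields simple functions that converge to it. *)
Lemma simple_sampling T : 0 < T -> exists g : nat -> R -> R,
  (forall k, simple_map T (g k)) /\
  (forall k t, t \in `]-T, T[ -> (g k t \in `]-T, T[) /\ `|g k t - t| <= T / k.+1%:R).
Proof.
move=> T0; pose x k t : R := (t + T) * k.+1%:R / (2 * T).
(* The cell containing t has index truncn (x k t), and the half-integer shift selects
   its midpoint, which lies in the open interval also for the last cell. *)
pose g k t : R := - T + 2 * T / k.+1%:R * ((Num.truncn (x k t))%:R + 2^-1).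
have T20 : 0 < 2 * T by rewrite mulr_gt0.
have gj k t : t \in `]-T, T[ -> [/\ (Num.truncn (x k t) < k.+1)%N,
    (Num.truncn (x k t))%:R <= x k t & x k t < (Num.truncn (x k t))%:R + 1].
  rewrite in_itv/= => /andP[t1 t2].
  have x0 : 0 <= x k t by rewrite /x divr_ge0 ?ltW// mulr_gt0// -ltrBlDr sub0r.
  have xk : x k t < k.+1%:R.
    rewrite /x ltr_pdivrMr// mulrC ltr_pM2l// mulrDl mul1r ltrD2r//.
  have /andP[h1 h2] := truncn_itv x0.
  split => //; last by rewrite natr1.
  by rewrite -(ltr_nat R); exact: le_lt_trans xk.
have mono k : {homo g k : s t / s <= t}.
  move=> s t st; rewrite /g lerD2l; apply: ler_wpM2l; first by rewrite divr_ge0// ltW.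
  rewrite lerD2r ler_nat le_truncn// /x; apply: ler_wpM2r; first by rewrite invr_ge0 ltW.
  by rewrite ler_wpM2r// lerD2r.
exists g; split => [k|k t Dt]; first split.
- apply: (@sub_finite_set _ _ ((fun j : nat => - T + 2 * T / k.+1%:R * (j%:R + 2^-1)) @` `I_k.+1)).
    by move=> _ [t Dt <-]; have [h1 _ _] := gj k t Dt; exists (Num.truncn (x k t)).
  exact/finite_image/finite_II.
- move=> y; apply: (@nondecreasing_measurable R `]-T, T[%classic (g k)) => //.
- have [h1 h2 h3] := gj k t Dt; set j := Num.truncn (x k t) in h1 h2 h3 *.
  have k0 : (0 : R) < k.+1%:R by rewrite ltr0n.
  have tE : t = - T + 2 * T / k.+1%:R * x k t.
    by rewrite /x; field; rewrite gt_eqF//= gt_eqF// ltr0n.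
  have c0 : 0 < 2 * T / k.+1%:R by rewrite divr_gt0.
  split.
    rewrite in_itv/= /g -/j ltrDl mulr_gt0//=.
    rewrite addrC ltrBlDr -mulr2n -(mulr_natl T 2) mulrAC ltr_pdivrMr// ltr_pM2l//.
    apply: (@lt_le_trans _ _ (j%:R + 1)); last by rewrite natr1 ler_nat.
    by rewrite ltrD2l invf_lt1// ltr1n.
  rewrite {2}tE /g -/j opprD addrACA subrr add0r -mulrBr normrM (gtr0_norm c0).
  rewrite (_ : T / k.+1%:R = 2 * T / k.+1%:R * 2^-1); last first.
    by field; rewrite gt_eqF.
  by rewrite ler_pM2l// ler_norml; apply/andP; split; lra.
Qed.

Lemma subset_time_segment T t : t \in `]-T, T[ -> time_segment t `<=` `]-T, T[%classic.
Proof.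
rewrite in_itv/= => /andP[t1 t2] s; rewrite /time_segment; case: ifPn => t0;
  rewrite /= !in_itv/= => /andP[s1 s2]; apply/andP; split; lra.
Qed.

End simple_maps.

(** * Duhamel integrals *)

Section duhamel.
Context (R : realType) (I : Type) (A : flow_algebra R I) (T : R).
Local Notation E := (I -> R[i]).
Local Notation K := (@carrier R I A).
Local Notation "a <=v C" := (var_le (tests A) a C) (at level 70).
Local Notation leb := (@lebesgue_measure R).
Local Notation TR := (measurableTypeR R).
Local Notation D := (`]-T, T[).
Implicit Types (a b : E) (w : R -> E) (F : E -> E).

(** The trace of strong measurability on coordinates: almost everywhere limits, in the
    norm, of simple functions with values in the carrier. *)
Definition bochner w := exists wk : nat -> R -> E,
  [/\ forall k, simple_map T (wk k),
      forall k t, t \in D -> K (wk k t) &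
      {ae leb, forall t, t \in D -> forall e : R, 0 < e ->
        \forall k \near \oo, (wk k t \- w t) <=v e}].

Definition var_continuous w := forall t, t \in D -> forall e : R, 0 < e ->
  \forall s \near t, s \in D -> (w s \- w t) <=v e.

Definition in_ball (r : R) w := forall t, t \in D -> K (w t) /\ w t <=v r.

Lemma near_segment t : t \in D -> \forall s \near t, s \in D.
Proof. by move=> Dt; exact: near_in_itvoo. Qed.

(** Sampling a continuous function at finitely many times gives simple functions that
    converge everywhere. *)
Lemma var_continuous_bochner w : 0 < T -> (forall t, t \in D -> K (w t)) ->
  var_continuous w -> bochner w.
Proof.
move=> T0 Kw cw; have [g [sg gD]] := simple_sampling T0.
exists (fun k t => w (g k t)); split.
- by move=> k; exact: simple_map_comp.
- by move=> k t /(gD k)[+ _]; exact: Kw.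
- apply/aeW => t Dt e e0; have /nbhs_ballP[d /= d0 dP] := cw t Dt e e0.
  have /cvgrPdist_lt/(_ _ d0) : T / k.+1%:R @[k --> \oo] --> (0:R).
    rewrite -(mulr0 T); apply: cvgMr; exact: cvg_harmonic.
  apply: filterS => k; rewrite sub0r normrN ger0_norm; last by rewrite divr_ge0// ltW.
  move=> kd; have [Dg gt_le] := gD k t Dt; apply: dP => //.
  by rewrite /ball/= distrC (le_lt_trans gt_le).
Qed.

Lemma flow_coord_continuous a i : K a ->
  continuous (fun s => complex.Re (flow A s a i)) /\
  continuous (fun s => complex.Im (flow A s a i)).
Proof.
move=> Ka.
have key (h : R[i] -> R) : (forall z1 z2, h (z1 - z2) = h z1 - h z2) ->
    (forall z, `|h z| <= modulus z) -> continuous (fun s => h (flow A s a i)).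
  move=> hB hle t; apply/cvgrPdist_le => e e0.
  apply: filterS (flow_cont t Ka e0) => s /(var_le_coord i) /= le_e.
  by rewrite distrC -hB (le_trans (hle _)).
split; apply: key.
- by move=> z1 z2; rewrite ReD ReN.
- exact: normr_Re_le.
- by move=> z1 z2; rewrite ImD ImN.
- exact: normr_Im_le.
Qed.

Lemma flow_coord_cmeasurable t a i (S : set TR) : K a ->
  @cmeasurable _ TR R S (fun s => flow A (t - s) a i).
Proof.
move=> Ka; have [c1 c2] := flow_coord_continuous i Ka.
have ct : continuous (fun s : R => t - s).
  by move=> s; apply: cvgB; [exact: cvg_cst|exact: cvg_id].
split; apply: (@measurable_funS _ _ TR R setT) => //.
  apply: continuous_measurable_fun => s.
  apply: (@continuous_comp _ _ _ (fun s => t - s) (fun s => complex.Re (flow A s a i))).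
    exact: ct.
  exact: c1.
apply: continuous_measurable_fun => s.
apply: (@continuous_comp _ _ _ (fun s => t - s) (fun s => complex.Im (flow A s a i))).
  exact: ct.
exact: c2.
Qed.

(** A Lipschitz constant on every ball: the power nonlinearity has no global one. *)
Definition loc_lipschitz F := forall r, 0 <= r -> exists L, lipschitz_upto A F r L.

(** Approximating sequences need not stay in the ball in which w lives, hence the
    Lipschitz constant of the ball of radius one more. *)
Lemma duhamel_measurable F r w t t' i : loc_lipschitz F -> in_ball r w -> bochner w ->
  t \in D -> ae_cmeasurable (time_segment t) (fun s => flow A (t' - s) (F (w s)) i).
Proof.
move=> lF bw [wk [sw Kw cw]] Dt.
have r0 : 0 <= r by have [_ /var_le_ge0] := bw t Dt.
have [L [L0 FK _ FL]] := lF (r + 1) (addr_ge0 r0 ler01).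
have sub := subset_time_segment Dt.
apply: (@ae_cmeasurable_lim R _ (fun k s => flow A (t' - s) (F (wk k s)) i)).
- exact: measurable_time_segment.
- move=> k; exists set0; split => //.
  apply: (@sub_cmeasurable _ TR R _ `]-T, T[%classic).
  + exact: measurable_itv.
  + by move=> s [/sub].
  + apply: (simple_map_cmeasurable (G := fun y s => flow A (t' - s) (F y) i) (sw k)).
    by move=> _ [s Ds <-]; apply: flow_coord_cmeasurable; apply: FK; exact: Kw.
- case: cw => N [mN N0 NP]; exists N; split => //; apply: subset_trans NP.
  apply: subsetC => s hs /sub Ds.
  apply/cvgrPdist_le => e e0.
  have e1 : 0 < Num.min 1 (e / (L + 1)).
    by rewrite lt_min ltr01 divr_gt0// ltr_wpDl.
  apply: filterS (hs Ds _ e1) => k kle.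
  rewrite sub0r normrN ger0_norm ?modulus_ge0//.
  have [Kws ws] := bw s Ds; have Kk := Kw k s Ds.
  have wkr : wk k s <=v (r + 1).
    rewrite (_ : wk k s = w s \+ (wk k s \- w s)); last first.
      by apply/funext => j /=; rewrite addrC subrK.
    by apply: var_leD => //; apply: var_leW kle; rewrite ge_min lexx.
  have wsr : w s <=v (r + 1) by apply: var_leW ws; rewrite lerDl.
  have := var_le_coord i (flow_le (t' - s) (carrierB (FK _ Kk) (FK _ Kws)) (FL _ _ _ Kk Kws wkr wsr kle)).
  rewrite flowB//; [move=> /= /le_trans; apply|exact: FK..].
  rewrite (@le_trans _ _ (L * (e / (L + 1))))//.
    by rewrite ler_wpM2l// ge_min lexx orbT.
  by rewrite mulrA ler_pdivrMr ?ltr_wpDl// mulrDr mulr1 (mulrC L) lerDl ltW.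
Qed.

Definition duhamel F w t : E :=
  fun i => time_integral t (fun s => flow A (t - s) (F (w s)) i).

Section duhamel_theory.
Context (F : E -> E) (lF : loc_lipschitz F).

Let FK a : K a -> K (F a).
Proof. by have [L [_ h _ _]] := lF (lexx 0); exact: h. Qed.

Lemma duhamel_carrier r w t : in_ball r w -> bochner w -> t \in D -> K (duhamel F w t).
Proof.
move=> bw mw Dt; have sub := subset_time_segment Dt.
have r0 : 0 <= r by have [_ /var_le_ge0] := bw t Dt.
have [L [L0 _ FL _]] := lF r0.
apply: (@carrier_int _ _ A t (fun s => flow A (t - s) (F (w s))) (L * r)).
- by move=> s /sub Ds; apply/carrier_flow/FK; have [] := bw s Ds.
- move=> s /sub Ds; have [Kw wr] := bw s Ds; apply: flow_le; first exact: FK.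
  exact: FL.
- by move=> i; exact: duhamel_measurable lF bw mw Dt.
Qed.

Lemma duhamel_le r w t C : in_ball r w -> bochner w -> t \in D ->
  (forall s, s \in D -> F (w s) <=v C) -> duhamel F w t <=v (`|t| * C).
Proof.
move=> bw mw Dt FC l Pl; have sub := subset_time_segment Dt.
apply: sum_modulus_time_integral.
- by move=> i; exact: duhamel_measurable lF bw mw Dt.
- move=> i; exists C => s /sub Ds; apply: var_le_coord; apply: flow_le; last exact: FC.
  by apply: FK; have [] := bw s Ds.
- move=> s /sub Ds; apply: (flow_le (t - s)) => //; last exact: FC.
  by apply: FK; have [] := bw s Ds.
Qed.

Lemma duhamelB_le r w w' t C : in_ball r w -> in_ball r w' -> bochner w -> bochner w' ->
  t \in D -> (forall s, s \in D -> (F (w s) \- F (w' s)) <=v C) ->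
  (duhamel F w t \- duhamel F w' t) <=v (`|t| * C).
Proof.
move=> bw bw' mw mw' Dt FC l Pl; have sub := subset_time_segment Dt.
have r0 : 0 <= r by have [_ /var_le_ge0] := bw t Dt.
have [L [L0 _ FL _]] := lF r0.
have Kf v s : in_ball r v -> s \in D -> K (F (v s)) by move=> bv /bv[+ _]; exact: FK.
have Lr v s i : in_ball r v -> time_segment t s -> modulus (flow A (t - s) (F (v s)) i) <= L * r.
  move=> bv /sub Ds; have [Kv vr] := bv s Ds.
  by apply: var_le_coord; apply: flow_le; [exact: FK|exact: FL].
have m v i := @duhamel_measurable F r v t t i lF.
have E i : duhamel F w t i - duhamel F w' t i = time_integral t
    (fun s => flow A (t - s) (F (w s)) i - flow A (t - s) (F (w' s)) i).
  apply/esym/(@time_integralB R t _ _ (L * r)); try exact: m.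
  - by move=> s; exact: Lr.
  - by move=> s; exact: Lr.
under eq_bigr do rewrite /= E.
apply: sum_modulus_time_integral.
- by move=> i; apply: ae_cmeasurableB; [exact: measurable_time_segment|exact: m..].
- move=> i; exists (L * r + L * r) => s ts.
  by rewrite (le_trans (modulusB _ _))// lerD//; exact: Lr.
- move=> s /sub Ds; have := flow_le (t - s) (carrierB (Kf _ _ bw Ds) (Kf _ _ bw' Ds)) (FC s Ds) Pl.
  by rewrite flowB//; exact: Kf.
Qed.

(** The increment of the Duhamel integral has two parts. The change of the flow inside
    the integral is small uniformly in s: it is so near each s by strong continuity of
    the flow at the single element F (w s) and continuity of F (w s) in s, and a
    compact segment is covered by finitely many such neighbourhoods. The change of the
    domain of integration is controlled by its length. *)
Lemma duhamel_continuous r w : 0 < T -> in_ball r w -> var_continuous w ->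
  var_continuous (duhamel F w).
Proof.
move=> T0 bw cw t0 Dt0 e e0.
have mw : bochner w by apply: var_continuous_bochner => // t /bw[].
have r0 : 0 <= r by have [_ /var_le_ge0] := bw t0 Dt0.
have [L [L0 _ FL FB]] := lF r0.
pose C := L * r; have C0 : 0 <= C by rewrite mulr_ge0.
pose p s := F (w s).
have Kp s : s \in D -> K (p s) by move=> /bw[/FK].
have pC s : s \in D -> p s <=v C by move=> /bw[Kw wr]; exact: FL.
pose e1 := e / (2 * T); have e10 : 0 < e1 by rewrite divr_gt0// mulr_gt0.
have e40 : 0 < e1 / 4 by rewrite divr_gt0.
have e2L : 0 < e1 / 4 / (L + 1) by rewrite divr_gt0// ltr_wpDl.
have t0T : `|t0| < T by move: Dt0; rewrite in_itv/= => /andP[? ?]; rewrite ltr_norml; apply/andP.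
(* A closed segment inside the open interval that contains all times between 0 and t,
   for t near t0. *)
pose T' := (`|t0| + T) / 2.
have T'T : T' < T by rewrite /T'; lra.
have t0T' : `|t0| < T' by rewrite /T'; lra.
have DT' s : s \in `[- T', T'] -> s \in D.
  by rewrite !in_itv/= => /andP[? ?]; apply/andP; split; lra.
have /compact_near_coveringP/(_ _ (nbhs t0) (fun t s =>
    (flow A (t - s) (p s) \- flow A (t0 - s) (p s)) <=v e1) _) unif :=
  @segment_compact R (- T') T'.
have {}unif : \forall t \near t0, forall s, s \in `[- T', T'] ->
    (flow A (t - s) (p s) \- flow A (t0 - s) (p s)) <=v e1.
  apply: unif => s /DT' Ds.
  have /nbhs_ballP[d1 /= d10 P1] := cw s Ds _ e2L.
  have /nbhs_ballP[d2 /= d20 P2] := flow_cont (t0 - s) (Kp s Ds) e40.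
  have /nbhs_ballP[d3 /= d30 P3] := near_segment Ds.
  pose d := Num.min d1 (Num.min (d2 / 2) d3).
  have d0 : 0 < d by rewrite !lt_min d10 d30 divr_gt0.
  exists (ball s d, ball t0 (d2 / 2)).
    split; first exact: nbhsx_ballx.
    by apply: nbhsx_ballx; rewrite divr_gt0.
  move=> [s' t] [/= s's tt0].
  have s's1 : ball s d1 s' by apply: le_ball s's; rewrite ge_min lexx.
  have s's2 : `|s - s'| < d2 / 2.
    by apply: (lt_le_trans s's); rewrite !ge_min lexx/= orbT.
  have Ds' : s' \in D.
    by apply: P3; apply: le_ball s's; rewrite !ge_min lexx/= !orbT.
  have ps : (p s' \- p s) <=v (e1 / 4).
    have [Kw wr] := bw s Ds; have [Kw' wr'] := bw s' Ds'.
    apply: var_leW (FB _ _ _ Kw' Kw wr' wr (P1 s' s's1 Ds')).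
    rewrite mulrA ler_pdivrMr ?ltr_wpDl// mulrDr mulr1 (mulrC L) lerDl ltW//.
  (* Both times t and t0 are compared with the flow at time t0 - s of p s, through the
     contraction property and strong continuity. *)
  have fl ta : ball t0 (d2 / 2) ta ->
      (flow A (ta - s') (p s') \- flow A (t0 - s) (p s)) <=v (e1 / 4 + e1 / 4).
    move=> tat0; apply: (@var_le_trans _ _ _ (flow A (ta - s') (p s))).
      by rewrite -flowB//; [apply: flow_le => //; apply: carrierB; exact: Kp|exact: Kp..].
    apply: P2; rewrite /ball/= (_ : _ - _ = (t0 - ta) + (s' - s)); last by ring.
    rewrite (le_lt_trans (ler_normD _ _))// (splitr d2) ltrD//.
    by rewrite distrC.
  apply: var_leW (var_le_trans (fl t tt0) (var_leBC (fl t0 _))); first lra.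
  by apply: ballxx; rewrite divr_gt0.
have nearT' : \forall t \near t0, `|t| < T'.
  have /cvgrPdist_lt h : `|t| @[t --> t0] --> `|t0| by exact: norm_continuous.
  have /h : 0 < T' - `|t0| by rewrite subr_gt0.
  apply: filterS => t; rewrite distrC ltr_norml => /andP[_]; lra.
have near_e : \forall t \near t0, `|t - t0| * C <= e / 2.
  have k0 : 0 < e / 2 / (C + 1) by rewrite !divr_gt0// ltr_wpDl.
  apply: filterS (nbhsx_ballx t0 _ k0) => t; rewrite /ball/= distrC => /ltW h.
  apply: (@le_trans _ _ (e / 2 / (C + 1) * C)); first by rewrite ler_wpM2r.
  by rewrite mulrAC ler_pdivrMr ?ltr_wpDl// ler_pM2l ?divr_gt0// lerDl.
apply: filterS3 unif nearT' near_e => t un tT' te Dt.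
have segT' t' : `|t'| < T' -> time_segment t' `<=` `[- T', T']%classic.
  move=> t'T' s; rewrite /time_segment; case: ifPn => h; rewrite /= !in_itv/=;
    move=> /andP[? ?]; move: t'T'; rewrite ltr_norml => /andP[? ?];
    apply/andP; split; lra.
have sub := segT' t tT'; have sub0 := segT' t0 t0T'.
pose h t' s i := flow A (t' - s) (p s) i.
have mh ta tb i : tb \in D -> ae_cmeasurable (time_segment tb) (fun s => h ta s i).
  by move=> Dtb; exact: duhamel_measurable lF bw mw Dtb.
have hC ta s i : s \in `[- T', T'] -> modulus (h ta s i) <= C.
  by move=> /DT' Ds; apply: var_le_coord; apply: flow_le; [exact: Kp|exact: pC].
apply: (@var_le_near_trans _ _ _ _ (fun i => time_integral t (fun s => h t0 s i))).
  apply: (@var_leW _ _ _ _ (`|t| * e1)).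
    rewrite /e1 (_ : e / 2 = T * (e / (2 * T))); last by field; rewrite gt_eqF.
    by rewrite ler_wpM2r// ?ltW// (lt_trans tT').
  move=> l Pl.
  have E i : duhamel F w t i - time_integral t (fun s => h t0 s i) =
      time_integral t (fun s => h t s i - h t0 s i).
    apply/esym/(@time_integralB R t _ _ C); [exact: mh|exact: mh|..].
      by move=> s /sub; exact: hC.
    by move=> s /sub; exact: hC.
  under eq_bigr do rewrite /= E.
  apply: sum_modulus_time_integral.
  - by move=> i; apply: ae_cmeasurableB; [exact: measurable_time_segment|exact: mh..].
  - move=> i; exists (C + C) => s /sub Ts.
    by rewrite (le_trans (modulusB _ _))// lerD ?hC.
  - by move=> s /sub Ts; exact: (un s Ts _ Pl).
apply: (var_leW te) => l Pl; apply: sum_time_integral_increment.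
- by move=> t' i [->|->]; exact: mh.
- by move=> i; exists C => t' s [->|->]; [move=> /sub|move=> /sub0]; exact: hC.
- move=> t' s tt ts; have Ts : s \in `[- T', T'] by case: tt ts => ->; [exact: sub|exact: sub0].
  have Ds := DT' s Ts; exact: (flow_le (t0 - s) (Kp s Ds) (pC s Ds)).
Qed.

End duhamel_theory.

End duhamel.

(** * Picard iteration in coordinates *)

Section geometric_limits.
Context (R : realType).

Lemma le_add_geometric (x y M : R) : (forall k, x <= y + M / 2 ^+ k) -> x <= y.
Proof.
move=> h; rewrite -subr_le0.
have c : M / 2 ^+ k @[k --> \oo] --> (0:R).
  rewrite -(mulr0 M); apply: cvgMr; under eq_fun do rewrite -exprVn.
  by apply: cvg_expr; rewrite ger0_norm ?invr_ge0// invf_lt1// ltr1n.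
rewrite -(cvg_lim _ c)//; apply: limr_ge; first by apply/cvg_ex; exists 0.
by apply: nearW => k; rewrite lerBlDl.
Qed.

(** The limit is the supremum of the increasing lower bounds x k - 2 C / 2^k. *)
Lemma real_geometric_limit (x : nat -> R) C :
  (forall k, `|x k.+1 - x k| <= C / 2 ^+ k) ->
  exists y, forall k, `|y - x k| <= 2 * C / 2 ^+ k.
Proof.
move=> xC.
pose lo k := x k - 2 * C / 2 ^+ k; pose hi k := x k + 2 * C / 2 ^+ k.
have stepE k : 2 * C / 2 ^+ k.+1 = C / 2 ^+ k.
  by rewrite exprS; field; rewrite expf_neq0.
have dE k : 2 * C / 2 ^+ k = C / 2 ^+ k + C / 2 ^+ k by ring.
have lo_nd : {homo lo : i j / (i <= j)%N >-> i <= j}.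
  apply/nondecreasing_seqP => k; rewrite /lo stepE dE.
  by have := xC k; rewrite ler_norml => /andP[? ?]; lra.
have hi_ni : {homo hi : i j / (i <= j)%N >-> j <= i}.
  apply/nonincreasing_seqP => k; rewrite /hi stepE dE.
  by have := xC k; rewrite ler_norml => /andP[? ?]; lra.
have lohi j : lo j <= hi j.
  rewrite /lo /hi; have : 0 <= 2 * C / 2 ^+ j; last lra.
  by rewrite dE addr_ge0// (le_trans _ (xC j)).
have lh j k : lo j <= hi k.
  apply: le_trans (lo_nd _ _ (leq_maxl j k)) _.
  by apply: le_trans (lohi _) (hi_ni _ _ (leq_maxr j k)).
have lob k : ubound (range lo) (hi k) by move=> _ [j _ <-].
exists (sup (range lo)) => k.
rewrite ler_norml; apply/andP; split.
  have : lo k <= sup (range lo); last by rewrite /lo; lra.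
  by apply: ub_le_sup; [exists (hi k)|exists k].
have : sup (range lo) <= hi k; last by rewrite /hi; lra.
by apply: ge_sup; first by exists (lo 0%N); exists 0%N.
Qed.

End geometric_limits.

Section picard.
Context (R : realType) (I : Type) (A : flow_algebra R I).
Local Notation E := (I -> R[i]).
Local Notation K := (@carrier R I A).
Local Notation "a <=v C" := (var_le (tests A) a C) (at level 70).

(** The limit is built entry by entry; the finite sums of moduli pass to the limit,
    which upgrades convergence of the entries to convergence in norm. *)
Lemma carrier_geometric_limit (u : nat -> E) C : (forall k, K (u k)) ->
  (forall k, (u k.+1 \- u k) <=v (C / 2 ^+ k)) ->
  exists a, K a /\ forall k, (a \- u k) <=v (2 * C / 2 ^+ k).
Proof.
move=> Ku uC.
have /choice[a aP] : forall i, exists z : R[i], forall k, modulus (z - u k i) <= 4 * C / 2 ^+ k.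
  move=> i.
  have [|x xP] := @real_geometric_limit R (fun k => complex.Re (u k i)) C.
    move=> k; rewrite -ReN -ReD (le_trans (normr_Re_le _))//.
    exact: var_le_coord i (uC k).
  have [|y yP] := @real_geometric_limit R (fun k => complex.Im (u k i)) C.
    move=> k; rewrite -ImN -ImD (le_trans (normr_Im_le _))//.
    exact: var_le_coord i (uC k).
  exists (x +i* y) => k; apply: le_trans (modulus_le_ReIm _) _.
  rewrite ReD ImD ReN ImN /= (_ : 4 * C / _ = 2 * C / 2 ^+ k + 2 * C / 2 ^+ k).
    by rewrite lerD.
  by ring.
have Cauchy k n : (u (k + n)%N \- u k) <=v (2 * C / 2 ^+ k - 2 * C / 2 ^+ (k + n)).
  elim: n => [|n IH].
    rewrite addn0 subrr (_ : _ \- _ = fun=> 0); first exact: var_le0.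
    by apply/funext => i /=; rewrite subrr.
  rewrite addnS; apply: var_leW (var_le_trans (uC (k + n)%N) IH).
  rewrite (_ : 2 * C / 2 ^+ (k + n).+1 = C / 2 ^+ (k + n)); last first.
    by rewrite exprS; field; rewrite expf_neq0.
  rewrite (_ : 2 * C / 2 ^+ (k + n) = C / 2 ^+ (k + n) + C / 2 ^+ (k + n)); last by ring.
  lra.
have C0 : 0 <= C by have /var_le_ge0 := uC 0%N; rewrite expr0 divr1.
have bnd k : (a \- u k) <=v (2 * C / 2 ^+ k).
  move=> l Pl; apply: (@le_add_geometric _ _ _ ((size l)%:R * (4 * C))) => n.
  have h1 := Cauchy k n l Pl.
  have h2 : \sum_(i <- l) modulus (a i - u (k + n)%N i) <= (size l)%:R * (4 * C) / 2 ^+ (k + n).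
    apply: (@le_trans _ _ (\sum_(i <- l) (4 * C / 2 ^+ (k + n)))).
      by apply: ler_sum => i _; exact: aP.
    by rewrite big_const_seq count_predT iter_addr_0 -[leLHS]mulr_natl mulrA.
  apply: (@le_trans _ _ (\sum_(i <- l) (modulus (a i - u (k + n)%N i) +
      modulus (u (k + n)%N i - u k i)))).
    apply: ler_sum => i _; apply: le_trans (modulusD _ _).
    by rewrite addrA subrK.
  rewrite big_split/= addrC; apply: lerD.
    by apply: le_trans h1 _; rewrite gerBl divr_ge0 ?mulr_ge0 ?exprn_ge0.
  apply: le_trans h2 _; apply: ler_wpM2l; first by rewrite !mulr_ge0.
  by rewrite lef_pV2 ?posrE ?exprn_gt0// ler_weXn2l ?ler1n// leq_addl.
exists a; split => //; apply: (@carrier_lim _ _ A u a) => // e e0.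
have [k ke] : exists k, 2 * C / 2 ^+ k <= e.
  apply: contrapT => /forallNP h.
  suff : e <= 0 by rewrite leNgt e0.
  apply: (@le_add_geometric _ _ _ (2 * C)) => k; rewrite add0r.
  by have /negP := h k; rewrite -ltNge => /ltW.
by exists k; apply: var_leBC; apply: var_leW (bnd k).
Qed.

Context (T : R) (T0 : 0 < T).
Local Notation D := (`]-T, T[).
Variables (F1 F2 : E -> E) (c1 c2 : R[i]) (r L1 L2 : R).
Hypotheses (lF1 : loc_lipschitz A F1) (lF2 : loc_lipschitz A F2).
Hypotheses (c1_unit : modulus c1 = 1) (c2_unit : modulus c2 = 1).
Hypotheses (lipF1 : lipschitz_upto A F1 r L1) (lipF2 : lipschitz_upto A F2 r L2).
Hypothesis TL : T * (L1 + L2) <= 2^-1.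
Implicit Types (a : E) (w : R -> E).

(** The right-hand side of the mild equation. The unimodular constants are the factors
    -i lambda and i in front of the two time integrals. *)
Definition mild_map a w t : E :=
  (flow A t a \+ (fun i => c1 * duhamel A F1 w t i)) \+
  (fun i => c2 * duhamel A F2 w t i).

Let absT t : t \in D -> `|t| <= T.
Proof. by rewrite in_itv/= ler_norml => /andP[/ltW -> /ltW ->]. Qed.

Lemma mild_map_carrier a w t : K a -> in_ball A T r w -> bochner A T w -> t \in D ->
  K (mild_map a w t).
Proof.
move=> Ka bw mw Dt; apply: carrierD; first apply: carrierD.
- exact: carrier_flow.
- exact: (carrierZ c1 (duhamel_carrier lF1 bw mw Dt)).
- exact: (carrierZ c2 (duhamel_carrier lF2 bw mw Dt)).
Qed.

(** The choice of T makes the two Duhamel terms together at most half of the bound on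
    w. *)
Lemma mild_map_le a w t al rho : K a -> a <=v al -> rho <= r -> in_ball A T rho w ->
  bochner A T w -> t \in D -> mild_map a w t <=v (al + rho / 2).
Proof.
move=> Ka aal rr bw mw Dt.
have rho0 : 0 <= rho by have [_ /var_le_ge0] := bw t Dt.
have H F c L : loc_lipschitz A F -> modulus c = 1 -> lipschitz_upto A F r L ->
    (fun i => c * duhamel A F w t i) <=v (T * (L * rho)).
  move=> lF cE [L0 _ FL _].
  have -> : T * (L * rho) = modulus c * (T * (L * rho)) by rewrite cE mul1r.
  apply: var_leZ; apply: (@var_leW _ _ _ _ (`|t| * (L * rho))).
    by rewrite ler_wpM2r ?mulr_ge0// absT.
  apply: (duhamel_le lF bw mw Dt) => s Ds.
  by have [Kw wr] := bw s Ds; exact: FL.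
apply: var_leW (var_leD (var_leD (flow_le t Ka aal) (H _ _ _ lF1 c1_unit lipF1)) (H _ _ _ lF2 c2_unit lipF2)).
rewrite -addrA lerD2l -mulrDr -mulrDl mulrA (mulrC rho) ler_wpM2r//.
Qed.

Lemma mild_mapB_le a a' w w' t de d : K a -> K a' -> (a \- a') <=v de ->
  in_ball A T r w -> in_ball A T r w' -> bochner A T w -> bochner A T w' ->
  (forall s, s \in D -> (w s \- w' s) <=v d) -> t \in D ->
  (mild_map a w t \- mild_map a' w' t) <=v (de + d / 2).
Proof.
move=> Ka Ka' aa' bw bw' mw mw' ww' Dt.
have d0 : 0 <= d by have /var_le_ge0 := ww' t Dt.
have H F c L : loc_lipschitz A F -> modulus c = 1 -> lipschitz_upto A F r L ->
    ((fun i => c * duhamel A F w t i) \- (fun i => c * duhamel A F w' t i)) <=v (T * (L * d)).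
  move=> lF cE [L0 _ _ FL].
  have -> : T * (L * d) = modulus c * (T * (L * d)) by rewrite cE mul1r.
  rewrite (_ : _ \- _ = fun i => c * (duhamel A F w t \- duhamel A F w' t) i); last first.
    by apply/funext => i /=; rewrite mulrBr.
  apply: var_leZ; apply: (@var_leW _ _ _ _ (`|t| * (L * d))).
    by rewrite ler_wpM2r ?mulr_ge0// absT.
  apply: (duhamelB_le lF bw bw' mw mw' Dt) => s Ds.
  by have [Kw wr] := bw s Ds; have [Kw' wr'] := bw' s Ds; exact: FL (ww' s Ds).
have -> : mild_map a w t \- mild_map a' w' t = ((flow A t a \- flow A t a') \+
    ((fun i => c1 * duhamel A F1 w t i) \- (fun i => c1 * duhamel A F1 w' t i))) \+
    ((fun i => c2 * duhamel A F2 w t i) \- (fun i => c2 * duhamel A F2 w' t i)).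
  by apply/funext => i; rewrite /mild_map /=; ring.
have fa : (flow A t a \- flow A t a') <=v de.
  by rewrite -flowB//; apply: flow_le => //; exact: carrierB.
apply: var_leW (var_leD (var_leD fa (H _ _ _ lF1 c1_unit lipF1)) (H _ _ _ lF2 c2_unit lipF2)).
by rewrite -addrA lerD2l -mulrDr -mulrDl mulrA (mulrC d) ler_wpM2r.
Qed.

Lemma mild_map_continuous a w : K a -> in_ball A T r w -> var_continuous A T w ->
  var_continuous A T (mild_map a w).
Proof.
move=> Ka bw cw t Dt e e0.
have e3 : 0 < e / 3 by rewrite divr_gt0.
apply: filterS3 (flow_cont t Ka e3) (duhamel_continuous lF1 T0 bw cw Dt e3)
  (duhamel_continuous lF2 T0 bw cw Dt e3) => s h1 h2 h3 Ds.
have -> : mild_map a w s \- mild_map a w t = ((flow A s a \- flow A t a) \+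
    (fun i => c1 * (duhamel A F1 w s \- duhamel A F1 w t) i)) \+
    (fun i => c2 * (duhamel A F2 w s \- duhamel A F2 w t) i).
  by apply/funext => i; rewrite /mild_map /=; ring.
apply: var_leW (var_leD (var_leD h1 (var_leZ c1 (h2 Ds))) (var_leZ c2 (h3 Ds))).
by rewrite c1_unit c2_unit !mul1r; lra.
Qed.

(** The contraction estimate, iterated. It applies to any two mild solutions in the
    ball and yields uniqueness (same data) as well as Lipschitz dependence on the data;
    the factor 2 is the sum of the geometric series. *)
Lemma mild_solution_lipschitz a a' w w' de : K a -> K a' -> (a \- a') <=v de ->
  in_ball A T r w -> in_ball A T r w' -> bochner A T w -> bochner A T w' ->
  (forall t, t \in D -> w t = mild_map a w t) ->
  (forall t, t \in D -> w' t = mild_map a' w' t) ->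
  forall t, t \in D -> (w t \- w' t) <=v (2 * de).
Proof.
move=> Ka Ka' aa' bw bw' mw mw' wE w'E t Dt l Pl.
apply: (@le_add_geometric _ _ _ (r + r)) => k.
suff : forall s, s \in D -> (w s \- w' s) <=v (2 * de + (r + r) / 2 ^+ k).
  by move=> /(_ t Dt); exact.
have de0 := var_le_ge0 aa'.
elim: k => [|k IH] s Ds.
  rewrite expr0 divr1; apply: (@var_leW _ _ _ _ (r + r)).
    by rewrite lerDr mulr_ge0.
  by have [_ h] := bw s Ds; have [_ h'] := bw' s Ds; exact: var_leB.
rewrite wE// w'E//.
apply: var_leW (mild_mapB_le Ka Ka' aa' bw bw' mw mw' IH Ds).
rewrite exprS le_eqVlt; apply/orP; left; apply/eqP.
by field; rewrite expf_neq0.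
Qed.

(** Picard iteration from 0. The radius 2 al is stable, since al + (2 al) / 2 = 2 al,
    and successive iterates approach each other geometrically, uniformly in time; so
    the limit is continuous, hence strongly measurable, and solves the equation. *)
Lemma mild_solution_exists a al : K a -> a <=v al -> 2 * al <= r ->
  exists w, [/\ in_ball A T (2 * al) w, var_continuous A T w &
    forall t, t \in D -> w t = mild_map a w t].
Proof.
move=> Ka aal alr; have al0 := var_le_ge0 aal.
have inr w : in_ball A T (2 * al) w -> in_ball A T r w.
  by move=> bw t /bw[Kw wr]; split => //; exact: var_leW wr.
pose W k := iter k (mild_map a) (fun _ _ => 0).
have WP k : in_ball A T (2 * al) (W k) /\ var_continuous A T (W k).
  elim: k => [|k [IH1 IH2]].
    split=> [t Dt|t Dt e e0].
      split; first exact: carrier0.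
      by apply: (@var_leW _ _ _ _ 0); [rewrite mulr_ge0|exact: var_le0].
    apply/nbhs_ballP; exists 1 => //= s _ Ds; rewrite (_ : _ \- _ = fun=> 0).
      by apply: (@var_leW _ _ _ _ 0); [exact: ltW|exact: var_le0].
    by apply/funext => i /=; rewrite subrr.
  have mk : bochner A T (W k) by apply: var_continuous_bochner => // t /IH1[].
  split=> [t Dt|]; last exact: mild_map_continuous (inr _ IH1) IH2.
  split; first exact: mild_map_carrier (inr _ IH1) mk Dt.
  apply: var_leW (mild_map_le Ka aal alr IH1 mk Dt).
  by rewrite le_eqVlt; apply/orP; left; apply/eqP; field.
have mW k : bochner A T (W k).
  by have [h1 h2] := WP k; apply: var_continuous_bochner => // t /h1[].
(* Two elements of the ball of radius 2 al differ by at most 4 al, and each iteration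
   halves the difference. *)
have step k t : t \in D -> (W k.+1 t \- W k t) <=v (4 * al / 2 ^+ k).
  elim: k t => [|k IH] t Dt.
    rewrite expr0 divr1; have [h1 _] := WP 1%N; have [h0 _] := WP 0%N.
    have [_ h1t] := h1 t Dt; have [_ h0t] := h0 t Dt.
    by apply: var_leW (var_leB h1t h0t); rewrite -mulrDl ler_wpM2r//; lra.
  have aa : (a \- a) <=v 0.
    by rewrite (_ : _ \- _ = fun=> 0); [exact: var_le0|apply/funext => i /=; rewrite subrr].
  have [h1 _] := WP k.+1; have [h0 _] := WP k.
  apply: var_leW (mild_mapB_le Ka Ka aa (inr _ h1) (inr _ h0) (mW _) (mW _) IH Dt).
  rewrite add0r exprS le_eqVlt; apply/orP; left; apply/eqP.
  by field; rewrite expf_neq0.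
have /choice[w wP] : forall t, exists b, t \in D ->
    K b /\ forall k, (b \- W k t) <=v (2 * (4 * al) / 2 ^+ k).
  move=> t; have [Dt|nDt] := boolP (t \in D); last by exists (fun=> 0).
  have [|b bP] := @carrier_geometric_limit (fun k => W k t) (4 * al) _ (fun k => step k t Dt).
    by move=> k; have [/(_ t Dt)[]] := WP k.
  by exists b.
pose M := 2 * (4 * al).
have M0 : 0 <= M by rewrite !mulr_ge0.
have bw : in_ball A T (2 * al) w.
  move=> t Dt; have [Kw wW] := wP t Dt; split => // l Pl.
  apply: (@le_add_geometric _ _ _ M) => k.
  have [/(_ t Dt)[_ Wk] _] := WP k.
  have -> : w t = W k t \+ (w t \- W k t).
    by apply/funext => i /=; rewrite addrC subrK.
  exact: var_leD Wk (wW k) l Pl.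
have small e : 0 < e -> exists k, M / 2 ^+ k <= e.
  move=> e0; apply: contrapT => /forallNP h.
  suff : e <= 0 by rewrite leNgt e0.
  apply: (@le_add_geometric _ _ _ M) => k; rewrite add0r.
  by have /negP := h k; rewrite -ltNge => /ltW.
have cw : var_continuous A T w.
  move=> t Dt e e0; have e4 : 0 < e / 4 by rewrite divr_gt0.
  have [k kle] := small _ e4.
  have [_ /(_ t Dt _ e4)] := WP k; apply: filterS => s /[swap] Ds /(_ Ds) h.
  have [_ /(_ k) ws] := wP s Ds; have [_ /(_ k) wt] := wP t Dt.
  apply: var_leW (var_le_trans (var_le_trans ws h) (var_leBC wt)); rewrite -/M; lra.
exists w; split => // t Dt.
have mw : bochner A T w by apply: var_continuous_bochner => // s /bw[].
apply: (var_le_eq (A := A)) => e e0.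
have e2 : 0 < e / 2 by rewrite divr_gt0.
have [k kle] := small _ e2.
have aa : (a \- a) <=v 0.
  by rewrite (_ : _ \- _ = fun=> 0); [exact: var_le0|apply/funext => i /=; rewrite subrr].
have [Wk _] := WP k.
have h := @mild_mapB_le a a (W k) w t 0 (M / 2 ^+ k) Ka Ka aa (inr _ Wk) (inr _ bw) (mW k) mw
  (fun s Ds => var_leBC ((wP s Ds).2 k)) Dt.
apply: var_leW (var_le_trans ((wP t Dt).2 k.+1) h).
rewrite add0r -/M exprS (_ : M / (2 * 2 ^+ k) = M / 2 ^+ k / 2); last first.
  by field; rewrite expf_neq0.
have : 0 <= M / 2 ^+ k by rewrite divr_ge0// exprn_ge0.
lra.
Qed.

End picard.

(** * Well-posedness for distributions with coordinates *)

Section wellposedness.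
Context (R : realType) (n : nat) (I : Type) (A : flow_algebra R I).
Variables (X : set (distr R n)) (N : distr R n -> \bar R) (h : distr R n -> I -> R[i]).
Local Notation E := (I -> R[i]).
Local Notation K := (@carrier R I A).
Local Notation "a <=v C" := (var_le (tests A) a C) (at level 70).
Local Notation leb := (@lebesgue_measure R).
Local Notation TR := (measurableTypeR R).
Hypothesis XD : forall f g, X f -> X g -> X (f + g).
Hypothesis XB : forall f g, X f -> X g -> X (f - g).
Hypothesis hD : forall f g, X f -> X g -> h (f + g) = h f \+ h g.
Hypothesis hB : forall f g, X f -> X g -> h (f - g) = h f \- h g.
Hypothesis hK : forall f, X f -> K (h f).
Hypothesis N_le : forall f C, X f -> (N f <= C%:E)%E <-> h f <=v C.
Hypothesis h_surj : forall a, K a -> exists f, X f /\ h f = a.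

Lemma choose_coordinates a : K a ->
  X (choose_elt 0 [set f | X f /\ h f = a]) /\ h (choose_elt 0 [set f | X f /\ h f = a]) = a.
Proof.
move=> /h_surj Ka; rewrite /choose_elt; case: pselect => // e.
by case: (cid e).
Qed.

Lemma norm_real f : X f -> exists C, [/\ 0 <= C, N f = C%:E & h f <=v C].
Proof.
move=> Xf; have [C hC] := carrier_fin (hK Xf).
have : (N f <= C%:E)%E by apply/N_le.
case E : (N f) => [c| |] // _.
  have hc : h f <=v c by apply/N_le; rewrite // E.
  by exists c; split => //; exact: var_le_ge0 hc.
have /var_le_ge0 : h f <=v (-1) by apply/N_le; rewrite // E leNye.
by rewrite lerNr oppr0 ler10.
Qed.

(** Convergence of the norms as extended real numbers turns into eventual bounds on
    the finite sums of moduli of the coordinates. *)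
Lemma strongly_measurable_bochner T u : (forall t, t \in `]-T, T[ -> X (u t)) ->
  strongly_measurable X N T u -> bochner A T (fun t => h (u t)).
Proof.
move=> Xu [w [sw [M [mM M0 MP]]]]; exists (fun k t => h (w k t)); split.
- move=> k; have [fw _ mw] := sw k.
  by apply: simple_map_comp; split.
- by move=> k t Dt; have [_ + _] := sw k; move=> /(_ t Dt); exact: hK.
- exists M; split => //; apply: subset_trans MP; apply: subsetC => t ht Dt e e0.
  have := ht Dt; have Xw k : X (w k t) by have [_ + _] := sw k; exact.
  have Xwu k : X (w k t - u t) by apply: XB => //; exact: Xu.
  have /choice[c cP] : forall k, exists c, N (w k t - u t) = c%:E.
    by move=> k; have [c [_ ? _]] := norm_real (Xwu k); exists c.
  move=> /fine_cvgP[_ /cvgrPdist_le/(_ _ e0)]; apply: filterS => k.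
  rewrite /= sub0r normrN cP /= => ce; rewrite -hB//; last exact: Xu.
  by apply/N_le => //; rewrite cP lee_fin (le_trans (ler_norm _)).
Qed.

(** The approximating simple functions sample u itself, so that their values are
    elements of X and no choice of distributions with given coordinates is involved.
    *)
Lemma var_continuous_strongly_measurable T u : 0 < T ->
  (forall t, t \in `]-T, T[ -> X (u t)) -> var_continuous A T (fun t => h (u t)) ->
  strongly_measurable X N T u.
Proof.
move=> T0 Xu cu; have [g [sg gD]] := simple_sampling T0.
exists (fun k t => u (g k t)); split.
  move=> k; have [f1 f2] := simple_map_comp u (sg k); split => //.
  by move=> t /(gD k)[+ _]; exact: Xu.
apply/aeW => t Dt.
have Xg k : X (u (g k t)) by apply: Xu; have [] := gD k t Dt.
have Xgu k : X (u (g k t) - u t) by apply: XB => //; exact: Xu.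
have /choice[c cP] : forall k, exists c, 0 <= c /\ N (u (g k t) - u t) = c%:E.
  by move=> k; have [c [? ? _]] := norm_real (Xgu k); exists c.
under eq_fun do rewrite (cP _).2.
apply: cvg_EFin; first exact: nearW.
apply/cvgrPdist_le => e e0; have /nbhs_ballP[d /= d0 dP] := cu t Dt e e0.
have /cvgrPdist_lt/(_ _ d0) : T / k.+1%:R @[k --> \oo] --> (0:R).
  rewrite -(mulr0 T); apply: cvgMr; exact: cvg_harmonic.
apply: filterS => k; rewrite sub0r normrN ger0_norm; last by rewrite divr_ge0// ltW.
move=> kd; have [Dg gt_le] := gD k t Dt.
have : h (u (g k t)) \- h (u t) <=v e.
  by apply: dP => //; rewrite /ball/= distrC (le_lt_trans gt_le).
rewrite -hB//; last exact: Xu.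
move=> /N_le -/(_ (Xgu k)); rewrite (cP k).2 lee_fin => ce.
by rewrite /= sub0r normrN ger0_norm// (cP k).1.
Qed.

Lemma Linfty_norm_le T u C : (forall t, t \in `]-T, T[ -> (N (u t) <= C)%E) ->
  (Linfty_norm N T u <= C)%E.
Proof.
move=> uC; apply/ess_supP; exists (~` `]-T, T[); split.
- by apply: measurableC; exact: measurable_itv.
- change (leb (~` `]-T, T[%classic `&` `]-T, T[%classic) = 0%E).
  by rewrite setICl measure0.
- by apply: subsetC => t Dt; exact: uC.
Qed.

Variables (S : R -> distr R n -> distr R n) (B L : (R -> distr R n) -> R -> distr R n).
Variables (F1 F2 : E -> E) (c1 c2 : R[i]).
Hypotheses (lF1 : loc_lipschitz A F1) (lF2 : loc_lipschitz A F2).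
Hypotheses (c1_unit : modulus c1 = 1) (c2_unit : modulus c2 = 1).
Hypothesis SE : forall t f, S t f = choose_elt 0 [set g | X g /\ h g = flow A t (h f)].
Hypothesis BE : forall u t, B u t = choose_elt 0
  [set g | X g /\ h g = fun i => c1 * duhamel A F1 (fun s => h (u s)) t i].
Hypothesis LE : forall u t, L u t = choose_elt 0
  [set g | X g /\ h g = fun i => c2 * duhamel A F2 (fun s => h (u s)) t i].

Section fixed_time.
Context (T : R) (T0 : 0 < T) (r L1 L2 : R).
Hypotheses (lipF1 : lipschitz_upto A F1 r L1) (lipF2 : lipschitz_upto A F2 r L2).
Hypothesis TL : T * (L1 + L2) <= 2^-1.
Local Notation bsol := (bounded_solution X N S B L T).
Local Notation mmap := (mild_map A F1 F2 c1 c2).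

Lemma S_coordinates t f : X f -> X (S t f) /\ h (S t f) = flow A t (h f).
Proof. by move=> Xf; rewrite SE; apply: choose_coordinates; apply/carrier_flow/hK. Qed.

Lemma B_coordinates rho u t : in_ball A T rho (fun s => h (u s)) ->
  bochner A T (fun s => h (u s)) -> t \in `]-T, T[ ->
  X (B u t) /\ h (B u t) = fun i => c1 * duhamel A F1 (fun s => h (u s)) t i.
Proof.
move=> bu mu Dt; rewrite BE; apply: choose_coordinates.
exact: (carrierZ c1 (duhamel_carrier lF1 bu mu Dt)).
Qed.

Lemma L_coordinates rho u t : in_ball A T rho (fun s => h (u s)) ->
  bochner A T (fun s => h (u s)) -> t \in `]-T, T[ ->
  X (L u t) /\ h (L u t) = fun i => c2 * duhamel A F2 (fun s => h (u s)) t i.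
Proof.
move=> bu mu Dt; rewrite LE; apply: choose_coordinates.
exact: (carrierZ c2 (duhamel_carrier lF2 bu mu Dt)).
Qed.

Lemma mild_terms_coordinates rho v0 u t : X v0 -> in_ball A T rho (fun s => h (u s)) ->
  bochner A T (fun s => h (u s)) -> t \in `]-T, T[ ->
  X (S t v0 + B u t + L u t) /\
  h (S t v0 + B u t + L u t) = mmap (h v0) (fun s => h (u s)) t.
Proof.
move=> X0 bu mu Dt; have [XS hS] := S_coordinates t X0.
have [XB' hB'] := B_coordinates bu mu Dt; have [XL hL] := L_coordinates bu mu Dt.
split; first by apply: XD => //; exact: XD.
by rewrite hD ?hD ?hS ?hB' ?hL//; exact: XD.
Qed.

(** The integral terms see u only through its coordinates, and these determine them as
    distributions. *)
Lemma eq_mild_terms u u' t : (forall s, s \in `]-T, T[ -> h (u s) = h (u' s)) ->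
  t \in `]-T, T[ -> B u t = B u' t /\ L u t = L u' t.
Proof.
move=> uu' Dt; have sub := subset_time_segment Dt.
have E F : duhamel A F (fun s => h (u s)) t = duhamel A F (fun s => h (u' s)) t.
  by apply/funext => i; apply: eq_time_integral => s /sub Ds; rewrite uu'.
by rewrite !BE !LE !E.
Qed.

Lemma bounded_solution_coordinates v0 v al : X v0 -> (N v0 <= al%:E)%E -> 2 * al <= r ->
  bsol v0 v ->
  [/\ in_ball A T r (fun t => h (v t)), bochner A T (fun t => h (v t)) &
    forall t, t \in `]-T, T[ -> h (v t) = mmap (h v0) (fun t => h (v t)) t].
Proof.
move=> X0 N0 alr [[[Xv mv _] vE] vsup].
have bv : in_ball A T r (fun t => h (v t)).
  move=> t Dt; split; first exact/hK/Xv.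
  apply/N_le; first exact: Xv.
  apply: (@le_trans _ _ (sup_norm N T v)); first by apply: ereal_sup_ubound; exists t.
  apply: le_trans vsup _; apply: (@le_trans _ _ (2%:E * al%:E)%E).
    by rewrite lee_pmul2l.
  by rewrite -EFinM lee_fin.
have mv' := strongly_measurable_bochner Xv mv.
split => // t Dt; rewrite {1}vE//.
by have [] := mild_terms_coordinates X0 bv mv' Dt.
Qed.

(** Coordinates need not determine a distribution. From any lift u' of the fixed point
    the solution is obtained as the right-hand side of the mild equation at u': it has
    the same coordinates, hence the same right-hand side, and therefore satisfies the
    equation as an equality of distributions. *)
Lemma bounded_solution_exists v0 al : X v0 -> N v0 = al%:E -> 2 * al <= r ->
  exists u, bsol v0 u.
Proof.
move=> X0 N0 alr.
have h0 : h v0 <=v al by apply/N_le => //; rewrite N0.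
have [w [bw cw wE]] := mild_solution_exists T0 lF1 lF2 c1_unit c2_unit lipF1 lipF2 TL (hK X0) h0 alr.
have /choice[u' u'P] : forall t, exists f, t \in `]-T, T[ -> X f /\ h f = w t.
  move=> t; have [Dt|nDt] := boolP (t \in `]-T, T[); last by exists 0.
  by have [Kw _] := bw t Dt; have [f fP] := h_surj Kw; exists f.
have bu' : in_ball A T r (fun t => h (u' t)).
  move=> t Dt; have [_ ->] := u'P t Dt; have [Kw wr] := bw t Dt.
  by split => //; exact: var_leW wr.
have cu' : var_continuous A T (fun t => h (u' t)).
  move=> t Dt e e0; apply: filterS (cw t Dt e e0) => s + Ds.
  by have [_ ->] := u'P t Dt; have [_ ->] := u'P s Ds; exact.
have mu' : bochner A T (fun t => h (u' t)).
  by apply: var_continuous_bochner => // t /bu'[].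
pose u t := S t v0 + B u' t + L u' t.
have uP t : t \in `]-T, T[ -> X (u t) /\ h (u t) = h (u' t).
  move=> Dt; have [Xu hu] := mild_terms_coordinates X0 bu' mu' Dt; split => //.
  rewrite hu; have [_ ->] := u'P t Dt; rewrite wE//.
  have E F : duhamel A F (fun s => h (u' s)) t = duhamel A F w t.
    apply/funext => i; apply: eq_time_integral => s /(subset_time_segment Dt) Ds.
    by have [_ ->] := u'P s Ds.
  by rewrite /mild_map !E.
have uN t : t \in `]-T, T[ -> (N (u t) <= (2 * al)%:E)%E.
  move=> Dt; have [Xu hu] := uP t Dt; apply/N_le => //; rewrite hu.
  by have [_ ->] := u'P t Dt; have [] := bw t Dt.
have cu : var_continuous A T (fun t => h (u t)).
  move=> t Dt e e0; apply: filterS (cu' t Dt e e0) => s + Ds.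
  by have [_ ->] := uP t Dt; have [_ ->] := uP s Ds; exact.
exists u; split; first split; first split.
- by move=> t /uP[].
- by apply: var_continuous_strongly_measurable => // t /uP[].
- by apply: le_lt_trans (Linfty_norm_le uN) _; rewrite ltry.
- move=> t Dt; have uu' s : s \in `]-T, T[ -> h (u s) = h (u' s) by move=> /uP[].
  by have [-> ->] := eq_mild_terms uu' Dt.
- apply: ub_ereal_sup => _ [t Dt <-]; rewrite N0 -EFinM; exact: uN.
Qed.

Lemma bounded_solution_lipschitz v0 w0 v w al de : X v0 -> X w0 ->
  (N v0 <= al%:E)%E -> (N w0 <= al%:E)%E -> 2 * al <= r ->
  (N (v0 - w0)%R <= de%:E)%E -> bsol v0 v -> bsol w0 w ->
  forall t, t \in `]-T, T[ -> [/\ X (v t), X (w t) & h (v t) \- h (w t) <=v (2 * de)].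
Proof.
move=> Xv Xw Nv Nw alr Nvw sv sw t Dt.
have [bv mv vE] := bounded_solution_coordinates Xv Nv alr sv.
have [bw mw wE] := bounded_solution_coordinates Xw Nw alr sw.
split; [by case: sv => [[[+ _ _] _] _]; exact|by case: sw => [[[+ _ _] _] _]; exact|].
apply: (mild_solution_lipschitz lF1 lF2 c1_unit c2_unit lipF1 lipF2 TL (hK Xv) (hK Xw) _
  bv bw mv mw vE wE Dt).
by rewrite -hB//; apply/N_le => //; exact: XB.
Qed.

(** Two solutions have the same coordinates by the Lipschitz estimate with equal data,
    and then they are equal because both are given by the right-hand side of the
    equation. *)
Lemma bounded_solution_unique v0 al : X v0 -> N v0 = al%:E -> 2 * al <= r ->
  unique_bounded_solution X N S B L T v0.
Proof.
move=> X0 N0 alr; have [u us] := bounded_solution_exists X0 N0 alr.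
exists u; split => // v vs.
have N00 : (N (v0 - v0)%R <= 0%:E)%E.
  apply/N_le; first exact: XB.
  rewrite hB// (_ : _ \- _ = fun=> 0); first exact: var_le0.
  by apply/funext => i /=; rewrite subrr.
have N0' : (N v0 <= al%:E)%E by rewrite N0.
have uv s : s \in `]-T, T[ -> h (v s) = h (u s).
  move=> Ds; apply: (var_le_eq (A := A)) => e e0.
  have [_ _] := bounded_solution_lipschitz X0 X0 N0' N0' alr N00 vs us Ds.
  by apply: var_leW; rewrite mulr0 ltW.
move=> t Dt; have [[_ uE] _] := us; have [[_ vE] _] := vs.
by rewrite uE// vE//; have [-> ->] := eq_mild_terms uv Dt.
Qed.

End fixed_time.

(** The radius r bounds twice the norm of every datum at distance at most 1 from u0,
    so that one time T serves for all of them. *)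
Lemma local_wellposedness u0 : X u0 ->
  exists T : R, [/\ 0 < T, unique_bounded_solution X N S B L T u0 &
    data_solution_map_lipschitz_near X N S B L T u0].
Proof.
move=> X0; have [al [al0 N0 h0]] := norm_real X0.
pose r := 2 * (al + 1).
have r0 : 0 <= r by rewrite mulr_ge0// addr_ge0.
have [L1 lip1] := lF1 r0; have [L2 lip2] := lF2 r0.
have [L10 _ _ _] := lip1; have [L20 _ _ _] := lip2.
(* The summand 1 keeps the denominator positive when both Lipschitz constants vanish.
   *)
pose T := (2 * (L1 + L2 + 1))^-1.
have L12 : 0 < L1 + L2 + 1 by rewrite ltr_wpDl// addr_ge0.
have T0 : 0 < T by rewrite invr_gt0 mulr_gt0.
have TL : T * (L1 + L2) <= 2^-1.
  rewrite /T invfM -mulrA ler_piMr ?invr_ge0// mulrC ler_pdivrMr// mul1r.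
  by rewrite lerDl.
have near v0 : X v0 -> (N (v0 - u0)%R < 1%:E)%E ->
    exists c, [/\ N v0 = c%:E, (N v0 <= (al + 1)%:E)%E & 2 * c <= r].
  move=> Xv Nvu; have [c [_ Nc _]] := norm_real Xv.
  have hv : (N v0 <= (al + 1)%:E)%E.
    apply/N_le => //; rewrite (_ : h v0 = h u0 \+ (h v0 \- h u0)).
      apply: var_leD => //; rewrite -hB//; apply/N_le; first exact: XB.
      exact: ltW.
    by apply/funext => i /=; rewrite addrC subrK.
  exists c; split => //; rewrite /r ler_pM2l//.
  by move: hv; rewrite Nc lee_fin.
exists T; split => //.
  apply: (bounded_solution_unique T0 lip1 lip2 TL X0 N0).
  by rewrite /r ler_pM2l// lerDl.
exists 1, 2; split => //.
  move=> v0 Xv Nv; have [c [Nc _ cr]] := near v0 Xv Nv.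
  exact: (bounded_solution_unique T0 lip1 lip2 TL Xv Nc cr).
move=> v0 w0 v w Xv Xw Nv Nw sv sw.
have [cv [Ncv Nv1 _]] := near v0 Xv Nv; have [cw [Ncw Nw1 _]] := near w0 Xw Nw.
have [d [_ Nd _]] := norm_real (XB Xv Xw).
apply: Linfty_norm_le => t Dt.
have Nd' : (N (v0 - w0)%R <= d%:E)%E by rewrite Nd.
have [Xvt Xwt vw] :=
  bounded_solution_lipschitz lip1 lip2 TL Xv Xw Nv1 Nw1 (lexx _) Nd' sv sw Dt.
by rewrite Nd -EFinM; apply/N_le; [exact: XB|rewrite hB].
Qed.

End wellposedness.

(** * Smooth functions and their partial derivatives *)

Section smooth_functions.
Context (R : realType) (n : nat).
Local Notation V := 'rV[R]_n.
Implicit Types (f g : V -> R).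

(** Smoothness is proved for whole classes of functions at once: no formula for the
    derivatives of higher order is needed. *)
Lemma smooth_class (G : set (V -> R)) :
  (forall g x, G g -> differentiable g x) -> (forall g i, G g -> G (partial i g)) ->
  forall g, G g -> smooth g.
Proof.
move=> Gd Gp g Gg s x; apply: Gd.
by elim: s => //= i s; exact: Gp.
Qed.

Lemma dotDl (x y v : V) : dot (x + y) v = dot x v + dot y v.
Proof. by rewrite /dot -big_split/=; apply: eq_bigr => i _; rewrite mxE mulrDl. Qed.

Lemma dotZl a (x v : V) : dot (a *: x) v = a * dot x v.
Proof. by rewrite /dot mulr_sumr; apply: eq_bigr => i _; rewrite mxE mulrA. Qed.

Lemma dotC (x v : V) : dot x v = dot v x.
Proof. by rewrite /dot; apply: eq_bigr => i _; rewrite mulrC. Qed.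

Lemma dot_delta i (v : V) : dot (delta_mx 0 i) v = v 0 i.
Proof.
rewrite /dot (bigD1 i)//= mxE !eqxx mul1r big1 ?addr0// => j /negPf ji.
by rewrite mxE eqxx ji mul0r.
Qed.

Lemma differentiable_dot (v x : V) : differentiable (fun y => dot y v) x.
Proof.
rewrite (_ : (fun y => dot y v) = \sum_(i < n) (fun y : V => y 0 i * v 0 i)); last first.
  by apply/funext => y; rewrite fct_sumE.
apply: differentiable_sum => i.
by apply: differentiableM => //; exact: differentiable_coord.
Qed.

(** The partial derivatives are directional derivatives, hence derivatives of the
    restriction to a line. *)
Lemma derive_line (f : V -> R) (x e : V) (g : R -> R) c :
  (forall h, f (h *: e + x) = g h) -> is_derive (0:R) 1 g c -> 'D_e f x = c.
Proof.
move=> fg gc; rewrite -(@derive_val _ _ _ _ _ _ _ gc) /derive.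
have f0 : f x = g 0 by rewrite -fg scale0r add0r.
suff -> : (fun h : R => h^-1 *: ((f \o shift x) (h *: e) - f x)) =
  (fun h : R => h^-1 *: ((g \o shift 0) (h *: 1) - g 0)) by [].
by apply/funext => h /=; rewrite fg f0 [h *: 1]mulr1 addr0.
Qed.

Lemma differentiable_comp_real (g : R -> R) (f : V -> R) x :
  differentiable f x -> derivable g (f x) 1 -> differentiable (fun y => g (f y)) x.
Proof.
by move=> df dg; apply: (@differentiable_comp _ _ _ _ f g) => //; exact/derivable1_diffP.
Qed.

Lemma partial_comp_dot (g : R -> R) (v x : V) th i c :
  is_derive (dot x v + th) (1:R) g c ->
  partial i (fun y => g (dot y v + th)) x = v 0 i * c.
Proof.
move=> gc; apply: (@derive_line _ _ _ (fun h => g (h * v 0 i + (dot x v + th)))).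
  by move=> h; rewrite dotDl dotZl dot_delta addrA.
have d1 : is_derive (0:R) 1 (fun h : R => h * v 0 i + (dot x v + th)) (v 0 i).
  by apply: is_derive_eq; rewrite /GRing.scale /=; ring.
have gc' : is_derive (0 * v 0 i + (dot x v + th)) (1:R) g c by rewrite mul0r add0r.
have := @is_derive1_comp R g (fun h : R => h * v 0 i + (dot x v + th)) 0 _ _ gc' d1.
by rewrite /= mulrC; exact.
Qed.

Lemma partialD f g i x : differentiable f x -> differentiable g x ->
  partial i (fun y => f y + g y) x = partial i f x + partial i g x.
Proof. by move=> df dg; rewrite /partial deriveD//; exact: diff_derivable. Qed.

Lemma partialM f g i x : differentiable f x -> differentiable g x ->
  partial i (fun y => f y * g y) x = f x * partial i g x + partial i f x * g x.
Proof.
move=> df dg; rewrite /partial deriveM//; try exact: diff_derivable.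
by rewrite /GRing.scale /= (mulrC (g x)).
Qed.

Lemma partial_cst (c : R) i : partial i (fun _ : V => c) = fun=> 0.
Proof. by apply/funext => x; rewrite /partial derive_cst. Qed.

Lemma partialZ c f i x : differentiable f x ->
  partial i (fun y => c * f y) x = c * partial i f x.
Proof.
by move=> df; rewrite partialM// partial_cst mul0r addr0.
Qed.

Lemma partial_coord i j : partial i (fun y : V => y 0 j) = fun=> (i == j)%:R.
Proof.
apply/funext => x; apply: (@derive_line _ _ _ (fun h => h * (i == j)%:R + x 0 j)).
  by move=> h; rewrite !mxE eqxx/= eq_sym.
by apply: is_derive_eq; rewrite /GRing.scale /=; ring.
Qed.

Lemma smooth_cos (v : V) (c th : R) : smooth (fun x => c * cos (dot x v + th)).
Proof.
pose G := [set f : V -> R | exists c th, f = fun x => c * cos (dot x v + th)].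
apply: (@smooth_class G); last by exists c, th.
- move=> _ x [c' [th' ->]]; apply: differentiableM; first exact: differentiable_cst.
  apply: (@differentiable_comp_real cos); last by [].
  by apply: differentiableD; [exact: differentiable_dot|exact: differentiable_cst].
(* The derivative of the cosine is the cosine at a phase advanced by pi / 2, which
   keeps the class stable. *)
- move=> _ i [c' [th' ->]]; exists (c' * v 0 i), (th' + pi / 2); apply/funext => x.
  rewrite partialZ; last first.
    apply: (@differentiable_comp_real cos); last by [].
    by apply: differentiableD; [exact: differentiable_dot|exact: differentiable_cst].
  rewrite (@partial_comp_dot cos v x th' i (- sin (dot x v + th'))).
  by rewrite addrA cosDpihalf mulrA.
Qed.

Lemma partials_linear (a : R) f g (s : seq 'I_n) : smooth f -> smooth g ->
  partials s (fun x => a * f x + g x) = (fun x => a * partials s f x + partials s g x).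
Proof.
move=> sf sg; elim: s => //= i s ->; apply/funext => x.
rewrite partialD ?partialZ//; try exact: sf; try exact: sg.
by apply: differentiableM; [exact: differentiable_cst|exact: sf].
Qed.

Lemma smooth_linear (a : R) f g : smooth f -> smooth g -> smooth (fun x => a * f x + g x).
Proof.
move=> sf sg s x; rewrite partials_linear//; apply: differentiableD; last exact: sg.
by apply: differentiableM; [exact: differentiable_cst|exact: sf].
Qed.

Lemma cpartials_linear (c : R[i]) (phi psi : V -> R[i]) s : csmooth phi -> csmooth psi ->
  cpartials s (fun x => c * phi x + psi x) =
  (fun x => c * cpartials s phi x + cpartials s psi x) /\
  csmooth (fun x => c * phi x + psi x).
Proof.
move=> [p1 p2] [q1 q2].
have reE : @complex.Re R \o (fun x => c * phi x + psi x) =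
    fun x => complex.Re c * (@complex.Re R \o phi) x +
      (- complex.Im c * (@complex.Im R \o phi) x + (@complex.Re R \o psi) x).
  by apply/funext => x /=; rewrite ReD ReM; ring.
have imE : @complex.Im R \o (fun x => c * phi x + psi x) =
    fun x => complex.Re c * (@complex.Im R \o phi) x +
      (complex.Im c * (@complex.Re R \o phi) x + (@complex.Im R \o psi) x).
  by apply/funext => x /=; rewrite ImD ImM; ring.
have s1 := smooth_linear (- complex.Im c) p2 q1.
have s2 := smooth_linear (complex.Im c) p1 q2.
split; last by split; rewrite ?reE ?imE; exact: smooth_linear.
apply/funext => x; rewrite /cpartials reE imE !partials_linear//.
by apply: complex_eqP; rewrite ?ReD ?ReM ?ImD ?ImM /=; ring.
Qed.

Lemma smooth_continuous f : smooth f -> continuous f.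
Proof. by move=> sf x; apply: differentiable_continuous; exact: (sf [::] x). Qed.

End smooth_functions.

(** * Absolutely summable families on the lattice *)

Section expi_theory.
Context (R : realType).
Implicit Types x y t : R.

Lemma expiD x y : expi (x + y) = expi x * expi y.
Proof.
by apply: complex_eqP; rewrite ?ReM ?ImM /= ?cosD ?sinD// addrC.
Qed.

Lemma expi0 : expi (0 : R) = 1.
Proof. by rewrite /expi cos0 sin0. Qed.

(** A mean value inequality without any order between x and y; it gives all the Taylor
    estimates below. *)
Lemma mean_value_le (f g : R -> R) (M x y : R) :
  (forall t, is_derive t (1:R) f (g t)) ->
  (forall t, Num.min x y <= t <= Num.max x y -> `|g t| <= M) ->
  `|f x - f y| <= M * `|x - y|.
Proof.
wlog xy : x y / x <= y => [wl|] fg gM.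
  have [xy|/ltW yx] := leP x y; first exact: wl.
  by rewrite distrC (distrC x); apply: wl => //; rewrite minC maxC.
rewrite distrC (distrC x); have [|c cxy ->] := @MVT_segment R f g x y xy (fun t _ => fg t).
- by apply: derivable_within_continuous => t _; have [] := fg t.
- rewrite normrM ler_wpM2r//; apply: gM.
  by move: cxy; rewrite in_itv/= min_l// max_r.
Qed.

Lemma norm_cosB x y : `|cos x - cos y| <= `|x - y|.
Proof.
rewrite -[leRHS]mul1r; apply: (@mean_value_le _ (fun t => - sin t)) => t _.
by rewrite normrN ler_norml sin_geN1 sin_le1.
Qed.

Lemma norm_sinB x y : `|sin x - sin y| <= `|x - y|.
Proof.
rewrite -[leRHS]mul1r; apply: (@mean_value_le _ (@cos R)) => t _.
by rewrite ler_norml cos_geN1 cos_le1.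
Qed.

Lemma modulus_expiB x y : modulus (expi x - expi y) <= 2 * `|x - y|.
Proof.
apply: le_trans (modulus_le_ReIm _) _; rewrite ReD ImD ReN ImN /=.
by rewrite mulr_natl mulr2n lerD ?norm_cosB ?norm_sinB.
Qed.

Lemma norm_between0 t x : Num.min x 0 <= t <= Num.max x 0 -> `|t| <= `|x|.
Proof.
have [x0|x0] := leP x 0.
  by move=> /andP[tx t0]; rewrite !ler0_norm// lerN2.
by move=> /andP[t0 tx]; rewrite !ger0_norm// ltW.
Qed.

Lemma norm_cos_sub1 t : `|cos t - 1| <= t ^+ 2.
Proof.
have := @mean_value_le (@cos R) (fun s => - sin s) `|t| t 0.
rewrite cos0 subr0 -expr2 real_normK ?num_real//; apply => // s st.
rewrite normrN (le_trans _ (norm_between0 st))//.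
by have := norm_sinB s 0; rewrite sin0 !subr0.
Qed.

Lemma norm_sin_subr t : `|sin t - t| <= t ^+ 2.
Proof.
have := @mean_value_le (fun s => sin s - s) (fun s => cos s - 1) `|t| t 0.
rewrite sin0 !subr0 -expr2 real_normK ?num_real//; apply => s st.
rewrite (le_trans _ (norm_between0 st))//.
by have := norm_cosB s 0; rewrite cos0 !subr0.
Qed.

End expi_theory.

Section summation.
Context (R : realType) (I : choiceType).
Local Notation Pi := [set l : seq I | uniq l].

(** The finite sums of a function along lists without repetition are those that
    define the sum of a family. *)
Lemma esum_le_seq (f : I -> R) C : (forall i, 0 <= f i) ->
  (\esum_(i in [set: I]) (f i)%:E <= C%:E)%E <->
  (forall l, uniq l -> \sum_(i <- l) f i <= C).
Proof.
move=> f0; split=> [fC l ul|fC].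
  rewrite -lee_fin; apply: le_trans fC; apply: esum_ge; exists [set` l].
    by split => //; exact: finite_seq.
  by rewrite -fsbig_seq//= sumEFin.
apply: ub_ereal_sup => _ [D [fD _] <-].
by rewrite fsbig_finite//= sumEFin lee_fin fC.
Qed.

(** A list whose sum is within e of the supremum leaves less than e to every disjoint
    list. *)
Lemma summable_tail (a : I -> R) C (e : R) : (forall i, 0 <= a i) ->
  (forall l, uniq l -> \sum_(i <- l) a i <= C) -> 0 < e ->
  exists l0, uniq l0 /\ forall l, uniq l -> (forall i, i \in l -> i \notin l0) ->
    \sum_(i <- l) a i <= e.
Proof.
move=> a0 aC e0.
pose S := [set x | exists l, uniq l /\ x = \sum_(i <- l) a i].
have hS : has_sup S.
  split; first by exists 0, [::]; rewrite big_nil.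
  by exists C => _ [l [ul ->]]; exact: aC.
have [_ [l0 [ul0 ->]] hl0] := sup_adherent e0 hS.
exists l0; split => // l ul dl.
have : \sum_(i <- l ++ l0) a i <= sup S.
  apply: ub_le_sup; first by case: hS.
  exists (l ++ l0); split => //; rewrite cat_uniq ul ul0 andbT /=.
  by apply/hasPn => i il0; apply/negP => /dl; rewrite il0.
rewrite big_cat/=; lra.
Qed.

Lemma sum_subset_le (a : I -> R) (l1 l2 : seq I) : (forall i, 0 <= a i) ->
  uniq l1 -> uniq l2 -> {subset l1 <= l2} -> \sum_(i <- l1) a i <= \sum_(i <- l2) a i.
Proof.
move=> a0 u1 u2 sub; rewrite [leRHS](bigID (mem l1)) /= -[X in _ <= X + _]big_filter.
have -> : \sum_(i <- l1) a i = \sum_(i <- [seq i <- l2 | i \in l1]) a i.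
  apply: perm_big; apply: uniq_perm => //; first exact: filter_uniq.
  move=> i; rewrite mem_filter; apply/idP/idP => [il1|/andP[]//].
  by rewrite il1 sub.
by rewrite lerDl sumr_ge0.
Qed.

Lemma summable_approx_ge0 (a : I -> R) C (e : R) : (forall i, 0 <= a i) ->
  (forall l, uniq l -> \sum_(i <- l) a i <= C) -> 0 < e ->
  exists l0 : seq I, forall l : seq I, uniq l -> {subset l0 <= l} ->
    `|fine (\esum_(i in [set: I]) (a i)%:E) - \sum_(i <- l) a i| <= e.
Proof.
move=> a0 aC e0; have aC' := (esum_le_seq C a0).2 aC.
have fin : \esum_(i in [set: I]) (a i)%:E \is a fin_num.
  rewrite ge0_fin_numE; first exact: le_lt_trans aC' (ltry _).
  by apply: esum_ge0 => i _; rewrite lee_fin.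
set S := fine _; have SE : \esum_(i in [set: I]) (a i)%:E = S%:E by rewrite fineK.
have Sle l : uniq l -> \sum_(i <- l) a i <= S.
  by apply: (esum_le_seq S a0).1; rewrite SE.
have [l0 [ul0 h]] := summable_tail a0 Sle e0.
exists l0 => l ul sl; rewrite ger0_norm ?subr_ge0 ?Sle// lerBlDl.
rewrite -lee_fin -SE; apply/esum_le_seq => // l' ul'.
rewrite (bigID (mem l)) /= -[X in X + _]big_filter -[X in _ + X]big_filter lerD//.
  apply: sum_subset_le => //; first exact: filter_uniq.
  by move=> i; rewrite mem_filter => /andP[].
apply: h; first exact: filter_uniq.
by move=> i; rewrite mem_filter => /andP[il _]; apply: contra il; exact: sl.
Qed.

End summation.

Section csum_theory.
Context (R : realType) (n : nat).
Local Notation Z := 'rV[int]_n.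
Implicit Types (a b : Z -> R[i]) (l : seq Z).

Definition uniq_lists : set (seq Z) := [set l | uniq l].
Local Notation "a <=v C" := (var_le uniq_lists a C) (at level 70).

(** Convergence along the net of finite lists. It is additive and homogeneous by
    inspection, whereas the sum is defined through the positive and negative parts of
    its real and imaginary parts; convolution identities are proved with the former
    and transported to the latter. *)
Definition has_csum a (z : R[i]) := forall e : R, 0 < e -> exists l0 : seq Z,
  forall l, uniq l -> {subset l0 <= l} -> modulus (z - \sum_(i <- l) a i) <= e.

Lemma has_csum2 a b z w (e : R) : has_csum a z -> has_csum b w -> 0 < e ->
  exists l, [/\ uniq l, modulus (z - \sum_(i <- l) a i) <= e &
    modulus (w - \sum_(i <- l) b i) <= e].
Proof.
move=> az bw e0; have [l1 h1] := az _ e0; have [l2 h2] := bw _ e0.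
exists (undup (l1 ++ l2)); split; first exact: undup_uniq.
  by apply: h1; [exact: undup_uniq|move=> i il; rewrite mem_undup mem_cat il].
by apply: h2; [exact: undup_uniq|move=> i il; rewrite mem_undup mem_cat il orbT].
Qed.

Lemma has_csum_eq a z w : has_csum a z -> has_csum a w -> z = w.
Proof.
move=> az aw; apply/subr0_eq/modulus_eq0/eqP.
rewrite eq_le modulus_ge0 andbT; apply/ler_addgt0Pr => e e0; rewrite add0r.
have e20 : 0 < e / 2 by rewrite divr_gt0.
have [l [_ h1 h2]] := has_csum2 az aw e20.
rewrite (_ : z - w = (z - \sum_(i <- l) a i) - (w - \sum_(i <- l) a i)); last by ring.
by rewrite (le_trans (modulusB _ _))// (splitr e) lerD.
Qed.

Lemma has_csumD a b z w : has_csum a z -> has_csum b w -> has_csum (a \+ b) (z + w).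
Proof.
move=> az bw e e0; have e20 : 0 < e / 2 by rewrite divr_gt0.
have [l1 h1] := az _ e20; have [l2 h2] := bw _ e20.
exists (l1 ++ l2) => l ul sl; rewrite big_split/= opprD addrACA.
rewrite (le_trans (modulusD _ _))// (splitr e) lerD//.
  by apply: h1 => // i il; apply: sl; rewrite mem_cat il.
by apply: h2 => // i il; apply: sl; rewrite mem_cat il orbT.
Qed.

Lemma has_csumZ c a z : has_csum a z -> has_csum (fun i => c * a i) (c * z).
Proof.
move=> az e e0.
have c1 : 0 < modulus c + 1 by rewrite ltr_wpDl ?modulus_ge0.
have ec : 0 < e / (modulus c + 1) by rewrite divr_gt0.
have [l0 h] := az _ ec; exists l0 => l ul sl.
rewrite -mulr_sumr -mulrBr modulusM.
apply: (le_trans (ler_wpM2l (modulus_ge0 _) (h l ul sl))).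
by rewrite mulrA ler_pdivrMr// mulrDr mulr1 mulrC lerDl ltW.
Qed.

Lemma rsum_approx (g : Z -> R) C (e : R) :
  (forall l, uniq l -> \sum_(i <- l) `|g i| <= C) -> 0 < e ->
  exists l0 : seq Z, forall l, uniq l -> {subset l0 <= l} ->
    `|rsum g - \sum_(i <- l) g i| <= e.
Proof.
move=> gC e0; have e20 : 0 < e / 2 by rewrite divr_gt0.
have pC l : uniq l -> \sum_(i <- l) g^\+ i <= C.
  move=> ul; apply: le_trans (gC l ul); apply: ler_sum => i _.
  by rewrite /funrpos ge_max ler_norm normr_ge0.
have nC l : uniq l -> \sum_(i <- l) g^\- i <= C.
  move=> ul; apply: le_trans (gC l ul); apply: ler_sum => i _.
  by rewrite /funrneg ge_max normr_ge0 andbT -normrN ler_norm.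
have [l1 h1] := summable_approx_ge0 (funrpos_ge0 g) pC e20.
have [l2 h2] := summable_approx_ge0 (funrneg_ge0 g) nC e20.
exists (l1 ++ l2) => l ul sl.
have -> : \sum_(i <- l) g i = \sum_(i <- l) g^\+ i - \sum_(i <- l) g^\- i.
  by rewrite -sumrB; apply: eq_bigr => i _; rewrite -[in LHS](funrposBneg g).
rewrite /rsum opprD addrACA -opprD (le_trans (ler_normB _ _))// (splitr e) lerD//.
  by apply: h1 => // i il; apply: sl; rewrite mem_cat il.
by apply: h2 => // i il; apply: sl; rewrite mem_cat il orbT.
Qed.

Lemma csum_has_csum a C : a <=v C -> has_csum a (csum a).
Proof.
move=> aC e e0; have e20 : 0 < e / 2 by rewrite divr_gt0.
have [|l1 h1] := @rsum_approx (fun i => complex.Re (a i)) C _ _ e20.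
  move=> l /aC; apply: le_trans; apply: ler_sum => i _; exact: normr_Re_le.
have [|l2 h2] := @rsum_approx (fun i => complex.Im (a i)) C _ _ e20.
  move=> l /aC; apply: le_trans; apply: ler_sum => i _; exact: normr_Im_le.
exists (l1 ++ l2) => l ul sl.
apply: le_trans (modulus_le_ReIm _) _; rewrite ReD ImD ReN ImN Re_sum Im_sum (splitr e).
rewrite lerD//.
  by apply: h1 => // i il; apply: sl; rewrite mem_cat il.
by apply: h2 => // i il; apply: sl; rewrite mem_cat il orbT.
Qed.

Lemma has_csum_le a z C : a <=v C -> has_csum a z -> modulus z <= C.
Proof.
move=> aC az; apply/ler_addgt0Pr => e e0.
have [l0 h] := az _ e0.
have ul := undup_uniq l0.
rewrite (_ : z = (z - \sum_(i <- undup l0) a i) + \sum_(i <- undup l0) a i); last by rewrite subrK.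
rewrite addrC (le_trans (modulusD _ _))// lerD//.
  by apply: le_trans (modulus_sum _ _) _; exact: aC.
by apply: h => // i; rewrite mem_undup.
Qed.

Lemma var_le_mulr_bounded a b C M : a <=v C -> (forall i, modulus (b i) <= M) -> 0 <= M ->
  (fun i => b i * a i) <=v (M * C).
Proof.
move=> aC bM M0 l /aC h; apply: le_trans (ler_wpM2l M0 h).
by rewrite mulr_sumr; apply: ler_sum => i _; rewrite modulusM ler_wpM2r ?modulus_ge0.
Qed.

Lemma var_le_pt a C i : a <=v C -> modulus (a i) <= C.
Proof. by move=> /(_ [:: i] isT); rewrite big_seq1. Qed.

Lemma var_le_pos a C : a <=v C -> 0 <= C.
Proof. by move=> /(_ [::] isT); rewrite big_nil. Qed.

Lemma conv_terms a b A B m : a <=v A -> b <=v B ->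
  (fun xi => a (m - xi) * b xi) <=v (A * B).
Proof.
by move=> aA bB; apply: var_le_mulr_bounded => //; [move=> i; exact: var_le_pt|exact: var_le_pos aA].
Qed.

(** A finite sum of moduli of entries of the convolution is bounded by the same sum
    taken under the summation sign, where for each xi it is a sum of moduli of a over
    a translated list. *)
Lemma conv_seq_le a b A B : a <=v A -> b <=v B -> conv_seq a b <=v (A * B).
Proof.
move=> aA bB l ul; apply/ler_addgt0Pr => e e0.
pose e' := e / (size l).+1%:R.
have e'0 : 0 < e' by rewrite divr_gt0.
have /choice[l0 h] := fun m => csum_has_csum (conv_terms m aA bB) e'0.
pose L := undup (flatten [seq l0 m | m <- l]).
have uL : uniq L by exact: undup_uniq.
have mL m : m \in l -> {subset l0 m <= L}.
  move=> ml i il; rewrite mem_undup; apply/flattenP; exists (l0 m) => //.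
  by apply/mapP; exists m.
have step m : m \in l ->
    modulus (conv_seq a b m) <= \sum_(xi <- L) modulus (a (m - xi)) * modulus (b xi) + e'.
  move=> ml; have h' := h m L uL (mL m ml).
  rewrite (_ : conv_seq a b m = (\sum_(xi <- L) a (m - xi) * b xi) +
    (csum (fun xi => a (m - xi) * b xi) - \sum_(xi <- L) a (m - xi) * b xi)); last first.
    by rewrite addrC subrK.
  rewrite (le_trans (modulusD _ _))// lerD//.
  by apply: le_trans (modulus_sum _ _) _; apply: ler_sum => xi _; rewrite modulusM.
apply: (@le_trans _ _ (\sum_(m <- l) (\sum_(xi <- L) modulus (a (m - xi)) * modulus (b xi) + e'))).
  by rewrite big_seq [leRHS]big_seq; apply: ler_sum => m; exact: step.
rewrite big_split/= lerD//; last first.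
  rewrite big_const_seq count_predT iter_addr_0 -[leLHS]mulr_natl /e' mulrCA.
  by rewrite ler_piMr ?(ltW e0)// ler_pdivrMr// mul1r ler_nat.
rewrite exchange_big/= ; apply: (@le_trans _ _ (\sum_(xi <- L) A * modulus (b xi))).
  apply: ler_sum => xi _; rewrite -mulr_suml ler_wpM2r ?modulus_ge0//.
  rewrite -(big_map (fun m => m - xi) xpredT (fun m => modulus (a m))).
  by apply: aA; rewrite /uniq_lists /= map_inj_uniq//; exact: addIr.
rewrite -mulr_sumr ler_wpM2l//; first exact: var_le_pos aA.
exact: bB.
Qed.

Lemma conv_seqBl a b c A B C : a <=v A -> b <=v B -> c <=v C ->
  conv_seq (a \- b) c = conv_seq a c \- conv_seq b c.
Proof.
move=> aA bB cC; apply/funext => m /=.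
have h := csum_has_csum (conv_terms m (var_leB aA bB) cC).
have ha := csum_has_csum (conv_terms m aA cC).
have hb := csum_has_csum (conv_terms m bB cC).
apply: (has_csum_eq h); rewrite -mulN1r.
have := has_csumD ha (has_csumZ (-1) hb); congr has_csum.
by apply/funext => xi /=; ring.
Qed.

Lemma conv_seqBr a b c A B C : a <=v A -> b <=v B -> c <=v C ->
  conv_seq a (b \- c) = conv_seq a b \- conv_seq a c.
Proof.
move=> aA bB cC; apply/funext => m /=.
have h := csum_has_csum (conv_terms m aA (var_leB bB cC)).
have hb := csum_has_csum (conv_terms m aA bB).
have hc := csum_has_csum (conv_terms m aA cC).
apply: (has_csum_eq h); rewrite -mulN1r.
have := has_csumD hb (has_csumZ (-1) hc); congr has_csum.
by apply/funext => xi /=; ring.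
Qed.

Lemma modulus_phase_per (t : R) (m : Z) : modulus (phase_per t m) = 1.
Proof. exact: modulus_expi. Qed.

Lemma phase_le a C t : a <=v C -> (fun m => phase_per t m * a m) <=v C.
Proof. by move=> aC l /aC; under [X in _ -> X <= _]eq_bigr do rewrite modulusM modulus_phase_per mul1r. Qed.

(** The phases converge only pointwise in m, so that the tail of the series has to be
    cut off before letting s tend to t. *)
Lemma phase_continuous a C (t e : R) : a <=v C -> 0 < e ->
  \forall s \near t,
    ((fun m => phase_per s m * a m) \- (fun m => phase_per t m * a m)) <=v e.
Proof.
move=> aC e0; have e40 : 0 < e / 4 by rewrite divr_gt0.
have [l0 [ul0 tail]] := summable_tail (fun m => modulus_ge0 (a m)) aC e40.
pose M := \sum_(m <- l0) 2 * (4 * pi ^+ 2 * `|dot (intv R m) (intv R m)|) * modulus (a m).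
have M0 : 0 <= M.
  apply: sumr_ge0 => m _; rewrite !mulr_ge0 ?modulus_ge0// ?exprn_ge0// pi_ge0//.
have d0 : 0 < e / 2 / (M + 1) by rewrite !divr_gt0// ltr_wpDl.
apply: filterS (nbhsx_ballx t _ d0) => s; rewrite /ball/= distrC => st l ul.
rewrite (bigID (mem l0)) /= -[X in X + _]big_filter -[X in _ + X]big_filter (splitr e) lerD//.
  apply: (@le_trans _ _ (M * `|s - t|)); last first.
    apply: (@le_trans _ _ (M * (e / 2 / (M + 1)))); first by rewrite ler_wpM2l// ltW.
    by rewrite mulrA ler_pdivrMr ?ltr_wpDl// mulrDr mulr1 mulrC lerDl divr_ge0// ltW.
  apply: (@le_trans _ _ (\sum_(m <- l0) modulus (phase_per s m * a m - phase_per t m * a m))).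
    apply: sum_subset_le => //; [by move=> m; exact: modulus_ge0|exact: filter_uniq|].
    by move=> i; rewrite mem_filter => /andP[].
  rewrite /M mulr_suml; apply: ler_sum => m _; rewrite -mulrBl modulusM.
  rewrite [leRHS]mulrAC ler_wpM2r ?modulus_ge0//.
  rewrite /phase_per (le_trans (modulus_expiB _ _))// -[leRHS]mulrA ler_pM2l//.
  rewrite [X in `|X| <= _](_ : _ = - (4 * pi ^+ 2 * dot (intv R m) (intv R m) * (s - t))); last by ring.
  rewrite normrN 2!normrM (ger0_norm (x := 4 * pi ^+ 2))//.
  by rewrite mulr_ge0// exprn_ge0// pi_ge0.
apply: (@le_trans _ _ (2 * \sum_(m <- [seq m <- l | m \notin l0]) modulus (a m))).
  rewrite mulr_sumr; apply: ler_sum => m _; apply: le_trans (modulusB _ _) _.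
  by rewrite !modulusM !modulus_phase_per !mul1r mulr_natl mulr2n.
have : \sum_(m <- [seq m <- l | m \notin l0]) modulus (a m) <= e / 4; last lra.
apply: tail; first exact: filter_uniq.
by move=> i; rewrite mem_filter => /andP[].
Qed.

End csum_theory.

(** * A mean on the torus *)

(** Bounded sequences have a generalized limit which is linear: the limit along an
    ultrafilter. Applied to averages over finer and finer grids it gives a mean on
    the torus for which the characters are orthonormal, without integration. *)
Section generalized_limit.
Context (R : realType).

Lemma ultra_infinity : exists U : set_system nat, UltraFilter U /\ \oo `<=` U.
Proof. by have [U [h1 h2]] := @ultraFilterLemma nat \oo _; exists U. Qed.

(** An ultrafilter finer than the neighbourhoods of infinity: along it every bounded
    sequence converges. *)
Definition ultra : set_system nat := projT1 (cid ultra_infinity).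

Lemma ultra_ultra : UltraFilter ultra.
Proof. by rewrite /ultra; case: cid => U []. Qed.

Lemma ultra_le : \oo `<=` ultra.
Proof. by rewrite /ultra; case: cid => U []. Qed.

Definition ulim (x : nat -> R) : R := lim (x @ ultra).

Lemma ulim_cvg (x : nat -> R) C : (forall k, `|x k| <= C) -> x @ ultra --> ulim x.
Proof.
move=> xC; have U := ultra_ultra.
have [|y [_ yx]] := @segment_compact R (- C) C (x @ ultra) _.
  by apply: nearW => k; rewrite /= in_itv/= -ler_norml.
apply/cvg_ex; exists y => B yB.
have [//|xB] := @in_ultra_setVsetC _ ultra (x @^-1` B) U.
by have [z [/= Bz nBz]] := yx (~` B) B xB yB.
Qed.

Lemma ulim_le (x : nat -> R) C : (forall k, `|x k| <= C) -> `|ulim x| <= C.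
Proof.
move=> xC; have U := ultra_ultra; have c := ulim_cvg xC.
rewrite ler_norml; apply/andP; split.
  apply: limr_ge; first by apply/cvg_ex; exists (ulim x).
  by apply: nearW => k; have := xC k; rewrite ler_norml => /andP[].
apply: limr_le; first by apply/cvg_ex; exists (ulim x).
by apply: nearW => k; have := xC k; rewrite ler_norml => /andP[].
Qed.

Lemma ulim_eq (x : nat -> R) c N : (forall k, (N <= k)%N -> x k = c) -> ulim x = c.
Proof.
move=> xc; have U := ultra_ultra; apply: cvg_lim => //.
apply: cvg_near_cst; apply: ultra_le; by exists N.
Qed.

Lemma ulimD (x y : nat -> R) C D : (forall k, `|x k| <= C) -> (forall k, `|y k| <= D) ->
  ulim (fun k => x k + y k) = ulim x + ulim y.
Proof.
move=> xC yD; have U := ultra_ultra; apply: cvg_lim => //.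
by apply: cvgD; [exact: ulim_cvg xC|exact: ulim_cvg yD].
Qed.

Lemma ulimZ c (x : nat -> R) C : (forall k, `|x k| <= C) ->
  ulim (fun k => c * x k) = c * ulim x.
Proof.
move=> xC; have U := ultra_ultra; apply: cvg_lim => //.
by apply: cvgMr; exact: ulim_cvg xC.
Qed.

Definition culim (z : nat -> R[i]) : R[i] :=
  ulim (fun k => complex.Re (z k)) +i* ulim (fun k => complex.Im (z k)).

(** The factor 2 comes from bounding real and imaginary parts separately. *)
Lemma culim_le (z : nat -> R[i]) C : (forall k, modulus (z k) <= C) ->
  modulus (culim z) <= 2 * C.
Proof.
move=> zC; apply: le_trans (modulus_le_ReIm _) _; rewrite mulr_natl mulr2n /=.
by apply: lerD; apply: ulim_le => k; apply: le_trans (zC k);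
  [exact: normr_Re_le|exact: normr_Im_le].
Qed.

Lemma culim_eq (z : nat -> R[i]) c N : (forall k, (N <= k)%N -> z k = c) -> culim z = c.
Proof.
move=> zc; apply: complex_eqP => /=; apply: (@ulim_eq _ _ N) => k Nk; by rewrite zc.
Qed.

Lemma culim_linear c (z w : nat -> R[i]) C D : (forall k, modulus (z k) <= C) ->
  (forall k, modulus (w k) <= D) ->
  culim (fun k => c * z k + w k) = c * culim z + culim w.
Proof.
move=> zC wD.
have hz k : `|complex.Re (z k)| <= C by apply: le_trans (zC k); exact: normr_Re_le.
have iz k : `|complex.Im (z k)| <= C by apply: le_trans (zC k); exact: normr_Im_le.
have hw k : `|complex.Re (w k)| <= D by apply: le_trans (wD k); exact: normr_Re_le.
have iw k : `|complex.Im (w k)| <= D by apply: le_trans (wD k); exact: normr_Im_le.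
have b (x y : R) (u v : nat -> R) : (forall k, `|u k| <= C) -> (forall k, `|v k| <= C) ->
    forall k, `|x * u k + y * v k| <= `|x| * C + `|y| * C.
  move=> uC vC k; apply: le_trans (ler_normD _ _) _.
  by rewrite !normrM lerD// ler_wpM2l.
have key (x y : R) (u v s : nat -> R) : (forall k, `|u k| <= C) -> (forall k, `|v k| <= C) ->
    (forall k, `|s k| <= D) ->
    ulim (fun k => (x * u k + y * v k) + s k) = (x * ulim u + y * ulim v) + ulim s.
  move=> uC vC sD; rewrite (ulimD (b x y u v uC vC) sD); congr (_ + _).
  rewrite (@ulimD _ _ (`|x| * C) (`|y| * C)).
  - by rewrite (ulimZ _ uC) (ulimZ _ vC).
  - by move=> k; rewrite normrM ler_wpM2l.
  - by move=> k; rewrite normrM ler_wpM2l.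
apply: complex_eqP; rewrite ?ReD ?ImD ?ReM ?ImM /=.
  under eq_fun do rewrite ReD ReM -mulNr; by rewrite key// mulNr.
by under eq_fun do rewrite ImD ImM; rewrite key.
Qed.

End generalized_limit.

Section torus_mean.
Context (R : realType) (n : nat).
Local Notation V := 'rV[R]_n.
Implicit Types (phi : V -> R[i]).

Definition grid_point N (k : {ffun 'I_n -> 'I_N.+1}) : V := \row_i ((k i)%:R / N.+1%:R).

Definition grid_mean phi N : R[i] :=
  ((N.+1 ^ n)%:R^-1)%:C * \sum_(k : {ffun 'I_n -> 'I_N.+1}) phi (grid_point k).

Definition torus_mean phi : R[i] := culim (grid_mean phi).

Definition character (m : 'rV[int]_n) (x : V) : R[i] := expi (2 * pi * dot x (intv R m)).

Lemma grid_mean_le phi C N : (forall x : V, (forall i, 0 <= x 0 i <= 1) -> modulus (phi x) <= C) ->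
  modulus (grid_mean phi N) <= C.
Proof.
move=> pC; rewrite /grid_mean modulusM modulus_real ger0_norm ?invr_ge0//.
rewrite mulrC ler_pdivrMr; last by rewrite ltr0n expn_gt0.
apply: le_trans (modulus_sum _ _) _.
apply: (@le_trans _ _ (\sum_(k : {ffun 'I_n -> 'I_N.+1}) C)).
  apply: ler_sum => k _; apply: pC => i; rewrite mxE divr_ge0//=.
  by rewrite ler_pdivrMr ?ltr0n// mul1r ler_nat ltnW.
by rewrite sumr_const card_ffun !card_ord mulr_natr.
Qed.

Lemma torus_mean_le phi C : (forall x : V, (forall i, 0 <= x 0 i <= 1) -> modulus (phi x) <= C) ->
  modulus (torus_mean phi) <= 2 * C.
Proof. by move=> pC; apply: culim_le => k; exact: grid_mean_le. Qed.

Lemma torus_mean_linear c phi psi C D :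
  (forall x : V, (forall i, 0 <= x 0 i <= 1) -> modulus (phi x) <= C) ->
  (forall x : V, (forall i, 0 <= x 0 i <= 1) -> modulus (psi x) <= D) ->
  torus_mean (fun x => c * phi x + psi x) = c * torus_mean phi + torus_mean psi.
Proof.
move=> pC qD.
rewrite -(culim_linear c (fun k => grid_mean_le k pC) (fun k => grid_mean_le k qD)).
congr culim; apply/funext => N; rewrite /grid_mean.
rewrite mulrCA -mulrDr; congr (_ * _); rewrite mulr_sumr -big_split/=.
by [].
Qed.

Lemma expi_natmul (t : R) k : expi (k%:R * t) = expi t ^+ k.
Proof.
elim: k => [|k IH]; first by rewrite mul0r expi0.
by rewrite -natr1 mulrDl mul1r expiD IH exprSr.
Qed.

Lemma expi_sum (I : Type) (s : seq I) (F : I -> R) :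
  expi (\sum_(i <- s) F i) = \prod_(i <- s) expi (F i).
Proof.
elim: s => [|i s IH]; first by rewrite !big_nil expi0.
by rewrite !big_cons expiD IH.
Qed.

Lemma expi_2pi_int (z : int) : expi (2 * pi * z%:~R : R) = 1.
Proof.
have nat k : expi (2 * pi * k%:R : R) = 1.
  rewrite mulrC expi_natmul (_ : expi (2 * pi) = 1) ?expr1n//.
  by rewrite /expi mulr_natl cos2pi sin2pi.
case: z => k; first exact: nat.
rewrite NegzE mulrN; have /(congr1 (fun w => expi (- (2 * pi * k.+1%:R)) * w)) := nat k.+1.
by rewrite -expiD addNr expi0 mulr1 => <-.
Qed.

Lemma expi_neq1 (t : R) : 0 < t < 2 * pi -> expi t != 1.
Proof.
move=> /andP[t0 t2]; apply/eqP => /(congr1 (@complex.Re R)) /= c1.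
have s0 : 0 < sin (t / 2).
  apply: sin_gt0_pi; rewrite divr_gt0//=.
  by rewrite ltr_pdivrMr// mulrC.
have : cos t = 1 - sin (t / 2) ^+ 2 *+ 2.
  by rewrite {1}(splitr t) -mulr2n cos_mulr2n cos2sin2 mulrnBl; ring.
rewrite c1 => /eqP; rewrite -subr_eq0 opprB addrCA subrr addr0 mulrn_eq0/= sqrf_eq0.
by rewrite gt_eqF.
Qed.

(** The geometric sum of the N-th roots of unity. *)
Lemma sum_root_of_unity (z : int) N : z != 0 -> (`|z| < N.+1)%N ->
  \sum_(k < N.+1) expi (2 * pi * ((k%:R / N.+1%:R) * z%:~R)) = 0 :> R[i].
Proof.
move=> z0 zN; pose w : R[i] := expi (2 * pi * (z%:~R / N.+1%:R)).
have N0 : (N.+1%:R : R) != 0 by rewrite pnatr_eq0.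
under eq_bigr => k _.
  rewrite (_ : 2 * pi * _ = k%:R * (2 * pi * (z%:~R / N.+1%:R))); last by ring.
  rewrite expi_natmul -/w; over.
have wN : w ^+ N.+1 = 1.
  rewrite -expi_natmul (_ : _ * _ = 2 * pi * z%:~R) ?expi_2pi_int//.
  by field.
have w1 : w != 1.
  rewrite /w; have [zp|zn|/eqP] := ltgtP 0 z; last by rewrite eq_sym (negPf z0).
    apply: expi_neq1; rewrite mulr_gt0 ?mulr_gt0 ?pi_gt0 ?divr_gt0 ?ltr0z//=.
    rewrite gtr_pMr ?mulr_gt0 ?pi_gt0// ltr_pdivrMr ?ltr0n// mul1r.
    by case: z zp zN {z0 w wN} => // k _; rewrite ltr_nat.
  have : expi (2 * pi * ((- z)%:~R / N.+1%:R)) != 1 :> R[i].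
    apply: expi_neq1; rewrite mulr_gt0 ?mulr_gt0 ?pi_gt0 ?divr_gt0 ?ltr0z ?oppr_gt0//=.
    rewrite gtr_pMr ?mulr_gt0 ?pi_gt0// ltr_pdivrMr ?ltr0n// mul1r.
    by case: z zn zN {z0 w wN} => // k _; rewrite NegzE opprK ltr_nat.
  apply: contra => /eqP h; apply/eqP.
  have := congr1 (fun v => expi (2 * pi * ((- z)%:~R / N.+1%:R)) * v) h.
  rewrite mulr1 -expiD (_ : _ + _ = 0) ?expi0// rmorphN /=; ring.
have := subrX1 w N.+1; rewrite wN subrr => /esym/eqP.
by rewrite mulf_eq0 subr_eq0 (negPf w1) => /eqP.
Qed.

(** The average over the grid of step 1 / (N + 1) is a product of geometric sums. For
    m nonzero it vanishes as soon as N is at least the absolute value of each entry of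
    m, so that the generalized limit is taken of an eventually constant sequence. *)
Lemma torus_mean_character (m : 'rV[int]_n) : torus_mean (character m) = (m == 0)%:R.
Proof.
apply: (culim_eq (N := (\max_(i < n) `|m 0%R i|)%N)) => N mN; rewrite /grid_mean /character.
have -> : \sum_(k : {ffun 'I_n -> 'I_N.+1}) expi (2 * pi * dot (grid_point k) (intv R m)) =
    \prod_(i < n) \sum_(j < N.+1) expi (2 * pi * ((j%:R / N.+1%:R) * (m 0 i)%:~R)) :> R[i].
  rewrite bigA_distr_bigA /=; apply: eq_bigr => k _.
  rewrite -expi_sum /dot mulr_sumr; congr expi; apply: eq_bigr => i _.
  by rewrite !mxE.
have [->|m0] := eqVneq m 0.
  rewrite (eq_bigr (fun _ => N.+1%:R)); last first.
    move=> i _; rewrite (eq_bigr (fun _ => 1)); first by rewrite sumr_const card_ord.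
    by move=> j _; rewrite mxE !mulr0 expi0.
  rewrite prodr_const card_ord -natrX mulr1n.
  have N0 : ((N.+1 ^ n)%:R : R) != 0 by rewrite pnatr_eq0 expn_eq0.
  rewrite -(rmorph_nat (real_complex R)) -rmorphM /= mulVf//.
have [i mi] : exists i, m 0 i != 0.
  apply/existsP; rewrite -negb_forall; apply: contra m0 => /forallP h.
  by apply/eqP/rowP => i; rewrite mxE; exact/eqP/h.
rewrite (bigD1 i)//= sum_root_of_unity//; first by rewrite mul0r mulr0.
rewrite ltnS; apply: leq_trans mN.
exact: (leq_bigmax (F := fun i => `|m 0%R i|%N) i).
Qed.

End torus_mean.

(** * The periodic case *)

Section periodic_case.
Context (R : realType) (n : nat).
Local Notation Z := 'rV[int]_n.
Local Notation V := 'rV[R]_n.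
Local Notation Pi := (@uniq_lists n).
Implicit Types (a b : Z -> R[i]) (f g : distr R n) (phi psi : V -> R[i]).

Definition summable_coefficients : set (Z -> R[i]) := [set a | exists C, var_le Pi a C].

(** Sums over finite lists are exchanged with the time integral, and the segment has
    length |t|. *)
Lemma periodic_time_integral t (g : R -> Z -> R[i]) C :
  (forall s, time_segment t s -> summable_coefficients (g s)) ->
  (forall s, time_segment t s -> var_le Pi (g s) C) ->
  (forall i, ae_cmeasurable (time_segment t) (fun s => g s i)) ->
  summable_coefficients (fun i => time_integral t (fun s => g s i)).
Proof.
move=> _ gC mg; exists (`|t| * C) => l ul; apply: sum_modulus_time_integral => //.
- by move=> i; exists C => s /gC h; exact: var_le_pt h.
- by move=> s /gC; exact.
Qed.

Program Definition periodic_algebra : flow_algebra R Z :=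
  @FlowAlgebra R Z Pi summable_coefficients (@conv_seq R n)
    (fun t a m => phase_per t m * a m) _ _ _ _ _ _ _ periodic_time_integral _ _ _ _ _ _ _ _.
Next Obligation. by []. Qed.
Next Obligation. by []. Qed.
Next Obligation. by exists 0; exact: var_le0. Qed.
Next Obligation. by move=> a b [A aA] [B bB]; exists (A + B); exact: var_leD. Qed.
Next Obligation. by move=> z a [A aA]; exists (modulus z * A); exact: var_leZ. Qed.
Next Obligation. by move=> a. Qed.
Next Obligation.
move=> u a uK ua; have [k ka] := ua 1 ltr01; have [C uC] := uK k; exists (C + 1).
rewrite (_ : a = u k \- (u k \- a)); first exact: var_leB.
by apply/funext => i /=; rewrite opprB addrC subrK.
Qed.
Next Obligation. by move=> a b [A aA] [B bB]; exists (A * B); exact: conv_seq_le. Qed.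
Next Obligation. by move=> a b c [A aA] [B bB] [C cC]; exact: conv_seqBl aA bB cC. Qed.
Next Obligation. by move=> a b c [A aA] [B bB] [C cC]; exact: conv_seqBr aA bB cC. Qed.
Next Obligation. by move=> a b A B _ _; exact: conv_seq_le. Qed.
Next Obligation. by move=> t a [C aC]; exists C; exact: phase_le. Qed.
Next Obligation. by move=> t a b _ _; apply/funext => m /=; rewrite mulrBr. Qed.
Next Obligation. by move=> t a C _; exact: phase_le. Qed.
Next Obligation. by move=> a t e [C aC] e0; exact: phase_continuous aC e0. Qed.

Lemma norm_Iper_le f C : (norm_Iper f <= C%:E)%E <-> var_le Pi (fcoef f) C.
Proof. by apply: esum_le_seq => m; exact: modulus_ge0. Qed.

Lemma Iper_summable f : Iper f -> summable_coefficients (fcoef f).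
Proof.
move=> [_ fin]; exists (fine (norm_Iper f)); apply/norm_Iper_le.
rewrite fineK// ge0_fin_numE//; apply: esum_ge0 => m _.
by rewrite lee_fin modulus_ge0.
Qed.

Lemma seminorm_ge0 w k phi : (0 <= seminorm w k phi)%E.
Proof.
apply: (@le_trans _ _ (((1 + `|0 : V|) ^+ w * modulus (cpartials [::] phi 0))%:E)).
  by rewrite lee_fin mulr_ge0 ?modulus_ge0// exprn_ge0// addr_ge0.
by apply: ereal_sup_ubound; exists ([::], 0).
Qed.

Lemma le_seminorm w w' k k' phi : (w <= w')%N -> (k <= k')%N ->
  (seminorm w k phi <= seminorm w' k' phi)%E.
Proof.
move=> ww kk; apply: ub_ereal_sup => _ [[s x] /= sk <-].
apply: (@le_trans _ _ (((1 + `|x|) ^+ w' * modulus (cpartials s phi x))%:E)).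
  rewrite lee_fin ler_wpM2r ?modulus_ge0// ler_weXn2l//.
  by rewrite lerDl.
by apply: ereal_sup_ubound; exists (s, x) => //=; exact: leq_trans kk.
Qed.

(** Sums and opposites of continuous functionals, for the tempered as well as for the
    periodic distributions: the bounds of two functionals are compared in the larger
    of their two orders. *)
Section dual_spaces.
Variables (test : set (V -> R[i])) (p : nat -> (V -> R[i]) -> \bar R).
Hypothesis p0 : forall k phi, (0 <= p k phi)%E.
Hypothesis p_nd : forall k l phi, (k <= l)%N -> (p k phi <= p l phi)%E.

Lemma continuous_dual_abs f : continuous_dual test p f -> exists k c, 0 <= c /\
  forall phi, test phi -> ((modulus (f phi))%:E <= c%:E * p k phi)%E.
Proof.
move=> [_ [k [c fc]] _]; exists k, `|c|; split => // phi /fc /le_trans; apply.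
by rewrite lee_wpmul2r// lee_fin ler_norm.
Qed.

Lemma continuous_dualD f g : continuous_dual test p f -> continuous_dual test p g ->
  continuous_dual test p (f + g).
Proof.
move=> df dg; have [k [c [c0 fc]]] := continuous_dual_abs df.
have [l [d [d0 gd]]] := continuous_dual_abs dg.
have [fl _ f0] := df; have [gl _ g0] := dg; split.
- move=> a phi psi tp tq.
  change (f (fun x => a * phi x + psi x) + g (fun x => a * phi x + psi x) =
    a * (f phi + g phi) + (f psi + g psi)).
  by rewrite fl// gl//; ring.
- exists (maxn k l), (c + d) => phi tphi.
  change ((modulus (f phi + g phi))%:E <= (c + d)%:E * p (maxn k l) phi)%E.
  apply: (@le_trans _ _ ((modulus (f phi))%:E + (modulus (g phi))%:E)%E).
    by rewrite -EFinD lee_fin modulusD.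
  rewrite EFinD ge0_muleDl ?lee_fin//; apply: leeD.
    by apply: (le_trans (fc _ tphi)); apply: lee_wpmul2l; [rewrite lee_fin|exact/p_nd/leq_maxl].
  by apply: (le_trans (gd _ tphi)); apply: lee_wpmul2l; [rewrite lee_fin|exact/p_nd/leq_maxr].
- move=> phi ntphi; change (f phi + g phi = 0).
  by rewrite f0// g0// addr0.
Qed.

Lemma continuous_dualN f : continuous_dual test p f -> continuous_dual test p (- f).
Proof.
move=> [fl [k [c fc]] f0]; split.
- move=> a phi psi tp tq; change (- f (fun x => a * phi x + psi x) = a * - f phi - f psi).
  by rewrite fl//; ring.
- exists k, c => phi tphi; change ((modulus (- f phi))%:E <= c%:E * p k phi)%E.
  by rewrite modulusN fc.
- by move=> phi ntphi; change (- f phi = 0); rewrite f0// oppr0.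
Qed.

End dual_spaces.

Lemma Iper_add f g : Iper f -> Iper g -> Iper (f + g).
Proof.
move=> If Ig; split.
  apply: continuous_dualD; [exact: seminorm_ge0|by move=> k l phi kl; exact: le_seminorm| |].
    by case: If.
  by case: Ig.
have [A fA] := Iper_summable If; have [B gB] := Iper_summable Ig.
apply: (@le_lt_trans _ _ (A + B)%:E); last exact: ltry.
by apply/norm_Iper_le; exact: (var_leD fA gB).
Qed.

Lemma Iper_sub f g : Iper f -> Iper g -> Iper (f - g).
Proof.
move=> If Ig; apply: Iper_add => //; split; first by apply: continuous_dualN; case: Ig.
have [B gB] := Iper_summable Ig.
apply: (@le_lt_trans _ _ B%:E); last exact: ltry.
by apply/norm_Iper_le; exact: (var_leN gB).
Qed.

Lemma periodic_smooth_cube_bounded phi : periodic_smooth phi ->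
  exists2 C, 0 <= C & forall x : V, (forall i, 0 <= x 0 i <= 1) -> modulus (phi x) <= C.
Proof.
move=> [[s1 s2] _].
pose Q := [set x : V | forall i, `[0:R, 1]%classic (x ord0 i)].
have cQ : compact Q by apply: (rV_compact (A := fun=> `[0:R, 1]%classic)) => i; exact: segment_compact.
have b (h : V -> R) : smooth h -> exists2 C, 0 <= C & forall x, Q x -> `|h x| <= C.
  move=> /smooth_continuous ch.
  have : compact (h @` Q).
    by apply: continuous_compact => //; apply: continuous_subspaceT.
  move=> /compact_bounded[M [_ hM]]; exists (`|M| + 1); first by rewrite addr_ge0.
  move=> x Qx; apply: (hM (`|M| + 1)); last by exists x.
  by rewrite (le_lt_trans (ler_norm _))// ltrDl.
have [C C0 hC] := b _ s1; have [D D0 hD] := b _ s2.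
exists (C + D); first exact: addr_ge0.
move=> x xQ; have Qx : Q x by move=> i; rewrite /= in_itv/=; exact: xQ.
apply: le_trans (modulus_le_ReIm _) _; exact: lerD (hC x Qx) (hD x Qx).
Qed.

Lemma csmooth_character (v : V) th : csmooth (fun x => expi (dot x v + th)).
Proof.
split.
  rewrite (_ : _ \o _ = fun x => 1 * cos (dot x v + th)); first exact: smooth_cos.
  by apply/funext => x /=; rewrite mul1r.
rewrite (_ : _ \o _ = fun x => (-1) * cos (dot x v + (th + pi / 2))); first exact: smooth_cos.
by apply/funext => x /=; rewrite addrA cosDpihalf mulN1r opprK.
Qed.

Lemma periodic_smooth_character (m : Z) :
  periodic_smooth (fun x : V => expi (- (2 * pi * dot x (intv R m)))).
Proof.
split.
  rewrite (_ : (fun _ => _) = fun x => expi (dot x (- (2 * pi) *: intv R m) + 0)).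
    exact: csmooth_character.
  by apply/funext => x; rewrite addr0 [in RHS]dotC dotZl mulNr dotC.
move=> i x; rewrite dotDl dot_delta mulrDr opprD expiD.
have -> : - (2 * pi * intv R m 0 i) = 2 * pi * (- m 0 i)%:~R.
  by rewrite /intv mxE mulrNz mulrN.
by rewrite expi_2pi_int mulr1.
Qed.

Lemma character_cube (m : Z) phi C :
  (forall x : V, (forall i, 0 <= x 0 i <= 1) -> modulus (phi x) <= C) ->
  forall x : V, (forall i, 0 <= x 0 i <= 1) -> modulus (phi x * character m x) <= C.
Proof. by move=> pC x /pC; rewrite modulusM modulus_expi mulr1. Qed.

Lemma periodic_smooth_linear (c : R[i]) phi psi : periodic_smooth phi -> periodic_smooth psi ->
  periodic_smooth (fun x => c * phi x + psi x).
Proof.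
move=> [sp pp] [sq pq]; split; first exact: (cpartials_linear c [::] sp sq).2.
by move=> i x; rewrite pp pq.
Qed.

(** The distribution with Fourier series sum_m a_m e^(2 pi i m.x), tested against phi
    through the mean of phi times each character. *)
Definition of_coefficients a : distr R n := fun phi =>
  if pselect (periodic_smooth phi) is left _ then
    csum (fun m => a m * torus_mean (fun x => phi x * character m x))
  else 0.

Lemma of_coefficients_terms a C phi M : var_le Pi a C -> 0 <= M ->
  (forall x : V, (forall i, 0 <= x 0 i <= 1) -> modulus (phi x) <= M) ->
  var_le Pi (fun m => a m * torus_mean (fun x => phi x * character m x)) (2 * M * C).
Proof.
move=> aC M0 pM; have h m : modulus (torus_mean (fun x => phi x * character m x)) <= 2 * M.
  by apply: torus_mean_le; exact: character_cube.
have := var_le_mulr_bounded aC h (mulr_ge0 (ler0n R 2) M0).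
by under eq_fun do rewrite mulrC.
Qed.

Lemma of_coefficientsE a (m : Z) :
  fcoef (of_coefficients a) m = a m.
Proof.
rewrite /fcoef /of_coefficients; case: pselect => [_|]; last first.
  by move=> h; exfalso; exact: h (periodic_smooth_character m).
have E k : torus_mean (fun x : V => expi (- (2 * pi * dot x (intv R m))) * character k x) =
    (k == m)%:R.
  rewrite (_ : (fun _ => _) = character (k - m)).
    by rewrite torus_mean_character subr_eq0.
  apply/funext => x; rewrite /character -expiD; congr expi.
  have -> : dot x (intv R (k - m)) = dot x (intv R k) - dot x (intv R m).
    by rewrite /dot -sumrB; apply: eq_bigr => i _; rewrite !mxE rmorphB /= mulrBr.
  ring.
under [X in csum X]eq_fun do rewrite E.
have aC : var_le Pi (fun k => a k * (k == m)%:R) (modulus (a m)).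
  move=> l ul; have [ml|ml] := boolP (m \in l).
    rewrite (bigD1_seq m)//= eqxx mulr1 big1 ?addr0// => k /negPf ->.
    by rewrite mulr0 modulus0.
  rewrite big_seq big1 ?modulus_ge0// => k kl.
  case: eqP kl ml => [-> ->//|_ _ _]; by rewrite mulr0 modulus0.
apply: (has_csum_eq (csum_has_csum aC)) => e e0; exists [:: m] => l ul sl.
have ml : m \in l by apply: sl; rewrite inE.
rewrite (bigD1_seq m)//= eqxx mulr1 big1 ?addr0 ?subrr ?modulus0 ?ltW// => k /negPf ->.
by rewrite mulr0.
Qed.

(** The mean of phi times a character is bounded by the supremum of phi, so that the
    functional is continuous already for the seminorm of order 0. *)
Lemma of_coefficients_Iper a : summable_coefficients a -> Iper (of_coefficients a).
Proof.
move=> [C aC]; split; last first.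
  apply: (@le_lt_trans _ _ C%:E); last exact: ltry.
  apply/norm_Iper_le; rewrite (_ : fcoef _ = a)//.
  by apply/funext => m; exact: of_coefficientsE.
have C0 := var_le_pos aC.
split.
- move=> c phi psi sp sq.
  have [M M0 pM] := periodic_smooth_cube_bounded sp.
  have [M' M'0 qM] := periodic_smooth_cube_bounded sq.
  rewrite /of_coefficients; case: pselect => [_|h]; last first.
    by exfalso; exact: h (periodic_smooth_linear c sp sq).
  case: pselect => // _; case: pselect => // _.
  have hp := csum_has_csum (of_coefficients_terms aC M0 pM).
  have hq := csum_has_csum (of_coefficients_terms aC M'0 qM).
  have [|M'' M''0 rM] := @periodic_smooth_cube_bounded (fun x => c * phi x + psi x).
    exact: periodic_smooth_linear.
  have hr := csum_has_csum (of_coefficients_terms aC M''0 rM).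
  apply: (has_csum_eq hr); have := has_csumD (has_csumZ c hp) hq; congr has_csum.
  apply/funext => m /=.
  rewrite (_ : torus_mean (fun x => (c * phi x + psi x) * character m x) =
    c * torus_mean (fun x => phi x * character m x) + torus_mean (fun x => psi x * character m x)).
    by ring.
  rewrite -(torus_mean_linear c (character_cube m pM) (character_cube m qM)).
  by congr torus_mean; apply/funext => x; rewrite mulrDl mulrA.
- exists 0%N, (2 * C + 1) => phi sp.
  have c0 : 0 < 2 * C + 1 by rewrite ltr_wpDl// mulr_ge0.
  case E : (seminorm 0 0 phi) => [M| |]; last first.
  + by have := seminorm_ge0 0 0 phi; rewrite E.
  + by rewrite gt0_muley ?lte_fin// leey.
  have M0 : 0 <= M by rewrite -lee_fin -E seminorm_ge0.
  have pM (x : V) : modulus (phi x) <= M.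
    rewrite -lee_fin -E; apply: ereal_sup_ubound; exists ([::], x) => //=.
    by rewrite expr0 mul1r; case: (phi x).
  rewrite /of_coefficients; case: pselect => // _; rewrite -EFinM lee_fin.
  have t := of_coefficients_terms aC M0 (fun x _ => pM x).
  apply: le_trans (has_csum_le t (csum_has_csum t)) _.
  by rewrite -mulrA (mulrC M) mulrA ler_wpM2r// lerDl.
- by move=> phi h; rewrite /of_coefficients; case: pselect.
Qed.

Lemma periodic_wellposedness (rho : nat) (lam : R) (u0 mu : distr R n) :
  (1 <= rho)%N -> lam = 1 \/ lam = -1 -> Iper u0 -> Iper mu ->
  exists T : R, [/\ 0 < T,
    unique_bounded_solution (@Iper R n) (@norm_Iper R n) (@S_per R n)
      (@B_per R n rho lam) (@L_per R n mu) T u0 &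
    data_solution_map_lipschitz_near (@Iper R n) (@norm_Iper R n) (@S_per R n)
      (@B_per R n rho lam) (@L_per R n mu) T u0].
Proof.
move=> rho1 lam1 Iu0 Imu; have [M muM] := Iper_summable Imu.
apply: (@local_wellposedness R n Z periodic_algebra _ _ (@fcoef R n) _ _ _ _ _ _ _ _ _ _
  (powc periodic_algebra rho) (mulc periodic_algebra (fcoef mu)) (- 'i * lam%:C) 'i) => //.
- exact: Iper_add.
- exact: Iper_sub.
- exact: Iper_summable.
- by move=> f C _; exact: norm_Iper_le.
- move=> a Ka; exists (of_coefficients a); split; first exact: of_coefficients_Iper.
  by apply/funext => m; exact: of_coefficientsE.
- by move=> r r0; exists (rho%:R * r ^+ rho.-1); exact: powc_lipschitz.
- by move=> r r0; exists M; apply: mulc_lipschitz => //; exact: Iper_summable.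
- rewrite modulusM modulusN modulus_i mul1r modulus_real.
  by case: lam1 => ->; rewrite ?normrN normr1.
- exact: modulus_i.
Qed.

End periodic_case.

(** * Integration against complex measures *)

Section quantization.
Context (R : realType) d (T : measurableType d).

Lemma measurable_truncn_preimage (g : T -> R) (k : nat) : measurable_fun setT g ->
  measurable [set x | Num.truncn (g x) = k].
Proof.
move=> mg.
have mt : @measurable_fun _ _ (measurableTypeR R) R setT (fun x : R => (Num.truncn x)%:R : R).
  apply: (@nondecreasing_measurable R) => // x y xy.
  by rewrite ler_nat le_truncn.
have : measurable_fun setT (fun x => (Num.truncn (g x))%:R : R) by exact: (measurableT_comp mt mg).
move=> /(_ measurableT [set k%:R]); rewrite setTI.
rewrite (_ : _ @^-1` _ = [set x | Num.truncn (g x) = k]); first by apply; exact: measurable_set1.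
by apply/seteqP; split=> x /=; [move=> /eqP; rewrite eqr_nat => /eqP|move=> ->].
Qed.

(** A finite family of bounded measurable functions is uniformly close to a family of
    simple functions over a common finite partition, and the values on each piece
    can be those of the family at one point: this preserves any bound on the sum of
    the moduli. *)
Lemma quantize N (g : 'I_N -> T -> R[i]) (B e : R) : 0 < e ->
  (forall i, cmeasurable setT (g i)) -> (forall i x, modulus (g i x) <= B) ->
  exists (J : finType) (G : J -> set T) (c : J -> 'I_N -> R[i]),
  [/\ forall j, measurable (G j), trivIset setT G, \bigcup_j G j = setT,
      forall j x, G j x -> forall i, modulus (g i x - c j i) <= e &
      forall j, (forall i, c j i = 0) \/ exists y, forall i, c j i = g i y].
Proof.
move=> e0 mg gB.
(* Half of e for the real and half for the imaginary part. *)
pose d1 := e / 2; have d10 : 0 < d1 by rewrite divr_gt0.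
pose q (u : R) := Num.truncn ((u + B) / d1).
pose M := q B.
have qle u : `|u| <= B -> (q u < M.+1)%N.
  move=> /(le_trans (ler_norm u)) uB; rewrite ltnS le_truncn//; apply: ler_wpM2r.
    by rewrite invr_ge0 ltW.
  by rewrite lerD2r.
have qeq u v : `|u| <= B -> `|v| <= B -> q u = q v -> `|u - v| <= d1.
  have h w : `|w| <= B -> (q w)%:R * d1 <= w + B /\ w + B < ((q w)%:R + 1) * d1.
    rewrite ler_norml => /andP[w1 _].
    have w0 : 0 <= (w + B) / d1 by apply: divr_ge0; [lra|exact: ltW].
    have /andP[h1 h2] := truncn_itv w0.
    by rewrite -ler_pdivlMr// -ltr_pdivrMr//; split => //; rewrite natr1.
  move=> /h[u1 u2] /h[v1 v2] uv; rewrite uv in u1 u2; rewrite ler_norml.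
  by apply/andP; split; lra.
have rb i x : `|complex.Re (g i x)| <= B by apply: le_trans (gB i x); exact: normr_Re_le.
have ib i x : `|complex.Im (g i x)| <= B by apply: le_trans (gB i x); exact: normr_Im_le.
pose J := {ffun 'I_N -> 'I_M.+1 * 'I_M.+1}%type.
(* Two points lie in the same piece when all the quantized real and imaginary parts
   agree. *)
pose code x : J := [ffun i => (Ordinal (qle _ (rb i x)), Ordinal (qle _ (ib i x)))].
pose G (j : J) := [set x | code x = j].
pose c (j : J) i : R[i] := if pselect (exists y, G j y) is left h then g i (projT1 (cid h)) else 0.
exists J, G, c; split.
- move=> j; rewrite (_ : G j = \bigcap_(i in [set: 'I_N])
    ([set x | q (complex.Re (g i x)) = (j i).1] `&` [set x | q (complex.Im (g i x)) = (j i).2])).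
    apply: fin_bigcap_measurable => // i _; have [m1 m2] := mg i.
    by apply: measurableI; apply: measurable_truncn_preimage; apply: measurable_funM => //;
      apply: measurable_funD.
  apply/seteqP; split=> [x <- i _|x h]; first by rewrite /= ffunE.
  by apply/ffunP => i; have [h1 h2] := h i I; rewrite ffunE [RHS]surjective_pairing;
    congr pair; apply: val_inj.
- by apply/trivIsetP => i j _ _ ij; apply/seteqP; split => // x [/= xi xj];
    move: ij; rewrite -xi -xj eqxx.
- by apply/seteqP; split => // x _; exists (code x).
- move=> j x Gx i; rewrite /c; case: pselect => [h|]; last by case; exists x.
  case: cid => y /= Gy.
  have /ffunP/(_ i) : code x = code y by rewrite Gx Gy.
  rewrite !ffunE => -[h1 h2]; apply: le_trans (modulus_le_ReIm _) _.
  rewrite ReD ImD ReN ImN (splitr e); apply: lerD; exact: qeq.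
- move=> j; rewrite /c; case: pselect => [h|_]; last by left.
  by right; exists (projT1 (cid h)).
Qed.

Lemma cintegral_simple (p : {finite_measure set T -> \bar R}) (J : finType)
    (G : J -> set T) (c : J -> R[i]) :
  (forall j, measurable (G j)) ->
  cintegrable p setT (fun x => \sum_j c j * (\1_(G j) x)%:C) /\
  cintegral p setT (fun x => \sum_j c j * (\1_(G j) x)%:C) =
  \sum_j c j * (fine (p (G j)))%:C.
Proof.
move=> mG.
have i1 j : cintegrable p setT (fun x => (\1_(G j) x)%:C).
  apply: (@cintegrable_bounded _ _ _ _ _ _ 1) => //.
  - by rewrite -ge0_fin_numE// fin_num_measure.
  - by apply: cmeasurable_real; exact: measurable_indic.
  - move=> x _; rewrite modulus_real indicE; case: (x \in G j); rewrite ?normr0 ?normr1//.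
have ic j : cintegrable p setT (fun x => c j * (\1_(G j) x)%:C) by exact: cintegrableZ.
have [h1 h2] := cintegral_sum (index_enum J) measurableT ic.
split => //; rewrite h2; apply: eq_bigr => j _; rewrite cintegralZ//; congr (_ * _).
rewrite /cintegral; apply: complex_eqP => /=.
  by rewrite /Rintegral integral_indic// setIT.
by rewrite /Rintegral integral0_eq.
Qed.

(** On each piece f is within e of a constant. *)
Lemma cintegral_approx (p : {finite_measure set T -> \bar R}) (J : finType)
    (G : J -> set T) (c : J -> R[i]) (f : T -> R[i]) (B e : R) :
  0 <= e -> cmeasurable setT f -> (forall x, modulus (f x) <= B) ->
  (forall j, measurable (G j)) -> trivIset setT G -> \bigcup_j G j = setT ->
  (forall j x, G j x -> modulus (f x - c j) <= e) ->
  modulus (cintegral p setT f - \sum_j c j * (fine (p (G j)))%:C) <= e * fine (p setT).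
Proof.
move=> e0 mf fB mG tG cG fc.
have [si sE] := cintegral_simple p c mG.
have pT : (p setT < +oo)%E by rewrite -ge0_fin_numE// fin_num_measure.
have fi : cintegrable p setT f by apply: (cintegrable_bounded (C := B)).
have ie : p.-integrable setT (EFin \o (fun=> e)).
  apply: measurable_bounded_integrable => //; exists `|e|; split; first exact: num_real.
  by move=> M eM x _; rewrite (le_trans _ (ltW eM)).
rewrite -sE -cintegralB//.
apply: le_trans (modulus_cintegral measurableT (cintegrableB measurableT fi si) ie _) _; last first.
  by rewrite Rintegral_cst.
move=> x _; have [j _ Gx] : (\bigcup_j G j) x by rewrite cG.
rewrite (bigD1 j)//= indicE mem_set// mulr1 big1 ?addr0; first exact: fc.
move=> k kj; rewrite indicE memNset ?mulr0// => Gk.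
have /trivIsetP/(_ j k I I) := tG; rewrite eq_sym => /(_ kj) => h.
by have : (G j `&` G k) x by []; rewrite h.
Qed.

End quantization.

Section complex_measure_parts.
Context (R : realType) (n : nat).
Local Notation V := 'rV[R]_n.
Implicit Types (nu eta : cmeasure R n) (f g : V -> R[i]) (D A : set V).

(** A complex measure as a combination, with coefficients 1, -1, i and -i, of four
    finite positive measures. *)
Definition parts nu : seq (R[i] * {finite_measure set V -> \bar R}) :=
  [:: (1, jordanp (cmRe nu)); (-1, jordann (cmRe nu));
      ('i, jordanp (cmIm nu)); (- 'i, jordann (cmIm nu))].

Lemma jordanB (nu : {charge set V -> \bar R}) A : measurable A ->
  fine (nu A) = fine (jordanp nu A) - fine (jordann nu A).
Proof.
move=> mA; rewrite /jordanp /jordann.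
have /(congr1 fine) -> := jordan_decomp (projT2 (cid (projT2 (cid (Hahn_decomposition nu))))) mA.
have fn : (jordan_neg (projT2 (cid (projT2 (cid (Hahn_decomposition nu))))) A) \is a fin_num.
  exact: fin_num_measure.
move: fn; rewrite /cadd /= /cadd /cscale /= => fn; rewrite EFinN mulN1e fineD ?fineN//.
- exact: fin_num_measure.
- by rewrite fin_numN.
Qed.

Lemma sum_parts nu (F : R[i] -> {finite_measure set V -> \bar R} -> R[i]) :
  \sum_(cp <- parts nu) F cp.1 cp.2 =
  F 1 (jordanp (cmRe nu)) + (F (-1) (jordann (cmRe nu)) +
    (F 'i (jordanp (cmIm nu)) + F (- 'i) (jordann (cmIm nu)))).
Proof. by rewrite /parts !big_cons big_nil /= addr0. Qed.

Lemma cmintegral_parts nu D f :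
  cmintegral nu D f = \sum_(cp <- parts nu) cp.1 * cintegral cp.2 D f.
Proof.
rewrite (sum_parts nu (fun c p => c * cintegral p D f)) /cmintegral /integral_charge.
apply: complex_eqP; rewrite ?ReD ?ImD ?ReM ?ImM ?ReN ?ImN /cintegral /=; ring.
Qed.

Lemma cmval_parts nu A : measurable A ->
  cmval nu A = \sum_(cp <- parts nu) cp.1 * (fine (cp.2 A))%:C.
Proof.
move=> mA; rewrite (sum_parts nu (fun c p => c * (fine (p A))%:C)) /cmval.
apply: complex_eqP; rewrite ?ReD ?ImD ?ReM ?ImM ?ReN ?ImN /= jordanB//; ring.
Qed.

Definition total_mass nu : R := \sum_(cp <- parts nu) fine (cp.2 setT).

Lemma total_mass_ge0 nu : 0 <= total_mass nu.
Proof. by apply: sumr_ge0 => cp _; exact: fine_ge0. Qed.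

Lemma sum_parts_le nu (F : R[i] * {finite_measure set V -> \bar R} -> R[i])
    (G : R[i] * {finite_measure set V -> \bar R} -> R) :
  (forall cp, modulus (F cp) <= G cp) ->
  modulus (\sum_(cp <- parts nu) cp.1 * F cp) <= \sum_(cp <- parts nu) G cp.
Proof.
move=> FG; apply: le_trans (modulus_sum _ _) _.
rewrite /parts !big_cons !big_nil /= !modulusM !modulusN modulus1 modulus_i !mul1r.
by rewrite !lerD.
Qed.

Lemma cmintegral_approx nu (J : finType) (G : J -> set V) (c : J -> R[i]) f (B e : R) :
  0 <= e -> cmeasurable setT f -> (forall x, modulus (f x) <= B) ->
  (forall j, measurable (G j)) -> trivIset setT G -> \bigcup_j G j = setT ->
  (forall j x, G j x -> modulus (f x - c j) <= e) ->
  modulus (cmintegral nu setT f - \sum_j c j * cmval nu (G j)) <= e * total_mass nu.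
Proof.
move=> e0 mf fB mG tG cG fc.
have -> : cmintegral nu setT f - \sum_j c j * cmval nu (G j) =
    \sum_(cp <- parts nu) cp.1 * (cintegral cp.2 setT f - \sum_j c j * (fine (cp.2 (G j)))%:C).
  under [X in _ - X]eq_bigr do rewrite cmval_parts// mulr_sumr.
  rewrite cmintegral_parts exchange_big/= -sumrB; apply: eq_bigr => cp _.
  rewrite mulrBr; congr (_ - _); rewrite mulr_sumr; apply: eq_bigr => j _.
  by rewrite mulrCA.
rewrite /total_mass mulr_sumr; apply: sum_parts_le => cp.
exact: cintegral_approx fc.
Qed.

(** Measures are families indexed by this type: values on sets that are not measurable
    must not matter when two measures are compared. *)
Definition borel := {A : set V | measurable A}.

Definition cmv nu (A : borel) : R[i] := cmval nu (sval A).

(** Disjointness is required between positions and not between members, so that a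
    repeated set has to be empty. *)
Definition disjoint_lists : set (seq borel) := [set l |
  forall j k, (j < size l)%N -> (k < size l)%N -> j != k ->
    nth set0 (map sval l) j `&` nth set0 (map sval l) k = set0].

Lemma disjoint_lists_ord (J : finType) (G : J -> set V) (mG : forall j, measurable (G j)) :
  trivIset setT G -> disjoint_lists [seq (exist _ (G j) (mG j) : borel) | j <- enum J].
Proof.
move=> /trivIsetP tG j k; rewrite size_map => js ks jk.
have [j0 _] : exists j0 : J, True by move: js; case: (enum J) => // j0; exists j0.
have E i : (i < size (enum J))%N -> nth set0 (map sval
    [seq (exist _ (G j) (mG j) : borel) | j <- enum J]) i = G (nth j0 (enum J) i).
  by move=> si; rewrite -map_comp (nth_map j0).
rewrite !E//; apply: tG => //.
by apply: contra jk => /eqP h; have := enum_uniq J => u; rewrite -(nth_uniq j0 js ks u) h.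
Qed.

(** The sum over the pieces of the partition is the place where the variation norm
    enters; quantizing all functions at once keeps the pointwise bound M. *)
Lemma sum_cmintegral_le nu N (g : 'I_N -> V -> R[i]) (M C : R) :
  var_le disjoint_lists (cmv nu) C -> (forall i, cmeasurable setT (g i)) ->
  (forall x, \sum_i modulus (g i x) <= M) -> 0 <= M ->
  \sum_i modulus (cmintegral nu setT (g i)) <= M * C.
Proof.
move=> nuC mg gM M0; apply/ler_addgt0Pr => e e0.
have gB i x : modulus (g i x) <= M.
  apply: le_trans (gM x); rewrite (bigD1 i)//= lerDl.
  by apply: sumr_ge0 => k _; exact: modulus_ge0.
pose m := N%:R * total_mass nu.
have m0 : 0 <= m by rewrite mulr_ge0// total_mass_ge0.
have e10 : 0 < e / (m + 1) by rewrite divr_gt0// ltr_wpDl.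
have [J [G [c [mG tG cG gc cval]]]] := quantize e10 mg gB.
apply: (@le_trans _ _ (\sum_(i < N) (\sum_j modulus (c j i) * modulus (cmval nu (G j)) +
    e / (m + 1) * total_mass nu))).
  apply: ler_sum => i _.
  rewrite (_ : cmintegral nu setT (g i) = \sum_j c j i * cmval nu (G j) +
    (cmintegral nu setT (g i) - \sum_j c j i * cmval nu (G j))); last by rewrite addrC subrK.
  apply: le_trans (modulusD _ _) _; apply: lerD.
    by apply: le_trans (modulus_sum _ _) _; apply: ler_sum => j _; rewrite modulusM.
  by apply: (cmintegral_approx nu (ltW e10) (mg i) (gB i) mG tG cG) => j x Gx; exact: gc.
rewrite big_split/= lerD//; last first.
  rewrite sumr_const card_ord -[leLHS]mulr_natl mulrCA -/m mulrAC.
  by rewrite ler_pdivrMr ?ltr_wpDl// ler_pM2l// lerDl.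
rewrite exchange_big/=.
apply: (@le_trans _ _ (\sum_j M * modulus (cmval nu (G j)))).
  apply: ler_sum => j _; rewrite -mulr_suml ler_wpM2r ?modulus_ge0//.
  have [c0|[y cy]] := cval j; last by under eq_bigr do rewrite cy.
  by rewrite big1// => i _; rewrite c0 modulus0.
rewrite -mulr_sumr ler_wpM2l//.
have := nuC _ (@disjoint_lists_ord J G mG tG).
by rewrite big_map /= big_enum.
Qed.

(** Two complex measures are compared through their values on a common partition. *)
Lemma cmintegral_combination (nu eta : cmeasure R n) (th : cmeasure R n) (z : R[i]) f (B : R) :
  (forall A, measurable A -> cmval th A = cmval nu A + z * cmval eta A) ->
  cmeasurable setT f -> (forall x, modulus (f x) <= B) ->
  cmintegral th setT f = cmintegral nu setT f + z * cmintegral eta setT f.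
Proof.
move=> tE mf fB; apply/subr0_eq/modulus_eq0/eqP; rewrite eq_le modulus_ge0 andbT.
apply/ler_addgt0Pr => e e0; rewrite add0r.
pose m := total_mass th + (total_mass nu + modulus z * total_mass eta).
have m0 : 0 <= m by rewrite !addr_ge0 ?mulr_ge0 ?total_mass_ge0 ?modulus_ge0.
have e10 : 0 < e / (m + 1) by rewrite divr_gt0// ltr_wpDl.
have [J [G [c [mG tG cG gc _]]]] := quantize (N := 1) e10 (fun=> mf) (fun=> fB).
have ap w := @cmintegral_approx w J G (fun j => c j ord0) f B _ (ltW e10) mf fB mG tG cG
  (fun j x Gx => gc j x Gx ord0).
set I1 := cmintegral th _ _; set I2 := cmintegral nu _ _; set I3 := cmintegral eta _ _.
have -> : I1 - (I2 + z * I3) = (I1 - \sum_j c j ord0 * cmval th (G j)) -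
   ((I2 - \sum_j c j ord0 * cmval nu (G j)) + z * (I3 - \sum_j c j ord0 * cmval eta (G j))).
  have -> : \sum_j c j ord0 * cmval th (G j) = \sum_j c j ord0 * cmval nu (G j) +
      z * \sum_j c j ord0 * cmval eta (G j).
    rewrite mulr_sumr -big_split/=; apply: eq_bigr => j _; rewrite tE//; ring.
  ring.
apply: le_trans (modulusB _ _) _.
apply: (@le_trans _ _ (e / (m + 1) * m)); last first.
  by rewrite mulrAC ler_pdivrMr ?ltr_wpDl// ler_pM2l// lerDl.
rewrite (_ : e / (m + 1) * m = e / (m + 1) * total_mass th + (e / (m + 1) * total_mass nu +
  e / (m + 1) * (modulus z * total_mass eta))); last by rewrite -!mulrDr.
apply: lerD; first exact: ap.
apply: le_trans (modulusD _ _) _; apply: lerD; first exact: ap.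
by rewrite modulusM mulrCA; apply: ler_wpM2l; [exact: modulus_ge0|exact: ap].
Qed.

Lemma cmintegral_setT nu D f : measurable D ->
  cmintegral nu D f = cmintegral nu setT (fun x => (\1_D x)%:C * f x).
Proof.
move=> mD; rewrite !cmintegral_parts; apply: eq_bigr => cp _; congr (_ * _).
rewrite /cintegral; apply: complex_eqP => /=; rewrite Rintegral_mkcond;
  apply: eq_Rintegral => x _; rewrite patchE indicE; case: (x \in D);
  by rewrite ?ReM ?ImM /= ?mul1r ?mul0r ?subr0 ?addr0 ?add0r.
Qed.

Lemma cmintegralD nu f g (B C : R) : cmeasurable setT f -> (forall x, modulus (f x) <= B) ->
  cmeasurable setT g -> (forall x, modulus (g x) <= C) -> forall z,
  cmintegral nu setT (fun x => f x + z * g x) = cmintegral nu setT f + z * cmintegral nu setT g.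
Proof.
move=> mf fB mg gC z; rewrite !cmintegral_parts mulr_sumr -big_split/=.
apply: eq_bigr => cp _.
have pT : (cp.2 setT < +oo)%E by rewrite -ge0_fin_numE// fin_num_measure.
have fi : cintegrable cp.2 setT f by exact: (cintegrable_bounded (C := B)).
have gi : cintegrable cp.2 setT g by exact: (cintegrable_bounded (C := C)).
rewrite cintegralD//; last exact: cintegrableZ.
rewrite cintegralZ//; ring.
Qed.

End complex_measure_parts.

(** * Set functions that are complex measures *)

Section charges_from_set_functions.
Context (R : realType) (n : nat).
Local Notation V := 'rV[R]_n.

Section charge_of.
Variable m : set V -> R.
Hypothesis mU : forall A B, measurable A -> measurable B -> A `&` B = set0 ->
  m (A `|` B) = m A + m B.
Hypothesis mC : forall F : (set V)^nat, (forall k, measurable (F k)) -> trivIset setT F ->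
  m (\big[setU/set0]_(0 <= k < j) F k) @[j --> \oo] --> m (\bigcup_k F k).

Let m0 : m set0 = 0.
Proof.
have := @mU set0 set0 measurable0 measurable0 (set0I _).
by rewrite setU0 => /eqP; rewrite -subr_eq0 opprD addrA subrr add0r oppr_eq0 => /eqP.
Qed.

Let mbig (F : (set V)^nat) j : (forall k, measurable (F k)) -> trivIset setT F ->
  m (\big[setU/set0]_(0 <= k < j) F k) = \sum_(0 <= k < j) m (F k).
Proof.
move=> mF tF; elim: j => [|j IH]; first by rewrite !big_geq.
rewrite !big_nat_recr//= mU//.
- by rewrite IH.
- exact: bigsetU_measurable.
- rewrite big_mkord -bigcup_mkord; apply/seteqP; split => // x [[k /= kj Fk] Fj].
  have /trivIsetP/(_ k j I I) := tF; rewrite ltn_eqF// => /(_ isT) => h.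
  by have : (F k `&` F j) x by []; rewrite h.
Qed.

Definition charge_of (A : set V) : \bar R := (m A)%:E.

Let c0 : charge_of set0 = 0%E.
Proof. by rewrite /charge_of m0. Qed.

Let cfin A : measurable A -> charge_of A \is a fin_num.
Proof. by []. Qed.

Let csigma : semi_sigma_additive charge_of.
Proof.
move=> F mF tF mUF; have := mC mF tF.
under eq_fun do rewrite mbig//.
move=> h; rewrite /charge_of.
rewrite (_ : (fun k => _) = EFin \o (fun j => \sum_(0 <= k < j) m (F k))); last first.
  by apply/funext => j /=; rewrite sumEFin.
by apply: cvg_EFin; [exact: nearW|exact: h].
Qed.

HB.instance Definition _ := isCharge.Build _ _ _ charge_of c0 cfin csigma.

(** Finite additivity turns continuity along unions into countable additivity. *)
Lemma charge_exists : exists nu : {charge set V -> \bar R},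
  forall A, fine (nu A) = m A.
Proof. by exists charge_of. Qed.

End charge_of.

(** The criterion by which set functions are recognized as complex measures: it asks
    for finite additivity and for continuity along increasing unions only. *)
Lemma cmeasure_exists (m : set V -> R[i]) :
  (forall A B, measurable A -> measurable B -> A `&` B = set0 -> m (A `|` B) = m A + m B) ->
  (forall F : (set V)^nat, (forall k, measurable (F k)) -> trivIset setT F ->
    modulus (m (\big[setU/set0]_(0 <= k < j) F k) - m (\bigcup_k F k)) @[j --> \oo] --> (0:R)) ->
  exists nu : cmeasure R n, forall A, cmval nu A = m A.
Proof.
move=> mU mC.
have H (h : R[i] -> R) : (forall z w, h (z + w) = h z + h w) ->
    (forall z w, h (z - w) = h z - h w) ->
    (forall z, `|h z| <= modulus z) ->
    exists nu : {charge set V -> \bar R}, forall A, fine (nu A) = h (m A).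
  move=> hD hB hle; apply: (@charge_exists (fun A => h (m A))).
    by move=> A B mA mB AB; rewrite mU.
  move=> F mF tF; apply/cvgrPdist_le => e e0.
  have /cvgrPdist_le/(_ _ e0) := mC F mF tF; apply: filterS => j.
  rewrite sub0r normrN ger0_norm ?modulus_ge0// => le_e.
  by rewrite distrC -hB (le_trans (hle _)).
have [|||re reE] := H (@complex.Re R).
- exact: ReD.
- by move=> z w; rewrite ReD ReN.
- exact: normr_Re_le.
have [|||im imE] := H (@complex.Im R).
- exact: ImD.
- by move=> z w; rewrite ImD ImN.
- exact: normr_Im_le.
by exists (CMeasure re im) => A; rewrite /cmval /= reE imE; case: (m A).
Qed.

Implicit Types (nu : cmeasure R n).

Lemma fine_measureU (p : {finite_measure set V -> \bar R}) A B :
  measurable A -> measurable B -> A `&` B = set0 ->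
  fine (p (A `|` B)) = fine (p A) + fine (p B).
Proof. by move=> mA mB AB; rewrite measureU// fineD// fin_num_measure. Qed.

Lemma cmvalU nu A B : measurable A -> measurable B -> A `&` B = set0 ->
  cmval nu (A `|` B) = cmval nu A + cmval nu B.
Proof.
move=> mA mB AB; rewrite !cmval_parts//; last exact: measurableU.
rewrite -big_split/=; apply: eq_bigr => cp _.
by rewrite fine_measureU// rmorphD/= mulrDr.
Qed.

Lemma cmval_le_mass nu A : measurable A ->
  modulus (cmval nu A) <= \sum_(cp <- parts nu) fine (cp.2 A).
Proof.
move=> mA; rewrite cmval_parts//; apply: sum_parts_le => cp.
by rewrite modulus_real ger0_norm// fine_ge0.
Qed.

(** The tails of an increasing union have small mass for each of the four parts. *)
Lemma mass_tail_cvg nu (F : (set V)^nat) : (forall k, measurable (F k)) -> trivIset setT F ->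
  (\sum_(cp <- parts nu) fine (cp.2 (\bigcup_k F k `\` \big[setU/set0]_(0 <= k < j) F k)))
    @[j --> \oo] --> (0:R).
Proof.
move=> mF tF.
have mUF : measurable (\bigcup_k F k) by exact: bigcup_measurable.
have mB j : measurable (\big[setU/set0]_(0 <= k < j) F k) by exact: bigsetU_measurable.
have key (p : {finite_measure set V -> \bar R}) :
    fine (p (\bigcup_k F k `\` \big[setU/set0]_(0 <= k < j) F k)) @[j --> \oo] --> (0:R).
  have E j : fine (p (\bigcup_k F k `\` \big[setU/set0]_(0 <= k < j) F k)) =
      fine (p (\bigcup_k F k)) - \sum_(0 <= k < j) fine (p (F k)).
    have sub : \big[setU/set0]_(0 <= k < j) F k `<=` \bigcup_k F k.
      by rewrite big_mkord -bigcup_mkord; move=> x [k _ Fx]; exists k.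
    rewrite measureD//; last by rewrite -ge0_fin_numE// fin_num_measure.
    rewrite setIidr// fineB ?fin_num_measure//; congr (_ - _).
    rewrite sum_fine; last by move=> k _; exact: fin_num_measure.
    by rewrite !big_mkord measure_bigsetU.
  under eq_fun do rewrite E.
  have -> : nbhs (0 : R) = nbhs (fine (p (\bigcup_k F k)) - fine (p (\bigcup_k F k))) by rewrite subrr.
  apply: cvgB; first exact: cvg_cst.
  have := @measure_semi_sigma_additive _ _ _ p F mF tF mUF.
  move=> h; have : (fun j => \sum_(0 <= i < j) p (F i))%E @ \oo --> (fine (p (\bigcup_k F k)))%:E.
    by rewrite fineK; [exact: h|exact: fin_num_measure].
  move=> /fine_cvg; apply: cvg_trans.
  apply: near_eq_cvg; apply: nearW => j /=.
  by rewrite sum_fine// => k _; rewrite fin_num_measure.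
rewrite /parts.
under eq_fun do rewrite !big_cons big_nil /= addr0.
rewrite -(addr0 0); apply: cvgD; first exact: key.
rewrite -(addr0 0); apply: cvgD; first exact: key.
rewrite -(addr0 0); apply: cvgD; exact: key.
Qed.

Lemma cmval_cvg nu (F : (set V)^nat) : (forall k, measurable (F k)) -> trivIset setT F ->
  modulus (cmval nu (\big[setU/set0]_(0 <= k < j) F k) - cmval nu (\bigcup_k F k))
    @[j --> \oo] --> (0:R).
Proof.
move=> mF tF.
have mUF : measurable (\bigcup_k F k) by exact: bigcup_measurable.
have mB j : measurable (\big[setU/set0]_(0 <= k < j) F k) by exact: bigsetU_measurable.
have tl := mass_tail_cvg nu mF tF.
apply: (@squeeze_cvgr _ _ _ _ (fun=> 0) (fun j : nat => \sum_(cp <- parts nu)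
  fine (cp.2 (\bigcup_k F k `\` \big[setU/set0]_(0 <= k < j) F k)))); [|exact: cvg_cst|exact: tl].
apply: nearW => j; rewrite modulus_ge0 andTb.
have sub : \big[setU/set0]_(0 <= k < j) F k `<=` \bigcup_k F k.
  by rewrite big_mkord -bigcup_mkord; move=> x [k _ Fx]; exists k.
have mD : measurable (\bigcup_k F k `\` \big[setU/set0]_(0 <= k < j) F k) by exact: measurableD.
rewrite modulusBC -{1}(setDUK sub) cmvalU//; last by rewrite setDIK.
by rewrite addrAC subrr add0r cmval_le_mass.
Qed.

(** Finite lists of disjoint sets and countable partitions give the same supremum: a
    list is completed to a partition by the complement of its union and empty sets,
    and the sum over a partition is a limit of sums over finite lists. *)
Lemma total_variation_le (nu : cmeasure R n) (C : R) :
  (Defs.total_variation nu <= C%:E)%E <-> var_le (@disjoint_lists R n) (cmv nu) C.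
Proof.
split=> [tv l dl|nuC].
  pose G k := nth set0 (map sval l) k.
  have mG k : measurable (G k).
    rewrite /G; have [ks|sk] := ltnP k (size l); last by rewrite nth_default ?size_map.
    case: l {dl G} ks => // A0 l ks.
    by rewrite (nth_map A0)//; case: (nth A0 (A0 :: l) k).
  pose F k := if (k < size l)%N then G k else
    if k == size l then ~` \bigcup_(j < size l) G j else set0.
  have mF k : measurable (F k).
    rewrite /F; case: ifP => // _; case: ifP => // _.
    by apply: measurableC; exact: bigcup_measurable.
  have tF : trivIset setT F.
    apply/trivIsetP => i j _ _; wlog ij : i j / (i < j)%N => [wl|].
      by move=> nij; have [ij|ji|ij] := ltngtP i j; [apply: wl|rewrite setIC; apply: wl; rewrite // eq_sym|rewrite ij eqxx in nij].
    move=> nij; rewrite /F; have [il|li] := ltnP i (size l); last first.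
      rewrite ltnNge (leq_trans li (ltnW ij))/=.
      by rewrite [j == _]gtn_eqF ?setI0// (leq_ltn_trans li).
    have [js|sj] := ltnP j (size l); first exact: dl.
    case: ifP => _; last by rewrite setI0.
    apply/seteqP; split => // x [Gx]; apply; by exists i.
  have cF : \bigcup_i F i = setT.
    apply/seteqP; split => // x _.
    have [[j /= js Gx]|nx] := pselect ((\bigcup_(j < size l) G j) x).
      by exists j => //; rewrite /F js.
    by exists (size l) => //; rewrite /F ltnn eqxx.
  rewrite -lee_fin; apply: le_trans tv.
  apply: (@le_trans _ _ (\sum_(0 <= i <oo) (modulus (cmval nu (F i)))%:E)%E); last first.
    by apply: ereal_sup_ubound; exists F.
  apply: le_trans (nneseries_lim_ge (size l) _); last by move=> *; rewrite lee_fin modulus_ge0.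
  rewrite sumEFin lee_fin.
  rewrite (_ : \sum_(i <- l) _ = \sum_(0 <= i < size l) modulus (cmval nu (F i)))//.
  clear -l; case: l @G @F => [|A0 l] G F; first by rewrite big_nil big_geq.
  rewrite (big_nth A0) big_nat [RHS]big_nat; apply: eq_bigr => i /= ils.
  by rewrite /F ils /G (nth_map A0).
apply: ub_ereal_sup => _ [F [mF tF cF] <-].
apply: lime_le; first by apply: is_cvg_nneseries => k _ _; rewrite lee_fin modulus_ge0.
apply: nearW => N; rewrite sumEFin lee_fin.
pose l : seq (borel R n) := [seq exist _ (F k) (mF k) | k <- iota 0 N].
have dl : disjoint_lists l.
  move=> j k; rewrite size_map size_iota => jN kN jk.
  have E i : (i < N)%N -> nth set0 (map sval l) i = F i.
    move=> iN; rewrite /l -map_comp (nth_map 0%N) ?size_iota//.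
    by rewrite nth_iota.
  by rewrite !E//; move/trivIsetP : tF => /(_ j k I I jk).
have := nuC _ dl; rewrite big_map /cmv /=.
by rewrite /index_iota subn0.
Qed.

Lemma sum_disjoint_mass (p : {finite_measure set V -> \bar R}) (l : seq (borel R n)) E :
  measurable E -> disjoint_lists l ->
  \sum_(A <- l) fine (p (sval A `&` E)) <= fine (p E).
Proof.
move=> mE dl; pose G k := nth set0 (map sval l) k `&` E.
have mG k : measurable (G k).
  apply: measurableI => //; have [ks|sk] := ltnP k (size l); last by rewrite nth_default ?size_map.
  case: l {dl G} ks => // A0 l ks.
  by rewrite (nth_map A0)//; case: (nth A0 (A0 :: l) k).
have tG : trivIset setT G.
  apply/trivIsetP => i j _ _ ij; rewrite /G setIACA.
  have [il|li] := ltnP i (size l); last by rewrite [nth _ _ i]nth_default ?size_map// !set0I.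
  have [js|sj] := ltnP j (size l); last by rewrite [nth _ _ j]nth_default ?size_map// setI0 set0I.
  by rewrite dl// set0I.
rewrite (_ : \sum_(A <- l) _ = \sum_(k < size l) fine (p (G k))); last first.
  clear -l; case: l @G => [|A0 l] G; first by rewrite big_nil big_ord0.
  rewrite (big_nth A0) big_mkord; apply: eq_bigr => i _.
  by rewrite /G (nth_map A0).
rewrite sum_fine//; last by move=> k _; rewrite fin_num_measure.
rewrite -measure_bigsetU//.
have mU : measurable (\big[setU/set0]_(k < size l) G k) by exact: bigsetU_measurable.
apply: fine_le; [exact: fin_num_measure|exact: fin_num_measure|].
rewrite le_measure ?inE// -bigcup_mkord => x [k _ []]//.
Qed.

Lemma var_le_total_mass nu : var_le (@disjoint_lists R n) (cmv nu) (total_mass nu).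
Proof.
move=> l dl; apply: (@le_trans _ _ (\sum_(A <- l) \sum_(cp <- parts nu) fine (cp.2 (sval A)))).
  by apply: ler_sum => A _; apply: cmval_le_mass; case: A.
rewrite exchange_big/=; apply: ler_sum => cp _.
have := sum_disjoint_mass cp.2 measurableT dl.
by under [X in X <= _ -> _]eq_bigr do rewrite setIT.
Qed.

End charges_from_set_functions.

(** * Complex measures as families indexed by Borel sets *)

Section cmeasure_algebra.
Context (R : realType) (n : nat).
Local Notation V := 'rV[R]_n.
Implicit Types (nu eta th : cmeasure R n) (f g : V -> R[i]) (A B D : set V).
Local Notation "a <=v C" := (var_le (@disjoint_lists R n) a C) (at level 70).

Lemma cmeasurable_restrict D f : measurable D -> cmeasurable setT f ->
  cmeasurable setT (fun x => (\1_D x)%:C * f x).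
Proof.
move=> mD mf; apply: cmeasurableM => //; apply: cmeasurable_real.
exact: measurable_indic.
Qed.

Lemma modulus_restrict D f x : modulus ((\1_D x)%:C * f x) <= modulus (f x).
Proof.
rewrite modulusM modulus_real indicE.
by case: (x \in D); rewrite ?normr1 ?normr0 ?mul1r// mul0r modulus_ge0.
Qed.

Lemma cmintegral_lin nu eta th z f (C : R) D : measurable D ->
  (forall A, measurable A -> cmval th A = cmval nu A + z * cmval eta A) ->
  cmeasurable setT f -> (forall x, modulus (f x) <= C) ->
  cmintegral th D f = cmintegral nu D f + z * cmintegral eta D f.
Proof.
move=> mD tE mf fC; rewrite !(cmintegral_setT _ _ mD).
apply: (cmintegral_combination (B := C)) => //; first exact: cmeasurable_restrict.
by move=> x; apply: le_trans (modulus_restrict _ _ _) (fC x).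
Qed.

Lemma eq_cmintegral_measure nu eta f (C : R) D : measurable D ->
  (forall A, measurable A -> cmval nu A = cmval eta A) ->
  cmeasurable setT f -> (forall x, modulus (f x) <= C) ->
  cmintegral nu D f = cmintegral eta D f.
Proof.
move=> mD h mf fC; rewrite (@cmintegral_lin eta eta nu 0 f C)//.
  by rewrite mul0r addr0.
by move=> A mA; rewrite h// mul0r addr0.
Qed.

Lemma cmintegral_le nu D f (B : R) : measurable D -> cmeasurable setT f ->
  (forall x, D x -> modulus (f x) <= B) ->
  modulus (cmintegral nu D f) <= B * \sum_(cp <- parts nu) fine (cp.2 D).
Proof.
move=> mD mf fB; rewrite cmintegral_parts mulr_sumr; apply: sum_parts_le => cp.
have pD : (cp.2 D < +oo)%E by rewrite -ge0_fin_numE// fin_num_measure.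
have mfD : cmeasurable D f by apply: sub_cmeasurable mf.
have fi : cintegrable cp.2 D f by exact: (cintegrable_bounded (C := B)).
have ie : cp.2.-integrable D (EFin \o (fun=> B)).
  apply: measurable_bounded_integrable => //; exists `|B|; split; first exact: num_real.
  by move=> M eM x _; rewrite (le_trans _ (ltW eM)).
by rewrite (le_trans (modulus_cintegral mD fi ie fB))// Rintegral_cst.
Qed.

Lemma cmintegralU nu f A B (C : R) : cmeasurable setT f -> (forall x, modulus (f x) <= C) ->
  measurable A -> measurable B -> A `&` B = set0 ->
  cmintegral nu (A `|` B) f = cmintegral nu A f + cmintegral nu B f.
Proof.
move=> mf fC mA mB AB; have mAB := measurableU _ _ mA mB.
rewrite (cmintegral_setT _ _ mAB) (cmintegral_setT _ _ mA) (cmintegral_setT _ _ mB).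
have h D : measurable D -> forall x, modulus ((\1_D x)%:C * f x) <= C.
  by move=> mD x; apply: le_trans (modulus_restrict _ _ _) (fC x).
have := cmintegralD nu (cmeasurable_restrict mA mf) (h _ mA) (cmeasurable_restrict mB mf) (h _ mB) 1.
rewrite mul1r => <-; congr cmintegral; apply/funext => x.
rewrite mul1r -mulrDl; congr (_ * _); rewrite -rmorphD/=; congr (_%:C).
rewrite !indicE in_setU; have [xA|] := boolP (x \in A); last by rewrite add0r.
have [xB|] := boolP (x \in B); last by rewrite addr0.
have : (A `&` B) x by split; exact/set_mem.
by rewrite AB.
Qed.

(** Densities: integrals of a bounded function over varying sets form a measure. *)
Lemma cmintegral_measure nu f (C : R) : cmeasurable setT f -> (forall x, modulus (f x) <= C) ->
  exists th, forall A, measurable A -> cmval th A = cmintegral nu A f.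
Proof.
move=> mf fC.
have [|F mF tF|th thE] := @cmeasure_exists R n (fun A => cmintegral nu A f).
- by move=> A B mA mB AB; exact: cmintegralU.
- have mUF : measurable (\bigcup_k F k) by exact: bigcup_measurable.
  have mB j : measurable (\big[setU/set0]_(0 <= k < j) F k) by exact: bigsetU_measurable.
  have tl : (fun j : nat => C * \sum_(cp <- parts nu)
      fine (cp.2 (\bigcup_k F k `\` \big[setU/set0]_(0 <= k < j) F k))) @ \oo --> (0 : R).
    have -> : nbhs (0 : R) = nbhs (C * 0) by rewrite mulr0.
    by apply: cvgMr; exact: mass_tail_cvg.
  apply: squeeze_cvgr (cvg_cst 0) tl; apply: nearW => j; rewrite modulus_ge0 andTb.
  have sub : \big[setU/set0]_(0 <= k < j) F k `<=` \bigcup_k F k.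
    by rewrite big_mkord -bigcup_mkord => x [k _ Fx]; exists k.
  have mD : measurable (\bigcup_k F k `\` \big[setU/set0]_(0 <= k < j) F k) by exact: measurableD.
  rewrite modulusBC -{1}(setDUK sub) (cmintegralU nu mf fC)//; last by rewrite setDIK.
  by rewrite addrAC subrr add0r; apply: cmintegral_le.
- by exists th => A _; exact: thE.
Qed.

Definition is_cmv : set (borel R n -> R[i]) := [set a | exists nu, cmv nu = a].

(** Some measure with the given values. The operations are carried out on
    representatives; their values depend only on the family. *)
Definition rep (a : borel R n -> R[i]) : cmeasure R n :=
  choose_elt (cmzero R n) [set nu | cmv nu = a].

Lemma repE a : is_cmv a -> cmv (rep a) = a.
Proof.
move=> Ka; rewrite /rep /choose_elt; case: pselect => // h.
by case: cid.
Qed.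

Lemma repP a A (mA : measurable A) : is_cmv a -> cmval (rep a) A = a (exist _ A mA).
Proof. by move=> /repE h; rewrite -[in RHS]h. Qed.

Lemma is_cmvP (m : set V -> R[i]) a :
  (forall A (mA : measurable A), a (exist _ A mA) = m A) ->
  (forall A B, measurable A -> measurable B -> A `&` B = set0 -> m (A `|` B) = m A + m B) ->
  (forall F : (set V)^nat, (forall k, measurable (F k)) -> trivIset setT F ->
    modulus (m (\big[setU/set0]_(0 <= k < j) F k) - m (\bigcup_k F k)) @[j --> \oo] --> (0:R)) ->
  is_cmv a.
Proof.
move=> aE mU mC; have [nu nuE] := cmeasure_exists mU mC.
by exists nu; apply/funext => -[A mA]; rewrite /cmv /= nuE aE.
Qed.

Lemma is_cmvD a b z : is_cmv a -> is_cmv b -> is_cmv (fun i => a i + z * b i).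
Proof.
move=> [nu <-] [eta <-].
apply: (@is_cmvP (fun A => cmval nu A + z * cmval eta A)) => //.
  by move=> A B mA mB AB; rewrite !cmvalU//; ring.
move=> F mF tF; have h1 := cmval_cvg nu mF tF; have h2 := cmval_cvg eta mF tF.
have h : (fun j : nat => modulus (cmval nu (\big[setU/set0]_(0 <= k < j) F k) - cmval nu (\bigcup_k F k)) +
   modulus z * modulus (cmval eta (\big[setU/set0]_(0 <= k < j) F k) - cmval eta (\bigcup_k F k)))
   @ \oo --> (0 : R).
  have -> : nbhs (0 : R) = nbhs (0 + modulus z * 0) by rewrite mulr0 addr0.
  by apply: cvgD => //; apply: cvgMr.
apply: squeeze_cvgr (cvg_cst 0) h; apply: nearW => j; rewrite modulus_ge0 andTb.
rewrite -modulusM; apply: le_trans (modulusD _ _); rewrite le_eqVlt; apply/orP; left; apply/eqP.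
by congr modulus; ring.
Qed.

Lemma is_cmv_flow f (C : R) a : cmeasurable setT f -> (forall x, modulus (f x) <= C) ->
  is_cmv a -> is_cmv (fun i => cmintegral (rep a) (sval i) f).
Proof.
move=> mf fC Ka; have [th thE] := cmintegral_measure (rep a) mf fC.
by exists th; apply/funext => -[A mA]; rewrite /cmv /= thE.
Qed.

(** Additivity and continuity along unions are inherited with an error of three times
    the distance to an approximating measure. *)
Lemma is_cmv_lim (u : nat -> borel R n -> R[i]) a : (forall k, is_cmv (u k)) ->
  (forall e : R, 0 < e -> exists k, (u k \- a) <=v e) -> is_cmv a.
Proof.
move=> Ku ua.
pose m (A : set V) := if pselect (measurable A) is left mA then a (exist _ A mA) else 0.
have mE A (mA : measurable A) : m A = a (exist _ A mA).
  by rewrite /m; case: pselect => // mA'; congr a; apply: eq_exist.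
have near k e A : measurable A -> (u k \- a) <=v e -> exists nu,
    cmv nu = u k /\ modulus (cmval nu A - m A) <= e.
  move=> mA /(_ [:: exist _ A mA]); have [nu nuE] := Ku k; rewrite big_seq1 -nuE => h.
  exists nu; split => //; rewrite mE; apply: h.
  by move=> [|j] [|l].
have appr e : 0 < e -> exists nu, forall A, measurable A -> modulus (cmval nu A - m A) <= e.
  move=> /ua[k uk]; have [nu nuE] := Ku k; exists nu => A mA; rewrite mE.
  have := uk [:: exist _ A mA]; rewrite big_seq1 -nuE; apply.
  by move=> [|j] [|l].
apply: (@is_cmvP m) => [A mA|A B mA mB AB|F mF tF]; first by rewrite mE.
- apply/subr0_eq/modulus_eq0/eqP; rewrite eq_le modulus_ge0 andbT.
  apply/ler_addgt0Pr => e e0; rewrite add0r.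
  have [|nu nuE] := appr (e / 3); first by rewrite divr_gt0.
  rewrite (_ : m (A `|` B) - (m A + m B) = (cmval nu A - m A) + (cmval nu B - m B) -
    (cmval nu (A `|` B) - m (A `|` B))); last by rewrite cmvalU//; ring.
  apply: le_trans (modulusB _ _) _; apply: le_trans (lerD (modulusD _ _) (lexx _)) _.
  have := nuE _ mA; have := nuE _ mB; have := nuE _ (measurableU _ _ mA mB); lra.
- apply/cvgrPdist_le => e e0.
  have [|nu nuE] := appr (e / 3); first by rewrite divr_gt0.
  have /cvgrPdist_le/(_ (e / 3)) := cmval_cvg nu mF tF.
  have -> : 0 < e / 3 by rewrite divr_gt0.
  move=> /(_ isT); apply: filterS => j.
  rewrite !sub0r !normrN !ger0_norm ?modulus_ge0// => h.
  set U := \bigcup_k F k in h *; set Uj := \big[setU/set0]_(0 <= k < j) F k in h *.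
  have mUF : measurable U by exact: bigcup_measurable.
  have mB : measurable Uj by exact: bigsetU_measurable.
  rewrite (_ : m Uj - m U = (cmval nu Uj - cmval nu U) - (cmval nu Uj - m Uj) + (cmval nu U - m U)); last by ring.
  apply: le_trans (modulusD _ _) _; apply: le_trans (lerD (modulusB _ _) (lexx _)) _.
  by have := nuE _ mUF; have := nuE _ mB; lra.
Qed.

(** The setwise time integral of measures is again a measure: additivity passes
    through the integral, and continuity along unions holds at each time, hence after
    integration by dominated convergence. *)
Lemma is_cmv_int t (g : R -> borel R n -> R[i]) (C : R) :
  (forall s, time_segment t s -> is_cmv (g s)) ->
  (forall s, time_segment t s -> g s <=v C) ->
  (forall i, ae_cmeasurable (time_segment t) (fun s => g s i)) ->
  is_cmv (fun i => time_integral t (fun s => g s i)).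
Proof.
move=> Kg gC mg.
pose m (A : set V) := if pselect (measurable A) is left mA
  then time_integral t (fun s => g s (exist _ A mA)) else 0.
have mE A (mA : measurable A) : m A = time_integral t (fun s => g s (exist _ A mA)).
  rewrite /m; case: pselect => // mA'; congr time_integral; apply/funext => s.
  by congr g; apply: eq_exist.
have gB s i : time_segment t s -> modulus (g s i) <= C.
  by move=> ts; have := gC _ ts [:: i]; rewrite big_seq1; apply; move=> [|j] [|l].
apply: (@is_cmvP m) => [A mA|A B mA mB AB|F mF tF]; first by rewrite mE.
- have mAB := measurableU _ _ mA mB.
  rewrite (mE _ mAB) (mE _ mA) (mE _ mB); apply/eqP; rewrite -subr_eq; apply/eqP.
  rewrite -(@time_integralB _ _ _ _ C)//; [|by move=> s /gB|by move=> s /gB].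
  apply: eq_time_integral => s ts; have [nu nuE] := Kg _ ts.
  by rewrite -nuE /cmv/= cmvalU// addrK.
- have mUF : measurable (\bigcup_k F k) by exact: bigcup_measurable.
  have mB j : measurable (\big[setU/set0]_(0 <= k < j) F k) by exact: bigsetU_measurable.
  rewrite (mE _ mUF).
  under eq_fun do rewrite (mE _ (mB _)).
  apply: (@time_integral_cvg _ _ _ _ C) => // [k s ts|s ts]; first exact: gB.
  have [nu nuE] := Kg _ ts; rewrite -nuE /cmv/=; exact: cmval_cvg.
Qed.

End cmeasure_algebra.

(** * Convolution of measures *)

Section convolution.
Context (R : realType) (n : nat).
Local Notation V := 'rV[R]_n.
Implicit Types (nu eta th : cmeasure R n) (A : set V).
Local Notation "a <=v C" := (var_le (@disjoint_lists R n) a C) (at level 70).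

Definition shift_set (x : V) A : set V := [set y | A (x + y)].

Lemma measurable_add_preimage A : measurable A ->
  measurable ((fun z : V * V => z.1 + z.2) @^-1` A).
Proof. by move=> mA; rewrite -[X in measurable X]setTI; exact: measurable_rVD. Qed.

Lemma shift_setE x A : shift_set x A = xsection ((fun z : V * V => z.1 + z.2) @^-1` A) x.
Proof. by apply/seteqP; split=> y; rewrite /xsection/= inE. Qed.

Lemma measurable_shift_set x A : measurable A -> measurable (shift_set x A).
Proof.
by move=> mA; rewrite shift_setE; apply: measurable_xsection; exact: measurable_add_preimage.
Qed.

Lemma measurable_shift_measure (q : {finite_measure set V -> \bar R}) A : measurable A ->
  measurable_fun setT (fun x => fine (q (shift_set x A))).
Proof.
move=> mA; apply/measurable_EFinP.
rewrite (_ : EFin \o _ = q \o xsection ((fun z : V * V => z.1 + z.2) @^-1` A)).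
  by apply: measurable_fun_xsection; exact: measurable_add_preimage.
apply/funext => x /=; rewrite -shift_setE fineK//; apply: fin_num_measure.
exact: measurable_shift_set.
Qed.

Lemma integrable_shift_measure (p q : {finite_measure set V -> \bar R}) A : measurable A ->
  p.-integrable setT (EFin \o (fun x => fine (q (shift_set x A)))).
Proof.
move=> mA; apply: measurable_bounded_integrable => //.
- by rewrite -ge0_fin_numE// fin_num_measure.
- exact: measurable_shift_measure.
- exists (fine (q setT)); split; first exact: num_real.
  move=> M qM x _; apply: le_trans (ltW qM); rewrite ger0_norm ?fine_ge0//.
  apply: fine_le; rewrite ?fin_num_measure//; first exact: measurable_shift_set.
  by apply: le_measure; rewrite ?inE//; exact: measurable_shift_set.
Qed.

Lemma conv_measureE (p q : {finite_measure set V -> \bar R}) A : measurable A ->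
  fine (conv_measure p q A) = \int[p]_x fine (q (shift_set x A)).
Proof.
move=> mA; rewrite /Rintegral; congr fine.
rewrite /conv_measure /pushforward /product_measure1 /=.
apply: eq_integral => x _; rewrite fineK; first by rewrite /= -shift_setE.
by apply: fin_num_measure; exact: measurable_shift_set.
Qed.

Lemma fine_cadd (a b : {charge set V -> \bar R}) A : measurable A ->
  fine (cadd a b A) = fine (a A) + fine (b A).
Proof. by move=> mA; rewrite /cadd /= fineD//; exact: fin_num_measure. Qed.

Lemma fine_copp (a : {charge set V -> \bar R}) A : fine (copp a A) = - fine (a A).
Proof. by rewrite /copp /= fineN. Qed.

Lemma conv_chargeE (a b : {charge set V -> \bar R}) A : measurable A ->
  fine (conv_charge a b A) = integral_charge a setT (fun x => fine (b (shift_set x A))).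
Proof.
move=> mA; rewrite /conv_charge fine_cadd// fine_copp !fine_cadd// !conv_measureE//.
rewrite /integral_charge.
have E (p : {finite_measure set V -> \bar R}) : \int[p]_x fine (b (shift_set x A)) =
    \int[p]_x fine (jordanp b (shift_set x A)) - \int[p]_x fine (jordann b (shift_set x A)).
  rewrite -RintegralB//; try exact: integrable_shift_measure.
  apply: eq_Rintegral => x _; rewrite jordanB//; exact: measurable_shift_set.
rewrite !E; ring.
Qed.

(** Fubini's theorem in the form in which it gives bilinearity of the convolution and
    its bound: the measure of A is an integral of the measures of the translates of A. *)
Lemma cmval_conv nu eta A : measurable A ->
  cmval (cmconv nu eta) A = cmintegral nu setT (fun x => cmval eta (shift_set x A)).
Proof.
move=> mA; congr (_ +i* _).
  have := fine_cadd (conv_charge (cmRe nu) (cmRe eta)) (copp (conv_charge (cmIm nu) (cmIm eta))) mA.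
  by move=> /= ->; rewrite fine_copp (conv_chargeE _ _ mA) (conv_chargeE _ _ mA).
have := fine_cadd (conv_charge (cmRe nu) (cmIm eta)) (conv_charge (cmIm nu) (cmRe eta)) mA.
by move=> /= ->; rewrite (conv_chargeE _ _ mA) (conv_chargeE _ _ mA).
Qed.

Lemma cmeasurable_shift eta A : measurable A ->
  cmeasurable setT (fun x => cmval eta (shift_set x A)).
Proof.
move=> mA.
have mb (b : {charge set V -> \bar R}) : measurable_fun setT (fun x => fine (b (shift_set x A))).
  rewrite (_ : (fun _ => _) = (fun x => fine (jordanp b (shift_set x A)) -
    fine (jordann b (shift_set x A)))); last first.
    by apply/funext => x; apply: jordanB; exact: measurable_shift_set.
  by apply: measurable_funB; exact: measurable_shift_measure.
by split; exact: mb.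
Qed.

Lemma cmval_bound eta A : measurable A -> modulus (cmval eta A) <= total_mass eta.
Proof.
move=> mA; apply: le_trans (cmval_le_mass eta mA) _; apply: ler_sum => cp _.
by apply: fine_le; rewrite ?fin_num_measure//; apply: le_measure; rewrite ?inE.
Qed.

Definition shift_borel x (i : borel R n) : borel R n :=
  exist _ (shift_set x (sval i)) (measurable_shift_set x (svalP i)).

Lemma disjoint_shift x (l : seq (borel R n)) : disjoint_lists l ->
  disjoint_lists [seq shift_borel x i | i <- l].
Proof.
move=> dl j k; rewrite size_map => jl kl jk.
have E i : (i < size l)%N -> nth set0 (map sval [seq shift_borel x i | i <- l]) i =
    shift_set x (nth set0 (map sval l) i).
  case: l {dl jl kl} => // A0 l il.
  by rewrite -map_comp (nth_map A0)// (nth_map A0).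
rewrite !E//; have := dl j k jl kl jk => h.
by apply/seteqP; split => // y [h1 h2]; rewrite -[set0 _]/(set0 (x + y)) -h.
Qed.

(** For each x the translates of disjoint sets are disjoint, so that the variation of
    eta bounds the sum of moduli under the integral with respect to nu. *)
Lemma cmconv_le nu eta (C D : R) : cmv nu <=v C -> cmv eta <=v D ->
  cmv (cmconv nu eta) <=v (C * D).
Proof.
move=> nuC etaD l dl.
have D0 : 0 <= D by have := etaD [::]; rewrite big_nil; apply; case.
case: l dl => [|A0 l] dl.
  rewrite big_nil mulr_ge0//.
  by have := nuC [::]; rewrite big_nil; apply; case.
set l1 := A0 :: l in dl *.
rewrite (big_nth A0) big_mkord mulrC.
have E (i : 'I_(size l1)) := cmval_conv nu eta (svalP (nth A0 l1 i)).
under eq_bigr do rewrite [cmv _ _]E.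
apply: (sum_cmintegral_le nuC) => //.
- by move=> i; apply: cmeasurable_shift; case: (nth _ _ _).
- move=> x; have := etaD _ (@disjoint_shift x l1 dl).
  rewrite big_map; apply: le_trans; rewrite (big_nth A0) big_mkord.
  by apply: ler_sum.
Qed.

Lemma cmv_conv_ext nu nu' eta eta' : cmv nu = cmv nu' -> cmv eta = cmv eta' ->
  cmv (cmconv nu eta) = cmv (cmconv nu' eta').
Proof.
move=> E1 E2; apply/funext => -[A mA]; rewrite /cmv /= !cmval_conv//.
have -> : (fun x => cmval eta (shift_set x A)) = (fun x => cmval eta' (shift_set x A)).
  apply/funext => x.
  exact: (congr1 (fun a => a (exist _ _ (measurable_shift_set x mA) : borel R n)) E2).
apply: (eq_cmintegral_measure (C := total_mass eta')) => //.
- by move=> B mB; exact: (congr1 (fun a => a (exist _ B mB : borel R n)) E1).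
- exact: cmeasurable_shift.
- by move=> x; apply: cmval_bound; exact: measurable_shift_set.
Qed.

Definition mulm (a b : borel R n -> R[i]) := cmv (cmconv (rep a) (rep b)).

Lemma mulmE a b A (mA : measurable A) : mulm a b (exist _ A mA) =
  cmintegral (rep a) setT (fun x => cmval (rep b) (shift_set x A)).
Proof. exact: cmval_conv. Qed.

Lemma mulmBl a b c : is_cmv a -> is_cmv b -> is_cmv c ->
  mulm (a \- b) c = mulm a c \- mulm b c.
Proof.
move=> Ka Kb Kc; apply/funext => -[A mA].
change (mulm (a \- b) c (exist _ A mA) = mulm a c (exist _ A mA) - mulm b c (exist _ A mA)).
rewrite !mulmE.
have Kab : is_cmv (a \- b).
  have := is_cmvD (-1) Ka Kb; congr is_cmv; apply/funext => i /=; by rewrite mulN1r.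
rewrite (@cmintegral_combination _ _ (rep a) (rep b) _ (-1) _ (total_mass (rep c))).
- by rewrite mulN1r.
- by move=> B mB; rewrite !(repP mB)//= mulN1r.
- exact: cmeasurable_shift.
- by move=> x; apply: cmval_bound; exact: measurable_shift_set.
Qed.

Lemma mulmBr a b c : is_cmv a -> is_cmv b -> is_cmv c ->
  mulm a (b \- c) = mulm a b \- mulm a c.
Proof.
move=> Ka Kb Kc; apply/funext => -[A mA].
change (mulm a (b \- c) (exist _ A mA) = mulm a b (exist _ A mA) - mulm a c (exist _ A mA)).
rewrite !mulmE.
have Kbc : is_cmv (b \- c).
  have := is_cmvD (-1) Kb Kc; congr is_cmv; apply/funext => i /=; by rewrite mulN1r.
have mb e : cmeasurable setT (fun x => cmval e (shift_set x A)) by exact: cmeasurable_shift.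
have bd e x : modulus (cmval e (shift_set x A)) <= total_mass e.
  by apply: cmval_bound; exact: measurable_shift_set.
have := cmintegralD (rep a) (mb (rep b)) (bd (rep b)) (mb (rep c)) (bd (rep c)) (-1).
rewrite mulN1r => <-; congr cmintegral; apply/funext => x.
by have m := measurable_shift_set x mA; rewrite !(repP m)//= mulN1r.
Qed.

End convolution.

(** * The free flow on measures *)

Section free_flow.
Context (R : realType) (n : nat).
Local Notation V := 'rV[R]_n.
Implicit Types (nu eta th : cmeasure R n) (A : set V).
Local Notation "a <=v C" := (var_le (@disjoint_lists R n) a C) (at level 70).

Lemma measurable_dot (v : V) : measurable_fun setT (fun x : V => dot v x).
Proof.
apply: measurable_sum => i; apply: measurable_funM => //; exact: measurable_coor.
Qed.

Lemma measurable_dot_sq : measurable_fun setT (fun x : V => dot x x).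
Proof. by apply: measurable_sum => i; apply: measurable_funM; exact: measurable_coor. Qed.

Lemma cmeasurable_expi d (T : measurableType d) (h : T -> R) : measurable_fun setT h ->
  cmeasurable setT (fun x => expi (h x)).
Proof.
move=> mh; split => /=.
  by apply: measurableT_comp mh; apply: continuous_measurable_fun; exact: continuous_cos.
by apply: measurableT_comp mh; apply: continuous_measurable_fun; exact: continuous_sin.
Qed.

Lemma cmeasurable_phase t : cmeasurable setT (@phase R n t).
Proof.
apply: cmeasurable_expi; apply: measurable_funN; apply: measurable_funM => //.
by apply: measurable_funM => //; exact: measurable_dot_sq.
Qed.

Lemma modulus_phase t (x : V) : modulus (phase t x) <= 1.
Proof. by rewrite modulus_expi. Qed.

Lemma dot_ge0 (x : V) : 0 <= dot x x.
Proof. by apply: sumr_ge0 => i _; rewrite -expr2 sqr_ge0. Qed.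

Lemma phase_increment s t (x : V) (K : R) : dot x x <= K ->
  modulus (phase s x - phase t x) <= 8 * pi ^+ 2 * K * `|s - t|.
Proof.
move=> xK; apply: le_trans (modulus_expiB _ _) _.
have -> : - (4 * pi ^+ 2 * dot x x * s) - - (4 * pi ^+ 2 * dot x x * t) =
  - (4 * pi ^+ 2 * dot x x * (s - t)) by ring.
rewrite normrN normrM mulrA ler_wpM2r// ger0_norm; last first.
  by rewrite !mulr_ge0 ?dot_ge0 ?exprn_ge0 ?pi_ge0.
have -> : 2 * (4 * pi ^+ 2 * dot x x) = 8 * pi ^+ 2 * dot x x by ring.
by rewrite ler_wpM2l// mulr_ge0// exprn_ge0// pi_ge0.
Qed.

(** At each point at most one of the disjoint sets contributes, with modulus one. *)
Lemma phase_flow_le t nu (C : R) : cmv nu <=v C ->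
  (fun i => cmintegral nu (sval i) (phase t)) <=v C.
Proof.
move=> nuC [|A0 l] dl; first by rewrite big_nil; have := nuC [::]; rewrite big_nil; apply; case.
set l1 := A0 :: l in dl *; rewrite (big_nth A0) big_mkord -[leRHS]mul1r.
have mA (i : 'I_(size l1)) : measurable (sval (nth A0 l1 i)) by case: (nth _ _ _).
under eq_bigr do rewrite (cmintegral_setT _ _ (mA _)).
apply: (sum_cmintegral_le nuC) => // [i|x].
  exact: cmeasurable_restrict (mA i) (cmeasurable_phase t).
have E (i : 'I_(size l1)) : modulus ((\1_(sval (nth A0 l1 i)) x)%:C * phase t x) =
    (x \in sval (nth A0 l1 i))%:R.
  by rewrite modulusM modulus_expi mulr1 modulus_real indicE ger0_norm.
under eq_bigr do rewrite E.
have [[i Ax]|nA] := pselect (exists i : 'I_(size l1), sval (nth A0 l1 i) x); last first.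
  by rewrite big1// => i _; rewrite memNset// => Ax; apply: nA; exists i.
rewrite (bigD1 i)//= mem_set// big1 ?addr0// => j ji; rewrite memNset// => Ajx.
have := dl j i (ltn_ord j) (ltn_ord i) ji.
rewrite !(nth_map A0)//= => h.
by have : (sval (nth A0 l1 j) `&` sval (nth A0 l1 i)) x by []; rewrite h.
Qed.

(** The phases are uniformly continuous in time on bounded sets of frequencies, and a
    finite measure has small mass outside a large one. *)
Lemma phase_flow_continuous nu t (e : R) : 0 < e ->
  \forall s \near t, (fun i => cmintegral nu (sval i) (phase s) -
    cmintegral nu (sval i) (phase t)) <=v e.
Proof.
(* The frequencies are cut according to the integer part of |x|^2. *)
move=> e0; pose F k : set V := [set x | Num.truncn (dot x x) = k].
have mF k : measurable (F k) by apply: measurable_truncn_preimage; exact: measurable_dot_sq.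
have tF : trivIset setT F.
  by apply/trivIsetP => i j _ _ ij; apply/seteqP; split => // x [/= hi hj]; case/eqP: ij; rewrite -hi -hj.
have mB j : measurable (\big[setU/set0]_(0 <= k < j) F k) by exact: bigsetU_measurable.
have mU : measurable (\bigcup_k F k) by exact: bigcup_measurable.
have [j jE] : exists j : nat, \sum_(cp <- parts nu)
    fine (cp.2 (\bigcup_k F k `\` \big[setU/set0]_(0 <= k < j) F k)) <= e / 4.
  have e40 : 0 < e / 4 by rewrite divr_gt0.
  have /cvgrPdist_le/(_ _ e40)[j _ /(_ _ (leqnn _))] := mass_tail_cvg nu mF tF.
  by rewrite sub0r normrN => /(le_trans (ler_norm _)); exists j.
pose E : set V := \bigcup_k F k `\` \big[setU/set0]_(0 <= k < j) F k.
have mE : measurable E by exact: measurableD.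
have outE x : (~` E) x -> dot x x <= j%:R.
  move=> nE; have [tj|jt] := ltnP (Num.truncn (dot x x)) j.
    by rewrite ltW// (lt_le_trans (truncnS_gt _))// ler_nat.
  exfalso; apply: nE; split; first by exists (Num.truncn (dot x x)).
  rewrite big_mkord -bigcup_mkord => -[k /= kj Fk].
  by move: jt; rewrite Fk leqNgt kj.
pose m := 8 * pi ^+ 2 * j%:R * total_mass nu.
have m0 : 0 <= m by rewrite !mulr_ge0 ?exprn_ge0 ?pi_ge0 ?total_mass_ge0.
have d0 : 0 < e / 2 / (m + 1) by rewrite !divr_gt0// ltr_wpDl.
near=> s.
have st : `|s - t| <= e / 2 / (m + 1).
  by rewrite distrC; near: s; apply: cvgr_dist_le d0; exact: cvg_id.
pose h (x : V) : R[i] := phase s x - phase t x.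
have mh : cmeasurable setT h.
  apply: cmeasurableD; first exact: cmeasurable_phase.
  by apply: cmeasurableN; exact: cmeasurable_phase.
have h2 x : modulus (h x) <= 2.
  by rewrite (le_trans (modulusB _ _))// !modulus_expi.
have E1 A : measurable A -> cmintegral nu A (phase s) - cmintegral nu A (phase t) =
    cmintegral nu (A `&` E) h + cmintegral nu (A `\` E) h.
  move=> mA; rewrite -(cmintegralU nu mh h2); [|exact: measurableI|exact: measurableD|]; last first.
    by apply/seteqP; split => // x [[_ ?] []].
  rewrite setUIDK !cmintegral_parts -sumrB; apply: eq_bigr => cp _; rewrite -mulrBr; congr (_ * _).
  have pA : (cp.2 A < +oo)%E by rewrite -ge0_fin_numE// fin_num_measure.
  have fi r : cintegrable cp.2 A (@phase R n r).
    apply: (cintegrable_bounded (C := 1)) => // [|x _]; last exact: modulus_phase.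
    by apply: sub_cmeasurable (cmeasurable_phase r).
  by rewrite cintegralB.
move=> l dl.
apply: (@le_trans _ _ (\sum_(A <- l) (2 * \sum_(cp <- parts nu) fine (cp.2 (sval A `&` E)) +
   8 * pi ^+ 2 * j%:R * `|s - t| * \sum_(cp <- parts nu) fine (cp.2 (sval A `&` setT))))).
  apply: ler_sum => A1 _; move: (sval A1) (svalP A1) => A mA.
  rewrite (E1 _ mA) setIT; apply: le_trans (modulusD _ _) _; apply: lerD.
    by apply: cmintegral_le => //; exact: measurableI.
  apply: (@le_trans _ _ (8 * pi ^+ 2 * j%:R * `|s - t| *
      \sum_(cp <- parts nu) fine (cp.2 (A `\` E)))).
    apply: cmintegral_le => //; first exact: measurableD.
    by move=> x [_ nE]; apply: phase_increment; exact: outE.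
  rewrite ler_wpM2l ?mulr_ge0 ?exprn_ge0 ?pi_ge0//; apply: ler_sum => cp _.
  have mAE : measurable (A `\` E) by exact: measurableD.
  by apply: fine_le; rewrite ?fin_num_measure//; apply: le_measure; rewrite ?inE.
rewrite big_split/= -!mulr_sumr exchange_big/=.
rewrite [X in _ + _ * X]exchange_big/=.
have B1 : \sum_(cp <- parts nu) \sum_(A <- l) fine (cp.2 (sval A `&` E)) <= e / 4.
  by apply: le_trans jE; apply: ler_sum => cp _; exact: sum_disjoint_mass.
have B2 : \sum_(cp <- parts nu) \sum_(A <- l) fine (cp.2 (sval A `&` setT)) <= total_mass nu.
  by apply: ler_sum => cp _; exact: sum_disjoint_mass.
have B3 : 8 * pi ^+ 2 * j%:R * `|s - t| * total_mass nu <= e / 2.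
  rewrite mulrAC -/m; apply: (@le_trans _ _ (m * (e / 2 / (m + 1)))); first exact: ler_wpM2l.
  rewrite mulrCA ler_piMr ?divr_ge0 ?ltW//.
  by rewrite ltr_pdivrMr ?ltr_wpDl// mul1r ltrDl.
rewrite (_ : e = 2 * (e / 4) + e / 2); last by field.
apply: lerD; first by rewrite ler_wpM2l.
apply: le_trans B3; rewrite ler_wpM2l// !mulr_ge0 ?exprn_ge0 ?pi_ge0//.
Unshelve. all: by end_near.
Qed.

Program Definition free_algebra : flow_algebra R (borel R n) :=
  @FlowAlgebra R (borel R n) (@disjoint_lists R n) (@is_cmv R n) (@mulm R n)
    (fun t a i => cmintegral (rep a) (sval i) (phase t))
    _ _ _ _ _ _ (@is_cmv_lim R n) (@is_cmv_int R n) _ (@mulmBl R n) (@mulmBr R n) _ _ _ _ _.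
Next Obligation. by []. Qed.
Next Obligation. by move=> i [|j] [|k]. Qed.
Next Obligation.
exists (cmzero R n); apply/funext => A; rewrite /cmv /cmval /=.
by apply: complex_eqP.
Qed.
Next Obligation.
move=> a b Ka Kb; have := is_cmvD 1 Ka Kb; congr is_cmv.
by apply/funext => i /=; rewrite mul1r.
Qed.
Next Obligation.
move=> z a Ka; have K0 : is_cmv (fun _ : borel R n => 0 : R[i]) by exact: free_algebra_obligation_3.
have := is_cmvD z K0 Ka; congr is_cmv; by apply/funext => i /=; rewrite add0r.
Qed.
Next Obligation. by move=> a [nu <-]; exists (total_mass nu); exact: var_le_total_mass. Qed.
Next Obligation. by move=> a b _ _; exists (cmconv (rep a) (rep b)). Qed.
Next Obligation. by move=> a b A B Ka Kb aA bB; apply: cmconv_le; rewrite repE. Qed.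
Next Obligation.
move=> t a Ka; apply: (is_cmv_flow (C := 1)) => //; first exact: cmeasurable_phase.
by move=> x; exact: modulus_phase.
Qed.
Next Obligation.
move=> t a b Ka Kb; apply/funext => -[A mA] /=.
have Kab : is_cmv (a \- b).
  have := is_cmvD (-1) Ka Kb; congr is_cmv; apply/funext => i /=; by rewrite mulN1r.
rewrite (@cmintegral_lin _ _ (rep a) (rep b) _ (-1) _ 1)//.
- by rewrite mulN1r.
- by move=> B mB; rewrite !(repP mB)//= mulN1r.
- exact: cmeasurable_phase.
- by move=> x; exact: modulus_phase.
Qed.
Next Obligation. by move=> t a C Ka aC; apply: phase_flow_le; rewrite repE. Qed.
Next Obligation. by move=> a t e Ka e0; exact: phase_flow_continuous. Qed.

End free_flow.

(** * Lebesgue measure on R^n *)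

Section lebesgue_rV.
Context (R : realType).
Local Notation TR := (measurableTypeR R).
Local Notation leb := (@lebesgue_measure R).
Local Notation lam n := (lebesgue_measure_rV R n).

Lemma rV_cons0 n (x : R) (y : 'rV[R]_n) : rV_cons (x, y) 0 ord0 = x.
Proof. exact: (congr1 fst (rV_consK (x, y))). Qed.

Lemma rV_consS n (x : R) (y : 'rV[R]_n) j : rV_cons (x, y) 0 (lift ord0 j) = y 0 j.
Proof. by have /(congr1 snd)/rowP/(_ j) := rV_consK (x, y); rewrite mxE. Qed.

Lemma rV_consD n (x x' : R) (y y' : 'rV[R]_n) :
  rV_cons (x + x', y + y') = rV_cons (x, y) + rV_cons (x', y').
Proof.
apply/rowP => i; rewrite [RHS]mxE; case: (unliftP ord0 i) => [j|] ->.
  by rewrite !rV_consS mxE.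
by rewrite !rV_cons0.
Qed.

Lemma rV_unconsK n (x : 'rV[R]_n.+1) : rV_cons (rV_uncons x) = x.
Proof.
apply/rowP => i; case: (unliftP ord0 i) => [j|] ->; rewrite /rV_uncons.
  by rewrite rV_consS mxE.
by rewrite rV_cons0.
Qed.

Lemma ge0_integral_rV_step n (f : 'rV[R]_n.+1 -> \bar R) : measurable_fun setT f ->
  (forall x, 0 <= f x)%E ->
  (\int[lam n.+1]_x f x = \int[leb]_x \int[lam n]_y f (rV_cons (x, y)))%E.
Proof.
move=> mf f0.
rewrite (@ge0_integral_pushforward _ _ (TR * 'rV[R]_n)%type _ _ _ (@measurable_rV_cons R n)
  (leb \x lam n)%E setT f measurableT mf); last by move=> x _.
rewrite preimage_setT fubini_tonelli1//.
- by apply: measurableT_comp => //; exact: measurable_rV_cons.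
- by move=> z; exact: f0.
Qed.

Lemma integral_rV_prod n (h : R -> R) (c : R) : @measurable_fun _ _ TR R setT h ->
  (forall t, 0 <= h t) -> (\int[leb]_t (h t)%:E = c%:E)%E ->
  (\int[lam n]_x (\prod_i h (x 0%R i))%:E = (c ^+ n)%:E)%E.
Proof.
move=> mh h0 hc; elim: n => [|n IH].
  under eq_integral do rewrite big_ord0.
  by rewrite /= integral_dirac//= diracT mul1e.
rewrite (@ge0_integral_rV_step n (fun x => (\prod_i h (x 0%R i))%:E)); last first.
- by move=> x; rewrite lee_fin prodr_ge0.
- apply/measurable_EFinP; apply: measurable_prod => i _.
  exact: (measurableT_comp mh (measurable_coor i)).
have m0 : measurable_fun setT (fun y : 'rV[R]_n => \prod_i h (y 0 i)).
  by apply: measurable_prod => i _; exact: (measurableT_comp mh (measurable_coor i)).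
transitivity (\int[leb]_x ((h x)%:E * (c ^+ n)%:E))%E.
  apply: eq_integral => x _; rewrite -IH -ge0_integralZl//=.
  - apply: eq_integral => y _; rewrite -EFinM big_ord_recl rV_cons0; congr (_ * _)%:E.
    by apply: eq_bigr => j _; rewrite rV_consS.
  - exact/measurable_EFinP.
  - by move=> y _; rewrite lee_fin prodr_ge0.
  - by rewrite lee_fin.
have c0 : 0 <= c by rewrite -lee_fin -hc integral_ge0// => t _; rewrite lee_fin.
rewrite ge0_integralZr//=.
- by rewrite hc -EFinM exprS.
- exact/measurable_EFinP.
- by move=> t _; rewrite lee_fin.
- by rewrite lee_fin exprn_ge0.
Qed.

Lemma lebesgue_translate (a : R) (A : set TR) : measurable A ->
  leb [set x | A (x + a)] = leb A.
Proof.
have mT : @measurable_fun _ _ TR TR setT (fun x => x + a) by exact: measurable_funD.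
move=> mA; apply/esym.
apply: (@lebesgue_measure_unique R (pushforward leb (fun x : TR => x + a : TR))) => //= _ [[u v]] _ <-.
rewrite /pushforward (_ : _ @^-1` _ = `]u - a, v - a]%classic).
  rewrite !lebesgue_measure_itv/= !lte_fin ltrD2r; case: ifP => // _.
  by rewrite -!EFinD; congr EFin; ring.
by apply/seteqP; split=> x /=; rewrite !in_itv/= ltrBlDr lerBrDr.
Qed.

Lemma ge0_integral_translate1 (a : R) (f : TR -> \bar R) : measurable_fun setT f ->
  (forall x, 0 <= f x)%E -> (\int[leb]_x f (x + a)%R = \int[leb]_x f x)%E.
Proof.
move=> mf f0.
have mT : @measurable_fun _ _ TR TR setT (fun x => x + a) by exact: measurable_funD.
have := @ge0_integral_pushforward _ _ _ _ _ (fun x : TR => x + a : TR) mT leb setT f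
  measurableT mf (fun x _ => f0 x).
rewrite preimage_setT => <-.
by apply: eq_measure_integral => A mA _; exact: lebesgue_translate.
Qed.

Lemma lebesgue_rV_sections n (A : set 'rV[R]_n.+1) :
  lam n.+1 A = (\int[leb]_x lam n [set y | A (rV_cons (x, y))])%E.
Proof.
rewrite /= /lebesgue_rV_step /pushforward /product_measure1 /=.
apply: eq_integral => x _ /=; congr (lam n _).
by apply/seteqP; split=> y; rewrite /xsection/= inE.
Qed.

(** Induction on the dimension: the sections of a translated set are translates of
    sections, and the outer integral is invariant as well. *)
Lemma lebesgue_rV_translate n (a : 'rV[R]_n) A : measurable A ->
  lam n [set x | A (x + a)] = lam n A.
Proof.
elim: n a A => [|n IH] a A mA.
  by congr (lam 0 _); apply/seteqP; split=> x /=; rewrite [x + a]thinmx0 [x]thinmx0.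
rewrite !lebesgue_rV_sections -(rV_unconsK a).
move: (rV_uncons a) => [a0 a1].
have mS : measurable (@rV_cons R n @^-1` A).
  by rewrite -[X in measurable X]setTI; exact: measurable_rV_cons.
have mx (x : R) : measurable [set y | A (rV_cons (x, y))].
  rewrite (_ : [set y | _] = xsection (@rV_cons R n @^-1` A) x).
    exact: measurable_xsection.
  by apply/seteqP; split=> y; rewrite /xsection/= inE.
rewrite -(@ge0_integral_translate1 a0 (fun x => lam n [set y | A (rV_cons (x, y))])).
- apply: eq_integral => x _; rewrite -(IH a1 _ (mx (x + a0))); congr (lam n _).
  by apply/seteqP; split=> y /=; rewrite rV_consD.
- rewrite (_ : (fun _ => _) = lam n \o xsection (@rV_cons R n @^-1` A)).
    exact: measurable_fun_xsection.
  apply/funext => x /=; congr (lam n _).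
  by apply/seteqP; split=> y; rewrite /xsection/= inE.
- by move=> x; exact: measure_ge0.
Qed.

Lemma measurable_rV_translate n (a : 'rV[R]_n) : measurable_fun setT (fun x : 'rV[R]_n => x + a).
Proof.
apply: measurable_rVP => i; under eq_fun do rewrite mxE.
by apply: measurable_funD => //; exact: measurable_coor.
Qed.

Lemma ge0_integral_translate n (a : 'rV[R]_n) (f : 'rV[R]_n -> \bar R) : measurable_fun setT f ->
  (forall x, 0 <= f x)%E -> (\int[lam n]_x f (x + a)%R = \int[lam n]_x f x)%E.
Proof.
move=> mf f0.
have := @ge0_integral_pushforward _ _ _ _ _ _ (measurable_rV_translate a) (lam n) setT f
  measurableT mf (fun x _ => f0 x).
rewrite preimage_setT => <-.
apply: eq_measure_integral => [|mp A mA _]; first exact: measurable_rV_translate.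
exact: (lebesgue_rV_translate a mA).
Qed.

Lemma Rintegral_translate n (a : 'rV[R]_n) (f : 'rV[R]_n -> R) : measurable_fun setT f ->
  \int[lam n]_x f (x + a) = \int[lam n]_x f x.
Proof.
move=> mf; have mf' : measurable_fun setT (EFin \o f) by exact/measurable_EFinP.
rewrite /Rintegral; congr fine; rewrite [LHS]integralE [RHS]integralE; congr (_ - _)%E.
  rewrite -(@ge0_integral_translate _ a (EFin \o f)^\+%E)//; last exact: measurable_funepos.
  by apply: eq_integral => x _; rewrite !funeposE.
rewrite -(@ge0_integral_translate _ a (EFin \o f)^\-%E)//; last exact: measurable_funeneg.
by apply: eq_integral => x _; rewrite !funenegE.
Qed.

End lebesgue_rV.

Section decay.
Context (R : realType) (n : nat).
Local Notation V := 'rV[R]_n.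
Local Notation TR := (measurableTypeR R).
Local Notation leb := (@lebesgue_measure R).
Local Notation lam := (lebesgue_measure_rV R n).

Lemma continuous_measurable_rV (f : V -> R) : continuous f -> measurable_fun setT f.
Proof.
move=> cf; apply: (measurability _ (RGenOInfty.measurableE R)).
move=> _ [_ [r ->] <-]; rewrite setTI measurable_rV_open; apply: sub_sigma_algebra => /=.
by apply: open_comp => [x _|]; [exact: cf|rewrite set_itvE; exact: open_gt].
Qed.

Lemma integral_oneDsqr : (\int[leb]_x (oneDsqr x)^-1%:E = (pi : R)%:E)%E.
Proof.
rewrite ge0_symfun_integralT//=.
- rewrite (_ : [set x | 0 <= x] = `[0, +oo[%classic); last first.
    by apply/seteqP; split=> x /=; rewrite in_itv/= andbT.
  by rewrite integral0y_oneDsqr -EFinM mulrC divfK.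
- exact: continuous_oneDsqrV.
- by move=> x /=; rewrite /oneDsqr sqrrN.
Qed.

(** A product of functions of one variable, so that its integral is a power of a one-
    dimensional integral. It serves as the integrable majorant in the estimates below.
    *)
Definition decay_bound (x : V) : R := \prod_i (1 + x 0 i ^+ 2)^-1.

Lemma decay_bound_ge0 x : 0 <= decay_bound x.
Proof. by apply: prodr_ge0 => i _; rewrite invr_ge0 addr_ge0 ?sqr_ge0. Qed.

Lemma measurable_decay_bound : measurable_fun setT decay_bound.
Proof.
apply: measurable_prod => i _.
apply: (measurableT_comp (f := fun t : TR => (1 + t ^+ 2)^-1 : R)); last exact: measurable_coor.
by apply: continuous_measurable_fun; exact: continuous_oneDsqrV.
Qed.

Lemma integral_decay_bound : (\int[lam]_x (decay_bound x)%:E = (pi ^+ n)%:E)%E.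
Proof.
apply: (@integral_rV_prod R n (fun t => (1 + t ^+ 2)^-1)).
- by apply: continuous_measurable_fun; exact: continuous_oneDsqrV.
- by move=> t; rewrite invr_ge0 addr_ge0 ?sqr_ge0.
- exact: integral_oneDsqr.
Qed.

Lemma integrable_decay_bound : lam.-integrable setT (EFin \o decay_bound).
Proof.
apply/integrableP; split; first by apply/measurable_EFinP; exact: measurable_decay_bound.
under eq_integral do rewrite /= ger0_norm ?decay_bound_ge0//.
by rewrite integral_decay_bound ltry.
Qed.

Lemma decay_integrable (f : V -> R) C : measurable_fun setT f ->
  (forall x, `|f x| <= C * decay_bound x) -> lam.-integrable setT (EFin \o f).
Proof.
move=> mf fC; have := integrableZl measurableT C integrable_decay_bound.
apply: le_integrable => //; first exact/measurable_EFinP.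
by move=> x _; rewrite -EFinM /= lee_fin (le_trans (fC x))// ler_norm.
Qed.

Lemma decay_Rintegral_le (f : V -> R) C : measurable_fun setT f ->
  (forall x, `|f x| <= C * decay_bound x) -> `|\int[lam]_x f x| <= C * pi ^+ n.
Proof.
move=> mf fC; have fi := decay_integrable mf fC.
have Ci := integrableZl measurableT C integrable_decay_bound.
apply: le_trans (le_normr_Rintegral _ fi) _ => //.
apply: (@le_trans _ _ (\int[lam]_x (C * decay_bound x))).
  by apply: le_Rintegral => //; exact: integrable_norm.
rewrite RintegralZl//; last exact: integrable_decay_bound.
by rewrite /Rintegral integral_decay_bound.
Qed.

Lemma norm_coord_le (x : V) i : `|x 0 i| <= `|x|.
Proof.
rewrite /Num.norm /= mx_normrE.
exact: (le_bigmax _ (fun ij : 'I_1 * 'I_n => `|x ij.1 ij.2|) (0, i)).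
Qed.

(** Each factor of the inverse of the decay bound is at most the square of 1 + |x|,
    for the maximum norm. *)
Lemma weight_decay (x : V) : 1 <= (1 + `|x|) ^+ (2 * n) * decay_bound x.
Proof.
rewrite exprM -[X in _ ^+ X](card_ord n) -prodr_const /decay_bound -big_split/=.
elim/big_ind: _ => // [a b a1 b1|i _]; first by rewrite mulr_ege1.
rewrite ler_pdivlMr; last by rewrite ltr_wpDr ?sqr_ge0.
rewrite mul1r -(real_normK (num_real (x 0 i))).
have := norm_coord_le x i; have := normr_ge0 (x 0 i).
move: `|x 0 i| `|x| => a b a0 ab; nra.
Qed.

Lemma weight_le_decay (f : V -> R) C x : (1 + `|x|) ^+ (2 * n) * `|f x| <= C ->
  `|f x| <= C * decay_bound x.
Proof.
move=> fC; apply: (@le_trans _ _ ((1 + `|x|) ^+ (2 * n) * `|f x| * decay_bound x)).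
  by rewrite mulrAC ler_peMl// weight_decay.
by rewrite ler_wpM2r// decay_bound_ge0.
Qed.

End decay.

(** * Rapidly decreasing functions and oscillatory integrals *)

Section rapid_functions.
Context (R : realType) (n : nat).
Local Notation V := 'rV[R]_n.
Local Notation lam := (lebesgue_measure_rV R n).
Implicit Types (f g : V -> R).

(** The real Schwartz functions, with the weights and the order of derivation
    decoupled. *)
Definition rapid f := smooth f /\ forall k s, exists C, forall x,
  (1 + `|x|) ^+ k * `|partials s f x| <= C.

Lemma weight_ge1 (x : V) k : 1 <= (1 + `|x|) ^+ k.
Proof. by rewrite exprn_ege1// lerDl. Qed.

Lemma weight_ge0 (x : V) k : 0 <= (1 + `|x|) ^+ k.
Proof. exact: le_trans ler01 (weight_ge1 x k). Qed.

(** A class of differentiable functions that is stable under partial derivatives and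
    decays consists of rapidly decreasing functions; no derivative of higher order
    has to be written down. *)
Lemma rapid_class (G : set (V -> R)) :
  (forall g x, G g -> differentiable g x) -> (forall g i, G g -> G (partial i g)) ->
  (forall g k, G g -> exists C, forall x, (1 + `|x|) ^+ k * `|g x| <= C) ->
  forall g, G g -> rapid g.
Proof.
move=> Gd Gp Gb g Gg; split; first exact: smooth_class Gg.
by move=> k s; apply: Gb; elim: s => //= i s; exact: Gp.
Qed.

Lemma rapid_weight f k : rapid f -> exists C, forall x, (1 + `|x|) ^+ k * `|f x| <= C.
Proof. by move=> [_ /(_ k [::])]. Qed.

Lemma rapid_partial f i : rapid f -> rapid (partial i f).
Proof.
have E s : partials s (partial i f) = partials (rcons s i) f.
  by rewrite /partials foldr_rcons.
by move=> [sf df]; split => [s x|k s]; rewrite E; [exact: sf|exact: df].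
Qed.

Lemma rapid_differentiable f x : rapid f -> differentiable f x.
Proof. by move=> [/(_ [::] x)]. Qed.

Lemma rapid_linear a f g : rapid f -> rapid g -> rapid (fun x => a * f x + g x).
Proof.
move=> [sf df] [sg dg]; split; first exact: smooth_linear.
move=> k s; have [C fC] := df k s; have [D gD] := dg k s.
exists (`|a| * C + D) => x; rewrite partials_linear//.
apply: le_trans (ler_wpM2l (weight_ge0 _ _) (ler_normD _ _)) _; rewrite mulrDr; apply: lerD => //.
by rewrite normrM mulrCA ler_wpM2l.
Qed.

Lemma rapid0 : rapid (fun=> 0).
Proof.
apply: (@rapid_class [set fun=> 0]) => //.
- by move=> _ x ->; exact: differentiable_cst.
- by move=> _ i ->; exact: partial_cst.
- by move=> _ k ->; exists 0 => x; rewrite normr0 mulr0.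
Qed.

Lemma rapidZ a f : rapid f -> rapid (fun x => a * f x).
Proof. by move=> /(rapid_linear a)/(_ rapid0); under eq_fun do rewrite addr0. Qed.

Lemma rapid_coord j f : rapid f -> rapid (fun x => x 0 j * f x).
Proof.
pose G := [set h : V -> R | exists f g, [/\ rapid f, rapid g & h = fun x => x 0 j * f x + g x]].
have dj x : differentiable (fun y : V => y 0 j) x by exact: differentiable_coord.
move=> rf; apply: (@rapid_class G).
- move=> _ x [h [g [rh rg ->]]]; apply: differentiableD; last exact: rapid_differentiable.
  by apply: differentiableM => //; exact: rapid_differentiable.
- move=> _ i [h [g [rh rg ->]]].
  exists (partial i h), (fun x => (i == j)%:R * h x + partial i g x).
  split; [exact: rapid_partial|by apply: rapid_linear => //; exact: rapid_partial|].
  apply/funext => x; rewrite partialD; last 2 first.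
  + by apply: differentiableM => //; exact: rapid_differentiable.
  + exact: rapid_differentiable.
  rewrite partialM//; last exact: rapid_differentiable.
  by rewrite partial_coord addrA.
- move=> _ k [h [g [rh rg ->]]].
  have [C hC] := rapid_weight k.+1 rh; have [D gD] := rapid_weight k rg.
  exists (C + D) => x; apply: le_trans (ler_wpM2l (weight_ge0 _ _) (ler_normD _ _)) _.
  rewrite mulrDr; apply: lerD => //; apply: le_trans (hC x).
  rewrite normrM exprSr -!mulrA ler_wpM2l ?weight_ge0// ler_wpM2r//.
  by rewrite (le_trans (norm_coord_le x j))// lerDr.
- by exists f, (fun=> 0); split => //; [exact: rapid0|apply/funext => x; rewrite addr0].
Qed.

Lemma rapid_continuous f : rapid f -> continuous f.
Proof. by move=> [sf _]; exact: smooth_continuous. Qed.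

Lemma rapid_measurable f : rapid f -> measurable_fun setT f.
Proof. by move=> /rapid_continuous; exact: continuous_measurable_rV. Qed.

Lemma rapid_decay f k : rapid f -> exists C, forall x,
  (1 + `|x|) ^+ k * `|f x| <= C * decay_bound x.
Proof.
move=> rf; have [C fC] := rapid_weight (2 * n + k) rf.
exists C => x; have := @weight_le_decay R n (fun x => (1 + `|x|) ^+ k * f x) C x.
by rewrite normrM (ger0_norm (weight_ge0 _ _)) mulrA -exprD; apply.
Qed.

Lemma rapid_mul_integrable (g : V -> R) f C : measurable_fun setT g -> (forall x, `|g x| <= C) ->
  rapid f -> lam.-integrable setT (EFin \o (fun x => g x * f x)).
Proof.
move=> mg gC rf; have [D fD] := rapid_decay 0 rf; apply: (@decay_integrable _ _ _ (C * D)).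
  by apply: measurable_funM => //; exact: rapid_measurable.
move=> x; rewrite normrM -mulrA; have := fD x; rewrite expr0 mul1r => fDx.
by apply: ler_pM.
Qed.

Lemma integrable_scale a f : lam.-integrable setT (EFin \o f) ->
  lam.-integrable setT (EFin \o (fun x => a * f x)).
Proof. by move=> /(integrableZl measurableT a); exact: eq_integrable. Qed.

Lemma Rintegral_sum (I : Type) (s : seq I) (F : I -> V -> R) :
  (forall i, lam.-integrable setT (EFin \o F i)) ->
  \int[lam]_x (\sum_(i <- s) F i x) = \sum_(i <- s) \int[lam]_x F i x.
Proof.
move=> Fi; elim: s => [|i s IH].
  rewrite big_nil; under eq_Rintegral do rewrite big_nil.
  by rewrite /Rintegral integral0.
rewrite big_cons; under eq_Rintegral do rewrite big_cons.
rewrite RintegralD ?IH//.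
have := integrable_sum measurableT s (P := xpredT) (fun j _ => Fi j).
apply: eq_integrable => // x _ /=.
by rewrite sumEFin.
Qed.

End rapid_functions.

Section oscillatory_integral.
Context (R : realType) (n : nat).
Local Notation V := 'rV[R]_n.
Local Notation lam := (lebesgue_measure_rV R n).
Implicit Types (f g : V -> R) (xi : V) (th : R).

(** The real and imaginary parts of the Fourier transform of a real function are its
    values at the phases 0 and pi / 2; all phases together are stable under
    differentiation. *)
Definition osc th f xi : R := \int[lam]_x (cos (2 * pi * dot xi x + th) * f x).

Lemma measurable_cos_dot xi th : measurable_fun setT (fun x : V => cos (2 * pi * dot xi x + th)).
Proof.
apply: (measurableT_comp (f := @cos R)).
  by apply: continuous_measurable_fun; exact: continuous_cos.
by apply: measurable_funD => //; apply: measurable_funM => //; exact: measurable_dot.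
Qed.

Lemma norm_cos_le1 (t : R) : `|cos t| <= 1.
Proof. by rewrite ler_norml cos_geN1 cos_le1. Qed.

Lemma norm_sin_le1 (t : R) : `|sin t| <= 1.
Proof. by rewrite ler_norml sin_geN1 sin_le1. Qed.

Lemma osc_integrable th f xi : rapid f ->
  lam.-integrable setT (EFin \o (fun x => cos (2 * pi * dot xi x + th) * f x)).
Proof.
apply: rapid_mul_integrable; first exact: measurable_cos_dot.
by move=> x; exact: norm_cos_le1.
Qed.

Lemma osc_le f : rapid f -> exists C, forall th xi, `|osc th f xi| <= C.
Proof.
move=> rf; have [C fC] := rapid_decay 0 rf; exists (C * pi ^+ n) => th xi.
apply: decay_Rintegral_le.
  by apply: measurable_funM; [exact: measurable_cos_dot|exact: rapid_measurable].
move=> x; rewrite normrM; have := fC x; rewrite expr0 mul1r; apply: le_trans.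
by rewrite ler_piMl// norm_cos_le1.
Qed.

Lemma oscZ th a f xi : rapid f -> osc th (fun x => a * f x) xi = a * osc th f xi.
Proof.
move=> rf; rewrite /osc -RintegralZl//; last exact: osc_integrable.
by apply: eq_Rintegral => x _; rewrite mulrCA.
Qed.

(** The addition theorem: all phases are combinations of two phases a quarter period
    apart. *)
Lemma osc_phase th eta f xi : rapid f ->
  osc (th + eta) f xi = cos eta * osc th f xi + sin eta * osc (th + pi / 2) f xi.
Proof.
move=> rf; rewrite /osc -!RintegralZl//; try exact: osc_integrable.
rewrite -RintegralD//; try by apply: integrable_scale; exact: osc_integrable.
by apply: eq_Rintegral => x _; rewrite addrA cosD addrA cosDpihalf; ring.
Qed.

Lemma dot_le (x y : V) : `|dot x y| <= n%:R * `|x| * `|y|.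
Proof.
apply: le_trans (ler_norm_sum _ _ _) _.
apply: (@le_trans _ _ (\sum_(i < n) `|x| * `|y|)).
  by apply: ler_sum => i _; rewrite normrM ler_pM// norm_coord_le.
by rewrite sumr_const card_ord -[leLHS]mulr_natl mulrA.
Qed.

Lemma cos_taylor (u v : R) : `|cos (u + v) - cos u + v * sin u| <= 2 * v ^+ 2.
Proof.
have -> : cos (u + v) - cos u + v * sin u = cos u * (cos v - 1) - sin u * (sin v - v).
  by rewrite cosD; ring.
apply: le_trans (ler_normB _ _) _; rewrite !normrM mulrDl mul1r.
apply: lerD.
  by apply: le_trans (norm_cos_sub1 v); rewrite ler_piMl// norm_cos_le1.
by apply: le_trans (norm_sin_subr v); rewrite ler_piMl// norm_sin_le1.
Qed.

(** Differentiation under the integral sign multiplies the integrand by the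
    coordinates and advances the phase by a quarter period. *)
Definition osc_grad th f xi : V := \row_j (2 * pi * osc (th + pi / 2) (fun x => x 0 j * f x) xi).

(** The Taylor estimate of the cosine is integrated against f; its remainder costs two
    powers of the integration variable, which f absorbs. *)
Lemma osc_taylor th f xi : rapid f -> exists M, forall x,
  `|osc th f x - osc th f xi - dot (x - xi) (osc_grad th f xi)| <= M * `|x - xi| ^+ 2.
Proof.
move=> rf; have [C fC] := rapid_decay 2 rf.
exists (8 * pi ^+ 2 * n%:R ^+ 2 * (C * pi ^+ n)) => x; set h := x - xi.
pose F y := (cos (2 * pi * dot x y + th) - cos (2 * pi * dot xi y + th) +
  2 * pi * dot h y * sin (2 * pi * dot xi y + th)) * f y.
have iE j : lam.-integrable setT (EFin \o (fun y => h 0 j * (2 * pi * (cos (2 * pi * dot xi y + (th + pi / 2)) * (y 0 j * f y))))).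
  apply: integrable_scale; apply: integrable_scale.
  exact: osc_integrable (rapid_coord j rf).
have -> : osc th f x - osc th f xi - dot h (osc_grad th f xi) = \int[lam]_y F y.
  rewrite /dot /osc_grad; under eq_bigr do rewrite [X in _ * X]mxE.
  rewrite /osc -RintegralB//; try exact: osc_integrable.
  rewrite (_ : \sum_i _ = \int[lam]_y (\sum_i (h 0 i * (2 * pi *
      (cos (2 * pi * dot xi y + (th + pi / 2)) * (y 0 i * f y)))))); last first.
    rewrite Rintegral_sum//; apply: eq_bigr => j _.
    rewrite RintegralZl//; last first.
      by apply: integrable_scale; exact: osc_integrable (rapid_coord j rf).
    by rewrite RintegralZl//; exact: osc_integrable (rapid_coord j rf).
  rewrite -RintegralB//.
  - apply: eq_Rintegral => y _; rewrite /F.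
    under [X in _ - X]eq_bigr do rewrite addrA cosDpihalf.
    rewrite [X in _ - X](_ : _ = - (2 * pi * dot h y * sin (2 * pi * dot xi y + th) * f y)).
      ring.
    move: (sin _) => S; rewrite /dot mulr_sumr !mulr_suml -sumrN; apply: eq_bigr => i _; ring.
  - have := integrableB measurableT (osc_integrable th x rf) (osc_integrable th xi rf).
    exact: eq_integrable.
  - have := integrable_sum measurableT (index_enum 'I_n) (P := xpredT) (fun j _ => iE j).
    by apply: eq_integrable => // y _ /=; rewrite sumEFin.
rewrite mulrAC mulrA; apply: decay_Rintegral_le.
  apply: measurable_funM; last exact: rapid_measurable.
  apply: measurable_funD; first by apply: measurable_funB; exact: measurable_cos_dot.
  apply: measurable_funM; first by apply: measurable_funM => //; exact: measurable_dot.
  apply: (measurableT_comp (f := @sin R)).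
    by apply: continuous_measurable_fun; exact: continuous_sin.
  by apply: measurable_funD => //; apply: measurable_funM => //; exact: measurable_dot.
move=> y; rewrite /F normrM.
have -> : 2 * pi * dot x y + th = 2 * pi * dot xi y + th + 2 * pi * dot h y.
  by rewrite -[in LHS](subrK xi x) dotDl -/h; ring.
apply: le_trans (ler_wpM2r (normr_ge0 _) (cos_taylor _ _)) _.
have d2 : (2 * pi * dot h y) ^+ 2 <= 4 * pi ^+ 2 * n%:R ^+ 2 * `|h| ^+ 2 * (1 + `|y|) ^+ 2.
  have -> : (2 * pi * dot h y) ^+ 2 = 4 * pi ^+ 2 * `|dot h y| ^+ 2.
    by rewrite real_normK ?num_real//; ring.
  rewrite -!(mulrA (4 * pi ^+ 2)); apply: ler_wpM2l; first by rewrite mulr_ge0 ?exprn_ge0 ?pi_ge0.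
  rewrite -!exprMn lerXn2r ?nnegrE ?mulr_ge0 ?addr_ge0//.
  apply: le_trans (dot_le h y) _; rewrite ler_wpM2l ?mulr_ge0//.
  by rewrite lerDr.
apply: (@le_trans _ _ (2 * (4 * pi ^+ 2 * n%:R ^+ 2 * `|h| ^+ 2 * (1 + `|y|) ^+ 2) * `|f y|)).
  by rewrite ler_wpM2r// ler_wpM2l.
have K0 : 0 <= 8 * pi ^+ 2 * n%:R ^+ 2 * `|h| ^+ 2 :> R.
  by rewrite !mulr_ge0 ?exprn_ge0 ?pi_ge0.
apply: (@le_trans _ _ (8 * pi ^+ 2 * n%:R ^+ 2 * `|h| ^+ 2 * ((1 + `|y|) ^+ 2 * `|f y|))).
  by rewrite le_eqVlt; apply/orP; left; apply/eqP; ring.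
by apply: le_trans (ler_wpM2l K0 (fC y)) _; rewrite le_eqVlt; apply/orP; left; apply/eqP; ring.
Qed.

End oscillatory_integral.

(** * Derivatives of oscillatory integrals and integration by parts *)

Section oscillatory_rapid.
Context (R : realType) (n : nat).
Local Notation V := 'rV[R]_n.
Local Notation lam := (lebesgue_measure_rV R n).
Implicit Types (f g : V -> R) (xi : V) (th : R).

(** A function with a quadratic modulus at a point has derivative 0 there; subtracting
    the linear part reduces differentiability to this case. *)
Lemma quadratic_differentiable (E : V -> R) xi M :
  (forall x, `|E x - E xi| <= M * `|x - xi| ^+ 2) ->
  differentiable E xi /\ forall v, 'D_v E xi = 0.
Proof.
move=> EM.
have sE : E \o shift xi = cst (E xi) + (\0 : V -> R) +o_ (0 : V) id.
  apply/eqaddoP => e e0.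
  have M0 : 0 < `|M| + 1 by rewrite ltr_wpDl.
  near=> x; rewrite /= /cst /= !fctE addr0.
  have := EM (x + xi); rewrite addrK => /le_trans; apply.
  rewrite expr2 mulrA ler_wpM2r//.
  apply: (@le_trans _ _ ((`|M| + 1) * `|x|)).
    by rewrite ler_wpM2r// (le_trans (ler_norm _))// lerDl.
  rewrite mulrC -ler_pdivlMr//; near: x.
  have d0 : 0 < e / (`|M| + 1) by rewrite divr_gt0.
  apply/nbhs_ballP; exists (e / (`|M| + 1)) => // x /=.
  by rewrite -ball_normE /= sub0r normrN => /ltW.
have c0 : continuous (\0 : V -> R) by rewrite (_ : (\0 : V -> R) = cst 0)//; exact: cst_continuous.
have dE := @diff_unique R V R E (\0 : {linear V -> R}) xi c0 sE.
have df : differentiable E xi by apply/diff_locallyP; rewrite dE; split.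
by split => // v; rewrite deriveE// dE.
Unshelve. all: by end_near.
Qed.

Lemma osc_differentiable th f xi : rapid f ->
  differentiable (osc th f) xi /\ forall v, 'D_v (osc th f) xi = dot v (osc_grad th f xi).
Proof.
move=> rf; have [M HM] := osc_taylor th xi rf.
set w := osc_grad th f xi in HM *.
pose E x := osc th f x - dot x w.
have [|dE DE] := @quadratic_differentiable E xi M.
  move=> x; apply: le_trans (HM x); rewrite le_eqVlt; apply/orP; left; apply/eqP.
  have dx : dot x w = dot (x - xi) w + dot xi w by rewrite -dotDl subrK.
  by rewrite /E dx; congr `|_|; ring.
have oE : osc th f = fun x => E x + dot x w by apply/funext => x; rewrite subrK.
split; first by rewrite oE; apply: differentiableD => //; exact: differentiable_dot.
move=> v; rewrite oE deriveD; last 2 first.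
- exact: diff_derivable.
- by apply: diff_derivable; exact: differentiable_dot.
rewrite DE add0r; apply: (@derive_line _ _ _ _ _ (fun h => h * dot v w + dot xi w)).
  by move=> h; rewrite dotDl dotZl.
by apply: is_derive_eq; rewrite /GRing.scale /=; ring.
Qed.

Lemma osc_partial th f i : rapid f ->
  partial i (osc th f) = fun xi => 2 * pi * osc (th + pi / 2) (fun x => x 0 i * f x) xi.
Proof.
move=> rf; apply/funext => xi; rewrite /partial (osc_differentiable th xi rf).2.
by rewrite dot_delta mxE.
Qed.

Lemma derive_along f (x v : V) (t : R) : differentiable f (t *: v + x) ->
  is_derive t (1:R) (fun h : R => f (h *: v + x)) ('D_v f (t *: v + x)).
Proof.
move=> df; have d1 : derivable f (t *: v + x) v by exact: diff_derivable.
have E : (fun h : R => h^-1 *: (((fun h : R => f (h *: v + x)) \o shift t) (h *: (1:R)) -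
    f (t *: v + x))) =
  (fun h : R => h^-1 *: ((f \o shift (t *: v + x)) (h *: v) - f (t *: v + x))).
  by apply/funext => h /=; congr (_ *: (f _ - _)); rewrite [h *: (1:R)]mulr1 scalerDl addrA.
by split; [rewrite /derivable E|rewrite /derive E].
Qed.

Lemma rapid_line f (x : V) i (t : R) : rapid f ->
  is_derive t (1:R) (fun h : R => f (h *: delta_mx 0 i + x)) (partial i f (t *: delta_mx 0 i + x)).
Proof. by move=> rf; apply: derive_along; exact: rapid_differentiable. Qed.

(** A second order Taylor estimate along a coordinate with an integrable majorant:
    points at distance at most 1 have comparable weights. *)
Lemma rapid_difference f i : rapid f -> exists C, forall (h : R) x, `|h| <= 1 ->
  `|f (h *: delta_mx 0 i + x) - f x - h * partial i f x| <= C * h ^+ 2 * decay_bound x.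
Proof.
move=> rf; have rf1 := rapid_partial i rf; have rf2 := rapid_partial i rf1.
have [C0 fC] := rapid_weight (2 * n) rf2.
exists (2 ^+ (2 * n) * C0) => h x h1.
have b2 t : `|t| <= 1 -> `|partial i (partial i f) (t *: delta_mx 0 i + x)| <=
    2 ^+ (2 * n) * C0 * decay_bound x.
  move=> t1; apply: (@weight_le_decay R n (fun x => partial i (partial i f) (t *: delta_mx 0 i + x))).
  have := fC (t *: delta_mx 0 i + x); set y := t *: _ + x => fy.
  have xy : 1 + `|x| <= 2 * (1 + `|y|).
    have -> : x = y - t *: delta_mx 0 i by rewrite /y addrC addKr.
    have d1 : `|t *: delta_mx 0 i : V| <= 1.
      rewrite normrZ; apply: le_trans t1; rewrite ler_piMr//.
      rewrite /Num.norm /= mx_normrE; apply: bigmax_le => // -[a b] _ /=.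
      by rewrite mxE; case: (_ && _); rewrite ?normr0 ?normr1.
    have := ler_normB y (t *: delta_mx 0 i); have := normr_ge0 y; lra.
  apply: (@le_trans _ _ ((2 * (1 + `|y|)) ^+ (2 * n) * `|partial i (partial i f) y|)).
    by rewrite ler_wpM2r// lerXn2r ?nnegrE ?mulr_ge0 ?addr_ge0.
  by rewrite exprMn -mulrA ler_wpM2l// exprn_ge0.
set D := 2 ^+ (2 * n) * C0 * decay_bound x in b2 *.
have D0 : 0 <= D by apply: le_trans (b2 0 _); rewrite ?normr0.
have small t : Num.min h 0 <= t <= Num.max h 0 -> `|t| <= `|h| by exact: norm_between0.
have d1 t : `|t| <= `|h| -> `|partial i f (t *: delta_mx 0 i + x) - partial i f x| <= D * `|t|.
  move=> th; have := @mean_value_le R (fun s => partial i f (s *: delta_mx 0 i + x))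
    (fun s => partial i (partial i f) (s *: delta_mx 0 i + x)) D t 0 (fun s => rapid_line x i s rf1).
  rewrite scale0r add0r subr0; apply => s /norm_between0 st.
  by apply: b2; exact: le_trans st (le_trans th h1).
have := @mean_value_le R (fun s => f (s *: delta_mx 0 i + x) - s * partial i f x)
  (fun s => partial i f (s *: delta_mx 0 i + x) - partial i f x) (D * `|h|) h 0.
rewrite scale0r add0r mul0r !subr0 addrAC => H.
rewrite mulrAC -/D -real_normK ?num_real// expr2 mulrA; apply: H.
- move=> s; apply: is_deriveB; first exact: rapid_line.
  by apply: is_derive_eq; rewrite /GRing.scale /=; ring.
- move=> s /small sh; apply: le_trans (d1 s sh) _; exact: ler_wpM2l.
Qed.

Lemma small_eq0 (a K : R) : (forall h, 0 < h <= 1 -> `|a| <= K * h) -> a = 0.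
Proof.
move=> H; apply/eqP; rewrite -normr_le0; apply/ler_addgt0Pr => e e0; rewrite add0r.
have K0 : 0 < `|K| + 1 by rewrite ltr_wpDl.
pose h := Num.min 1 (e / (`|K| + 1)).
have h0 : 0 < h by rewrite lt_min ltr01 divr_gt0.
have h1 : h <= 1 by rewrite ge_min lexx.
have he : h <= e / (`|K| + 1) by rewrite ge_min lexx orbT.
apply: le_trans (H h _) _; first by rewrite h0.
apply: (@le_trans _ _ ((`|K| + 1) * h)).
  apply: ler_wpM2r; first exact: ltW.
  by apply: le_trans (ler_norm _) _; rewrite lerDl.
by rewrite mulrC -ler_pdivlMr.
Qed.

(** Integration by parts without a product rule: translating the integrand by h along
    a coordinate changes the phase by 2 pi h xi_j and f by h times its derivative, and
    the terms of first order in h have to cancel. *)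
Lemma osc_deriv th f j xi : rapid f ->
  osc (th + pi / 2) (partial j f) xi = 2 * pi * xi 0 j * osc th f xi.
Proof.
(* The formula for the phase th' is used at th + pi / 2, since a half period changes
   the sign. *)
suff key th' : rapid f ->
    osc th' (partial j f) xi = - (2 * pi * xi 0 j) * osc (th' + pi / 2) f xi.
  move=> rf; rewrite key// -[th + _ + _]addrA -splitr osc_phase//.
  by rewrite cospi sinpi mul0r addr0 mulN1r mulrN mulNr opprK.
move=> rf; have rf1 := rapid_partial j rf.
have [C fC] := rapid_difference j rf.
set a := 2 * pi * xi 0 j.
set A := osc th' f xi; set B := osc (th' + pi / 2) f xi.
set A1 := osc th' (partial j f) xi; set B1 := osc (th' + pi / 2) (partial j f) xi.
apply/eqP; rewrite -subr_eq0 mulNr opprK; apply/eqP.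
apply: (@small_eq0 _ (C * pi ^+ n + a ^+ 2 * `|A| + a ^+ 2 * `|B| + a ^+ 2 * `|A1| + `|a| * `|B1|)).
move=> h /andP[h0 h1]; have hn : `|h| <= 1 by rewrite ger0_norm//; exact: ltW.
pose eta := h * a.
have rfi (g : V -> R) t : rapid g -> lam.-integrable setT (EFin \o (fun x => cos (2 * pi * dot xi x + t) * g x)).
  exact: osc_integrable.
(* The integral A is computed after translating the variable of integration by h along
   the j-th coordinate. *)
have main : `|A - osc (th' + eta) f xi - h * osc (th' + eta) (partial j f) xi| <= C * h ^+ 2 * pi ^+ n.
  rewrite -oscZ//.
  have -> : A = \int[lam]_x (cos (2 * pi * dot xi x + (th' + eta)) * f (h *: delta_mx 0 j + x)).
    rewrite /A /osc -(@Rintegral_translate R n (h *: delta_mx 0 j)); last first.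
      by apply: measurable_funM; [exact: measurable_cos_dot|exact: rapid_measurable].
    apply: eq_Rintegral => x _; congr (cos _ * f _); last by rewrite addrC.
    by rewrite dotC dotDl dotZl dot_delta (dotC x) /eta /a; ring.
  have mc := measurable_cos_dot xi (th' + eta).
  have mfh : measurable_fun setT (fun x => f (h *: delta_mx 0 j + x)).
    under eq_fun do rewrite addrC.
    by apply: measurableT_comp (rapid_measurable rf) _; exact: measurable_rV_translate.
  have bound x : `|cos (2 * pi * dot xi x + (th' + eta)) * f (h *: delta_mx 0 j + x) -
      cos (2 * pi * dot xi x + (th' + eta)) * f x -
      cos (2 * pi * dot xi x + (th' + eta)) * (h * partial j f x)| <= C * h ^+ 2 * decay_bound x.
    rewrite -!mulrBr normrM; apply: le_trans (fC h x hn).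
    by rewrite ler_piMl// norm_cos_le1.
  have m3 : measurable_fun setT (fun x => cos (2 * pi * dot xi x + (th' + eta)) * f (h *: delta_mx 0 j + x) -
      cos (2 * pi * dot xi x + (th' + eta)) * f x -
      cos (2 * pi * dot xi x + (th' + eta)) * (h * partial j f x)).
    apply: measurable_funB; last first.
      by apply: measurable_funM => //; apply: measurable_funM => //; exact: rapid_measurable.
    apply: measurable_funB; first exact: measurable_funM.
    by apply: measurable_funM => //; exact: rapid_measurable.
  have i3 := decay_integrable m3 bound.
  have i1 := rfi f (th' + eta) rf.
  have i2 : lam.-integrable setT (EFin \o (fun x => cos (2 * pi * dot xi x + (th' + eta)) * (h * partial j f x))).
    exact: osc_integrable (rapidZ h rf1).
  rewrite /osc.
  have -> : \int[lam]_x (cos (2 * pi * dot xi x + (th' + eta)) * f (h *: delta_mx 0 j + x)) =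
      \int[lam]_x (cos (2 * pi * dot xi x + (th' + eta)) * f (h *: delta_mx 0 j + x) -
      cos (2 * pi * dot xi x + (th' + eta)) * f x -
      cos (2 * pi * dot xi x + (th' + eta)) * (h * partial j f x)) +
      (\int[lam]_x (cos (2 * pi * dot xi x + (th' + eta)) * f x) +
       \int[lam]_x (cos (2 * pi * dot xi x + (th' + eta)) * (h * partial j f x))).
    rewrite -RintegralD// -RintegralD//.
      by apply: eq_Rintegral => x _; ring.
    by have := integrableD measurableT i1 i2; exact: eq_integrable.
  rewrite (_ : forall u v w : R, u + (v + w) - v - w = u); first exact: decay_Rintegral_le.
  by move=> u v w; ring.
rewrite (osc_phase th' eta xi rf) (osc_phase th' eta xi rf1) -/A -/B -/A1 -/B1 in main.
have c1 := norm_cos_sub1 eta; have s1 := norm_sin_subr eta.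
have s2 : `|sin eta| <= `|eta| by have := norm_sinB eta 0; rewrite sin0 !subr0.
have E2 : eta ^+ 2 = a ^+ 2 * h ^+ 2 by rewrite /eta exprMn mulrC.
have aE : `|eta| = `|a| * h by rewrite /eta normrM (gtr0_norm h0) mulrC.
have : `|h * (A1 + a * B)| <= (C * pi ^+ n + a ^+ 2 * `|A| + a ^+ 2 * `|B| + a ^+ 2 * `|A1| + `|a| * `|B1|) * h * h.
  have -> : h * (A1 + a * B) = - (A - (cos eta * A + sin eta * B) - h * (cos eta * A1 + sin eta * B1))
    - (cos eta - 1) * A - (sin eta - eta) * B - h * (cos eta - 1) * A1 - h * sin eta * B1.
    by rewrite /eta; ring.
  have n1 : `|(cos eta - 1) * A| <= a ^+ 2 * h ^+ 2 * `|A| by rewrite normrM -E2 ler_wpM2r.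
  have n2 : `|(sin eta - eta) * B| <= a ^+ 2 * h ^+ 2 * `|B| by rewrite normrM -E2 ler_wpM2r.
  have n3 : `|h * (cos eta - 1) * A1| <= a ^+ 2 * h ^+ 2 * `|A1|.
    rewrite !normrM ler_wpM2r// -E2 (gtr0_norm h0); apply: le_trans c1.
    by rewrite ler_piMl.
  have n4 : `|h * sin eta * B1| <= `|a| * h ^+ 2 * `|B1|.
    rewrite normrM; apply: ler_wpM2r => //; rewrite normrM (gtr0_norm h0).
    rewrite (_ : `|a| * h ^+ 2 = h * `|eta|); last by rewrite aE expr2; ring.
    by apply: ler_wpM2l => //; exact: ltW.
  have tri (u p q r s : R) : `|- u - p - q - r - s| <= `|u| + `|p| + `|q| + `|r| + `|s|.
    by do 4 (apply: le_trans (ler_normB _ _) _; rewrite lerD2r); rewrite normrN.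
  apply: le_trans (tri _ _ _ _ _) _; move: main n1 n2 n3 n4; set z := h ^+ 2.
  have -> : forall K, K * h * h = K * z by move=> K; rewrite /z expr2 mulrA.
  lra.
rewrite normrM (gtr0_norm h0) [leRHS]mulrC ler_pM2l//.
Qed.

End oscillatory_rapid.

(** * Schwartz functions and Gaussians *)

Section oscillatory_schwartz.
Context (R : realType) (n : nat).
Local Notation V := 'rV[R]_n.
Implicit Types (f g : V -> R) (xi : V) (th : R).

(** Each factor xi_j is traded for a derivative of f. *)
Lemma osc_coord_decay k f j : rapid f ->
  exists C, forall th xi, `|xi 0 j| ^+ k * `|osc th f xi| <= C.
Proof.
elim: k f => [|k IH] f rf.
  by have [C fC] := osc_le rf; exists C => th xi; rewrite expr0 mul1r.
have [C HC] := IH _ (rapid_partial j rf); exists C => th xi.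
apply: le_trans (HC (th + pi / 2) xi); rewrite osc_deriv// normrM exprSr.
rewrite -!mulrA; apply: ler_wpM2l; first exact: exprn_ge0.
apply: ler_wpM2r => //; rewrite mulrA normrM ler_peMl//.
have := @pi_ge2 R; rewrite ger0_norm ?mulr_ge0 ?pi_ge0//; lra.
Qed.

Lemma rV_norm_coord (x : V) : `|x| = 0 \/ exists j, `|x| = `|x 0 j|.
Proof.
have [->|x0] := eqVneq `|x| 0; [by left|right].
have [|[a b] xE] := @mx_norm_neq0 _ _ _ x; first by move: x0; rewrite /Num.norm.
by exists b; rewrite {1}/Num.norm /= xE ord1.
Qed.

Lemma osc_decay k f : rapid f ->
  exists C, forall th xi, (1 + `|xi|) ^+ k * `|osc th f xi| <= C.
Proof.
move=> rf; have [C0 H0] := osc_le rf.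
have /choice[C HC] : forall j, exists C, forall th xi, `|xi 0 j| ^+ k * `|osc th f xi| <= C.
  by move=> j; exact: osc_coord_decay.
have C0_ge0 : 0 <= C0 by apply: le_trans (H0 0 0).
have CS_ge0 : 0 <= \sum_j `|C j| by apply: sumr_ge0.
exists (2 ^+ k * (C0 + \sum_j `|C j|)) => th xi.
have [x1|x1] := leP `|xi| 1.
  apply: (@le_trans _ _ (2 ^+ k * C0)); last by rewrite ler_wpM2l ?exprn_ge0// lerDl.
  apply: ler_pM; [exact: weight_ge0|exact: normr_ge0| |exact: H0].
  by rewrite lerXn2r ?nnegrE ?addr_ge0//; lra.
have [xi0|[j xj]] := rV_norm_coord xi; first by move: x1; rewrite xi0 ltr10.
apply: (@le_trans _ _ (2 ^+ k * `|C j|)); last first.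
  rewrite ler_wpM2l ?exprn_ge0// (bigD1 j)//= addrCA lerDl addr_ge0//.
  exact: sumr_ge0.
apply: (@le_trans _ _ (2 ^+ k * (`|xi 0 j| ^+ k * `|osc th f xi|))).
  rewrite mulrA ler_wpM2r// -exprMn -xj lerXn2r ?nnegrE ?mulr_ge0 ?addr_ge0//; lra.
by rewrite ler_wpM2l ?exprn_ge0// (le_trans (HC j th xi))// ler_norm.
Qed.

(** The transforms of all rapidly decreasing functions at all phases form a class that
    is stable under partial derivatives and decays. *)
Lemma osc_rapid th f : rapid f -> rapid (osc th f).
Proof.
pose G := [set h : V -> R | exists c th f, rapid f /\ h = fun xi => c * osc th f xi].
move=> rf; apply: (@rapid_class _ _ G).
- move=> _ x [c [t [g [rg ->]]]]; apply: differentiableM; first exact: differentiable_cst.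
  by have [] := osc_differentiable t x rg.
- move=> _ i [c [t [g [rg ->]]]].
  exists (c * (2 * pi)), (t + pi / 2), (fun x : V => x 0 i * g x); split; first exact: rapid_coord.
  apply/funext => x; rewrite partialZ; last by have [] := osc_differentiable t x rg.
  by rewrite osc_partial// mulrA.
- move=> _ k [c [t [g [rg ->]]]]; have [C HC] := osc_decay k rg.
  by exists (`|c| * C) => x; rewrite normrM mulrCA ler_wpM2l.
- by exists 1, th, f; split => //; apply/funext => x; rewrite mul1r.
Qed.

(** The seminorms of order k involve only finitely many words of indices. *)
Lemma words_bounded k (F : seq 'I_n -> V -> R) :
  (forall s, exists C, forall x, F s x <= C) ->
  exists C, forall s x, (size s <= k)%N -> F s x <= C.
Proof.
elim: k F => [|k IH] F HF.
  by have [C HC] := HF [::]; exists C => -[|//] x _.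
have [C0 H0] := HF [::].
have /choice[C HC] : forall i : 'I_n, exists C, forall s x, (size s <= k)%N -> F (i :: s) x <= C.
  by move=> i; apply: IH => s; exact: HF.
exists (`|C0| + \sum_i `|C i|) => -[|i s] x ks.
  by rewrite (le_trans (H0 x))// (le_trans (ler_norm _))// lerDl sumr_ge0.
rewrite (le_trans (HC i s x ks))// (bigD1 i)//= addrCA (le_trans (ler_norm _))// lerDl.
by rewrite addr_ge0// sumr_ge0.
Qed.

(** The modulus dominates real and imaginary parts, and a weight of order k on a
    derivative of order l is covered by the seminorm of order max(k, l). *)
Lemma schwartz_rapid (phi : V -> R[i]) : schwartz phi <->
  rapid (@complex.Re R \o phi) /\ rapid (@complex.Im R \o phi).
Proof.
split=> [[[s1 s2] fin]|[[s1 d1] [s2 d2]]]; last first.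
  split => // k.
  have HF s : exists C, forall x, (1 + `|x|) ^+ k * modulus (cpartials s phi x) <= C.
    have [C HC] := d1 k s; have [D HD] := d2 k s; exists (C + D) => x.
    apply: le_trans (lerD (HC x) (HD x)); rewrite -mulrDr ler_wpM2l ?weight_ge0//.
    exact: modulus_le_ReIm.
  have [C HC] := words_bounded k HF.
  apply: (@le_lt_trans _ _ C%:E); last exact: ltry.
  apply: ub_ereal_sup => _ [[s x] /= ks <-]; rewrite lee_fin; exact: HC.
have key k s : exists C, forall x, (1 + `|x|) ^+ k * modulus (cpartials s phi x) <= C.
  pose K := maxn k (size s); exists (fine (seminorm K K phi)) => x.
  have sfin : seminorm K K phi \is a fin_num by rewrite ge0_fin_numE ?fin// seminorm_ge0.
  rewrite -lee_fin fineK//.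
  apply: (@le_trans _ _ ((1 + `|x|) ^+ K * modulus (cpartials s phi x))%:E).
    by rewrite lee_fin ler_wpM2r ?modulus_ge0// ler_weXn2l ?leq_maxl// lerDl.
  by apply: ereal_sup_ubound; exists (s, x) => //=; exact: leq_maxr.
split; split => // k s; have [C HC] := key k s; exists C => x; apply: le_trans (HC x).
  by rewrite ler_wpM2l ?weight_ge0//; exact: (normr_Re_le (cpartials s phi x)).
by rewrite ler_wpM2l ?weight_ge0//; exact: (normr_Im_le (cpartials s phi x)).
Qed.

Lemma schwartz_cmeasurable (phi : V -> R[i]) : schwartz phi -> cmeasurable setT phi.
Proof. by move=> /schwartz_rapid[r1 r2]; split; exact: rapid_measurable. Qed.

Lemma schwartz_bounded (phi : V -> R[i]) : schwartz phi ->
  exists C, forall x, modulus (phi x) <= C.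
Proof.
move=> /schwartz_rapid[r1 r2].
have [C HC] := rapid_weight 0 r1; have [D HD] := rapid_weight 0 r2.
exists (C + D) => x; apply: le_trans (modulus_le_ReIm _) _; apply: lerD.
  by have := HC x; rewrite expr0 mul1r.
by have := HD x; rewrite expr0 mul1r.
Qed.

End oscillatory_schwartz.

Section gaussians.
Context (R : realType) (n : nat).
Local Notation V := 'rV[R]_n.
Local Notation lam := (lebesgue_measure_rV R n).
Local Notation TR := (measurableTypeR R).
Local Notation leb := (@lebesgue_measure R).
Implicit Types (f g q : V -> R) (s : R).

Definition gauss s (x : V) : R := expR (- (s * dot x x)).

Lemma is_derive_line_gauss s (x : V) i :
  is_derive (0:R) 1 (fun h : R => gauss s (h *: delta_mx 0 i + x)) (- (2 * s * x 0 i) * gauss s x).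
Proof.
have E : (fun h : R => gauss s (h *: delta_mx 0 i + x)) =
    (fun h : R => expR (- (s * (h * h + 2 * h * x 0 i + dot x x)))).
  apply/funext => h; rewrite /gauss; congr expR; congr (- (s * _)).
  rewrite dotDl dotZl dot_delta !(dotC _ (_ *: _ + _)) !mxE !eqxx /=.
  rewrite dotDl dotZl dot_delta; ring.
rewrite E.
have d1 : is_derive (0:R) 1 (fun h : R => - (s * (h * h + 2 * h * x 0 i + dot x x))) (- (2 * s * x 0 i)).
  by apply: is_derive_eq; rewrite /GRing.scale /=; ring.
have := @is_derive1_comp R expR _ 0 _ _ (is_derive_expR _) d1.
by rewrite !(mul0r, mulr0, add0r) mulrC /gauss; exact.
Qed.

Lemma differentiable_dot_sq (x : V) : differentiable (fun y => dot y y) x.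
Proof.
rewrite (_ : (fun y => dot y y) = \sum_(i < n) (fun y : V => y 0 i * y 0 i)); last first.
  by apply/funext => y; rewrite fct_sumE.
by apply: differentiable_sum => i; apply: differentiableM; exact: differentiable_coord.
Qed.

Lemma gauss_differentiable s x : differentiable (gauss s) x.
Proof.
apply: (@differentiable_comp_real _ _ expR); last by [].
rewrite (_ : (fun y => _) = (fun y : V => (- s) * dot y y)).
  by apply: differentiableM; [exact: differentiable_cst|exact: differentiable_dot_sq].
by apply/funext => y; rewrite mulNr.
Qed.

Lemma gauss_partial s i : partial i (gauss s) = fun x => - (2 * s * x 0 i) * gauss s x.
Proof.
apply/funext => x.
by apply: (@derive_line _ _ _ _ _ (fun h => gauss s (h *: delta_mx 0 i + x))) => //; exact: is_derive_line_gauss.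
Qed.

Lemma gauss_gt0 s x : 0 < gauss s x. Proof. exact: expR_gt0. Qed.

Lemma gauss_le1 s (x : V) : 0 <= s -> gauss s x <= 1.
Proof. by move=> s0; rewrite -[leRHS]expR0 ler_expR oppr_le0 mulr_ge0 ?dot_ge0. Qed.

Lemma gauss_sub1 s (x : V) : 0 <= s -> `|1 - gauss s x| <= s * dot x x.
Proof.
move=> s0; rewrite ger0_norm ?subr_ge0 ?gauss_le1//.
by have := expR_ge1Dx (- (s * dot x x)); rewrite -/(gauss s x); lra.
Qed.

Lemma norm_sq_le_dot (x : V) : `|x| ^+ 2 <= dot x x.
Proof.
have [->|[j ->]] := rV_norm_coord x; first by rewrite expr0n/= dot_ge0.
rewrite real_normK ?num_real// /dot (bigD1 j)//= expr2 lerDl.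
by apply: sumr_ge0 => i _; rewrite -expr2 sqr_ge0.
Qed.

Lemma gauss_weight s m : 0 < s -> exists C, forall x, (1 + `|x|) ^+ m * gauss s x <= C.
Proof.
move=> s0; pose s1 := s / m.+1%:R; have s10 : 0 < s1 by rewrite divr_gt0.
pose c := 2 + s1^-1; have c0 : 0 < c by rewrite addr_gt0// invr_gt0.
exists (c ^+ m.+1) => x; set a := `|x|.
have a0 : 0 <= a by exact: normr_ge0.
have step : 1 + a <= c * expR (s1 * a ^+ 2).
  apply: (@le_trans _ _ (c * (1 + s1 * a ^+ 2))).
    rewrite (_ : c * (1 + s1 * a ^+ 2) = 2 + s1^-1 + 2 * (s1 * a ^+ 2) + a ^+ 2); last first.
      by rewrite /c; field; rewrite gt_eqF.
    have : 0 <= s1 * a ^+ 2 by rewrite mulr_ge0 ?sqr_ge0 ?ltW.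
    have : 0 <= s1^-1 by rewrite invr_ge0 ltW.
    have : 0 <= (a - 1) ^+ 2 by exact: sqr_ge0.
    rewrite sqrrB expr1n mulr1; lra.
  by rewrite ler_wpM2l ?expR_ge1Dx// ltW.
apply: (@le_trans _ _ ((1 + a) ^+ m.+1 * gauss s x)).
  apply: ler_wpM2r; first exact/ltW/gauss_gt0.
  by rewrite ler_weXn2l// lerDl.
apply: (@le_trans _ _ ((c * expR (s1 * a ^+ 2)) ^+ m.+1 * gauss s x)).
  apply: ler_wpM2r; first exact/ltW/gauss_gt0.
  rewrite lerXn2r ?nnegrE ?addr_ge0//.
  by rewrite mulr_ge0 ?expR_ge0// ltW.
rewrite exprMn -mulrA; apply: ler_piMr; first by rewrite exprn_ge0// ltW.
rewrite -expRM_natl /gauss -expRD -[leRHS]expR0 ler_expR.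
rewrite (_ : m.+1%:R * (s1 * a ^+ 2) = s * a ^+ 2); last by rewrite /s1; field.
by rewrite subr_le0; apply: ler_wpM2l; [exact: ltW|exact: norm_sq_le_dot].
Qed.

Definition logistic (t : R) : R := (1 + expR (- t))^-1.

(** Polynomials in the coordinates and in logistic functions of one coordinate: an
    algebra stable under partial derivatives, because the logistic function satisfies
    l' = l (1 - l). Its products with Gaussians are the test functions that separate
    measures. *)
Inductive symbol : (V -> R) -> Prop :=
| symbol_cst c : symbol (fun=> c)
| symbol_coord j : symbol (fun x => x 0 j)
| symbol_logistic j a b : symbol (fun x => logistic (a * x 0 j + b))
| symbol_add f g : symbol f -> symbol g -> symbol (fun x => f x + g x)
| symbol_mul f g : symbol f -> symbol g -> symbol (fun x => f x * g x).

Lemma is_derive_logistic (t : R) : is_derive t (1:R) logistic (logistic t * (1 - logistic t)).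
Proof.
have p0 : 1 + expR (- t) != 0 by rewrite gt_eqF// addr_gt0// expR_gt0.
have d1 : is_derive t (1:R) (fun t : R => 1 + expR (- t)) (- expR (- t)).
  by apply: is_derive_eq; rewrite /GRing.scale /=; ring.
have := @is_deriveV R (fun t : R => 1 + expR (- t)) t _ _ p0 d1 => h.
apply: (is_derive_eq h).
by rewrite /GRing.scale /= /logistic; field.
Qed.

Lemma logistic_bound (t : R) : 0 <= logistic t <= 1.
Proof.
have p0 : 0 < 1 + expR (- t) by rewrite addr_gt0// expR_gt0.
by rewrite /logistic invr_ge0 ltW//= invf_le1// lerDl expR_ge0.
Qed.

Lemma symbol_differentiable q x : symbol q -> differentiable q x.
Proof.
elim=> [c|j|j a b|f g _ df _ dg|f g _ df _ dg].
- exact: differentiable_cst.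
- exact: differentiable_coord.
- apply: (@differentiable_comp_real _ _ logistic (fun x : V => a * x 0 j + b)).
    apply: differentiableD; last exact: differentiable_cst.
    by apply: differentiableM; [exact: differentiable_cst|exact: differentiable_coord].
  by have [] := is_derive_logistic (a * x 0 j + b).
- exact: differentiableD.
- exact: differentiableM.
Qed.

Lemma symbol_partial q i : symbol q -> symbol (partial i q).
Proof.
elim=> [c|j|j a b|f g sf df sg dg|f g sf df sg dg].
- by rewrite partial_cst; exact: symbol_cst.
- by rewrite partial_coord; exact: symbol_cst.
- rewrite (_ : partial i _ = fun x => (a * (i == j)%:R) *
    (logistic (a * x 0 j + b) * (1 + (-1) * logistic (a * x 0 j + b)))).
    do 2 (apply: symbol_mul; first by [exact: symbol_cst|exact: symbol_logistic]).
    apply: symbol_add; first exact: symbol_cst.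
    by apply: symbol_mul; [exact: symbol_cst|exact: symbol_logistic].
  apply/funext => x.
  apply: (@derive_line _ _ _ _ _ (fun h => logistic (h * (a * (i == j)%:R) + (a * x 0 j + b)))).
    by move=> h; congr logistic; rewrite !mxE eqxx/= eq_sym; ring.
  have d1 : is_derive (0:R) 1 (fun h : R => h * (a * (i == j)%:R) + (a * x 0 j + b)) (a * (i == j)%:R).
    by apply: is_derive_eq; rewrite /GRing.scale /=; ring.
  have dl : is_derive (0 * (a * (i == j)%:R) + (a * x 0 j + b)) (1:R) logistic
      (logistic (a * x 0 j + b) * (1 - logistic (a * x 0 j + b))).
    by rewrite mul0r add0r; exact: is_derive_logistic.
  have := @is_derive1_comp R logistic _ 0 _ _ dl d1.
  by rewrite mulN1r [X in is_derive _ _ _ X -> _]mulrC; exact.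
- rewrite (_ : partial i _ = fun x => partial i f x + partial i g x); first exact: symbol_add.
  by apply/funext => x; rewrite partialD//; exact: symbol_differentiable.
- rewrite (_ : partial i _ = fun x => f x * partial i g x + partial i f x * g x).
    by apply: symbol_add; exact: symbol_mul.
  by apply/funext => x; rewrite partialM//; exact: symbol_differentiable.
Qed.

Lemma symbol_growth q : symbol q -> exists C m, forall x, `|q x| <= C * (1 + `|x|) ^+ m.
Proof.
elim=> [c|j|j a b|f g _ [C [m Hf]] _ [D [k Hg]]|f g _ [C [m Hf]] _ [D [k Hg]]].
- by exists `|c|, 0%N => x; rewrite expr0 mulr1.
- exists 1, 1%N => x; rewrite mul1r expr1 (le_trans (norm_coord_le x j))// lerDr.
  exact: ler01.
- exists 1, 0%N => x; rewrite expr0 mulr1.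
  by have /andP[l0 l1] := logistic_bound (a * x 0 j + b); rewrite ger0_norm.
- exists (`|C| + `|D|), (maxn m k) => x; apply: le_trans (ler_normD _ _) _; rewrite mulrDl.
  have w1 := weight_ge0 x.
  apply: lerD.
    apply: le_trans (Hf x) _; apply: (@le_trans _ _ (`|C| * (1 + `|x|) ^+ m)).
      by rewrite ler_wpM2r ?w1// ler_norm.
    by rewrite ler_wpM2l// ler_weXn2l ?leq_maxl// lerDl.
  apply: le_trans (Hg x) _; apply: (@le_trans _ _ (`|D| * (1 + `|x|) ^+ k)).
    by rewrite ler_wpM2r ?w1// ler_norm.
  by rewrite ler_wpM2l// ler_weXn2l ?leq_maxr// lerDl.
- exists (`|C| * `|D|), (m + k)%N => x; rewrite normrM exprD mulrACA; apply: ler_pM => //.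
    by apply: le_trans (Hf x) _; rewrite ler_wpM2r ?weight_ge0// ler_norm.
  by apply: le_trans (Hg x) _; rewrite ler_wpM2r ?weight_ge0// ler_norm.
Qed.

Lemma symbol_gauss_rapid q s : 0 < s -> symbol q -> rapid (fun x => q x * gauss s x).
Proof.
move=> s0 sq; pose G := [set h : V -> R | exists q, symbol q /\ h = fun x => q x * gauss s x].
apply: (@rapid_class _ _ G); last by exists q.
- move=> _ x [p [sp ->]]; apply: differentiableM; first exact: symbol_differentiable.
  exact: gauss_differentiable.
- move=> _ i [p [sp ->]].
  exists (fun x => p x * ((- (2 * s)) * x 0 i) + partial i p x); split.
    apply: symbol_add; last exact: symbol_partial.
    apply: symbol_mul => //; apply: symbol_mul; [exact: symbol_cst|exact: symbol_coord].
  apply/funext => x; rewrite partialM; [|exact: symbol_differentiable|exact: gauss_differentiable].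
  by rewrite gauss_partial; ring.
- move=> _ k [p [sp ->]]; have [C [m HC]] := symbol_growth sp.
  have [D HD] := gauss_weight (k + m) s0; exists (`|C| * D) => x.
  rewrite normrM (gtr0_norm (gauss_gt0 s x)).
  apply: (@le_trans _ _ (`|C| * ((1 + `|x|) ^+ (k + m) * gauss s x))); last by rewrite ler_wpM2l.
  rewrite exprD !mulrA; apply: ler_wpM2r; first by rewrite ltW ?gauss_gt0.
  rewrite [leRHS]mulrAC [leLHS]mulrC; apply: ler_wpM2r; first exact: weight_ge0.
  by apply: le_trans (HC x) _; apply: ler_wpM2r; [exact: weight_ge0|exact: ler_norm].
Qed.

Lemma gauss_rapid s : 0 < s -> rapid (gauss s).
Proof.
move=> s0; have := symbol_gauss_rapid s0 (symbol_cst 1).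
by under eq_fun do rewrite mul1r.
Qed.

End gaussians.

(** * The transform of a Gaussian *)

Section gaussian_transform.
Context (R : realType) (n : nat).
Local Notation V := 'rV[R]_n.
Local Notation lam := (lebesgue_measure_rV R n).
Local Notation TR := (measurableTypeR R).
Local Notation leb := (@lebesgue_measure R).
Implicit Types (f g : V -> R) (s r : R) (x xi : V) (th : R).

(** The normalization of the density of the normal distribution with variance 1 / (2
    s). *)
Lemma integral_gauss1 s : 0 < s ->
  (\int[leb]_t (expR (- (s * t ^+ 2)))%:E = (Num.sqrt (pi / s))%:E)%E.
Proof.
move=> s0; pose sg := (Num.sqrt (2 * s))^-1.
have sg0 : sg != 0 by rewrite invr_neq0// gt_eqF// sqrtr_gt0 mulr_gt0.
have sg2 : sg ^+ 2 = (2 * s)^-1 by rewrite /sg exprVn sqr_sqrtr// mulr_ge0// ltW.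
have pos : 0 < pi / s by rewrite divr_gt0// pi_gt0.
have E t : expR (- (s * t ^+ 2)) = Num.sqrt (pi / s) * normal_pdf 0 sg t.
  rewrite normal_pdfE// /normal_peak /normal_fun subr0 sg2.
  have -> : (2 * s)^-1 * pi *+ 2 = pi / s by rewrite -mulr_natl; field; rewrite gt_eqF.
  rewrite mulVKf; last by rewrite gt_eqF// sqrtr_gt0.
  by congr expR; rewrite -mulr_natl; field; rewrite gt_eqF.
under eq_integral do rewrite E EFinM.
rewrite ge0_integralZl//=.
- by rewrite integral_normal_pdf mule1.
- by apply/measurable_EFinP; exact: measurable_normal_pdf.
- by move=> t _; rewrite lee_fin normal_pdf_ge0.
Qed.

Definition gauss_mass s : R := Num.sqrt (pi / s) ^+ n.

Lemma integral_gauss s : 0 < s -> \int[lam]_x gauss s x = gauss_mass s.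
Proof.
move=> s0; rewrite /Rintegral.
rewrite -[RHS]/(fine (gauss_mass s)%:E) /gauss_mass.
rewrite -(@integral_rV_prod R n (fun t => expR (- (s * t ^+ 2))) (Num.sqrt (pi / s)) _ _ (integral_gauss1 s0)).
- congr fine; apply: eq_integral => x _; congr EFin.
  rewrite /gauss /dot mulr_sumr -sumrN expR_sum.
  by apply: eq_bigr => i _; rewrite expr2.
- apply: (measurableT_comp (f := @expR R)) => //.
  by apply: measurable_funN; apply: measurable_funM => //; exact: measurable_funX.
- by move=> t; exact: expR_ge0.
Qed.

Lemma gauss_massM s r (c : R) : 0 < s -> 0 < r -> pi / s * (pi / r) = c ->
  gauss_mass s * gauss_mass r = Num.sqrt c ^+ n.
Proof.
move=> s0 r0 <-; rewrite /gauss_mass -exprMn -sqrtrM//.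
by rewrite divr_ge0 ?pi_ge0// ltW.
Qed.

Lemma osc_grad_gauss th s xi : 0 < s ->
  osc_grad th (gauss s) xi = (- (2 * (pi ^+ 2 / s)) * osc th (gauss s) xi) *: xi.
Proof.
move=> s0; have rg := gauss_rapid n s0.
apply/rowP => i; rewrite !mxE.
have -> : (fun x : V => x 0 i * gauss s x) = (fun x => - (2 * s)^-1 * partial i (gauss s) x).
  by apply/funext => x; rewrite gauss_partial; field; rewrite gt_eqF.
rewrite oscZ; last exact: rapid_partial.
by rewrite osc_deriv//; field; rewrite gt_eqF.
Qed.

(** The transform of a Gaussian satisfies the same differential equation as a Gaussian
    of reciprocal width, and is therefore a multiple of it. *)
Lemma osc_gauss th s xi : 0 < s ->
  osc th (gauss s) xi = cos th * gauss_mass s * gauss (pi ^+ 2 / s) xi.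
Proof.
move=> s0; have rg := gauss_rapid n s0.
set r := pi ^+ 2 / s.
(* Along the ray through xi the transform times the inverse of the expected Gaussian
   is constant. *)
pose H (t : R) := osc th (gauss s) (t *: xi + 0) * expR (r * dot xi xi * t ^+ 2).
have dH (t : R) : is_derive t (1:R) H 0.
  have [df DE] := osc_differentiable th (t *: xi + 0) rg.
  have d1 := derive_along df.
  have d2 : is_derive t (1:R) (fun t : R => r * dot xi xi * t ^+ 2) (r * dot xi xi * (2 * t)).
    by apply: is_derive_eq; rewrite /GRing.scale /=; ring.
  have d3 := @is_derive1_comp R expR _ t _ _ (is_derive_expR _) d2.
  apply: (is_derive_eq (is_deriveM d1 d3)).
  rewrite DE osc_grad_gauss// dotC dotZl addr0 dotZl /GRing.scale /= -/r; ring.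
have := @mean_value_le R H (fun=> 0) 0 1 0 dH.
rewrite normr0 mul0r normr_le0 subr_eq0 => /(_ (fun _ _ => lexx 0))/eqP.
rewrite /H scale1r scale0r !addr0 expr1n mulr1 expr0n /= mulr0 expR0 mulr1 => h.
have -> : osc th (gauss s) xi = osc th (gauss s) xi * expR (r * dot xi xi) * gauss r xi.
  by rewrite /gauss -mulrA -expRD subrr expR0 mulr1.
rewrite h; congr (_ * _); rewrite /osc -integral_gauss// -RintegralZl//.
  apply: eq_Rintegral => x _; congr (cos _ * _).
  by rewrite /dot big1 ?mulr0 ?add0r// => i _; rewrite mxE mul0r.
have [C fC] := rapid_decay 0 rg; apply: (@decay_integrable _ _ _ C).
  exact: rapid_measurable.
by move=> x; have := fC x; rewrite expr0 mul1r.
Qed.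

Lemma rapid_lipschitz f : rapid f -> exists2 L, 0 <= L & forall x z, `|f (z + x) - f x| <= L * `|z|.
Proof.
move=> rf.
have /choice[C HC] : forall i, exists C, forall x, `|partial i f x| <= C.
  move=> i; have [C HC] := rapid_weight 0 (rapid_partial i rf); exists C => x.
  by have := HC x; rewrite expr0 mul1r.
exists (\sum_i C i) => [|x z]; first by apply: sumr_ge0 => i _; exact: le_trans (HC i 0).
have Dz y : `|'D_z f y| <= (\sum_i C i) * `|z|.
  have df := rapid_differentiable y rf.
  rewrite deriveE// {1}[z]row_sum_delta linear_sum.
  apply: le_trans (ler_norm_sum _ _ _) _; rewrite mulr_suml; apply: ler_sum => i _.
  rewrite linearZ /= -deriveE// normrZ mulrC; apply: ler_pM => //; first exact: HC.
  exact: norm_coord_le.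
have := @mean_value_le R (fun t => f (t *: z + x)) (fun t => 'D_z f (t *: z + x))
  ((\sum_i C i) * `|z|) 1 0 (fun t => derive_along (rapid_differentiable _ rf)).
by rewrite scale1r scale0r add0r subr0 normr1 mulr1; apply => t _; exact: Dz.
Qed.

(** Half of the exponent absorbs the factor |z| at the scale 1 / k. *)
Lemma norm_gauss_le (k : R) (z : V) : 0 < k ->
  `|z| * gauss (k ^+ 2) z <= k^-1 * gauss (k ^+ 2 / 2) z.
Proof.
move=> k0; have -> : gauss (k ^+ 2) z = gauss (k ^+ 2 / 2) z * gauss (k ^+ 2 / 2) z.
  by rewrite /gauss -expRD; congr expR; field.
rewrite mulrA; apply: ler_wpM2r; first exact/ltW/gauss_gt0.
rewrite -[leRHS]mulr1 ler_pdivlMl// /gauss expRN mulrA ler_pdivrMr ?expR_gt0// mul1r.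
pose t := k * `|z|.
apply: (@le_trans _ _ (1 + t ^+ 2 / 2)).
  have : 0 <= (t - 1) ^+ 2 by exact: sqr_ge0.
  rewrite sqrrB expr1n mulr1 -/t; lra.
apply: le_trans (expR_ge1Dx _) _; rewrite ler_expR /t exprMn mulrAC; apply: ler_wpM2l.
  by rewrite divr_ge0// sqr_ge0.
exact: norm_sq_le_dot.
Qed.

Lemma gauss_translate_rapid f s x : 0 < s -> rapid f ->
  lam.-integrable setT (EFin \o (fun y => gauss s (y - x) * f y)).
Proof.
move=> s0 rf; apply: (@rapid_mul_integrable _ _ _ _ 1) => //.
  apply: measurableT_comp (rapid_measurable (gauss_rapid n s0)) _.
  exact: measurable_rV_translate.
by move=> y; rewrite ger0_norm ?expR_ge0//; apply: gauss_le1; exact: ltW.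
Qed.

Lemma gauss_integrable s : 0 < s -> lam.-integrable setT (EFin \o @gauss R n s).
Proof.
move=> s0; have [C fC] := rapid_decay 0 (gauss_rapid n s0).
apply: (@decay_integrable _ _ _ C); first by apply: rapid_measurable; exact: gauss_rapid.
by move=> x; have := fC x; rewrite expr0 mul1r.
Qed.

(** The normalized Gaussian of width 1 / k has mass one, so that the error is the
    average of f(y) - f(x); as f is Lipschitz, this is an average of |y - x|, of order
    1 / k. *)
Lemma gauss_approx_identity f x : rapid f -> exists K, forall k, 0 < k ->
  `|gauss_mass (pi ^+ 2 / k ^+ 2) * \int[lam]_y (gauss (k ^+ 2) (y - x) * f y) - f x| <= K / k.
Proof.
move=> rf; have [L L0 HL] := rapid_lipschitz rf; exists (L * Num.sqrt 2 ^+ n) => k k0.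
have k2 : 0 < k ^+ 2 by rewrite exprn_gt0.
have k22 : 0 < k ^+ 2 / 2 by rewrite divr_gt0.
have pk : 0 < pi ^+ 2 / k ^+ 2 :> R by rewrite divr_gt0// exprn_gt0// pi_gt0.
have k0' : k != 0 by rewrite gt_eqF.
have pi0 : (pi : R) != 0 by rewrite gt_eqF// pi_gt0.
have E1 : gauss_mass (pi ^+ 2 / k ^+ 2) * gauss_mass (k ^+ 2) = 1.
  have c1 (p : R) : p != 0 -> p / (p ^+ 2 / k ^+ 2) * (p / k ^+ 2) = 1.
    by move=> p0; field; rewrite k0' p0.
  by rewrite (gauss_massM pk k2 (c1 _ pi0)) sqrtr1 expr1n.
have E2 : gauss_mass (pi ^+ 2 / k ^+ 2) * gauss_mass (k ^+ 2 / 2) = Num.sqrt 2 ^+ n.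
  have c2 (p : R) : p != 0 -> p / (p ^+ 2 / k ^+ 2) * (p / (k ^+ 2 / 2)) = 2.
    by move=> p0; field; rewrite k0' p0.
  exact: gauss_massM (c2 _ pi0).
set N := gauss_mass _ in E1 E2 *.
have N0 : 0 <= N by rewrite exprn_ge0// sqrtr_ge0.
have mfx : measurable_fun setT (fun z : V => f (z + x)).
  by apply: measurableT_comp (rapid_measurable rf) _; exact: measurable_rV_translate.
have mg : measurable_fun setT (@gauss R n (k ^+ 2)) by exact: rapid_measurable (gauss_rapid n k2).
have -> : \int[lam]_y (gauss (k ^+ 2) (y - x) * f y) = \int[lam]_z (gauss (k ^+ 2) z * f (z + x)).
  rewrite -(@Rintegral_translate R n x); last first.
    apply: measurable_funM; last exact: rapid_measurable.
    by apply: measurableT_comp mg _; exact: measurable_rV_translate.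
  by apply: eq_Rintegral => z _; rewrite addrK.
have bd z : `|gauss (k ^+ 2) z * (f (z + x) - f x)| <= L / k * gauss (k ^+ 2 / 2) z.
  rewrite normrM (gtr0_norm (gauss_gt0 _ _)).
  apply: (@le_trans _ _ (L * (`|z| * gauss (k ^+ 2) z))).
    rewrite mulrC mulrA; apply: ler_wpM2r; first exact/ltW/gauss_gt0.
    exact: HL.
  by rewrite -mulrA; apply: ler_wpM2l => //; exact: norm_gauss_le.
have i1 : lam.-integrable setT (EFin \o (fun z => gauss (k ^+ 2) z * f (z + x))).
  have [C fC] := rapid_weight 0 rf.
  rewrite (_ : (fun z => _) = (fun z => f (z + x) * gauss (k ^+ 2) z)); last first.
    by apply/funext => z; rewrite mulrC.
  apply: (rapid_mul_integrable (C := C) mfx _ (gauss_rapid n k2)) => z.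
  by have := fC (z + x); rewrite expr0 mul1r.
have i2 : lam.-integrable setT (EFin \o (fun z => gauss (k ^+ 2) z * f x)).
  rewrite (_ : (fun z => _) = (fun z => f x * gauss (k ^+ 2) z)); last first.
    by apply/funext => z; rewrite mulrC.
  by apply: integrable_scale; exact: gauss_integrable.
have i3 : lam.-integrable setT (EFin \o (fun z => L / k * gauss (k ^+ 2 / 2) z)).
  by apply: integrable_scale; exact: gauss_integrable.
have i4 : lam.-integrable setT (EFin \o (fun z => gauss (k ^+ 2) z * (f (z + x) - f x))).
  have := integrableB measurableT i1 i2; apply: eq_integrable => // z _ /=.
  by rewrite mulrBr.
rewrite -{1}[f x]mul1r -{1}E1 -mulrA -mulrBr normrM (ger0_norm N0).
rewrite -integral_gauss// [_ * f x]mulrC -RintegralZl//; last exact: gauss_integrable.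
under [X in _ - X]eq_Rintegral do rewrite mulrC.
rewrite -RintegralB//; under eq_Rintegral do rewrite -mulrBr.
apply: (@le_trans _ _ (N * \int[lam]_z (L / k * gauss (k ^+ 2 / 2) z))).
  apply: ler_wpM2l => //; apply: le_trans (le_normr_Rintegral _ i4) _ => //.
  by apply: le_Rintegral => //; exact: integrable_norm.
rewrite RintegralZl//; last exact: gauss_integrable.
rewrite integral_gauss// mulrCA E2 le_eqVlt; apply/orP; left; apply/eqP; ring.
Qed.

End gaussian_transform.

(** * Fourier inversion *)

Section inversion.
Context (R : realType) (n : nat).
Local Notation V := 'rV[R]_n.
Local Notation lam := (lebesgue_measure_rV R n).
Implicit Types (f g : V -> R) (s r : R) (x xi : V) (th : R).

Lemma Rintegral_fubini (F : V * V -> R) C : measurable_fun setT F ->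
  (forall x y, `|F (x, y)| <= C * decay_bound x * decay_bound y) ->
  \int[lam]_x \int[lam]_y F (x, y) = \int[lam]_y \int[lam]_x F (x, y).
Proof.
move=> mF FC; have mEF : measurable_fun setT (EFin \o F) by exact/measurable_EFinP.
have FiL x : lam.-integrable setT (EFin \o (fun y => F (x, y))).
  apply: (@decay_integrable _ _ _ (C * decay_bound x)) => [|y]; last exact: FC.
  exact: measurableT_comp mF (measurable_pair1 x).
have FiR y : lam.-integrable setT (EFin \o (fun x => F (x, y))).
  apply: (@decay_integrable _ _ _ (C * decay_bound y)) => [|x].
    exact: measurableT_comp mF (measurable_pair2 y).
  by rewrite mulrAC; exact: FC.
have Fi : (lam \x lam)%E.-integrable setT (EFin \o F).
  apply/integrable12ltyP => //.
  apply: (@le_lt_trans _ _ (\int[lam]_x (C * pi ^+ n * decay_bound x)%:E)%E).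
    apply: ge0_le_integral => //.
    - by move=> x _; apply: integral_ge0.
    - apply: (@measurable_fun_fubini_tonelli_F _ _ _ _ _ lam (abse \o (EFin \o F))) => //.
        exact: measurableT_comp.
      by move=> z /=; rewrite lee_fin.
    - by apply/measurable_EFinP; apply: measurable_funM => //; exact: measurable_decay_bound.
    - move=> x _; apply: (@le_trans _ _ (\int[lam]_y (C * decay_bound x * decay_bound y)%:E)%E).
        apply: ge0_le_integral => //.
        + by apply: measurableT_comp => //; apply/measurable_EFinP; exact: measurableT_comp mF (measurable_pair1 x).
        + by apply/measurable_EFinP; apply: measurable_funM => //; exact: measurable_decay_bound.
        + by move=> y _; rewrite /= lee_fin.
      under eq_integral do rewrite EFinM.
      rewrite integralZl//; last exact: integrable_decay_bound.
      by rewrite integral_decay_bound -EFinM lee_fin mulrAC.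
  have fin := integrable_scale (C * pi ^+ n) (integrable_decay_bound R n).
  by rewrite ltey_eq (integrable_fin_num measurableT fin).
have := Fubini Fi; rewrite /Rintegral => h; congr fine.
transitivity (\int[lam]_x \int[lam]_y (EFin \o F) (x, y))%E.
  apply: eq_integral => x _; rewrite fineK//; exact: integrable_fin_num (FiL x).
rewrite h; apply: eq_integral => y _; rewrite fineK//; exact: integrable_fin_num (FiR y).
Qed.

(** The integrand of the inversion formula at the point x: the factor e^(2 pi i x.xi)
    of the inverse transform shifts the phase by - 2 pi x.xi. *)
Definition osc_at th f x xi := osc (th - 2 * pi * dot xi x) f xi.

Lemma osc_atE th f x xi : rapid f -> osc_at th f x xi =
  cos (2 * pi * dot xi x) * osc th f xi - sin (2 * pi * dot xi x) * osc (th + pi / 2) f xi.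
Proof. by move=> rf; rewrite /osc_at osc_phase// cosN sinN mulNr. Qed.

Lemma osc_at_decay th f x k : rapid f -> exists C, forall xi,
  (1 + `|xi|) ^+ k * `|osc_at th f x xi| <= C * decay_bound xi.
Proof.
move=> rf; have [C HC] := osc_decay (2 * n + k) rf; exists C => xi.
have := @weight_le_decay R n (fun xi => (1 + `|xi|) ^+ k * osc_at th f x xi) C xi.
rewrite normrM (ger0_norm (weight_ge0 _ _)) mulrA -exprD; apply; exact: HC.
Qed.

Lemma osc_at_measurable th f x : rapid f -> measurable_fun setT (osc_at th f x).
Proof.
move=> rf; rewrite (_ : osc_at th f x = fun xi => cos (2 * pi * dot xi x) * osc th f xi +
    (- sin (2 * pi * dot xi x)) * osc (th + pi / 2) f xi); last first.
  by apply/funext => xi; rewrite osc_atE// mulNr.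
have md : measurable_fun setT (fun xi : V => 2 * pi * dot xi x).
  apply: measurable_funM => //; under eq_fun do rewrite dotC; exact: measurable_dot.
apply: measurable_funD; apply: measurable_funM; try exact: rapid_measurable (osc_rapid _ rf).
  by apply: measurableT_comp md; apply: continuous_measurable_fun; exact: continuous_cos.
apply: measurable_funN.
by apply: measurableT_comp md; apply: continuous_measurable_fun; exact: continuous_sin.
Qed.

Lemma dot_sq_le (x : V) : dot x x <= n%:R * (1 + `|x|) ^+ 2.
Proof.
apply: le_trans (ler_norm _) _; apply: le_trans (dot_le x x) _.
rewrite -mulrA ler_wpM2l// expr2; have := normr_ge0 x; move: `|x| => a a0; nra.
Qed.

(** After the exchange the inner integral is the transform of a Gaussian at y - x,
    which is again a Gaussian. *)
Lemma gauss_fubini th f x s : 0 < s -> rapid f ->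
  \int[lam]_xi (osc_at th f x xi * gauss s xi) =
  cos th * (gauss_mass n s * \int[lam]_y (gauss (pi ^+ 2 / s) (y - x) * f y)).
Proof.
move=> s0 rf; have rg := gauss_rapid n s0.
have [C fC] := rapid_decay 0 rf; have [D gD] := rapid_decay 0 rg.
pose F (z : V * V) := cos (2 * pi * dot z.1 z.2 + (th - 2 * pi * dot z.1 x)) * f z.2 * gauss s z.1.
have m1 (h : V -> R) : measurable_fun setT h -> measurable_fun setT (fun z : V * V => h z.1).
  by move=> mh; exact: measurableT_comp mh (measurable_fst).
have m2 (h : V -> R) : measurable_fun setT h -> measurable_fun setT (fun z : V * V => h z.2).
  by move=> mh; exact: measurableT_comp mh (measurable_snd).
have mF : measurable_fun setT F.
  apply: measurable_funM; last by apply: m1; exact: rapid_measurable.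
  apply: measurable_funM; last by apply: m2; exact: rapid_measurable.
  apply: (measurableT_comp (f := @cos R)).
    by apply: continuous_measurable_fun; exact: continuous_cos.
  apply: measurable_funD.
    apply: measurable_funM => //; apply: measurable_sum => i; apply: measurable_funM.
      exact: m1 (measurable_coor i).
    exact: m2 (measurable_coor i).
  apply: measurable_funB => //; apply: measurable_funM => //.
  apply: (m1 (fun u => dot u x)); under eq_fun do rewrite dotC; exact: measurable_dot.
have FB u y : `|F (u, y)| <= C * D * decay_bound u * decay_bound y.
  rewrite /F /= !normrM; have := fC y; have := gD u; rewrite !expr0 !mul1r => h1 h2.
  apply: (@le_trans _ _ (`|f y| * `|gauss s u|)).
    by rewrite ler_wpM2r// ler_piMl// norm_cos_le1.
  rewrite (_ : C * D * decay_bound u * decay_bound y = C * decay_bound y * (D * decay_bound u)); last by ring.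
  exact: ler_pM.
have := Rintegral_fubini mF FB; rewrite /F /=.
under eq_Rintegral => xi _.
  rewrite (_ : \int[lam]_y _ = osc_at th f x xi * gauss s xi); last first.
    rewrite /osc_at /osc [RHS]mulrC -RintegralZl//; last exact: osc_integrable.
    by apply: eq_Rintegral => y _; rewrite mulrC.
  over.
move=> ->.
transitivity (\int[lam]_y (cos th * gauss_mass n s * (gauss (pi ^+ 2 / s) (y - x) * f y))).
  apply: eq_Rintegral => y _.
  rewrite (_ : cos th * gauss_mass n s * _ = f y * osc th (gauss s) (y - x)); last first.
    by rewrite osc_gauss//; ring.
  rewrite /osc -RintegralZl//; last exact: osc_integrable.
  apply: eq_Rintegral => u _.
  have -> : 2 * pi * dot u y + (th - 2 * pi * dot u x) = 2 * pi * dot (y - x) u + th.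
    by rewrite dotDl -(scaleN1r x) dotZl (dotC y) (dotC x); ring.
  ring.
rewrite RintegralZl//; first by rewrite mulrA.
by apply: gauss_translate_rapid => //; rewrite divr_gt0// exprn_gt0// pi_gt0.
Qed.

(** Fourier inversion. Inserting a wide Gaussian of xi makes the double integral
    absolutely convergent; exchanging the integrals turns it into an average of f
    against a narrow Gaussian centred at x. *)
Lemma osc_inversion th f x : rapid f -> \int[lam]_xi osc_at th f x xi = cos th * f x.
Proof.
move=> rf; have [K HK] := gauss_approx_identity x rf.
have [C HC] := osc_at_decay th x 2 rf.
have [C0 HC0] := osc_at_decay th x 0 rf.
have i0 : lam.-integrable setT (EFin \o osc_at th f x).
  apply: (@decay_integrable _ _ _ C0); first exact: osc_at_measurable.
  by move=> xi; have := HC0 xi; rewrite expr0 mul1r.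
apply/eqP; rewrite -subr_eq0; apply/eqP.
pose M := pi ^+ 2 * (n%:R * C * pi ^+ n).
apply: (@small_eq0 _ _ (M + K)) => h /andP[h0 h1].
(* A Gaussian factor of width 1 / h in xi becomes one of width h in y; both errors are
   then of order h. *)
pose k := h^-1; have k0 : 0 < k by rewrite invr_gt0.
pose s := pi ^+ 2 / k ^+ 2.
have s0 : 0 < s by rewrite divr_gt0// exprn_gt0// pi_gt0.
have mg : measurable_fun setT (@gauss R n s) by exact: rapid_measurable (gauss_rapid n s0).
have sE : pi ^+ 2 / s = k ^+ 2.
  by rewrite /s invf_div mulrCA divff ?mulr1// expf_neq0// gt_eqF// pi_gt0.
have i1 : lam.-integrable setT (EFin \o (fun xi => osc_at th f x xi * gauss s xi)).
  apply: (@decay_integrable _ _ _ C0).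
    by apply: measurable_funM => //; exact: osc_at_measurable.
  move=> xi; rewrite normrM; have := HC0 xi; rewrite expr0 mul1r; apply: le_trans.
  by rewrite ler_piMr// ger0_norm ?expR_ge0//; apply: gauss_le1; exact: ltW.
have E1 : `|\int[lam]_xi osc_at th f x xi - \int[lam]_xi (osc_at th f x xi * gauss s xi)| <= M * h.
  rewrite -RintegralB//.
  apply: (@le_trans _ _ (s * n%:R * C * pi ^+ n)).
    apply: decay_Rintegral_le.
      apply: measurable_funB; first exact: osc_at_measurable.
      by apply: measurable_funM => //; exact: osc_at_measurable.
    move=> xi; rewrite -[X in X - _]mulr1 -mulrBr normrM.
    have g1 : `|1 - gauss s xi| <= s * (n%:R * (1 + `|xi|) ^+ 2).
      apply: le_trans (gauss_sub1 _ (ltW s0)) _.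
      by apply: ler_wpM2l; [exact: ltW|exact: dot_sq_le].
    apply: le_trans (ler_wpM2l (normr_ge0 _) g1) _.
    rewrite (_ : `|osc_at th f x xi| * _ = s * n%:R * ((1 + `|xi|) ^+ 2 * `|osc_at th f x xi|)); last by ring.
    rewrite -[leRHS]mulrA; apply: ler_wpM2l; last exact: HC.
    by apply: mulr_ge0 => //; exact: ltW.
  have C_ge0 : 0 <= n%:R * C * pi ^+ n.
    rewrite mulr_ge0 ?exprn_ge0 ?pi_ge0// mulr_ge0//.
    have := HC 0; have : 0 <= decay_bound (0 : V) := decay_bound_ge0 _.
    have : 1 <= decay_bound (0 : V).
      by have := @weight_decay R n 0; rewrite normr0 addr0 expr1n mul1r.
    have : 0 <= (1 + `|0 : V|) ^+ 2 * `|osc_at th f x 0| by rewrite mulr_ge0 ?weight_ge0.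
    move: ((1 + _) ^+ 2 * _) (decay_bound 0) => a d; nra.
  rewrite /s /k exprVn invrK /M.
  rewrite (_ : pi ^+ 2 * h ^+ 2 * n%:R * C * pi ^+ n = pi ^+ 2 * (n%:R * C * pi ^+ n) * h * h); last by ring.
  rewrite ler_piMr//; apply: mulr_ge0; last exact: ltW.
  by rewrite mulr_ge0 ?exprn_ge0 ?pi_ge0.
rewrite gauss_fubini// sE in E1.
have := HK k k0; rewrite -/s => E2.
set A := \int[lam]_xi _ in E1 *; set B := gauss_mass n s * _ in E1 E2.
rewrite (_ : A - cos th * f x = (A - cos th * B) + cos th * (B - f x)); last by ring.
apply: le_trans (ler_normD _ _) _; rewrite mulrDl; apply: lerD => //.
rewrite normrM; apply: (@le_trans _ _ `|B - f x|).
  by rewrite ler_piMl// norm_cos_le1.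
by move: E2; rewrite /k invrK.
Qed.

End inversion.

(** * The Fourier transform of Schwartz functions and of measures *)

Section fourier_transform.
Context (R : realType) (n : nat).
Local Notation V := 'rV[R]_n.
Local Notation lam := (lebesgue_measure_rV R n).
Implicit Types (phi psi : V -> R[i]) (nu eta : cmeasure R n) (x xi : V).

Lemma schwartz_decay phi : schwartz phi -> exists2 P : R, seminorm (2 * n) (2 * n) phi = P%:E &
  forall x, modulus (phi x) <= P * decay_bound x.
Proof.
move=> [sp fin].
have sfin : seminorm (2 * n) (2 * n) phi \is a fin_num by rewrite ge0_fin_numE ?fin// seminorm_ge0.
exists (fine (seminorm (2 * n) (2 * n) phi)); first by rewrite fineK.
move=> x; have := @weight_le_decay R n (fun x => modulus (phi x)) (fine (seminorm (2 * n) (2 * n) phi)) x.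
rewrite ger0_norm ?modulus_ge0//; apply; rewrite -lee_fin fineK//.
by apply: ereal_sup_ubound; exists ([::], x) => //=; case: (phi x).
Qed.

Lemma schwartz_integrable phi xi : schwartz phi ->
  cintegrable lam setT (fun x => expi (- (2 * pi * dot xi x)) * phi x).
Proof.
move=> sp; have [P _ HP] := schwartz_decay sp.
apply: (@cintegrable_le _ _ _ _ _ _ (fun x => P * decay_bound x)) => //.
- apply: cmeasurableM; last exact: schwartz_cmeasurable.
  apply: cmeasurable_expi; apply: measurable_funN; apply: measurable_funM => //.
  exact: measurable_dot.
- by apply: integrable_scale; exact: integrable_decay_bound.
- by move=> x _; rewrite modulusM modulus_expi mul1r.
Qed.

Lemma modulus_fourier_le phi xi : schwartz phi ->
  ((modulus (fourier phi xi))%:E <= (pi ^+ n)%:E * seminorm (2 * n) (2 * n) phi)%E.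
Proof.
move=> sp; have [P -> HP] := schwartz_decay sp; rewrite -EFinM lee_fin.
apply: le_trans (modulus_cintegral measurableT (schwartz_integrable xi sp)
  (integrable_scale P (integrable_decay_bound R n)) _) _.
  by move=> x _; rewrite modulusM modulus_expi mul1r.
rewrite RintegralZl//; last exact: integrable_decay_bound.
by rewrite /Rintegral integral_decay_bound mulrC.
Qed.

(** The phases 0 and - pi / 2 give the cosine and the sine transforms of the real and
    imaginary parts. *)
Lemma fourier_osc phi xi : schwartz phi ->
  complex.Re (fourier phi xi) = osc 0 (@complex.Re R \o phi) xi + osc (- (pi / 2)) (@complex.Im R \o phi) xi /\
  complex.Im (fourier phi xi) = osc 0 (@complex.Im R \o phi) xi - osc (- (pi / 2)) (@complex.Re R \o phi) xi.
Proof.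
move=> /schwartz_rapid[r1 r2]; rewrite /fourier /cintegral /osc.
split => /=.
  rewrite -RintegralD//; try exact: osc_integrable.
  apply: eq_Rintegral => x _; rewrite ReM /= cosN sinN addr0 cosBpihalf; ring.
rewrite -RintegralB//; try exact: osc_integrable.
apply: eq_Rintegral => x _; rewrite ImM /= cosN sinN addr0 cosBpihalf; ring.
Qed.

Lemma fourier_schwartz phi : schwartz phi -> schwartz (fourier phi).
Proof.
move=> sp; have [r1 r2] := (schwartz_rapid phi).1 sp.
apply/schwartz_rapid; split.
- rewrite (_ : _ \o _ = fun xi => 1 * osc 0 (@complex.Re R \o phi) xi +
    osc (- (pi / 2)) (@complex.Im R \o phi) xi).
    by apply: rapid_linear; exact: osc_rapid.
  by apply/funext => xi; rewrite mul1r; exact: (fourier_osc xi sp).1.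
- rewrite (_ : _ \o _ = fun xi => (-1) * osc (- (pi / 2)) (@complex.Re R \o phi) xi +
    osc 0 (@complex.Im R \o phi) xi).
    by apply: rapid_linear; exact: osc_rapid.
  by apply/funext => xi; rewrite mulN1r addrC; exact: (fourier_osc xi sp).2.
Qed.

Lemma osc_atB x xi (f : V -> R) : rapid f ->
  osc_at 0 f x xi = cos (2 * pi * dot xi x) * osc 0 f xi + sin (2 * pi * dot xi x) * osc (- (pi / 2)) f xi /\
  osc_at (- (pi / 2)) f x xi = cos (2 * pi * dot xi x) * osc (- (pi / 2)) f xi - sin (2 * pi * dot xi x) * osc 0 f xi.
Proof.
move=> rf; rewrite !osc_atE// addNr add0r; split => //.
have -> : osc (pi / 2) f xi = - osc (- (pi / 2)) f xi.
  have := osc_phase (- (pi / 2)) pi xi rf; rewrite cospi sinpi mul0r addr0 mulN1r => <-.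
  by congr osc; rewrite [X in _ = - _ + X]splitr; ring.
by rewrite mulrN opprK.
Qed.

Lemma fourier_inversion phi x : schwartz phi -> fourier (fourier phi) (- x) = phi x.
Proof.
move=> sp; have [r1 r2] := (schwartz_rapid phi).1 sp.
have sF := fourier_schwartz sp; have [rA rB] := (schwartz_rapid _).1 sF.
have dN xi : 2 * pi * dot (- x) xi = - (2 * pi * dot xi x).
  by rewrite -scaleN1r dotZl dotC; ring.
have [ReE ImE] := fourier_osc (- x) sF.
have Fr xi : (@complex.Re R \o fourier phi) xi = _ := (fourier_osc xi sp).1.
have Fi xi : (@complex.Im R \o fourier phi) xi = _ := (fourier_osc xi sp).2.
have atB th f : rapid f -> lam.-integrable setT (EFin \o osc_at th f x).
  move=> rf; have [C HC] := osc_at_decay th x 0 rf.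
  apply: (@decay_integrable _ _ _ C); first exact: osc_at_measurable.
  by move=> xi; have := HC xi; rewrite expr0 mul1r.
apply: complex_eqP.
- rewrite ReE /osc -RintegralD//; try exact: osc_integrable.
  transitivity (\int[lam]_xi (osc_at 0 (@complex.Re R \o phi) x xi +
      osc_at (- (pi / 2)) (@complex.Im R \o phi) x xi)).
    apply: eq_Rintegral => xi _; rewrite (osc_atB x xi r1).1 (osc_atB x xi r2).2.
    rewrite Fr Fi dN addr0 cosN cosBpihalf sinN; ring.
  rewrite RintegralD//; try exact: atB.
  rewrite !osc_inversion// cos0 cosN cos_pihalf /=; ring.
- rewrite ImE /osc -RintegralB//; try exact: osc_integrable.
  transitivity (\int[lam]_xi (osc_at 0 (@complex.Im R \o phi) x xi -
      osc_at (- (pi / 2)) (@complex.Re R \o phi) x xi)).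
    apply: eq_Rintegral => xi _; rewrite (osc_atB x xi r2).1 (osc_atB x xi r1).2.
    rewrite Fr Fi dN addr0 cosN cosBpihalf sinN; ring.
  rewrite RintegralB//; try exact: atB.
  rewrite !osc_inversion// cos0 cosN cos_pihalf /=; ring.
Qed.

(** The distribution whose Fourier transform is a given measure: by the inversion
    formula it has to pair a test function psi with the measure through the inverse
    transform of psi. *)
Definition of_measure nu : distr R n := fun psi =>
  if pselect (schwartz psi) is left _ then cmintegral nu setT (fun x => fourier psi (- x)) else 0.

Lemma of_measure_hat nu : is_hat (of_measure nu) nu.
Proof.
move=> phi sp; rewrite /of_measure; case: pselect => [_|]; last first.
  by move=> h; exfalso; apply: h; exact: fourier_schwartz.
by congr cmintegral; apply/funext => x; exact: fourier_inversion.
Qed.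

Lemma fourier_reflect phi : schwartz phi -> cmeasurable setT (fun x => fourier phi (- x)).
Proof.
move=> sp; apply: cmeasurable_comp (schwartz_cmeasurable (fourier_schwartz sp)).
apply: measurable_rVP => i; under eq_fun do rewrite mxE.
by apply: measurable_funN; exact: measurable_coor.
Qed.

Lemma schwartz_linear (a : R[i]) phi psi : schwartz phi -> schwartz psi ->
  schwartz (fun x => a * phi x + psi x).
Proof.
move=> /schwartz_rapid[p1 p2] /schwartz_rapid[q1 q2]; apply/schwartz_rapid; split.
- rewrite (_ : _ \o _ = fun x => complex.Re a * (@complex.Re R \o phi) x +
      ((- complex.Im a) * (@complex.Im R \o phi) x + (@complex.Re R \o psi) x)).
    by do 2 apply: rapid_linear => //.
  by apply/funext => x /=; rewrite ReD ReM; ring.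
- rewrite (_ : _ \o _ = fun x => complex.Re a * (@complex.Im R \o phi) x +
      (complex.Im a * (@complex.Re R \o phi) x + (@complex.Im R \o psi) x)).
    by do 2 apply: rapid_linear => //.
  by apply/funext => x /=; rewrite ImD ImM; ring.
Qed.

Lemma of_measure_tempered nu : tempered (of_measure nu).
Proof.
split.
- move=> a phi psi sp sq.
  rewrite /of_measure; case: pselect => [_|h]; last by exfalso; apply: h; exact: schwartz_linear.
  case: pselect => // _; case: pselect => // _.
  have [B HB] := schwartz_bounded (fourier_schwartz sp).
  have [C HC] := schwartz_bounded (fourier_schwartz sq).
  rewrite addrC -(@cmintegralD _ _ nu _ _ C B) //; try exact: fourier_reflect.
  congr cmintegral; apply/funext => x; rewrite /fourier addrC -cintegralZ//; last exact: schwartz_integrable.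
  rewrite -cintegralD//; last exact: schwartz_integrable.
    by apply: eq_cintegral => y _; ring.
  by apply: cintegrableZ => //; exact: schwartz_integrable.
- exists (2 * n)%N, (pi ^+ n * total_mass nu) => phi sp.
  rewrite /of_measure; case: pselect => // _.
  have [P PE _] := schwartz_decay sp; rewrite PE -EFinM lee_fin.
  have := @cmintegral_le _ _ nu setT (fun x => fourier phi (- x)) (pi ^+ n * P) measurableT (fourier_reflect sp).
  rewrite -/(total_mass nu) mulrAC; apply => x _.
  by rewrite -lee_fin EFinM -PE; exact: modulus_fourier_le.
- by move=> phi h; rewrite /of_measure; case: pselect.
Qed.

End fourier_transform.

(** * Schwartz functions approximating indicators of orthants *)

Section separation.
Context (R : realType) (n : nat).
Local Notation V := 'rV[R]_n.
Implicit Types (nu eta : cmeasure R n) (a x : V) (p : {finite_measure set V -> \bar R}).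

Definition orthant a : set V := [set x | forall j, a 0 j < x 0 j].

(** The logistic function of k^2 t - k tends to the indicator of t > 0: the slope k^2
    dominates the shift k for t > 0, and the shift forces the limit 0 also at t = 0.
    The Gaussian factor, which tends to 1, makes the product rapidly decreasing. *)
Definition orthant_test a (k : nat) (x : V) : R :=
  (\prod_j logistic (k%:R ^+ 2 * x 0 j + (- (k%:R ^+ 2 * a 0 j) - k%:R))) * gauss (k.+1%:R^-1) x.

Lemma orthant_test_rapid a k : rapid (orthant_test a k).
Proof.
apply: symbol_gauss_rapid; first by rewrite invr_gt0.
elim: (index_enum _) => [|j s IH].
  by under eq_fun do rewrite big_nil; exact: symbol_cst.
by under eq_fun do rewrite big_cons; apply: symbol_mul => //; exact: symbol_logistic.
Qed.

Lemma orthant_test_bound a k x : 0 <= orthant_test a k x <= 1.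
Proof.
have [p0 p1] : 0 <= \prod_j logistic (k%:R ^+ 2 * x 0 j + (- (k%:R ^+ 2 * a 0 j) - k%:R)) /\
    \prod_j logistic (k%:R ^+ 2 * x 0 j + (- (k%:R ^+ 2 * a 0 j) - k%:R)) <= 1.
  split; first by apply: prodr_ge0 => j _; have /andP[] := logistic_bound (k%:R ^+ 2 * x 0 j + (- (k%:R ^+ 2 * a 0 j) - k%:R)).
  by apply: prodr_ile1 => j _; exact: logistic_bound.
have g1 : gauss (k.+1%:R^-1) x <= 1.
  by apply: gauss_le1; rewrite invr_ge0.
rewrite /orthant_test mulr_ge0//=; last exact/ltW/gauss_gt0.
by rewrite -[leRHS]mulr1; apply: ler_pM => //; exact/ltW/gauss_gt0.
Qed.

Lemma inv_natS_cvg : (k.+1%:R^-1 : R) @[k --> \oo] --> (0 : R).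
Proof. exact: cvg_harmonic. Qed.

Lemma logistic_le (t : R) : logistic t <= expR t.
Proof.
have p0 : 0 < 1 + expR (- t) by rewrite addr_gt0// expR_gt0.
by rewrite /logistic -[leRHS]invrK -expRN lef_pV2 ?posrE ?expR_gt0// lerDr.
Qed.

Lemma logistic_sub1 (t : R) : `|logistic t - 1| <= expR (- t).
Proof.
have p0 : 0 < 1 + expR (- t) by rewrite addr_gt0// expR_gt0.
rewrite (_ : logistic t - 1 = - (expR (- t) / (1 + expR (- t)))); last first.
  by rewrite /logistic; field; rewrite gt_eqF.
rewrite normrN ger0_norm; last by apply: divr_ge0; [exact: expR_ge0|exact: ltW].
by rewrite ler_pdivrMr// ler_peMr ?expR_ge0// lerDl expR_ge0.
Qed.

Lemma expRN_natS (k : nat) (t : R) : k%:R <= t -> expR (- t) <= k.+1%:R^-1.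
Proof.
move=> kt; rewrite expRN lef_pV2 ?posrE ?expR_gt0//.
by apply: le_trans (expR_ge1Dx t); rewrite -natr1 addrC lerD2l.
Qed.

Lemma logistic_step_cvg (u : R) :
  logistic (k%:R ^+ 2 * u - k%:R) @[k --> \oo] --> (((0 < u)%R)%:R : R).
Proof.
have [u0|u0] := ltP 0 u.
- apply/cvgrPdist_le => e e0.
  have /cvgrPdist_le/(_ _ e0) := inv_natS_cvg.
  have : \forall k \near \oo, 2 / u <= k%:R by exact: nbhs_infty_ger.
  apply: filterS2 => k ku.
  rewrite sub0r normrN ger0_norm ?invr_ge0// distrC; apply: le_trans.
  apply: le_trans (logistic_sub1 _) _; apply: expRN_natS.
  have k2 : 2 <= k%:R * u by rewrite -ler_pdivrMr.
  rewrite expr2 -mulrA; have : 0 <= k%:R :> R by [].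
  move: (k%:R * u) k2 => w w2 k0; nra.
- apply: (@squeeze_cvgr _ _ _ _ (fun=> 0) (fun k => k.+1%:R^-1 : R)); last 2 first.
  + exact: cvg_cst.
  + exact: inv_natS_cvg.
  apply: nearW => k; have /andP[-> _] /= := logistic_bound (k%:R ^+ 2 * u - k%:R).
  apply: le_trans (logistic_le _) _; rewrite -[X in expR X]opprK; apply: expRN_natS.
  by rewrite opprB lerBrDr gerDl mulr_ge0_le0 ?sqr_ge0.
Qed.

Lemma orthant_test_cvg a x : orthant_test a k x @[k --> \oo] --> (\1_(orthant a) x : R).
Proof.
have E1 : \1_(orthant a) x = (\prod_j ((0 < x 0 j - a 0 j)%R)%:R) * 1 :> R.
  rewrite mulr1 indicE; have [ax|nax] := pselect (orthant a x).
    by rewrite mem_set// big1// => j _; rewrite subr_gt0 ax.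
  rewrite memNset//; have /existsNP[j /negP] := nax; rewrite -leNgt => xj.
  by rewrite (bigD1 j)//= subr_gt0 ltNge xj mul0r.
rewrite E1; apply: cvgM.
  elim: (index_enum _) => [|j s IH].
    by rewrite big_nil; under eq_fun do rewrite big_nil; exact: cvg_cst.
  rewrite big_cons; under eq_fun do rewrite big_cons.
  apply: cvgM => //.
  rewrite (_ : (fun k => _) = (fun k => logistic (k%:R ^+ 2 * (x 0 j - a 0 j) - k%:R))).
    exact: logistic_step_cvg.
  by apply/funext => k; congr logistic; ring.
apply/cvgrPdist_le => e e0.
have d0 : 0 < e / (dot x x + 1) by rewrite divr_gt0// ltr_wpDl// dot_ge0.
have /cvgrPdist_le/(_ _ d0) := inv_natS_cvg; apply: filterS => k.
rewrite sub0r normrN ger0_norm ?invr_ge0// => ke.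
have k0 : 0 <= k.+1%:R^-1 :> R by rewrite invr_ge0.
apply: le_trans (gauss_sub1 x k0) _.
apply: (@le_trans _ _ (e / (dot x x + 1) * dot x x)); first by rewrite ler_wpM2r// dot_ge0.
rewrite mulrAC ler_pdivrMr ?ltr_wpDl ?dot_ge0// ler_pM2l// lerDl//.
Qed.

Lemma measurable_orthant a : measurable (orthant a).
Proof.
rewrite (_ : orthant a = \bigcap_(j in [set: 'I_n]) ((fun x : V => x 0 j) @^-1` `]a 0 j, +oo[)).
  apply: fin_bigcap_measurable => // j _; rewrite -[X in measurable X]setTI.
  by apply: measurable_coor => //; exact: measurable_itv.
apply/seteqP; split=> x h j; first by move=> _; rewrite /= in_itv/= andbT.
by have := h j I; rewrite /= in_itv/= andbT.
Qed.

Lemma integral_orthant_test p a : \int[p]_x orthant_test a k x @[k --> \oo] --> fine (p (orthant a)).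
Proof.
have mg k : measurable_fun setT (orthant_test a k) by exact: rapid_measurable (orthant_test_rapid a k).
have p1 : p.-integrable setT (EFin \o (fun=> 1 : R)).
  apply: measurable_bounded_integrable => //.
    by rewrite -ge0_fin_numE// fin_num_measure.
  by exists 1; split; [exact: num_real|move=> M M1 x _; rewrite normr1 ltW].
have cv : (\int[p]_x (orthant_test a k x)%:E)%E @[k --> \oo] --> (fine (p (orthant a)))%:E.
  rewrite fineK; last by apply: fin_num_measure; exact: measurable_orthant.
  have -> : p (orthant a) = (\int[p]_x (\1_(orthant a) x)%:E)%E.
    by rewrite integral_indic ?setIT//; exact: measurable_orthant.
  apply: (@dominated_cvg _ _ _ p setT measurableT (fun k => EFin \o orthant_test a k)
    (EFin \o \1_(orthant a)) (EFin \o (fun=> 1 : R))) => //.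
  - by move=> k; apply/measurable_EFinP.
  - by move=> x _; apply: cvg_EFin; [exact: nearW|exact: orthant_test_cvg].
  - move=> k x _; rewrite /= lee_fin.
    by have /andP[t0 t1] := orthant_test_bound a k x; rewrite ger0_norm.
exact: fine_cvg cv.
Qed.

End separation.

(** * Measures are determined by Schwartz functions *)

Section measure_determined.
Context (R : realType) (n : nat).
Local Notation V := 'rV[R]_n.
Implicit Types (nu eta : cmeasure R n) (c d : {charge set V -> \bar R}).

(** A half-space is a countable union of orthants whose other bounds tend to minus
    infinity. *)
Lemma orthants_generate : @measurable _ V `<=` <<s range (@orthant R n) >>.
Proof.
apply: smallest_sub; first exact: smallest_sigma_algebra.
move=> B; rewrite -bigcup_seq => -[i _ [C mC <-]].
pose T := g_sigma_algebraType (range (@orthant R n)).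
suff mi : measurable_fun [set: T] (fun x : T => (x : V) 0 i) by exact: mi.
apply: (measurability _ (RGenOInfty.measurableE R)).
move=> _ [_ [r ->] <-]; rewrite setTI.
rewrite (_ : _ @^-1` _ = \bigcup_k (orthant (\row_j (if j == i then r else - k%:R)))).
  apply: bigcupT_measurable => k; apply: sub_sigma_algebra.
  by exists (\row_j (if j == i then r else - k%:R)).
apply/seteqP; split=> x /=; rewrite in_itv/= andbT.
  move=> rx; pose k := Num.trunc `|x : V|; exists k.+1 => // j; rewrite mxE.
  case: eqP => [->//|_]; rewrite ltrNl.
  apply: le_lt_trans (ler_norm _) _; rewrite normrN.
  by apply: le_lt_trans (norm_coord_le _ _) _; exact: truncnS_gt.
by move=> [k _ /(_ i)]; rewrite mxE eqxx.
Qed.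

Lemma orthant_setI : setI_closed (range (@orthant R n)).
Proof.
move=> _ _ [a _ <-] [b _ <-]; exists (\row_j Num.max (a 0 j) (b 0 j)) => //.
apply/seteqP; split=> x.
  by move=> h; split=> j; have := h j; rewrite mxE gt_max => /andP[].
by move=> [ha hb] j; rewrite mxE gt_max ha hb.
Qed.

Lemma orthant_cover : \bigcup_k orthant (const_mx (- k%:R) : V) = setT.
Proof.
apply/seteqP; split=> // x _; pose k := Num.trunc `|x : V|; exists k.+1 => // j; rewrite mxE ltrNl.
apply: le_lt_trans (ler_norm _) _; rewrite normrN.
by apply: le_lt_trans (norm_coord_le _ _) _; exact: truncnS_gt.
Qed.

(** The tests recover the values of signed measures on orthants. Moving negative parts
    to the other side turns the equality into one of positive measures, which extends
    from the pi-system of orthants to all Borel sets. *)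
Lemma charge_determined c d : (forall f, rapid f -> integral_charge c setT f = integral_charge d setT f) ->
  forall A, measurable A -> fine (c A) = fine (d A).
Proof.
move=> cd A mA.
have fin (p : {finite_measure set V -> \bar R}) B : measurable B -> p B = (fine (p B))%:E.
  by move=> mB; rewrite fineK// fin_num_measure.
have sumE (p q : {finite_measure set V -> \bar R}) B : measurable B ->
    measure_add p q B = (fine (p B) + fine (q B))%:E.
  by move=> mB; rewrite measure_addE EFinD -(fin p _ mB) -(fin q _ mB).
(* The sums of the positive part of one charge with the negative part of the other. *)
pose m1 := measure_add (jordanp c) (jordann d); pose m2 := measure_add (jordanp d) (jordann c).
have E B : measurable B -> fine (jordanp c B) + fine (jordann d B) = fine (jordanp d B) + fine (jordann c B) ->
    m1 B = m2 B.
  by move=> mB h; rewrite /m1 /m2 !sumE// h.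
have m12 : m1 A = m2 A.
  apply: (@g_sigma_algebra_measure_unique _ _ _ (range (@orthant R n)) _
    (fun k => orthant (const_mx (- k%:R) : V))).
  - by move=> _ [a _ <-]; exact: measurable_orthant.
  - by move=> k; exists (const_mx (- k%:R)).
  - exact: orthant_cover.
  - exact: orthant_setI.
  - move=> _ [a _ <-]; apply: E; first exact: measurable_orthant.
    have cv e : integral_charge e setT (orthant_test a k) @[k --> \oo] -->
        fine (jordanp e (orthant a)) - fine (jordann e (orthant a)).
      by apply: cvgB; exact: integral_orthant_test.
    have := cv d; rewrite (_ : (fun k => _) = (fun k => integral_charge c setT (orthant_test a k))); last first.
      by apply/funext => k; rewrite cd//; exact: orthant_test_rapid.
    move=> h; have e := cvg_lim (@Rhausdorff R) h; rewrite (cvg_lim (@Rhausdorff R) (cv c)) in e.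
    by have {}e := e eventually_filter; lra.
  - move=> k; have mO := measurable_orthant (const_mx (- k%:R) : V).
    apply: (@le_lt_trans _ _ (m1 (orthant (const_mx (- k%:R) : V)))); first exact: lexx.
    by rewrite /m1 sumE// ltry.
  - exact: orthants_generate.
have key (w x y z : R) : w + x = y + z -> w - z = y - x by move=> e; lra.
move: m12; rewrite /m1 /m2 (sumE (jordanp c) (jordann d) A mA) (sumE (jordanp d) (jordann c) A mA) => -[] e.
by rewrite (jordanB c mA) (jordanB d mA); exact: key e.
Qed.

Lemma cmintegral_real nu (f : V -> R) :
  cmintegral nu setT (fun x => (f x)%:C) =
  integral_charge (cmRe nu) setT f +i* integral_charge (cmIm nu) setT f.
Proof.
have z c : integral_charge c setT (@complex.Im R \o (fun x => (f x)%:C)) = 0.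
  by rewrite /integral_charge /Rintegral !integral0 subrr.
by rewrite /cmintegral !z subr0 add0r.
Qed.

Lemma schwartz_determined nu eta :
  (forall phi, schwartz phi -> cmintegral nu setT phi = cmintegral eta setT phi) ->
  cmv nu = cmv eta.
Proof.
move=> h; have key (f : V -> R) : rapid f ->
    integral_charge (cmRe nu) setT f = integral_charge (cmRe eta) setT f /\
    integral_charge (cmIm nu) setT f = integral_charge (cmIm eta) setT f.
  move=> rf; have sf : schwartz (fun x => (f x)%:C).
    by apply/schwartz_rapid; split => //; exact: rapid0.
  by have := h _ sf; rewrite !cmintegral_real => -[].
apply/funext => -[A mA]; rewrite /cmv /cmval /=; congr (_ +i* _).
  by apply: charge_determined => // f /key[].
by apply: charge_determined => // f /key[].
Qed.

End measure_determined.

(** * The nonperiodic case *)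

Section nonperiodic_case.
Context (R : realType) (n : nat).
Local Notation V := 'rV[R]_n.
Implicit Types (f g : distr R n) (nu eta : cmeasure R n) (a : borel R n -> R[i]).

Lemma is_hat_unique f nu eta : is_hat f nu -> is_hat f eta -> cmv nu = cmv eta.
Proof. by move=> h1 h2; apply: schwartz_determined => phi sp; rewrite -h1// h2. Qed.

Lemma is_hat_hat f : I_space f -> is_hat f (hat f).
Proof.
move=> [_ [nu h]]; rewrite /hat /choose_elt; case: pselect => [e|ne].
  by case: cid.
by exfalso; apply: ne; exists nu.
Qed.

Lemma hatE f nu : I_space f -> is_hat f nu -> cmv (hat f) = cmv nu.
Proof. by move=> If; apply: is_hat_unique; exact: is_hat_hat. Qed.

Lemma is_hat_lin f g nu eta th (z : R[i]) : is_hat f nu -> is_hat g eta ->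
  (forall A, measurable A -> cmval th A = cmval nu A + z * cmval eta A) ->
  forall phi, schwartz phi -> f (fourier phi) + z * g (fourier phi) = cmintegral th setT phi.
Proof.
move=> fn ge tE phi sp; rewrite fn// ge//; have [B HB] := schwartz_bounded sp.
by rewrite (cmintegral_combination (B := B) tE)//; exact: schwartz_cmeasurable.
Qed.

Lemma cmv_combination nu eta (z : R[i]) : exists th,
  forall A, measurable A -> cmval th A = cmval nu A + z * cmval eta A.
Proof.
have [th thE] := is_cmvD z (ex_intro _ nu erefl : is_cmv (cmv nu)) (ex_intro _ eta erefl : is_cmv (cmv eta)).
by exists th => A mA; exact: (congr1 (fun a => a (exist _ A mA : borel R n)) thE).
Qed.

Lemma tempered_D f g : tempered f -> tempered g -> tempered (f + g).
Proof.
apply: continuous_dualD; first by move=> k phi; exact: seminorm_ge0.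
by move=> k l phi kl; exact: le_seminorm.
Qed.

(** Addition and subtraction at once: sums of transforms are represented by a measure,
    and this measure has the values of the transform of h because measures are
    determined by Schwartz functions. *)
Lemma I_space_lin f g (z : R[i]) (h : distr R n) : I_space f -> I_space g -> tempered h ->
  (forall phi, h phi = f phi + z * g phi) ->
  I_space h /\ cmv (hat h) = fun i => cmv (hat f) i + z * cmv (hat g) i.
Proof.
move=> If Ig th hE; have hf := is_hat_hat If; have hg := is_hat_hat Ig.
have [t tE] := cmv_combination (hat f) (hat g) z.
have ht : is_hat h t by move=> phi sp; rewrite hE; exact: (is_hat_lin hf hg tE sp).
have Ih : I_space h by split => //; exists t.
split => //; rewrite (hatE Ih ht); apply/funext => -[A mA]; exact: tE.
Qed.

Lemma I_space_add f g : I_space f -> I_space g ->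
  I_space (f + g) /\ cmv (hat (f + g)) = cmv (hat f) \+ cmv (hat g).
Proof.
move=> If Ig; have [||Ih hE] := @I_space_lin f g 1 (f + g) If Ig.
- by apply: tempered_D; [case: If|case: Ig].
- by move=> phi; rewrite mul1r.
by split => //; rewrite hE; apply/funext => i; rewrite mul1r.
Qed.

Lemma I_space_sub f g : I_space f -> I_space g ->
  I_space (f - g) /\ cmv (hat (f - g)) = cmv (hat f) \- cmv (hat g).
Proof.
move=> If Ig; have [||Ih hE] := @I_space_lin f g (-1) (f - g) If Ig.
- by apply: tempered_D; [case: If|apply: continuous_dualN; case: Ig].
- by move=> phi; rewrite mulN1r.
by split => //; rewrite hE; apply/funext => i; rewrite mulN1r.
Qed.

Lemma of_measure_I nu : I_space (of_measure nu).
Proof. by split; [exact: of_measure_tempered|exists nu; exact: of_measure_hat]. Qed.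

(** The distribution with a given transform, in terms of families indexed by Borel
    sets. *)
Lemma of_hatE (m : set V -> R[i]) a : (forall A (mA : measurable A), m A = a (exist _ A mA)) ->
  of_hat m = choose_elt 0 [set f | I_space f /\ cmv (hat f) = a].
Proof.
move=> ma; rewrite /of_hat; congr choose_elt; apply/seteqP; split=> f /= [If hf]; split => //.
  by apply/funext => -[A mA]; rewrite -ma; exact: hf.
by move=> A mA; rewrite ma -hf.
Qed.

Lemma flow_cmv nu A (mA : measurable A) t :
  cmintegral nu A (phase t) = flow (free_algebra R n) t (cmv nu) (exist _ A mA).
Proof.
apply: (eq_cmintegral_measure (C := 1)) => //.
- move=> B mB; have Knu : is_cmv (cmv nu) by exists nu.
  by rewrite (repP mB Knu).
- exact: cmeasurable_phase.
- by move=> x; exact: modulus_phase.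
Qed.

Lemma cmv_conv nu eta : cmv (cmconv nu eta) = mulc (free_algebra R n) (cmv nu) (cmv eta).
Proof. by apply: cmv_conv_ext; rewrite repE//; [exists nu|exists eta]. Qed.

Lemma cmv_conv_pow rho nu : cmv (cmconv_pow rho nu) = powc (free_algebra R n) rho (cmv nu).
Proof.
by rewrite /cmconv_pow /powc; elim: rho.-1 => //= k IH; rewrite cmv_conv IH.
Qed.

Lemma free_wellposedness (rho : nat) (lam : R) (u0 mu : distr R n) :
  (1 <= rho)%N -> lam = 1 \/ lam = -1 -> I_space u0 -> I_space mu ->
  exists T : R, [/\ 0 < T,
    unique_bounded_solution (@I_space R n) (@norm_I R n) (@S_free R n)
      (@B_free R n rho lam) (@L_free R n mu) T u0 &
    data_solution_map_lipschitz_near (@I_space R n) (@norm_I R n) (@S_free R n)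
      (@B_free R n rho lam) (@L_free R n mu) T u0].
Proof.
move=> rho1 lam1 Iu0 Imu.
have muM := var_le_total_mass (hat mu).
have Khat f : is_cmv (cmv (hat f)) by exists (hat f).
apply: (@local_wellposedness R n (borel R n) (free_algebra R n) _ _ (fun f => cmv (hat f))
  _ _ _ _ _ _ _ _ _ _
  (powc (free_algebra R n) rho) (mulc (free_algebra R n) (cmv (hat mu))) (- 'i * lam%:C) 'i) => //.
- by move=> f g If Ig; exact: (I_space_add If Ig).1.
- by move=> f g If Ig; exact: (I_space_sub If Ig).1.
- by move=> f g If Ig; exact: (I_space_add If Ig).2.
- by move=> f g If Ig; exact: (I_space_sub If Ig).2.
- by move=> f _; exact: Khat.
- by move=> f C _; exact: total_variation_le.
- move=> a [nu <-]; exists (of_measure nu); split; first exact: of_measure_I.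
  by apply: hatE; [exact: of_measure_I|exact: of_measure_hat].
- by move=> r r0; exists (rho%:R * r ^+ rho.-1); exact: powc_lipschitz.
- by move=> r r0; exists (total_mass (hat mu)); apply: mulc_lipschitz => //; exact: Khat.
- rewrite modulusM modulusN modulus_i mul1r modulus_real.
  by case: lam1 => ->; rewrite ?normrN normr1.
- exact: modulus_i.
- move=> t v0; apply: of_hatE => A mA; exact: flow_cmv.
- move=> u t; apply: of_hatE => A mA.
  apply: (congr1 (fun w => - 'i * lam%:C * time_integral t w)); apply/funext => s.
  by rewrite -cmv_conv_pow; exact: flow_cmv.
- move=> u t; apply: of_hatE => A mA.
  apply: (congr1 (fun w => 'i * time_integral t w)); apply/funext => s.
  by rewrite -cmv_conv; exact: flow_cmv.
Qed.

End nonperiodic_case.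

Theorem theorem7p1 (R : realType) (n rho : nat) (lam : R)
    (n_ge1 : (1 <= n)%N) (rho_ge1 : (1 <= rho)%N) (lam_pm1 : lam = 1 \/ lam = -1) :
  (forall u0 mu : distr R n,
    Iper u0 -> Iper mu ->
    exists T : R, [/\ 0 < T,
      unique_bounded_solution (@Iper R n) (@norm_Iper R n) (@S_per R n)
        (@B_per R n rho lam) (@L_per R n mu) T u0 &
      data_solution_map_lipschitz_near (@Iper R n) (@norm_Iper R n) (@S_per R n)
        (@B_per R n rho lam) (@L_per R n mu) T u0]) /\
  (forall u0 mu : distr R n,
    I_space u0 -> I_space mu ->
    exists T : R, [/\ 0 < T,
      unique_bounded_solution (@I_space R n) (@norm_I R n) (@S_free R n)
        (@B_free R n rho lam) (@L_free R n mu) T u0 &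
      data_solution_map_lipschitz_near (@I_space R n) (@norm_I R n) (@S_free R n)
        (@B_free R n rho lam) (@L_free R n mu) T u0]).
Proof.
by split=> u0 mu Iu0 Imu; [exact: periodic_wellposedness | exact: free_wellposedness].
Qed.
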